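(* Let $\mathbb G$ be a Carnot group of step 2 and rank $m$, and let $\mathbb W$ and $\mathbb L$ be two complementary subgroups of $\mathbb G$, with $\mathbb L$ horizontal and one-dimensional. Let $U\subseteq\mathbb W$ be an open set and let $\varphi\colon U\to\mathbb L$ be a continuous function. Fix coordinates on $\mathbb G$ adapted to the splitting $(\mathbb W,\mathbb L)$ as described in the context. Assume that one of the following conditions holds: (a) $\mathrm{graph}(\varphi)$ is a $C^1_{\mathrm H}$-hypersurface with tangents complemented by $\mathbb L$; (b) $\varphi$ is uniformly intrinsically differentiable on $U$; (c) $\varphi$ is intrinsically differentiable on $U$ and its intrinsic gradient is continuous; (d) there exists $\omega\in C(U;\mathbb R^{m-1})$ such that, for every $a\in U$, there exist $\delta>0$ and a family of functions $\{\varphi_\varepsilon\in C^1(B(a,\delta)):\varepsilon\in(0,1)\}$ such that $\lim_{\varepsilon\to0}\varphi_\varepsilon=\varphi$ and $\lim_{\varepsilon\to0}D^{\varphi_\varepsilon}_j\varphi_\varepsilon=\omega_j$ in $L^\infty(B(a,\delta))$ for every $j=2,\dots,m$ (here $B(a,\delta)$ is a ball in $\mathbb W$ contained in $U$); (e) there exists $\omega\in C(U;\mathbb R^{m-1})$ such that $D^\varphi\varphi=\omega$ holds in the broad sense on $U$; (f) there exists $\omega\in C(U;\mathbb R^{m-1})$ such that $D^\varphi\varphi=\omega$ holds in the broad* sense on $U$; (g) there exists $\omega\in C(U;\mathbb R^{m-1})$ such that $D^\varphi\varphi=\omega$ holds in the distributional sense on $U$. Then $\varphi$ is $1/2$-little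 Hölder continuous along the vertical coordinates.
   Context: **Carnot groups of step 2.** A Carnot group $\mathbb G$ of step 2 is a connected, simply connected Lie group whose Lie algebra is $\mathfrak g=V_1\oplus V_2$ with $V_1,V_2\neq\{0\}$, $[V_1,V_1]=V_2$, $[V_1,V_2]=\{0\}$. Its rank is $m=\dim V_1$; put $h=\dim V_2$. The dilations $\delta_\lambda$ ($\lambda>0$) are the linear maps of $\mathfrak g$ with $\delta_\lambda X=\lambda^jX$ for $X\in V_j$, transported to $\mathbb G$ by the diffeomorphism $\exp$. A subgroup is homogeneous if it is closed under all $\delta_\lambda$. Homogeneous subgroups $\mathbb W,\mathbb L$ are complementary if $\mathbb G=\mathbb W\cdot\mathbb L$ and $\mathbb W\cap\mathbb L=\{e\}$; then every $g\in\mathbb G$ is uniquely $g=\pi_{\mathbb W}(g)\cdot\pi_{\mathbb L}(g)$. $\mathbb L$ is horizontal and one-dimensional if $\mathbb L=\exp(\mathrm{span}\{X\})$ for some $0\ne X\in V_1$. Fix a homogeneous norm $\|\cdot\|$ on $\mathbb G$ (i.e. $\|\delta_\lambda x\|=\lambda\|x\|$, $\|xy\|\le\|x\|+\|y\|$, $\|x^{-1}\|=\|x\|$, $\|x\|=0$ iff $x=e$); $B(a,r)=\{x:\|a^{-1}x\|<r\}$. **Coordinates.** Choose a basis $(X_1,\dots,X_m,Y_1,\dots,Y_h)$ of $\mathfrak g$ such that $X_1,\dots,X_m$ is a basis of $V_1$, $Y_1,\dots,Y_h$ is a basis of $V_2$ chosen among the commutators of the $X_j$'s, $\mathbb L=\exp(\mathrm{span}\{X_1\})$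 and $\mathbb W=\exp(\mathrm{span}\{X_2,\dots,X_m,Y_1,\dots,Y_h\})$. Let $[X_j,X_\ell]=\sum_{i=1}^h b^{(i)}_{j\ell}Y_i$. Identify $\mathbb G$ with $\mathbb R^{m+h}$ via $(x,y)\leftrightarrow\exp(\sum_j x_jX_j+\sum_i y_iY_i)$; the product is $(x,y)\cdot(x',y')=(x+x',\,(y_i+y_i'-\tfrac12\sum_{j,\ell}b^{(i)}_{j\ell}x_\ell x'_j)_{i})$. Then $\mathbb L=\{(x_1,0,\dots,0)\}\equiv\mathbb R$ and $\mathbb W=\{x_1=0\}\equiv\mathbb R^{m+h-1}$ with coordinates $(x_2,\dots,x_m,y_1,\dots,y_h)$; $x_2,\dots,x_m$ are the horizontal coordinates and $y_1,\dots,y_h$ the vertical coordinates. Functions with values in $\mathbb L$ are regarded as real-valued; $C^1$ means Euclidean $C^1$ in these coordinates. **Little Hölder continuity.** For an open set $U\subseteq\mathbb R^N$ and $0<\alpha<1$, a map $\varphi\in C(U;\mathbb R^k)$ is $\alpha$-little Hölder continuous if $$\lim_{r\to0}\ \sup\Big\{\frac{|\varphi(b')-\varphi(b)|}{|b'-b|^{\alpha}}:\ b,b'\in U,\ 0<|b'-b|<r\Big\}=0.$$ ''Along the vertical coordinates'' means that this condition is considered for pairs $b,b'\in U$ that differ only in the vertical coordinates, i.e. $b=(x,y)$, $b'=(x,y')$ with the same $x=(x_2,\dots,x_m)$ and $y,y'\in\mathbb R^h$. **Projected vector fields.** For continuous $\varphi\colon U\subseteq\mathbb W\to\mathbb L$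 with $U$ open and $j=2,\dots,m$, on $U$ set $$D^\varphi_j=\partial_{x_j}-\sum_{i=1}^h\Big(b^{(i)}_{j1}\varphi+\tfrac12\sum_{k=2}^m x_kb^{(i)}_{jk}\Big)\partial_{y_i},\qquad D^\varphi=(D^\varphi_2,\dots,D^\varphi_m).$$ For $W=\sum_{j=2}^m w_jX_j\in\mathrm{Lie}(\mathbb W)\cap V_1$ put $D^\varphi_W=\sum_{j=2}^m w_jD^\varphi_j$ and, for $v\in\mathbb R^{m-1}$, $\langle v,W\rangle=\sum_{j=2}^m v_jw_j$. **Distributional sense.** $D^\varphi\varphi=\omega$ holds in the distributional sense on $U$ if for all $j=2,\dots,m$ and all $\xi\in C^\infty_c(U)$ $$\int_U\Big(-\varphi\,\partial_{x_j}\xi+\tfrac12\sum_{i=1}^hb^{(i)}_{j1}\varphi^2\,\partial_{y_i}\xi+\tfrac12\sum_{i=1}^h\sum_{k=2}^mx_kb^{(i)}_{jk}\varphi\,\partial_{y_i}\xi\Big)\,dx\,dy=\int_U\omega_j\,\xi\,dx\,dy.$$ **Broad\* sense.** $D^\varphi\varphi=\omega$ holds in the broad* sense on $U$ if for every $a_0\in U$ there exist $0<\delta_2<\delta_1$ with $\overline{B(a_0,\delta_1)}\cap\mathbb W\subseteq U$ and maps $E_j\colon(\overline{B(a_0,\delta_2)}\cap\mathbb W)\times[-\delta_2,\delta_2]\to\overline{B(a_0,\delta_1)}\cap\mathbb W$, $j=2,\dots,m$, such that for all $a\in\overline{B(a_0,\delta_2)}\cap\mathbb W$ and all $j$: (i)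 $t\mapsto E_j(a,t)$ is $C^1$ and solves $\dot\gamma=D^\varphi_j\circ\gamma$, $\gamma(0)=a$ on $[-\delta_2,\delta_2]$; (ii) $\varphi(E_j(a,t))-\varphi(a)=\int_0^t\omega_j(E_j(a,s))\,ds$ for all $t\in[-\delta_2,\delta_2]$. **Broad sense.** $D^\varphi\varphi=\omega$ holds in the broad sense on $U$ if for every $W\in\mathrm{Lie}(\mathbb W)\cap V_1$ and every integral curve $\gamma\colon I\to U$ of $D^\varphi_W$ one has $\frac{d}{ds}\big|_{s=t}(\varphi\circ\gamma)(s)=\langle\omega(\gamma(t)),W\rangle$ for all $t\in I$. **Graphs and intrinsic differentiability.** $\mathrm{graph}(\varphi)=\{w\cdot\varphi(w):w\in U\}$. For $q\in\mathbb G$ let $U_q=\{a\in\mathbb W:\pi_{\mathbb W}(q^{-1}a)\in U\}$ and $\varphi_q\colon U_q\to\mathbb L$, $\varphi_q(a)=(\pi_{\mathbb L}(q^{-1}a))^{-1}\cdot\varphi(\pi_{\mathbb W}(q^{-1}a))$. A map $\ell\colon\mathbb W\to\mathbb L$ is intrinsically linear if its graph is a homogeneous subgroup of $\mathbb G$; in the present setting this means that there is $v=(v_2,\dots,v_m)\in\mathbb R^{m-1}$ with $\ell(x_2,\dots,x_m,y)=\sum_{j=2}^mv_jx_j$. For $a\in U$ put $p_a=\varphi(a)^{-1}\cdot a^{-1}$ (so $\varphi_{p_a}(e)=e$). $\varphi$ is intrinsically differentiable at $a_0\in U$ if there is an intrinsically linear map $\ell=d^\varphi\varphi_{a_0}$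 with $$\lim_{r\to0}\sup\Big\{\frac{\|\ell(b)^{-1}\cdot\varphi_{p_{a_0}}(b)\|}{\|b\|}:b\in U_{p_{a_0}},\,0<\|b\|<r\Big\}=0;$$ the associated vector $v$ is the intrinsic gradient $\nabla^\varphi\varphi(a_0)\in\mathbb R^{m-1}$. $\varphi$ is uniformly intrinsically differentiable at $a_0$ if there is an intrinsically linear map $\ell$ with $$\lim_{r\to0}\sup\Big\{\frac{\|\ell(b)^{-1}\cdot\varphi_{p_a}(b)\|}{\|b\|}:a\in U,\ \|a_0^{-1}a\|<r,\ b\in U_{p_a},\ 0<\|b\|<r\Big\}=0.$$ Each property holds on $U$ if it holds at every point of $U$. **$C^1_{\mathrm H}$-hypersurfaces.** With $X_j$ also denoting the left-invariant vector fields, $f\in C^1_{\mathrm H}(\Omega)$ ($\Omega\subseteq\mathbb G$ open) means $f$ is continuous and the (distributional) derivatives $X_1f,\dots,X_mf$ are continuous on $\Omega$. $S\subseteq\mathbb G$ is a $C^1_{\mathrm H}$-hypersurface if for every $p\in S$ there are an open neighbourhood $\Omega$ of $p$ and $f\in C^1_{\mathrm H}(\Omega)$ with $S\cap\Omega=\{f=0\}$ and $(X_1f,\dots,X_mf)\ne0$ on $\Omega$. Its tangent at $p$ is the homogeneous subgroup $\{(x,y)\in\mathbb G:\sum_{j=1}^mx_jX_jf(p)=0\}$; $S$ has tangents complemented by $\mathbb L$ if at every $p\in S$ the tangent is complementary to $\mathbb L$ (equivalently $X_1f(p)\neq0$).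
   Formalization: The little Hölder limit is imposed on every open set with compact closure in U instead of with one supremum over all of U; the global form fails for φ = y_1² on U = W, which satisfies (d) but has unbounded vertical quotients at every scale. *)

(* Defs.v *)
From HB Require Import structures.
From mathcomp Require Import all_boot all_order all_algebra.
From mathcomp Require Import all_classical all_reals all_analysis.
From mathcomp Require Import ring.

Set Implicit Arguments.
Unset Strict Implicit.
Unset Printing Implicit Defensive.

Import Order.TTheory GRing.Theory Num.Theory.
Import numFieldNormedType.Exports.

Local Open Scope classical_set_scope.
Local Open Scope ring_scope.

Section LebesgueTuple.
Context (R : realType).
Let T := measurableTypeR R.
Context (n : nat) (mu : {sigma_finite_measure set (n.-tuple T) -> \bar R}).
Local Open Scope ereal_scope.

Definition tuple_cons (p : T * n.-tuple T) : n.+1.-tuple T :=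
  [the n.+1.-tuple T of p.1 :: p.2].
Definition tuple_uncons (t : n.+1.-tuple T) : T * n.-tuple T :=
  (thead t, [tuple of behead t]).

Lemma measurable_tuple_cons : measurable_fun setT tuple_cons.
Proof. exact: measurable_cons. Qed.

Lemma measurable_tuple_uncons : measurable_fun setT tuple_uncons.
Proof.
apply/measurable_fun_pairP; split; first exact: (measurable_tnth ord0).
exact: measurable_behead.
Qed.

Lemma tuple_consK : cancel tuple_cons tuple_uncons.
Proof.
by case=> x t; rewrite /tuple_uncons /thead tnth0; congr pair; exact/val_inj.
Qed.

Definition leb_step : set (n.+1.-tuple T) -> \bar R :=
  pushforward ((@lebesgue_measure R) \x mu) tuple_cons.

Let leb_step0 : leb_step set0 = 0.
Proof. by rewrite /leb_step /pushforward preimage_set0 measure0. Qed.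

Let leb_step_ge0 A : 0 <= leb_step A.
Proof. by rewrite /leb_step /pushforward measure_ge0. Qed.

Let leb_step_additive : semi_sigma_additive leb_step.
Proof.
have mf := measurable_tuple_cons.
move=> F mF tF mUF; rewrite /leb_step /pushforward preimage_bigcup.
apply: measure_semi_sigma_additive.
- by move=> k; rewrite -[X in measurable X]setTI; exact: mf.
- apply/trivIsetP => /= i j _ _ ij; rewrite -preimage_setI.
  by move/trivIsetP : tF => /(_ _ _ _ _ ij) ->//; rewrite preimage_set0.
- by rewrite -preimage_bigcup -[X in measurable X]setTI; exact: mf.
Qed.

HB.instance Definition _ := isMeasure.Build _ _ _ leb_step
  leb_step0 leb_step_ge0 leb_step_additive.

Let leb_step_sigma_finite : sigma_finite setT leb_step.
Proof.
have [F FT Ffin] : sigma_finite setT ((@lebesgue_measure R) \x mu).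
  have /sigma_finiteP[F [TF ndF Foo]] := sigma_finiteT (@lebesgue_measure R).
  have /sigma_finiteP[G [TG ndG Goo]] := sigma_finiteT mu.
  exists (fun k => F k `*` G k).
    rewrite -setXTT TF TG predeqE => -[x y]; split.
      move=> [/= [i _ Fix] [j _ Gjy]]; exists (maxn i j) => //; split.
      - by move: x Fix; exact/subsetPset/ndF/leq_maxl.
      - by move: y Gjy; exact/subsetPset/ndG/leq_maxr.
    by move=> [i _ []/= ? ?]; split; exists i.
  move=> k; have [? ?] := Foo k; have [? ?] := Goo k.
  split; first exact: measurableX.
  by rewrite product_measure1E// lte_mul_pinfty// ge0_fin_numE.
exists (fun k => tuple_uncons @^-1` F k).
  by rewrite -preimage_bigcup -FT preimage_setT.
move=> k; have [mF Fk] := Ffin k; split.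
  by rewrite -[X in measurable X]setTI; exact: measurable_tuple_uncons.
rewrite /leb_step /pushforward -comp_preimage (_ : _ \o _ = id)//.
by apply/funext => p /=; rewrite tuple_consK.
Qed.

HB.instance Definition _ := @Measure_isSigmaFinite.Build _ _ _ leb_step
  leb_step_sigma_finite.

End LebesgueTuple.

(* Lebesgue measure on R^n, R^n being the type of n-tuples with the product
   sigma-algebra. *)
Fixpoint lebesgueN (R : realType) (n : nat) :
    {sigma_finite_measure set (n.-tuple (measurableTypeR R)) -> \bar R} :=
  match n with
  | 0 => dirac [tuple]
  | n'.+1 => leb_step (lebesgueN R n')
  end.

Section Analysis.
Context (R : realType).

(* lim_(r -> 0+) sup (S r) = 0 for sets S r of nonnegative numbers; 0 is added
   to S r because ereal_sup set0 = -oo. *)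
Definition limsup_eq0 (S : R -> set R) : Prop :=
  ereal_sup (0%E |` [set x%:E | x in S r]) @[r --> 0^'+] --> 0%E.

Definition point_of_tuples a c (p : a.-tuple (measurableTypeR R) *
    c.-tuple (measurableTypeR R)) : 'rV[R]_a * 'rV[R]_c :=
  (\row_i tnth p.1 i, \row_i tnth p.2 i).

Definition integral2 a c (D : set ('rV[R]_a * 'rV[R]_c))
    (f : 'rV[R]_a * 'rV[R]_c -> R) : R :=
  \int[(lebesgueN R a \x lebesgueN R c)%E]_(p in @point_of_tuples a c @^-1` D)
    f (point_of_tuples p).

Definition Linfty_norm a c (D : set ('rV[R]_a * 'rV[R]_c))
    (f : 'rV[R]_a * 'rV[R]_c -> R) : \bar R :=
  'N[(lebesgueN R a \x lebesgueN R c)%E]_+oo%E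
    [EFin \o (fun w => f w * \1_D w)%R \o @point_of_tuples a c]%E.

(* int_0^t f, also for t < 0 *)
Definition oriented_integral (f : R -> R) (t : R) : R :=
  if 0 <= t then \int[lebesgue_measure]_(s in `[0, t]%classic) f s
  else - \int[lebesgue_measure]_(s in `[t, 0]%classic) f s.

(* C^k, through iterated directional derivatives *)
Fixpoint classC (V : normedModType R) (k : nat) (f : V -> R) : Prop :=
  if k is k'.+1 then
    forall v, (forall x, derivable f x v) /\ classC k' (fun x => 'D_v f x)
  else continuous f.

Definition test_function (V : normedModType R) (D : set V) (xi : V -> R) :=
  (forall k, classC k xi) /\
  exists K : set V, [/\ compact K, K `<=` D & forall x, ~ K x -> xi x = 0].

Definition classC1_on (V : normedModType R) (D : set V) (f : V -> R) : Prop :=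
  forall v, (forall x, D x -> derivable f x v) /\
            {within D, continuous (fun x => 'D_v f x)}.

(* derivative at t relative to the interval I, one-sided at endpoints *)
Definition has_derivative_in (V : normedModType R) (I : set R) (g : R -> V)
    (t : R) (v : V) : Prop :=
  (s - t)^-1 *: (g s - g t) @[s --> within I t^'] --> v.

(* C^1 integral curves of F; only the values of F on U are relevant *)
Definition integral_curve (V : normedModType R) (U : set V) (F : V -> V)
    (I : set R) (g : R -> V) : Prop :=
  [/\ forall t, I t -> U (g t),
      {within I, continuous (F \o g)} &
      forall t, I t -> has_derivative_in I g t (F (g t))].

End Analysis.

Record step2_stratification (R : realType) (g : vectType R) := Step2 {
  bracket : g -> g -> g;
  bracket_linearl : forall y, linear (bracket^~ y);
  bracket_linearr : forall x, linear (bracket x);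
  bracket_alternating : forall x, bracket x x = 0;
  bracket_jacobi : forall x y z,
    bracket x (bracket y z) + bracket y (bracket z x)
      + bracket z (bracket x y) = 0;
  layer1 : {vspace g};
  layer2 : {vspace g};
  layer1_neq0 : layer1 != 0%VS;
  layer2_neq0 : layer2 != 0%VS;
  layer_sum : (layer1 + layer2)%VS = fullv;
  layer_direct : (layer1 :&: layer2)%VS = 0%VS;
  layer11 : forall x y, x \in layer1 -> y \in layer1 -> bracket x y \in layer2;
  layer11_span : forall V : {vspace g},
    (forall x y, x \in layer1 -> y \in layer1 -> bracket x y \in V) ->
    (layer2 <= V)%VS;
  layer12 : forall x y, x \in layer1 -> y \in layer2 -> bracket x y = 0
}.

(* The rank is m = 1 + n. The first vector of the basis of the first layer spans
   the Lie algebra of L, the other vectors of the basis span that of W. *)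
Record adapted_basis (R : realType) (g : vectType R)
    (A : step2_stratification g) (n h : nat) := AdaptedBasis {
  basX : (1 + n).-tuple g;
  basY : h.-tuple g;
  basX_basis : basis_of (layer1 A) basX;
  basY_basis : basis_of (layer2 A) basY;
  basY_commutator : forall i, exists j l,
    tnth basY i = bracket A (tnth basX j) (tnth basX l)
}.

(* b^(i)_(j l) *)
Definition structure_constant (R : realType) (g : vectType R)
    (A : step2_stratification g) (n h : nat) (B : adapted_basis A n h)
    (i : 'I_h) (j l : 'I_(1 + n)) : R :=
  coord (basY B) i (bracket A (tnth (basX B) j) (tnth (basX B) l)).

(* Points of the group are (x, y) with x in R^m and y in R^h, in exponential
   coordinates; points of W are (x, y) with x in R^(m-1) and y in R^h. *)
Notation pointG R n h := ('rV[R]_(1 + n) * 'rV[R]_h)%type.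
Notation pointW R n h := ('rV[R]_n * 'rV[R]_h)%type.

Section Group.
Context (R : realType) (n h : nat).
Variable b : 'I_h -> 'I_(1 + n) -> 'I_(1 + n) -> R.
Local Notation G := (pointG R n h).
Local Notation Wt := (pointW R n h).
Implicit Types (p q : G) (w a : Wt) (t r : R).

(* the indices of X_1 and of X_2, ..., X_m *)
Definition idx1 : 'I_(1 + n) := lshift n ord0.
Definition idxW (j : 'I_n) : 'I_(1 + n) := rshift 1 j.

Definition gmul p q : G :=
  (p.1 + q.1,
   \row_i (p.2 ord0 i + q.2 ord0 i
     - 2^-1 * \sum_j \sum_l b i j l * p.1 ord0 l * q.1 ord0 j)).
Definition gone : G := 0.
Definition ginv p : G := - p.
Definition dilation t p : G := (t *: p.1, t ^+ 2 *: p.2).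

Definition homogeneous_subgroup (H : set G) : Prop :=
  [/\ H gone,
      forall p q, H p -> H q -> H (gmul p q),
      forall p, H p -> H (ginv p) &
      forall t p, 0 < t -> H p -> H (dilation t p)].

Definition complementary (H K : set G) : Prop :=
  [/\ homogeneous_subgroup H, homogeneous_subgroup K,
      forall g, exists p q, [/\ H p, K q & g = gmul p q] &
      H `&` K = [set gone]].

Definition homogeneous_norm (N : G -> R) : Prop :=
  [/\ forall t p, 0 < t -> N (dilation t p) = t * N p,
      forall p q, N (gmul p q) <= N p + N q,
      forall p, N (ginv p) = N p &
      forall p, N p = 0 <-> p = gone].

Definition inW w : G := (row_mx 0 w.1, w.2).
Definition inL t : G := (row_mx t%:M 0, 0).
Definition Wgroup : set G := range inW.
Definition Lgroup : set G := range inL.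

(* The projections of the splitting G = W . L, in coordinates of W and L. *)
Definition projL p : R := p.1 ord0 idx1.
Definition projW p : Wt :=
  let q := gmul p (ginv (inL (projL p))) in (rsubmx q.1, q.2).

Definition Dvec (phi : Wt -> R) (j : 'I_n) w : Wt :=
  (delta_mx ord0 j,
   \row_i - (b i (idxW j) idx1 * phi w
             + 2^-1 * \sum_k w.1 ord0 k * b i (idxW j) (idxW k))).

Definition Dvec_comb (phi : Wt -> R) (v : 'rV[R]_n) w : Wt :=
  \sum_j v ord0 j *: Dvec phi j w.

Definition dotp (u v : 'rV[R]_n) : R := \sum_j u ord0 j * v ord0 j.

Definition igraph (U : set Wt) (phi : Wt -> R) : set G :=
  [set gmul (inW w) (inL (phi w)) | w in U].

Definition trans_dom (q : G) (U : set Wt) : set Wt :=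
  [set a | U (projW (gmul (ginv q) (inW a)))].

Definition trans_fun (q : G) (phi : Wt -> R) (a : Wt) : R :=
  - projL (gmul (ginv q) (inW a)) + phi (projW (gmul (ginv q) (inW a))).

Definition base_point (phi : Wt -> R) (a : Wt) : G :=
  gmul (ginv (inL (phi a))) (ginv (inW a)).

Definition intrinsically_linear (l : Wt -> R) : Prop :=
  homogeneous_subgroup (igraph setT l).

Variable N : G -> R.

Definition intrinsic_differential (U : set Wt) (phi : Wt -> R) (a0 : Wt)
    (l : Wt -> R) : Prop :=
  intrinsically_linear l /\
  limsup_eq0 (fun r => [set c | exists w : Wt,
    [/\ trans_dom (base_point phi a0) U w, 0 < N (inW w) < r &
        c = N (gmul (ginv (inL (l w)))
                    (inL (trans_fun (base_point phi a0) phi w)))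
            / N (inW w)]]).

Definition intrinsic_gradient (U : set Wt) (phi : Wt -> R) (a0 : Wt)
    (v : 'rV[R]_n) : Prop :=
  intrinsic_differential U phi a0 (fun w => dotp v w.1).

Definition unif_intrinsic_differentiable_at (U : set Wt) (phi : Wt -> R)
    (a0 : Wt) : Prop :=
  exists l, intrinsically_linear l /\
  limsup_eq0 (fun r => [set c | exists a w : Wt,
    [/\ U a, N (gmul (ginv (inW a0)) (inW a)) < r,
        trans_dom (base_point phi a) U w, 0 < N (inW w) < r &
        c = N (gmul (ginv (inL (l w)))
                    (inL (trans_fun (base_point phi a) phi w)))
            / N (inW w)]]).

Definition unif_intrinsic_differentiable (U : set Wt) (phi : Wt -> R) : Prop :=
  forall a0, U a0 -> unif_intrinsic_differentiable_at U phi a0.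

Definition intrinsic_differentiable_C (U : set Wt) (phi : Wt -> R) : Prop :=
  exists grad : Wt -> 'rV[R]_n,
    (forall a0, U a0 -> intrinsic_gradient U phi a0 (grad a0)) /\
    {within U, continuous grad}.

Definition expX (j : 'I_(1 + n)) t : G := (t *: delta_mx ord0 j, 0).

(* the left-invariant vector field X_j *)
Definition leftX (j : 'I_(1 + n)) (f : G -> R) (p : G) : R :=
  derive1 (fun t : R => f (gmul p (expX j t))) 0.

(* X_j f = d in the sense of distributions; X_j is formally skew-adjoint *)
Definition weak_leftX (j : 'I_(1 + n)) (D : set G) (f d : G -> R) : Prop :=
  forall xi, test_function D xi ->
    integral2 D (fun p => f p * leftX j xi p) =
    - integral2 D (fun p => d p * xi p).

Definition C1H (D : set G) (f : G -> R) (Xf : 'I_(1 + n) -> G -> R) : Prop :=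
  {within D, continuous f} /\
  forall j, {within D, continuous (Xf j)} /\ weak_leftX j D f (Xf j).

Definition tangent_group (Xf : 'I_(1 + n) -> G -> R) (p : G) : set G :=
  [set q : G | \sum_j q.1 ord0 j * Xf j p = 0].

Definition C1H_hypersurface_complemented (S : set G) : Prop :=
  forall p, S p -> exists (D : set G) (f : G -> R) (Xf : 'I_(1 + n) -> G -> R),
    [/\ open D /\ D p,
        C1H D f Xf,
        S `&` D = D `&` [set q : G | f q = 0],
        forall q, D q -> exists j, Xf j q != 0 &
        complementary (tangent_group Xf p) Lgroup].

Definition gball (p : G) r : set G := [set q | N (gmul (ginv p) q) < r].
Definition wball (a : Wt) r : set Wt := inW @^-1` gball (inW a) r.
Definition cwball (a : Wt) r : set Wt := inW @^-1` closure (gball (inW a) r).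

Definition approximable (U : set Wt) (phi : Wt -> R) (omega : Wt -> 'rV[R]_n) :
    Prop :=
  forall a, U a -> exists (delta : R) (phie : R -> Wt -> R),
    [/\ 0 < delta, wball a delta `<=` U,
        forall e, 0 < e < 1 -> classC1_on (wball a delta) (phie e),
        Linfty_norm (wball a delta) (fun w => phie e w - phi w)
          @[e --> 0^'+] --> 0%E &
        forall j, Linfty_norm (wball a delta)
          (fun w => 'D_(Dvec (phie e) j w) (phie e) w - omega w ord0 j)
          @[e --> 0^'+] --> 0%E].

Definition broad (U : set Wt) (phi : Wt -> R) (omega : Wt -> 'rV[R]_n) : Prop :=
  forall (v : 'rV[R]_n) (I : set R) (g : R -> Wt),
    open I -> is_interval I -> integral_curve U (Dvec_comb phi v) I g ->
    forall t, I t -> is_derive t 1 (phi \o g) (dotp (omega (g t)) v).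

Definition broad_star (U : set Wt) (phi : Wt -> R) (omega : Wt -> 'rV[R]_n) :
    Prop :=
  forall a0, U a0 -> exists (d1 d2 : R) (E : 'I_n -> Wt -> R -> Wt),
    [/\ 0 < d2 < d1, cwball a0 d1 `<=` U &
        forall j a, cwball a0 d2 a ->
        [/\ E j a 0 = a,
            integral_curve (cwball a0 d1) (Dvec phi j)
              `[- d2, d2]%classic (E j a) &
            forall t, - d2 <= t <= d2 ->
              phi (E j a t) - phi a =
              oriented_integral (fun s => omega (E j a s) ord0 j) t]].

Definition dx (j : 'I_n) : Wt := (delta_mx ord0 j, 0).
Definition dy (i : 'I_h) : Wt := (0, delta_mx ord0 i).

Definition distributional (U : set Wt) (phi : Wt -> R)
    (omega : Wt -> 'rV[R]_n) : Prop :=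
  forall (j : 'I_n) (xi : Wt -> R), test_function U xi ->
    integral2 U (fun w =>
      - phi w * 'D_(dx j) xi w
      + 2^-1 * \sum_i b i (idxW j) idx1 * phi w ^+ 2 * 'D_(dy i) xi w
      + 2^-1 * \sum_i \sum_k
          w.1 ord0 k * b i (idxW j) (idxW k) * phi w * 'D_(dy i) xi w) =
    integral2 U (fun w => omega w ord0 j * xi w).

End Group.

Section LittleHolder.
Context (R : realType) (n h : nat).
Local Notation Wt := (pointW R n h).

Definition euclidean_norm (w : Wt) : R :=
  Num.sqrt (\sum_j w.1 ord0 j ^+ 2 + \sum_i w.2 ord0 i ^+ 2).

Definition little_holder_vertical (alpha : R) (U : set Wt) (phi : Wt -> R) :
    Prop :=
  limsup_eq0 (fun r => [set c | exists (x : 'rV[R]_n) (y y' : 'rV[R]_h),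
    [/\ U (x, y), U (x, y'),
        0 < euclidean_norm ((x, y') - (x, y)) < r &
        c = `|phi (x, y') - phi (x, y)|
            / euclidean_norm ((x, y') - (x, y)) `^ alpha]]).

(* The uniform condition is imposed on relatively compact open subsets of U. On
   all of U it fails even for smooth functions: phi (x, y) = y_1 ^+ 2 on U = W
   satisfies all the differentiability conditions above, but its difference
   quotients along y_1 are unbounded at every scale. *)
Definition local_little_holder_vertical (alpha : R) (U : set Wt)
    (phi : Wt -> R) : Prop :=
  forall V : set Wt, open V -> compact (closure V) -> closure V `<=` U ->
    little_holder_vertical alpha V phi.

End LittleHolder.

(* Consistency of the coordinates: gmul is the Baker-Campbell-Hausdorff product
   of the Lie algebra read through exponential coordinates, and projW, projL
   are the projections of the splitting G = W . L. *)
Section Coordinates.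
Context (R : realType) (g : vectType R) (A : step2_stratification g).
Context (n h : nat) (B : adapted_basis A n h).
Local Notation b := (structure_constant B).
Local Notation eX j := (tnth (basX B) j).
Local Notation eY i := (tnth (basY B) i).
Local Notation "[ u ,, v ]" := (bracket A u v).

Lemma bracketDl u v w : [u + v,, w] = [u,, w] + [v,, w].
Proof. by have := bracket_linearl A w 1 u v; rewrite !scale1r. Qed.

Lemma bracketDr u v w : [u,, v + w] = [u,, v] + [u,, w].
Proof. by have := bracket_linearr A u 1 v w; rewrite !scale1r. Qed.

Lemma bracket0l w : [0,, w] = 0.
Proof. by apply: (addrI [0,, w]); rewrite -bracketDl !addr0. Qed.

Lemma bracket0r w : [w,, 0] = 0.
Proof. by apply: (addrI [w,, 0]); rewrite -bracketDr !addr0. Qed.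

Lemma bracket_suml (I : finType) (F : I -> g) w :
  [\sum_i F i,, w] = \sum_i [F i,, w].
Proof. exact: (big_morph _ (fun u v => bracketDl u v w) (bracket0l w)). Qed.

Lemma bracket_sumr (I : finType) (F : I -> g) w :
  [w,, \sum_i F i] = \sum_i [w,, F i].
Proof. exact: (big_morph _ (bracketDr w) (bracket0r w)). Qed.

Lemma bracketZl t u v : [t *: u,, v] = t *: [u,, v].
Proof. by have := bracket_linearl A v t u 0; rewrite bracket0l !addr0. Qed.

Lemma bracketZr t u v : [u,, t *: v] = t *: [u,, v].
Proof. by have := bracket_linearr A u t v 0; rewrite bracket0r !addr0. Qed.

Lemma bracket_skew u v : [u,, v] = - [v,, u].
Proof.
apply/eqP; rewrite -addr_eq0; apply/eqP.
have := bracket_alternating A (u + v).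
by rewrite bracketDl !bracketDr !bracket_alternating add0r addr0.
Qed.

Lemma basX_layer1 j : eX j \in layer1 A.
Proof. by apply: (basis_mem (basX_basis B)); exact: mem_tnth. Qed.

Lemma basY_layer2 i : eY i \in layer2 A.
Proof. by apply: (basis_mem (basY_basis B)); exact: mem_tnth. Qed.

Lemma bracket_basXY j i : [eX j,, eY i] = 0.
Proof. exact: layer12 (basX_layer1 j) (basY_layer2 i). Qed.

Lemma bracket_basYX i j : [eY i,, eX j] = 0.
Proof. by rewrite bracket_skew bracket_basXY oppr0. Qed.

Lemma bracket_basYY i k : [eY i,, eY k] = 0.
Proof.
have [j [l ->]] := basY_commutator B k.
have := bracket_jacobi A (eY i) (eX j) (eX l).
by rewrite bracket_basYX bracket_basXY !bracket0r !addr0.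
Qed.

Lemma structure_constantE j l : [eX j,, eX l] = \sum_i b i j l *: eY i.
Proof.
have XX : [eX j,, eX l] \in layer2 A.
  exact: layer11 (basX_layer1 j) (basX_layer1 l).
rewrite {1}(coord_basis (basY_basis B) XX); apply: eq_bigr => i _.
by rewrite -tnth_nth.
Qed.

Lemma structure_constant_skew i j l : b i j l = - b i l j.
Proof. by rewrite /structure_constant bracket_skew linearN. Qed.

Lemma structure_constant_diag i j : b i j j = 0.
Proof. by rewrite /structure_constant bracket_alternating linear0. Qed.

Definition exp_coord (p : pointG R n h) : g :=
  \sum_j p.1 ord0 j *: eX j + \sum_i p.2 ord0 i *: eY i.

Lemma exp_coord_bracket (p q : pointG R n h) :
  [exp_coord p,, exp_coord q] =
  \sum_i (\sum_j \sum_l b i j l * p.1 ord0 j * q.1 ord0 l) *: eY i.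
Proof.
rewrite /exp_coord bracketDl !bracketDr !bracket_suml.
rewrite [X in _ + X + _]big1 ?addr0; last first.
  move=> j _; rewrite bracket_sumr big1// => i _.
  by rewrite bracketZl bracketZr bracket_basXY !scaler0.
rewrite [X in _ + (X + _)]big1 ?add0r; last first.
  move=> i _; rewrite bracket_sumr big1// => j _.
  by rewrite bracketZl bracketZr bracket_basYX !scaler0.
rewrite [X in _ + X]big1 ?addr0; last first.
  move=> i _; rewrite bracket_sumr big1// => k _.
  by rewrite bracketZl bracketZr bracket_basYY !scaler0.
under eq_bigr => j _.
  rewrite bracket_sumr.
  under eq_bigr => l _.
    rewrite bracketZl bracketZr structure_constantE scalerA scaler_sumr.
    under eq_bigr do rewrite scalerA mulrC mulrA.
    over.
  rewrite exchange_big/=.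
  under eq_bigr do rewrite -scaler_suml.
  over.
rewrite exchange_big/=.
by under eq_bigr do rewrite -scaler_suml.
Qed.

Lemma exp_coord_gmul (p q : pointG R n h) :
  exp_coord (gmul b p q) =
  exp_coord p + exp_coord q + 2^-1 *: [exp_coord p,, exp_coord q].
Proof.
rewrite exp_coord_bracket /exp_coord addrACA -!big_split/= -addrA; congr (_ + _).
  by apply: eq_bigr => j _; rewrite mxE scalerDl.
rewrite scaler_sumr -big_split/=; apply: eq_bigr => i _.
rewrite mxE scalerA -!scalerDl; congr (_ *: _); congr (_ + _).
rewrite -mulrN; congr (_ * _).
rewrite exchange_big/= -sumrN; apply: eq_bigr => j _.
rewrite -sumrN; apply: eq_bigr => l _.
by rewrite structure_constant_skew !mulNr opprK.
Qed.

Lemma gmul_inL (p : pointG R n h) t :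
  gmul b p (inL n h t) =
  (p.1 + row_mx t%:M 0,
   \row_i (p.2 ord0 i - 2^-1 * \sum_l b i (idx1 n) l * p.1 ord0 l * t)).
Proof.
congr (_, _); apply/rowP => i; rewrite !mxE addr0; congr (_ - _ * _).
rewrite big_split_ord/= big_ord1 [X in _ + X]big1 ?addr0.
  by apply: eq_bigr => l _; rewrite row_mxEl mxE.
by move=> j _; rewrite big1// => l _; rewrite row_mxEr mxE mulr0.
Qed.

Lemma gmul_projE (p : pointG R n h) :
  p = gmul b (inW (projW b p)) (inL n h (projL p)).
Proof.
rewrite gmul_inL /projW.
have -> : ginv (inL n h (projL p)) = inL n h (- projL p).
  by congr (_, _) => /=; rewrite ?oppr0// opp_row_mx oppr0 raddfN.
rewrite gmul_inL /=; case: p => x y /=; congr (_, _).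
  rewrite raddfD/= row_mxKr addr0 add_row_mx add0r addr0 -[LHS]hsubmxK.
  congr row_mx; apply/rowP => k; rewrite !mxE ord1/= mulr1n.
  by congr (x _ _); apply/val_inj.
apply/rowP => i; rewrite !mxE -addrA -[LHS]addr0; congr (_ + _).
rewrite -mulrN -mulrN -mulrDr -sumrN -sumrN -big_split/=.
rewrite big_split_ord/= big_ord1 structure_constant_diag !mul0r subr0 oppr0.
rewrite add0r big1 ?mulr0// => k _.
by rewrite row_mxEr [rsubmx _ _ _]mxE [(x + _) _ _]mxE row_mxEr mxE addr0 mulrN opprK subrr.
Qed.

Lemma Wgroup_Lgroup_complementary :
  complementary b (@Wgroup R n h) (@Lgroup R n h).
Proof.
split.
- split.
  + by exists 0 => //; rewrite /inW row_mx0.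
  + move=> _ _ [v _ <-] [w _ <-].
    exists (v.1 + w.1, (gmul b (inW v) (inW w)).2) => //.
    by rewrite /inW /= /gmul /= add_row_mx addr0.
  + by move=> _ [w _ <-]; exists (- w) => //; rewrite /inW /ginv /= -{1}[0]oppr0 -opp_row_mx.
  + move=> t _ _ [w _ <-]; exists (t *: w.1, t ^+ 2 *: w.2) => //.
    by rewrite /inW /dilation /= scale_row_mx scaler0.
- split.
  + by exists 0 => //; rewrite /inL raddf0 row_mx0.
  + move=> _ _ [s _ <-] [t _ <-]; exists (s + t) => //.
    rewrite gmul_inL /inL /= add_row_mx addr0 raddfD; congr (_, _).
    apply/rowP => i; rewrite !mxE add0r big_split_ord/= big_ord1.
    rewrite structure_constant_diag !mul0r add0r big1 ?mulr0 ?oppr0// => l _.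
    by rewrite row_mxEr mxE mulr0 mul0r.
  + move=> _ [t _ <-]; exists (- t) => //.
    by rewrite /inL /ginv /= raddfN/=; congr (_, _); rewrite ?oppr0// opp_row_mx oppr0.
  + move=> t _ _ [s _ <-]; exists (t * s) => //.
    by rewrite /inL /dilation /= scale_row_mx !scaler0 scale_scalar_mx.
- move=> p; exists (inW (projW b p)), (inL n h (projL p)).
  by split; [exists (projW b p) | exists (projL p) | exact: gmul_projE].
- apply/seteqP; split=> [p [[w _ <-] [t _]]|_ ->] /=.
    rewrite /inL /inW => -[/eq_row_mx[_ <-] <-].
    by rewrite row_mx0.
  by split; exists 0 => //; rewrite ?/inW ?/inL ?raddf0 row_mx0.
Qed.

End Coordinates.

(* Main.v *)
(* The characteristics of D^phi_j through (x, y) are the curves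
   p(t) = (x + s t e_j, y - s (t A_j x + tau(t) c_j)) with s = 1 or -1, tau' = phi o p,
   where (c_j)_i = b^(i)_(j1). Each of the conditions (b)-(g) makes phi little
   Hoelder directly, or yields that near a point phi grows along characteristics
   like s omega_j t + O(eps t) and that a characteristic issues from every point.
   The latter suffices. Two characteristics issued from points at distance d
   along c_j approach each other at speed |Delta phi|, hence cross, and comparing
   the values of phi at the crossing gives (Delta phi)^2 = O(eps d): this is the
   estimate in the directions c_j. Following the characteristics of X_j, X_k, -X_j,
   -X_k in turn for time t displaces the point by t^2 [X_j, X_k] up to O(t^2) along
   c_j and c_k, which reduces the directions [X_j, X_k] to the previous ones; by
   stratification these commutators span the vertical directions.
   The weak equation (g) gives growth along characteristics by testing against a
   function concentrated near the curve, as in Dafermos' treatment of Burgers'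
   equation: in (phi - tau')^2 - tau'^2 only the second square has a bad sign, and
   it cancels between the two edges of the test function.
   For (a), the same results with c = 0 apply on the whole group to the function
   f defining the hypersurface: f is little Hoelder vertically and grows linearly
   along X_1, so its zero set is a graph with the required regularity. *)
From HB Require Import structures.
Require Import Defs.
From mathcomp Require Import all_boot all_order all_algebra.
From mathcomp Require Import all_classical all_reals all_analysis.
From mathcomp Require Import measurable_realfun ring lra.
Set Implicit Arguments.
Unset Strict Implicit.
Unset Printing Implicit Defensive.
Import Order.TTheory GRing.Theory Num.Theory.
Import numFieldNormedType.Exports.
Local Open Scope classical_set_scope.
Local Open Scope ring_scope.

(** The Hölder constant is small because the slopes cancel: two crossing curves of the same field
    share the term s omega_j t, and around the commutator loop the four main terms cancel in pairs.
    Only errors of size eps t survive; the size of omega enters through [core_const], multiplied by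
    eps under a square root. As phi is merely continuous, characteristics are not unique, so
    [char_curve] asks for some curve from each point, with a slope frozen at the centre w0 and a
    lifetime uniform near w0. Freezing the slope and allowing an error eps makes the property
    stable: in case (d) it is checked for the C^1 approximations, with constants independent of the
    approximation, and the estimate passes to the limit. In case (c) the error is controlled by a
    homogeneous norm containing the square root of the deviation of tau from its tangent, which is
    the integral of the increment to be estimated; [slope_self_improvement] breaks this circle. In
    case (g) the test functions are products in coordinates sheared along a smooth approximation of
    the curve; the shear is triangular, so their integrals factor exactly. *)

Section RowNorms.
Context (R : realType).

Lemma row_norm_le n (x : 'rV[R]_n) (r : R) : 0 <= r ->
  (forall i, `|x ord0 i| <= r) -> `|x| <= r.
Proof.
move=> r0 xr; rewrite /Num.Def.normr/= mx_normrE.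
elim/big_ind: _ => // [u v ur vr|[i j] _ /=]; first by rewrite ge_max ur.
by rewrite ord1.
Qed.

Lemma row_coord_le n (x : 'rV[R]_n) i : `|x ord0 i| <= `|x|.
Proof.
rewrite [leRHS]/Num.Def.normr/= mx_normrE.
exact: (le_bigmax _ _ (ord0, i)).
Qed.

Lemma row_norm_delta n (i : 'I_n) : `|delta_mx ord0 i : 'rV[R]_n| <= 1.
Proof.
by apply: row_norm_le => // j; rewrite mxE eqxx/=; case: eqP; rewrite ?normr1 ?normr0.
Qed.

Lemma pair_norm_le (V W : normedModType R) (p : V * W) (r : R) :
  (`|p| <= r) = (`|p.1| <= r) && (`|p.2| <= r).
Proof. by rewrite prod_normE ge_max. Qed.

Lemma pair_norm_lt (V W : normedModType R) (p : V * W) (r : R) :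
  (`|p| < r) = (`|p.1| < r) && (`|p.2| < r).
Proof. by rewrite prod_normE gt_max. Qed.

Lemma pair_norm1_le (V W : normedModType R) (p : V * W) : `|p.1| <= `|p|.
Proof. by rewrite prod_normE le_max lexx. Qed.

Lemma pair_norm2_le (V W : normedModType R) (p : V * W) : `|p.2| <= `|p|.
Proof. by rewrite prod_normE le_max lexx orbT. Qed.

Lemma nbhs_norm_le (V : normedModType R) (w : V) (r : R) : 0 < r ->
  nbhs w [set q | `|q - w| <= r].
Proof.
move=> r0; apply/nbhs_normP; exists r => //= q /=.
by rewrite /ball_ /= distrC => /ltW.
Qed.

Lemma nbhs_norm_leP (V : normedModType R) (w : V) (A : set V) : nbhs w A ->
  exists2 r : R, 0 < r & forall q, `|q - w| <= r -> A q.
Proof.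
move=> /nbhs_normP[r /= r0 H]; exists (r / 2) => [|q qr].
  by rewrite divr_gt0.
by apply: H; rewrite /ball_ /= distrC (le_lt_trans qr)// ltr_pdivrMr// ltr_pMr// ltr1n.
Qed.

End RowNorms.

(** * Growth along characteristics implies vertical regularity *)

Section LoopArithmetic.
Context (R : realType).
Implicit Types t eps Lam : R.

(** The slopes lj, lk, - lj, - lk around the loop add up to zero, so only the four errors remain. *)
Lemma loop_increment (t eps lj lk x0 x1 x2 x3 x4 : R) :
  `|x1 - x0 - lj * t| <= eps * t -> `|x2 - x1 - lk * t| <= eps * t ->
  `|x3 - x2 - (- lj) * t| <= eps * t -> `|x4 - x3 - (- lk) * t| <= eps * t ->
  `|x4 - x0| <= 4 * eps * t.
Proof.
rewrite !ler_norml => /andP[? ?] /andP[? ?] /andP[? ?] /andP[? ?].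
by apply/andP; split; lra.
Qed.

(** Here u1 and u3 are the values of tau on two opposite sides of the loop. Their main parts t x0
    and t x2 differ by t times an increment of order t, so the loop fails to close along c_j by
    O(t^2) only. The summand 1 makes the constant at least 1. *)
Lemma loop_defect (t eps Lam lj lk x0 x1 x2 u1 u3 : R) : 0 <= t ->
  `|lj| <= Lam -> `|lk| <= Lam ->
  `|x1 - x0 - lj * t| <= eps * t -> `|x2 - x1 - lk * t| <= eps * t ->
  `|u1 - t * x0 - 2^-1 * lj * t ^+ 2| <= eps * t ^+ 2 ->
  `|u3 - t * x2 - - 2^-1 * lj * t ^+ 2| <= eps * t ^+ 2 ->
  `|u3 - u1| <= (3 * Lam + 4 * eps + 1) * t ^+ 2.
Proof.
move=> t0 lj1 lk1 a1 a2 b1 b3.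
have tm (x y : R) : `|x| <= y -> `|t * x| <= t * y.
  by move=> ?; rewrite normrM ger0_norm// ler_wpM2l.
have tt (x y : R) : `|x| <= y -> `|t ^+ 2 * x| <= t ^+ 2 * y.
  by move=> ?; rewrite normrM (ger0_norm (sqr_ge0 t)) ler_wpM2l// sqr_ge0.
move: (tm _ _ a1) (tm _ _ a2) (tt _ _ lj1) (tt _ _ lk1) b1 b3 (sqr_ge0 t).
clear; rewrite !ler_norml => /andP[? ?] /andP[? ?] /andP[? ?] /andP[? ?].
by move=> /andP[? ?] /andP[? ?] ?; apply/andP; split; lra.
Qed.

Lemma half_steps (rho c : R) : 8 * c <= rho -> 0 <= c ->
  [/\ rho / 2 <= rho, rho / 2 + c <= rho, rho / 2 + c + c <= rho,
      rho / 2 + c + c + c <= rho & rho / 2 + c + c + c + c <= rho].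
Proof. by move=> ? ?; split; lra. Qed.

Lemma loop_const_steps (B L t2 rho : R) : 0 <= B * t2 -> 0 <= L * t2 ->
  0 <= t2 -> 0 < rho -> 4 * ((B + L + 1) * t2) <= rho ->
  rho / 2 + B * t2 <= rho /\ rho / 2 + B * t2 + L * t2 <= rho.
Proof. by move=> ? ? ? ? ?; split; lra. Qed.

Lemma loop_total (eps S t x0 x4 x5 x6 : R) : `|x4 - x0| <= 4 * eps * t ->
  `|x4 - x5| <= S * t -> `|x5 - x6| <= S * t ->
  `|x6 - x0| <= (4 * eps + 2 * S) * t.
Proof.
rewrite !ler_norml => /andP[? ?] /andP[? ?] /andP[? ?].
by apply/andP; split; lra.
Qed.

Lemma sqrt_dist_le (A x t : R) : 0 <= A -> 0 <= t -> x ^+ 2 <= A * t ^+ 2 ->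
  `|x| <= Num.sqrt A * t.
Proof.
move=> A0 t0 xA; rewrite -(ger0_norm t0) -!sqrtr_sqr -sqrtrM// ler_sqrt//.
exact: le_trans (sqr_ge0 _) xA.
Qed.

End LoopArithmetic.

Section Characteristics.
Context (R : realType) (a h : nat).
Context (bb : 'I_a -> 'I_a -> 'rV[R]_h) (c : 'I_a -> 'rV[R]_h).
Hypothesis bb_skew : forall j k, bb j k = - bb k j.
Local Notation pt := ('rV[R]_a * 'rV[R]_h)%type.
Implicit Types (f : pt -> R) (w : pt) (j k : 'I_a) (lam : 'I_a -> R).

(** In exponential coordinates X_j is the field (e_j, - [half_bracket] j x), constant along its own
    direction because [bb j j] vanishes. *)
Definition half_bracket j (x : 'rV[R]_a) : 'rV[R]_h :=
  2^-1 *: \sum_k x ord0 k *: bb j k.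

Lemma bb_diag j : bb j j = 0.
Proof.
apply/rowP => i; have := congr1 (fun u : 'rV_h => u ord0 i) (bb_skew j j).
by rewrite !mxE; lra.
Qed.

Lemma half_bracketD j x y :
  half_bracket j (x + y) = half_bracket j x + half_bracket j y.
Proof.
rewrite /half_bracket -scalerDr -big_split/=; congr (_ *: _).
by apply: eq_bigr => k _; rewrite mxE scalerDl.
Qed.

Lemma half_bracketZ j t x : half_bracket j (t *: x) = t *: half_bracket j x.
Proof.
rewrite /half_bracket scalerA mulrC -scalerA scaler_sumr; congr (_ *: _).
by apply: eq_bigr => k _; rewrite mxE scalerA.
Qed.

Lemma half_bracket_delta j k :
  half_bracket j (delta_mx ord0 k) = 2^-1 *: bb j k.
Proof.
rewrite /half_bracket (bigD1 k)//= mxE !eqxx scale1r big1 ?addr0// => l lk.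
by rewrite mxE (negPf lk) andbF scale0r.
Qed.

Lemma half_bracket_deltaj j : half_bracket j (delta_mx ord0 j) = 0.
Proof. by rewrite half_bracket_delta bb_diag scaler0. Qed.

(* The plane swept by the flow of s X_j and by c j; the curve u = tau t in it is
   an integral curve of s D^f_j if and only if tau' = f. *)
Definition char_pt j (s : R) w (t u : R) : pt :=
  (w.1 + (s * t) *: delta_mx ord0 j,
   w.2 - s *: (t *: half_bracket j w.1 + u *: c j)).

(** No differential equation is imposed on tau: the second bound is what integrating the first along
    tau' = f yields, and it is all that the crossing and loop arguments use. A single curve from w
    is enough. *)
Definition char_curve f j s w (r l eps : R) := exists tau : R -> R,
  [/\ {within `[0, r], continuous tau}, tau 0 = 0 &
   forall t : R, 0 <= t <= r ->
     `|f (char_pt j s w t (tau t)) - f w - s * l * t| <= eps * t /\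
     `|tau t - t * f w - 2^-1 * s * l * t ^+ 2| <= eps * t ^+ 2].

(** The slope [lam j] and the lifetime r are common to all starting points in D, so that slopes
    cancel when curves issued from different points are compared. *)
Definition chars_on f (D : set pt) (r : R) lam (eps : R) :=
  forall j s w, s = 1 \/ s = -1 -> D w -> char_curve f j s w r (lam j) eps.

(* Two characteristics issued from points at distance d along c j cross
   before time 2 d / |Delta f|, unless Delta f = O(sqrt (eps * d)); but f has a
   single value at the crossing point. *)
Let crossing_pos f D (r : R) lam (eps : R) j w (d : R) : 0 < eps -> 0 < r ->
  chars_on f D r lam eps ->
  D w -> D (w.1, w.2 + d *: c j) -> 0 < d <= 2 * eps * r ^+ 2 ->
  (f (w.1, w.2 + d *: c j) - f w) ^+ 2 <= 8 * eps * d.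
Proof.
move=> e0 r0 ch Dw Dw' /andP[d0 dr]; set w' := (w.1, _); rewrite leNgt.
apply/negP => big.
pose K : R := `|f w' - f w|.
have Kgt0 : 0 < K.
  rewrite normr_gt0; apply: contraTneq big => ->.
  by rewrite expr0n/= -leNgt mulr_ge0 ?mulr_ge0 ?ltW.
(* The direction s is the sign of the difference, so that the two curves approach each other. *)
have [s s1 KE] : exists2 s : R, s = 1 \/ s = -1 & f w' - f w = s * K.
  rewrite /K.
  have [?|?] := ger0P (f w' - f w).
    by exists 1; [left|rewrite mul1r].
  by exists (-1); [right|rewrite mulN1r opprK].
have big' : 8 * eps * d < K ^+ 2 by rewrite /K real_normK ?num_real.
have [tau1 [ct1 t10 H1]] := ch j s w s1 Dw.
have [tau2 [ct2 t20 H2]] := ch j s w' s1 Dw'.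
(* The gap left between the two curves at time t, measured along [c j]. *)
pose del t := d - s * (tau2 t - tau1 t).
(* At constant speed K the gap would close at time d / K. Doubling this time leaves a margin d for
   the quadratic error 2 eps T^2, which is at most d because 8 eps d < K^2. *)
pose T := 2 * d / K.
have T0 : 0 < T by rewrite /T divr_gt0// mulr_gt0.
have TK : T * K = 2 * d by rewrite /T divfK// gt_eqF.
have Tr : T <= r.
  rewrite -ler_sqr ?nnegrE ?(ltW T0) ?(ltW r0)//.
  rewrite -(ler_pM2r (exprn_gt0 2 Kgt0)) -exprMn TK.
  have -> : (2 * d) ^+ 2 = 4 * d * d by ring.
  apply: (@le_trans _ _ (4 * d * (2 * eps * r ^+ 2))).
    by rewrite ler_pM2l// mulr_gt0.
  have -> : 4 * d * (2 * eps * r ^+ 2) = r ^+ 2 * (8 * eps * d) by ring.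
  by rewrite ler_pM2l ?exprn_gt0// ltW.
have bnd (t : R) : 0 <= t <= T -> `|tau2 t - tau1 t - t * (s * K)| <= 2 * eps * t ^+ 2.
  move=> /andP[t0 tT]; have tr : 0 <= t <= r by rewrite t0 (le_trans tT).
  have [_ A1] := H1 t tr; have [_ A2] := H2 t tr.
  rewrite -KE.
  have -> : tau2 t - tau1 t - t * (f w' - f w) =
    (tau2 t - t * f w' - 2^-1 * s * lam j * t ^+ 2) -
    (tau1 t - t * f w - 2^-1 * s * lam j * t ^+ 2) by ring.
  by apply: (le_trans (ler_normB _ _)); lra.
have delT : del T <= 0.
  have := bnd T; rewrite lexx ltW// => /(_ isT).
  rewrite ler_norml => /andP[L1 L2].
  have : s * (tau2 T - tau1 T) >= 2 * d - 2 * eps * T ^+ 2.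
    by case: s1 L1 L2 => ->; lra.
  rewrite /del.
  have : 2 * eps * T ^+ 2 * K ^+ 2 <= d * K ^+ 2.
    have -> : 2 * eps * T ^+ 2 * K ^+ 2 = d * (8 * eps * d).
      by rewrite -mulrA -exprMn TK; ring.
    by rewrite ler_pM2l// ltW.
  rewrite ler_pM2r ?exprn_gt0//; lra.
have cdel : {within `[0, T], continuous del}.
  have sub : `[0, T]%classic `<=` `[0, r].
    by apply: subset_itvl; rewrite bnd_simp.
  have c1 : {within `[0, T], continuous tau1} by exact: continuous_subspaceW ct1.
  have c2 : {within `[0, T], continuous tau2} by exact: continuous_subspaceW ct2.
  move=> t; apply: cvgB; first exact: cvg_cst.
  by apply: cvgM; [exact: cvg_cst|apply: cvgB; [exact: c2|exact: c1]].
have [t tT dt0] : exists2 t : R, t \in `[0, T]%R & del t = 0.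
  apply: IVT => //; first exact: ltW.
  rewrite /del t10 t20 subrr mulr0 subr0.
  by rewrite -/(del T) ge_min delT orbT le_max (ltW d0).
move: tT; rewrite in_itv/= => /andP[t0 tT].
have tr : 0 <= t <= r by rewrite t0 (le_trans tT).
have [A1 _] := H1 t tr; have [A2 _] := H2 t tr.
have E : char_pt j s w' t (tau2 t) = char_pt j s w t (tau1 t).
  congr (_, _) => /=; apply/subr0_eq.
  have -> : d = s * (tau2 t - tau1 t) by apply/eqP; rewrite -subr_eq0; apply/eqP.
  apply/rowP => i; rewrite !mxE; ring.
rewrite E in A2.
(* At the crossing f has one value and both increments contain the same s lam_j t, so only the two
   errors eps t remain. With t <= T this yields K^2 <= 4 eps d, against [big]. *)
have : K <= 2 * eps * t.
  rewrite /K.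
  have -> : f w' - f w = (f (char_pt j s w t (tau1 t)) - f w - s * lam j * t) -
    (f (char_pt j s w t (tau1 t)) - f w' - s * lam j * t) by ring.
  by apply: (le_trans (ler_normB _ _)); lra.
move=> Kt; have : K * K <= 2 * eps * T * K.
  rewrite ler_pM2r//; apply: (le_trans Kt).
  by rewrite ler_pM2l// mulr_gt0.
rewrite -mulrA TK -expr2 => ?.
have : K ^+ 2 <= 4 * eps * d by lra.
have : 0 < eps * d by rewrite mulr_gt0.
lra.
Qed.

Lemma crossing f D (r : R) lam (eps : R) j w (d : R) : 0 < eps -> 0 < r ->
  chars_on f D r lam eps ->
  D w -> D (w.1, w.2 + d *: c j) -> `|d| <= 2 * eps * r ^+ 2 ->
  (f (w.1, w.2 + d *: c j) - f w) ^+ 2 <= 8 * eps * `|d|.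
Proof.
move=> e0 r0 ch Dw Dw' dr.
have [d0|d0|<-] := ltgtP 0 d.
- by move: dr; rewrite gtr0_norm// => dr; apply: (crossing_pos e0 r0 ch); rewrite ?d0.
- move: dr; rewrite ltr0_norm// => dr.
  have := @crossing_pos f D r lam eps j (w.1, w.2 + d *: c j) (- d) e0 r0 ch.
  rewrite /= -addrA -scalerDl subrr scale0r addr0 -surjective_pairing.
  rewrite oppr_gt0 d0 dr -sqrrN opprB; exact.
- by rewrite scale0r addr0 -surjective_pairing subrr expr0n normr0 mulr0.
Qed.

Definition bb_bound : R := \sum_j \sum_k `|bb j k|.
Definition c_bound : R := \sum_j `|c j|.

Lemma bb_le j k : `|bb j k| <= bb_bound.
Proof.
rewrite /bb_bound (bigD1 j)//= (bigD1 k)//= -addrA lerDl.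
by rewrite addr_ge0// ?sumr_ge0// => l _; rewrite sumr_ge0.
Qed.

Lemma c_le j : `|c j| <= c_bound.
Proof. by rewrite /c_bound (bigD1 j)//= lerDl sumr_ge0. Qed.

Lemma bb_bound_ge0 : 0 <= bb_bound.
Proof. by apply: sumr_ge0 => j _; exact: sumr_ge0. Qed.

Lemma c_bound_ge0 : 0 <= c_bound.
Proof. exact: sumr_ge0. Qed.

Lemma half_bracket_le j x : `|half_bracket j x| <= bb_bound * `|x|.
Proof.
have hb : `|\sum_k x ord0 k *: bb j k| <= bb_bound * `|x|.
  apply: (le_trans (ler_norm_sum _ _ _)).
  apply: (@le_trans _ _ (\sum_k `|bb j k| * `|x|)).
    apply: ler_sum => k _; rewrite normrZ mulrC ler_wpM2l//.
    exact: row_coord_le.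
  rewrite -mulr_suml ler_wpM2r// /bb_bound [leRHS](bigD1 j)//= lerDl.
  by apply: sumr_ge0 => l _; exact: sumr_ge0.
apply: le_trans hb; rewrite /half_bracket normrZ ger0_norm ?invr_ge0//.
by rewrite -[leRHS]mul1r ler_wpM2r//; lra.
Qed.

Lemma char_pt_disp j (s : R) w (t u : R) : `|s| <= 1 -> 0 <= t ->
  `|char_pt j s w t u - w| <= t + (t * (bb_bound * `|w|) + `|u| * c_bound).
Proof.
move=> s1 t0; rewrite pair_norm_le /=; apply/andP; split.
  rewrite addrAC subrr add0r normrZ normrM (ger0_norm t0).
  apply: (@le_trans _ _ t).
    rewrite -[leRHS]mulr1 ler_pM ?mulr_ge0 ?row_norm_delta//.
    by rewrite -[leRHS]mul1r ler_wpM2r.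
  by rewrite lerDl addr_ge0 ?mulr_ge0 ?bb_bound_ge0 ?c_bound_ge0.
rewrite addrAC subrr add0r normrN normrZ -[leRHS]mul1r ler_pM//.
rewrite -[leLHS]add0r lerD//.
apply: (le_trans (ler_normD _ _)).
rewrite [`|t *: _|]normrZ [`|u *: _|]normrZ (ger0_norm t0) lerD//.
  rewrite ler_wpM2l//; apply: (le_trans (half_bracket_le _ _)).
  by rewrite ler_wpM2l ?bb_bound_ge0 ?pair_norm1_le.
by rewrite ler_wpM2l// c_le.
Qed.

(** The second and the third side each see the displacement of the preceding sides through
    [half_bracket], which contributes t^2 / 2 times [bb j k] twice. In step 2 there is no further
    term, and the values of tau enter only through differences over opposite sides. *)
Lemma loop_pt j k w (t u1 u2 u3 u4 : R) :
  char_pt k (-1) (char_pt j (-1) (char_pt k 1 (char_pt j 1 w t u1) t u2) t u3)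
    t u4 =
  (w.1, w.2 + t ^+ 2 *: bb j k + (u3 - u1) *: c j + (u4 - u2) *: c k).
Proof.
congr (_, _) => /=.
  by rewrite -!addrA; apply/rowP => i; rewrite !mxE; ring.
rewrite !half_bracketD !half_bracketZ !half_bracket_deltaj !half_bracket_delta.
rewrite [bb k j]bb_skew.
by apply/rowP => i; rewrite !mxE; field.
Qed.

(** The term 4 eps comes from the four sides of the loop. The square root is the crossing bound for
    a vertical gap of (3 Lam + 4 eps + 1) t^2, paid once along [c j] and once along [c k]. *)
Definition core_const (Lam eps : R) : R :=
  4 * eps + 2 * Num.sqrt (8 * eps * (3 * Lam + 4 * eps + 1)).

Section LoopEstimate.
Variables (f : pt -> R) (w0 : pt) (rho r : R) (lam : 'I_a -> R).
Variables (eps Lam M : R).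
Hypotheses (rho0 : 0 < rho) (r0 : 0 < r) (eps0 : 0 < eps) (M0 : 0 <= M).
Hypothesis lamLam : forall j, `|lam j| <= Lam.
Let D : set pt := [set w | `|w - w0| <= rho].
Hypothesis fM : forall w, D w -> `|f w| <= M.
Hypothesis ch : chars_on f D r lam eps.

(** A bound for the speed of a curve issued from the ball: the three terms are those of
    [char_pt_disp], with |tau t| <= t (M + (Lam + eps) r). *)
Definition disp_const (w0 : pt) (rho r eps Lam M : R) : R :=
  1 + bb_bound * (`|w0| + rho) + (M + (Lam + eps) * r) * c_bound.
Definition loop_const (eps Lam : R) : R :=
  bb_bound + (3 * Lam + 4 * eps + 1) * c_bound + 1.
Local Notation C := (disp_const w0 rho r eps Lam M).
Local Notation Q := (loop_const eps Lam).
Local Notation L := (3 * Lam + 4 * eps + 1).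

Let char_step j (s : R) w (t : R) : s = 1 \/ s = -1 -> 0 <= t <= r -> D w ->
  exists u : R, [/\ `|f (char_pt j s w t u) - f w - s * lam j * t| <= eps * t,
    `|u - t * f w - 2^-1 * s * lam j * t ^+ 2| <= eps * t ^+ 2 &
    `|char_pt j s w t u - w| <= C * t].
Proof.
move=> s1 /andP[t0 tr] Dw; have [tau [_ _ H]] := ch j s1 Dw.
have [|H1 H2] := H t; first by rewrite t0.
exists (tau t); split=> //.
have ns : `|s| = 1 by case: s1 => ->; rewrite ?normrN normr1.
have L0 : 0 <= Lam := le_trans (normr_ge0 _) (lamLam j).
apply: le_trans (char_pt_disp _ _ _ _ t0) _; first by rewrite ns.
have ut : `|tau t| <= t * (M + (Lam + eps) * r).
  have -> : tau t = tau t - t * f w - 2^-1 * s * lam j * t ^+ 2 +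
    (t * f w + 2^-1 * s * lam j * t ^+ 2) by ring.
  apply: (le_trans (ler_normD _ _)).
  have : `|t * f w + 2^-1 * s * lam j * t ^+ 2| <= t * M + 2^-1 * Lam * t ^+ 2.
    apply: (le_trans (ler_normD _ _)); rewrite lerD//.
      by rewrite normrM ger0_norm// ler_wpM2l// fM.
    rewrite normrM (ger0_norm (sqr_ge0 t)) ler_wpM2r ?sqr_ge0// normrM normrM ns.
    by rewrite mulr1 ger0_norm ?invr_ge0// ler_wpM2l ?invr_ge0.
  have : (Lam + eps) * t ^+ 2 <= (Lam + eps) * (t * r).
    by rewrite expr2 !ler_wpM2l// addr_ge0// ltW.
  have : 0 <= Lam * t ^+ 2 by rewrite mulr_ge0 ?sqr_ge0.
  lra.
have wn : `|w| <= `|w0| + rho.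
  by rewrite -[w](subrK w0) addrC (le_trans (ler_normD _ _))// lerD2l.
have H3 : t * (bb_bound * `|w|) <= t * (bb_bound * (`|w0| + rho)).
  by rewrite !ler_wpM2l ?bb_bound_ge0.
have H4 : `|tau t| * c_bound <= t * (M + (Lam + eps) * r) * c_bound.
  by rewrite ler_wpM2r ?c_bound_ge0.
rewrite /disp_const; lra.
Qed.

(** The loop ends at w4, which differs from the target p6 by (u4 - u2) [c k] and (u3 - u1) [c j];
    two applications of [crossing], through p5, remove these gaps. The three size conditions keep
    the corners of the loop in the ball, keep p5 and p6 in the ball, and keep the gaps in the range
    of [crossing], respectively. *)
Lemma loop_estimate j k w (t : R) : `|w - w0| <= rho / 2 -> 0 < t <= r ->
  8 * (C * t) <= rho -> 4 * (Q * t ^+ 2) <= rho -> L * t ^+ 2 <= 2 * eps * r ^+ 2 ->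
  `|f (w.1, w.2 + t ^+ 2 *: bb j k) - f w| <= core_const Lam eps * t.
Proof.
move=> ww0 /andP[t0 tr] Ct Qt Lt.
have L0 : 0 <= Lam := le_trans (normr_ge0 _) (lamLam j).
have near (p q : pt) (x y : R) : `|p - w0| <= x -> `|q - p| <= y ->
    `|q - w0| <= x + y.
  move=> pw qp; rewrite (_ : q - w0 = (p - w0) + (q - p)); last first.
    by rewrite [RHS]addrC addrA subrK.
  by rewrite (le_trans (ler_normD _ _))// lerD.
have trr : 0 <= t <= r by rewrite ltW.
have one : 1 = 1 :> R \/ 1 = -1 :> R by left.
have mone : -1 = 1 :> R \/ -1 = -1 :> R by right.
have C0 : 0 <= C * t.
  rewrite mulr_ge0 ?(ltW t0)// /disp_const.
  by rewrite !(addr_ge0, mulr_ge0) ?bb_bound_ge0 ?c_bound_ge0// ltW.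
have [s0 s1 s2 s3 s4] := half_steps Ct C0.
have Dw : D w by rewrite /D/= (le_trans ww0).
have [u1 [A1 B1 E1]] := char_step j one trr Dw.
set w1 := char_pt j 1 w t u1 in A1 E1.
have N1 := near _ _ _ _ ww0 E1.
have Dw1 : D w1 by rewrite /D/= (le_trans N1).
have [u2 [A2 B2 E2]] := char_step k one trr Dw1.
set w2 := char_pt k 1 w1 t u2 in A2 E2.
have N2 := near _ _ _ _ N1 E2.
have Dw2 : D w2 by rewrite /D/= (le_trans N2).
have [u3 [A3 B3 E3]] := char_step j mone trr Dw2.
set w3 := char_pt j (-1) w2 t u3 in A3 E3.
have N3 := near _ _ _ _ N2 E3.
have Dw3 : D w3 by rewrite /D/= (le_trans N3).
have [u4 [A4 B4 E4]] := char_step k mone trr Dw3.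
set w4 := char_pt k (-1) w3 t u4 in A4 E4.
have N4 := near _ _ _ _ N3 E4.
have Dw4 : D w4 by rewrite /D/= (le_trans N4).
have W4 : w4 = (w.1, w.2 + t ^+ 2 *: bb j k + (u3 - u1) *: c j +
    (u4 - u2) *: c k) by exact: loop_pt.
have lj := lamLam j; have lk := lamLam k.
rewrite !mulN1r in A3 A4; rewrite !mul1r in A1 A2.
rewrite ?mulr1 in B1 B2; rewrite !mulrN !mulr1 in B3 B4.
have L1 : 0 < L by rewrite ltr_wpDl// addr_ge0// mulr_ge0// ltW.
have u31 : `|u3 - u1| <= L * t ^+ 2.
  exact: loop_defect (ltW t0) lj lk A1 A2 B1 B3.
(* Sides 2 and 4 are in the position of sides 1 and 3, with slopes [lam k] and - [lam j] in place of
   [lam j] and [lam k]. *)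
have u42 : `|u4 - u2| <= L * t ^+ 2.
  have lj' : `|- lam j| <= Lam by rewrite normrN.
  exact: loop_defect (ltW t0) lk lj' A2 A3 B2 B4.
have t2 : 0 <= t ^+ 2 by rewrite sqr_ge0.
have f4 : `|f w4 - f w| <= 4 * eps * t by exact: loop_increment A1 A2 A3 A4.
have cj0 := c_bound_ge0; have b0 := bb_bound_ge0.
have Lc : 0 <= L * c_bound by rewrite mulr_ge0// ltW.
set p6 : pt := (w.1, _); pose p5 : pt := (w.1, p6.2 + (u4 - u2) *: c k).
have snd_disp (p : pt) (v : 'rV[R]_h) : `|(p.1, p.2 + v) - p : pt| <= `|v|.
  by rewrite pair_norm_le /= subrr normr0 normr_ge0 /= addrAC subrr add0r.
have [v1 v2] := loop_const_steps (mulr_ge0 b0 t2) (mulr_ge0 Lc t2) t2 rho0 Qt.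
have N6 : `|p6 - w0| <= rho / 2 + bb_bound * t ^+ 2.
  apply: (near w) => //; apply: (le_trans (snd_disp _ _)).
  by rewrite normrZ ger0_norm// mulrC ler_wpM2r// bb_le.
have N5 : `|p5 - w0| <= rho / 2 + bb_bound * t ^+ 2 + L * c_bound * t ^+ 2.
  apply: (near p6 p5 _ _ N6); apply: (le_trans (snd_disp p6 _)).
  by rewrite normrZ mulrAC ler_pM// c_le.
have D6 : D p6. by rewrite /D/= (le_trans N6).
have D5 : D p5. by rewrite /D/= (le_trans N5).
have W45 : w4 = (p5.1, p5.2 + (u3 - u1) *: c j).
  by rewrite W4 /p5 /p6 /=; congr (_, _); rewrite addrAC.
have e8 : 0 <= 8 * eps by rewrite mulr_ge0// ltW.
have sq (x y : R) : `|y| <= L * t ^+ 2 -> x ^+ 2 <= 8 * eps * `|y| ->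
    `|x| <= Num.sqrt (8 * eps * L) * t.
  move=> yL xy; apply: sqrt_dist_le (ltW t0) _; first by rewrite mulr_ge0// ltW.
  by apply: (le_trans xy); rewrite -[leRHS]mulrA ler_wpM2l.
have f56 : `|f p5 - f p6| <= Num.sqrt (8 * eps * L) * t.
  apply: (sq _ (u4 - u2)) => //.
  exact: (@crossing f D r lam eps k p6 _ eps0 r0 ch D6 D5 (le_trans u42 Lt)).
have f45 : `|f w4 - f p5| <= Num.sqrt (8 * eps * L) * t.
  apply: (sq _ (u3 - u1)) => //; rewrite W45 in Dw4 *.
  exact: (@crossing f D r lam eps j p5 _ eps0 r0 ch D5 Dw4 (le_trans u31 Lt)).
exact: loop_total f4 f45 f56.
Qed.

End LoopEstimate.

(** The radius r' is chosen before f and depends on f only through the bound M, so that a whole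
    family of approximations can be treated at one scale. *)
Lemma holder_at_origin_scale (w0 : pt) (rho r : R) lam (eps Lam M : R) :
  0 < rho -> 0 < r -> 0 < eps -> 0 <= M -> (forall j, `|lam j| <= Lam) ->
  0 <= Lam ->
  exists2 r' : R, 0 < r' & forall f,
    (forall w, `|w - w0| <= rho -> `|f w| <= M) ->
    chars_on f [set w | `|w - w0| <= rho] r lam eps ->
    forall v, (exists j, v = c j) \/ (exists j k, v = bb j k) ->
    forall w (d : R), `|w - w0| <= r' -> `|d| <= r' ->
    `|f (w.1, w.2 + d *: v) - f w| <= core_const Lam eps * Num.sqrt `|d|.
Proof.
move=> rho0 r0 eps0 M0 lamLam L0.
pose C := disp_const w0 rho r eps Lam M; pose Q := loop_const eps Lam.
pose L := 3 * Lam + 4 * eps + 1.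
have L1 : 0 < L by rewrite ltr_wpDl// addr_ge0// mulr_ge0// ltW.
have cb0 := c_bound_ge0; have bb0 := bb_bound_ge0.
have C0 : 0 < C.
  rewrite /C /disp_const -addrA ltr_pwDl// !(addr_ge0, mulr_ge0)//;
  by rewrite ?(ltW rho0) ?(ltW r0) ?(ltW eps0).
have Q0 : 0 < Q by rewrite ltr_wpDl// addr_ge0// mulr_ge0// ltW.
(* With t = sqrt |d| the five bounds give, in order: w well inside the ball, Q t^2 <= rho / 4, t <=
   r, 8 C t <= rho, and L t^2 <= 2 eps r^2. *)
pose r' := Num.min (rho / 4) (Num.min (rho / (4 * Q)) (Num.min (r ^+ 2)
  (Num.min ((rho / (8 * C)) ^+ 2) (2 * eps * r ^+ 2 / L)))).
have r'0 : 0 < r' by rewrite !lt_min !(divr_gt0, exprn_gt0, mulr_gt0).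
exists r' => // f fM ch v vbc w d ww0; rewrite !le_min.
move=> /and5P[d1 d2 d3 d4 d5].
have {}ww0 : `|w - w0| <= rho / 4.
  by apply: (le_trans ww0); rewrite /r' ge_min lexx.
pose t := Num.sqrt `|d|.
have t2 : t ^+ 2 = `|d| by rewrite sqr_sqrtr.
have Qd : 4 * (Q * `|d|) <= rho.
  by move: d2; rewrite ler_pdivlMr ?mulr_gt0// mulrC -mulrA.
have [->|dn0] := eqVneq d 0.
  rewrite scale0r addr0 -surjective_pairing subrr normr0 mulr_ge0//.
  by rewrite addr_ge0// mulr_ge0// ltW.
have t0 : 0 < t by rewrite sqrtr_gt0 normr_gt0.
have Ld : L * `|d| <= 2 * eps * r ^+ 2 by rewrite mulrC -ler_pdivlMr.
have ms (x y : R) : 0 < y -> x ^+ 2 <= y ^+ 2 -> x <= y.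
  move=> y0 xy; have [x0|/ltW x0] := leP x 0; first exact: (le_trans x0 (ltW _)).
  by move: xy; rewrite ler_sqr// ?nnegrE// ltW.
have tr : t <= r by apply: ms => //; rewrite t2.
have Ct : 8 * (C * t) <= rho.
  by rewrite mulrA mulrC -ler_pdivlMr ?mulr_gt0// ms ?t2// divr_gt0// mulr_gt0.
have disp (u : 'rV[R]_h) (B : R) : `|u| <= B -> B <= Q ->
    `|(w.1, w.2 + d *: u) - w0| <= rho / 2.
  move=> uB BQ; rewrite (_ : _ - w0 = w - w0 + (0, d *: u)); last first.
    by congr (_, _); rewrite /= ?addr0// addrAC.
  apply: (le_trans (ler_normD _ _)).
  have : `|(0, d *: u) : pt| <= Q * `|d|.
    rewrite pair_norm_le normr0 mulr_ge0 ?(ltW Q0)//= normrZ mulrC ler_wpM2r//.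
    exact: le_trans uB BQ.
  lra.
have e8 : 0 <= 8 * eps by rewrite mulr_ge0// ltW.
have rho_le (x : pt) : `|x - w0| <= rho / 2 -> `|x - w0| <= rho.
  by move=> H; apply: (le_trans H); lra.
have ww2 : `|w - w0| <= rho / 2 by apply: (le_trans ww0); lra.
have LE : 1 <= L by rewrite /L lerDr addr_ge0// mulr_ge0// ltW.
have LQ : L * c_bound <= Q by rewrite /Q /loop_const -/L addrAC lerDr addr_ge0.
case: vbc => [[j ->]|[j [k ->]]].
  have cQ : c_bound <= Q by apply: le_trans LQ; rewrite ler_peMl.
  have := crossing eps0 r0 ch (rho_le _ ww2) (rho_le _ (disp _ _ (c_le j) cQ)).
  have -> : `|d| <= 2 * eps * r ^+ 2.
    by apply: le_trans Ld; rewrite ler_peMl.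
  move=> /(_ isT) H.
  apply: (@le_trans _ _ (Num.sqrt (8 * eps * L) * t)).
    apply: sqrt_dist_le; [by rewrite mulr_ge0// ltW|exact: ltW|].
    by rewrite t2 (le_trans H)// -[leRHS]mulrA ler_wpM2l// ler_peMl.
  rewrite /core_const ler_wpM2r ?sqrtr_ge0// -/L.
  have := sqrtr_ge0 (8 * eps * L); lra.
have H := loop_estimate rho0 r0 eps0 M0 lamLam fM ch j k _ _.
have bbQ : bb_bound <= Q by rewrite /Q /loop_const -addrA lerDl addr_ge0// mulr_ge0// ltW.
have [dp|dm] := leP 0 d.
  have := H w t ww2; rewrite t0 tr t2 => /(_ isT Ct Qd Ld).
  by rewrite -/t (ger0_norm dp).
(* For negative d the loop is run from the displaced point and leads back to w. *)
have := H (w.1, w.2 + d *: bb j k) t (disp _ _ (bb_le j k) bbQ).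
rewrite t0 tr t2 => /(_ isT Ct Qd Ld).
rewrite -/t /= (ltr0_norm dm) -addrA -scalerDl subrr scale0r addr0.
by rewrite -surjective_pairing distrC.
Qed.

End Characteristics.

(** * Local form of the little Hölder condition *)

Section LittleHolderLocal.
Context (R : realType).

Lemma limsup_eq0P (S : R -> set R) : limsup_eq0 S <->
  (forall e : R, 0 < e -> exists2 d : R, 0 < d &
     forall r, 0 < r < d -> forall x, S r x -> x <= e).
Proof.
split=> [S0 e e0|H].
- have /S0 : nbhs (0%E : \bar R) [set y | (y < e%:E)%E].
    by apply: open_ereal_lt' => //; rewrite lte_fin.
  rewrite /nbhs/= => -[d /= d0 H]; exists d => // r /andP[r0 rd] x Sx.
  have /= : (ereal_sup (0%E |` [set x%:E | x in S r]) < e%:E)%E.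
    by apply: H => //=; rewrite sub0r normrN gtr0_norm.
  move=> /ltW; apply: contraTT; rewrite -!ltNge => ex.
  apply: (@lt_le_trans _ _ x%:E); first by rewrite lte_fin.
  by apply: ereal_sup_ubound; right; exists x.
- have bnd (e : R) : 0 < e -> \forall r \near 0^'+,
      (0 <= ereal_sup (0%E |` [set x%:E | x in S r]) <= e%:E)%E.
    move=> e0; have [d d0 Hd] := H _ e0; near=> r.
    have r0d : 0 < r < d.
      by apply/andP; split; near: r; [exact: nbhs_right_gt|exact: nbhs_right_lt].
    apply/andP; split; first by apply: ereal_sup_ubound; left.
    apply: ge_ereal_sup => z [->|[x Sx <-]]; first by rewrite lee_fin ltW.
    by rewrite lee_fin; exact: Hd Sx.
  apply/fine_cvgP; split.
    near=> r; have /andP[y0 y1] : (0 <= ereal_sup (0%E |` [set x%:E | x in S r])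
        <= 1%:E)%E by near: r; exact: bnd.
    by rewrite ge0_fin_numE// (le_lt_trans y1)// ltry.
  apply/cvgrPdist_le => e e0; near=> r.
  have /andP[y0 ye] : (0 <= ereal_sup (0%E |` [set x%:E | x in S r])
      <= e%:E)%E by near: r; exact: bnd.
  rewrite /= sub0r normrN ger0_norm ?fine_ge0// -lee_fin fineK//.
  by rewrite ge0_fin_numE// (le_lt_trans ye)// ltry.
Unshelve. all: by end_near. Qed.

(** Both points of a pair range over one ball around w0; compactness turns this pointwise condition
    into the uniform one on relatively compact open subsets. *)
Definition local_holder n h (U : set (pointW R n h)) (phi : pointW R n h -> R) :=
  forall w0, U w0 -> forall e : R, 0 < e -> exists2 r : R, 0 < r &
  forall x y y', `|(x, y) - w0| <= r -> `|(x, y') - w0| <= r ->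
    `|phi (x, y') - phi (x, y)| <= e * Num.sqrt `|y' - y|.

(** The vertical coordinates are changed one at a time, through points [z k] that agree with y' in
    the first k coordinates. Each of the h steps costs the fraction e / (h + 1), where h + 1 keeps
    the divisor positive. *)
Lemma local_holder_coord n h (U : set (pointW R n h)) phi :
  (forall w0, U w0 -> forall e : R, 0 < e -> exists2 r : R, 0 < r &
    forall i w (d : R), `|w - w0| <= r -> `|d| <= r ->
    `|phi (w.1, w.2 + d *: delta_mx ord0 i) - phi w| <= e * Num.sqrt `|d|) ->
  local_holder U phi.
Proof.
move=> H w0 Uw0 e e0.
have h0 : 0 < h.+1%:R :> R by [].
have [r r0 Hr] := H w0 Uw0 _ (divr_gt0 e0 h0).
exists (r / 2) => [|x y y']; first by rewrite divr_gt0.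
rewrite !pair_norm_le /= => /andP[xr yr] /andP[_ y'r].
pose z k : 'rV[R]_h := \row_i (if (i < k)%N then y' ord0 i else y ord0 i).
have zr k : `|z k - w0.2| <= r.
  apply: row_norm_le (ltW r0) _ => i; rewrite !mxE.
  have cl (u : 'rV[R]_h) : `|u - w0.2| <= r / 2 -> `|u ord0 i - w0.2 ord0 i| <= r.
    move=> ur; have := row_coord_le (u - w0.2) i; rewrite !mxE => ?; lra.
  by case: ifP => _; exact: cl.
have yy : `|y' - y| <= r.
  rewrite (_ : y' - y = (y' - w0.2) - (y - w0.2)); last first.
    by rewrite opprB addrA subrK.
  by apply: (le_trans (ler_normB _ _)); lra.
have xr' : `|x - w0.1| <= r by lra.
have step k : (k <= h)%N -> `|phi (x, z k) - phi (x, y)| <=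
    k%:R * (e / h.+1%:R * Num.sqrt `|y' - y|).
  elim: k => [_|k IH kh].
    rewrite (_ : z 0%N = y); last by apply/rowP => i; rewrite mxE.
    by rewrite subrr normr0 mul0r.
  have zS : z k.+1 = z k + (y' ord0 (Ordinal kh) - y ord0 (Ordinal kh)) *:
      delta_mx ord0 (Ordinal kh).
    apply/rowP => i; rewrite !mxE eqxx/= ltnS leq_eqVlt.
    have [->|ik] := eqVneq i (Ordinal kh).
      by rewrite eqxx ltnn /= mulr1 addrC subrK.
    have -> : (i == k :> nat) = false by apply/negbTE.
    by rewrite mulr0 addr0.
  have dr : `|y' ord0 (Ordinal kh) - y ord0 (Ordinal kh)| <= `|y' - y|.
    by have := row_coord_le (y' - y) (Ordinal kh); rewrite !mxE.
  have := Hr (Ordinal kh) (x, z k) _ _ (le_trans dr yy).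
  rewrite pair_norm_le /= xr' zr => /(_ isT); rewrite -zS => H1.
  rewrite -(subrKA (phi (x, z k))) -natr1 mulrDl mul1r addrC.
  apply: (le_trans (ler_normD _ _)); rewrite lerD ?IH ?(ltnW kh)//.
  apply: (le_trans H1); rewrite ler_wpM2l ?divr_ge0 ?(ltW e0)//.
  by rewrite ler_sqrt.
have zh : z h = y' by apply/rowP => i; rewrite mxE ltn_ord.
rewrite -zh; apply: (le_trans (step h (leqnn _))); rewrite zh mulrA.
rewrite ler_wpM2r ?sqrtr_ge0// mulrCA -[leRHS]mulr1 ler_wpM2l ?(ltW e0)//.
by rewrite ler_pdivrMr// mul1r ler_nat.
Qed.

(** A covering argument on the compact closure makes the radius uniform. The maximum norm of
    [local_holder] is dominated by the Euclidean norm, so passing to the latter costs no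
    constant. *)
Lemma local_holder_little n h (U : set (pointW R n h)) phi :
  local_holder U phi -> local_little_holder_vertical 2^-1 U phi.
Proof.
move=> H V oV cV VU; apply/limsup_eq0P => e e0.
have /compact_near_coveringP cov := cV.
have := cov R (0^'+) (fun (d : R) (w : pointW R n h) => forall w' : pointW R n h,
  w'.1 = w.1 -> `|w' - w| <= d ->
  `|phi w' - phi w| <= e * Num.sqrt `|w'.2 - w.2|) _.
case=> [w /VU Uw|].
  have [r r0 Hr] := H _ Uw _ e0.
  exists ([set q | `|q - w| <= r / 2], [set d | 0 < d < r / 2]); first split.
  - by apply: nbhs_norm_le; rewrite divr_gt0.
  - near=> d => /=; apply/andP; split; near: d; first exact: nbhs_right_gt.
    by apply: nbhs_right_lt; rewrite divr_gt0.
  move=> [[x y] d] /= [xyr /andP[d0 dr]] [x' y'] /= -> w'd.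
  apply: Hr; first lra.
  rewrite -(subrKA (x, y)) (le_trans (ler_normD _ _))//; lra.
move=> d /= d0 Hd; exists (d / 2) => [|r /andP[r0 rd] c].
  by rewrite divr_gt0.
move=> [x [y [y' [Vy Vy' /andP[n0 nr] ->]]]].
set E := euclidean_norm _ in n0 nr *.
have yE : `|y' - y| <= E.
  apply: row_norm_le (ltW n0) _ => i.
  rewrite -sqrtr_sqr ler_sqrt; last first.
    by rewrite addr_ge0// sumr_ge0// => k _; rewrite sqr_ge0.
  rewrite /= (bigD1 i)//= addrCA lerDl addr_ge0// sumr_ge0// => k _;
  by rewrite sqr_ge0.
rewrite powR12_sqrt ?(ltW n0)// ler_pdivrMr; last by rewrite sqrtr_gt0.
have yd : `|(x, y') - (x, y) : pointW R n h| <= d / 2.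
  rewrite pair_norm_le /= subrr normr0 divr_ge0 ?(ltW d0)//=.
  exact: le_trans yE (ltW (lt_trans nr rd)).
have := Hd (d / 2) _ _ (x, y) _ (x, y') erefl yd.
move=> Hc; apply: (le_trans (Hc _ _ _)).
- by rewrite /= sub0r normrN gtr0_norm ?divr_gt0//; lra.
- by rewrite divr_gt0.
- exact: subset_closure.
- by rewrite ler_wpM2l ?(ltW e0)// ler_wsqrtr.
Unshelve. all: by end_near. Qed.

End LittleHolderLocal.

Section CharacteristicsHolder.
Context (R : realType) (a h : nat).
Context (bb : 'I_a -> 'I_a -> 'rV[R]_h) (c : 'I_a -> 'rV[R]_h).
Hypothesis bb_skew : forall j k, bb j k = - bb k j.
Hypothesis bb_c_basis : forall i, exists v : 'rV[R]_h,
  ((exists j, v = c j) \/ (exists j k, v = bb j k)) /\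
  (delta_mx ord0 i = v \/ delta_mx ord0 i = - v).
Local Notation pt := ('rV[R]_a * 'rV[R]_h)%type.

Lemma core_const_small (Lam e : R) : 0 <= Lam -> 0 < e ->
  exists2 eps : R, 0 < eps & core_const Lam eps <= e.
Proof.
(* For eps <= 1 the radicand is at most A eps, and eps <= e^2 / (16 A) makes its root at most e / 4;
   eps <= e / 8 bounds the other term by e / 2. *)
move=> L0 e0; pose A := 8 * (3 * Lam + 5).
have A0 : 0 < A by rewrite mulr_gt0// ltr_wpDl// mulr_ge0.
pose eps := Num.min 1 (Num.min (e / 8) (e ^+ 2 / (16 * A))).
have eps0 : 0 < eps.
  rewrite /eps !lt_min ltr01; apply/and3P; split=> //; apply: divr_gt0 => //.
    exact: exprn_gt0.
  exact: mulr_gt0.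
have : eps <= eps by []; rewrite {2}/eps !le_min => /and3P[e1 e2 e3].
exists eps => //; rewrite /core_const.
have : `|Num.sqrt (8 * eps * (3 * Lam + 4 * eps + 1))| <= e / 4.
  rewrite ger0_norm ?sqrtr_ge0//.
  have e4 : 0 <= e / 4 by rewrite divr_ge0 ?(ltW e0).
  rewrite -(ger0_norm e4) -sqrtr_sqr ler_wsqrtr//.
  move: e3; rewrite (ler_pdivlMr _ _ (mulr_gt0 _ A0))// => e3; rewrite expr_div_n.
  have : eps * (4 * eps) <= eps * 4.
    by rewrite ler_wpM2l ?(ltW eps0)//; lra.
  move: e3; rewrite /A; lra.
rewrite ger0_norm ?sqrtr_ge0//; lra.
Qed.

(** The slopes are fixed before eps, so eps can be chosen small in terms of their size; rho, r and M
    are fixed before eta, so the estimate for g is uniform in eta and passes to f as eta tends to 0.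
    Cases where f itself has the curves take g = f. *)
Lemma chars_local_holder (U : set pt) (f : pt -> R) :
  (forall w0, U w0 -> exists lam : 'I_a -> R, forall eps : R, 0 < eps ->
    exists rho r M : R, [/\ 0 < rho, 0 < r, 0 <= M &
      forall eta : R, 0 < eta -> exists g : pt -> R,
      [/\ forall w, `|w - w0| <= rho -> `|g w - f w| <= eta,
          forall w, `|w - w0| <= rho -> `|g w| <= M &
          chars_on bb c g [set w | `|w - w0| <= rho] r lam eps]]) ->
  local_holder U f.
Proof.
move=> H; apply: local_holder_coord => w0 /H[lam {}H] e e0.
pose Lam := \sum_j `|lam j|.
have L0 : 0 <= Lam by exact: sumr_ge0.
have lamLam j : `|lam j| <= Lam by rewrite /Lam (bigD1 j)//= lerDl sumr_ge0.
have [eps eps0 epse] := core_const_small L0 e0.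
have [rho [r [M [rho0 r0 M0 {}H]]]] := H _ eps0.
have [r' r'0 core] := holder_at_origin_scale c bb_skew w0 rho0 r0 eps0 M0 lamLam L0.
exists (Num.min r' (rho / 2)) => [|i w d].
  by rewrite lt_min r'0 divr_gt0.
rewrite !le_min => /andP[wr' wrho] /andP[dr' drho].
set p := (w.1, _).
have pw : `|p - w0| <= rho.
  rewrite (_ : p - w0 = w - w0 + (0, d *: delta_mx ord0 i)); last first.
    by congr (_, _); rewrite /= ?addr0// addrAC.
  apply: (le_trans (ler_normD _ _)).
  have : `|(0, d *: delta_mx ord0 i) : pt| <= `|d|.
    rewrite pair_norm_le normr0 normr_ge0/= normrZ ler_piMr//.
    exact: row_norm_delta.
  lra.
have ww : `|w - w0| <= rho by apply: (le_trans wrho); lra.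
apply/ler_addgt0Pr => eta eta0.
have [g [gf gM ch]] := H (eta / 2) ltac:(by rewrite divr_gt0).
have gp : `|g p - g w| <= e * Num.sqrt `|d|.
  have [v [vb dv]] := bb_c_basis i.
  apply: (@le_trans _ _ (core_const Lam eps * Num.sqrt `|d|)); last first.
    by rewrite ler_wpM2r ?sqrtr_ge0.
  rewrite /p; case: dv => ->; first exact: core.
  by rewrite scalerN -scaleNr -[in leRHS](normrN d) core ?normrN.
rewrite (_ : f p - f w = g p - g w + ((g w - f w) - (g p - f p))); last by ring.
apply: (le_trans (ler_normD _ _)); rewrite lerD//.
apply: (le_trans (ler_normB _ _)).
by have := gf _ pw; have := gf _ ww; lra.
Qed.

End CharacteristicsHolder.

(** * Brackets of the adapted basis *)

Section StructureConstants.
Context (R : realType) (g : vectType R) (A : step2_stratification g).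
Context (n h : nat) (B : adapted_basis A n h).
Local Notation b := (structure_constant B).

Definition bvec (j l : 'I_(1 + n)) : 'rV[R]_h := \row_i b i j l.
Definition bvecW (j k : 'I_n) : 'rV[R]_h := bvec (idxW j) (idxW k).
Definition cvecW (j : 'I_n) : 'rV[R]_h := bvec (idxW j) (idx1 n).

Lemma bvec_skew j l : bvec j l = - bvec l j.
Proof. by apply/rowP => i; rewrite !mxE structure_constant_skew. Qed.

Lemma bvec_basis i : exists j l, delta_mx ord0 i = bvec j l.
Proof.
have [j [l jl]] := basY_commutator B i; exists j, l.
apply/rowP => k; rewrite !mxE eqxx /= /structure_constant -jl.
by rewrite (tnth_nth 0) coord_free ?(basis_free (basY_basis B))// eq_sym.
Qed.

Lemma idxP (j : 'I_(1 + n)) : j = idx1 n \/ exists k, j = idxW k.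
Proof.
case: (split_ordP j) => k ->; last by right; exists k.
by left; rewrite ord1.
Qed.

(** Each Y_i is a commutator [X_j, X_l]. If X_1 occurs in it, it is some c_k up to sign, otherwise a
    bracket inside W; X_1 cannot occur twice, as the commutator would vanish. *)
Lemma bvecW_basis i : exists v : 'rV[R]_h,
  ((exists j, v = cvecW j) \/ (exists j k, v = bvecW j k)) /\
  (delta_mx ord0 i = v \/ delta_mx ord0 i = - v).
Proof.
have [j [l jl]] := bvec_basis i; rewrite jl.
case: (idxP j) => [j1|[j' jE]]; case: (idxP l) => [l1|[l' lE]].
- move/rowP/(_ i): jl; rewrite j1 l1 !mxE !eqxx /= structure_constant_diag.
  by move=> /eqP; rewrite oner_eq0.
- exists (cvecW l'); split; first by left; exists l'.
  by right; rewrite bvec_skew j1 lE.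
- by exists (cvecW j'); split; [left; exists j'|left; rewrite jE l1].
- by exists (bvecW j' l'); split; [right; exists j', l'|left; rewrite jE lE].
Qed.

End StructureConstants.

(** * Existence of characteristics *)

Section Peano.
Context (R : realType) (r M : R) (F : R -> R -> R).
Hypotheses (r0 : 0 < r) (M0 : 0 <= M).
Hypothesis FM : forall t u : R, 0 <= t <= r -> `|u| <= M * r -> `|F t u| <= M.
Hypothesis F_uc : forall e : R, 0 < e -> exists2 d : R, 0 < d &
  forall t t' u u' : R, 0 <= t <= r -> 0 <= t' <= r ->
    `|u| <= M * r -> `|u'| <= M * r -> `|t' - t| <= d -> `|u' - u| <= d ->
    `|F t' u' - F t u| <= e.

Fixpoint euler (N : nat) (i : nat) : R :=
  if i is i'.+1 then euler N i' + F (i'%:R / N%:R) (euler N i') / N%:R else 0.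

Let euler_time (N i : nat) : (0 < N)%N -> i%:R <= r * N%:R :> R ->
  0 <= (i%:R / N%:R : R) <= r.
Proof. by move=> N0 iN; rewrite divr_ge0//= ler_pdivrMr ?ltr0n. Qed.

Lemma euler_le N i : (0 < N)%N -> i%:R <= r * N%:R ->
  `|euler N i| <= M * (i%:R / N%:R).
Proof.
move=> N0; elim: i => [|i IH] iN /=; first by rewrite normr0 mul0r mulr0.
have iN' : i%:R <= r * N%:R by rewrite (le_trans _ iN)// ler_nat.
have ei := IH iN'; have ti := euler_time N0 iN'.
rewrite (le_trans (ler_normD _ _))// -natr1 mulrDl mulrDr lerD//.
rewrite normrM [`|N%:R^-1|]ger0_norm ?invr_ge0// mul1r ler_wpM2r ?invr_ge0//.
apply: FM => //; apply: (le_trans ei); rewrite ler_wpM2l//.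
by case/andP: ti.
Qed.

(** While the scheme stays in the window of size d where F is within e of y, each step of length 1 /
    N adds y / N up to e / N. The time s need not be a grid point, which is why the window allows
    for one extra step. *)
Lemma euler_increment N i m (s y e d : R) : (0 < N)%N ->
  (i + m)%:R <= r * N%:R -> 0 <= s <= r -> 0 <= e ->
  (forall t u : R, 0 <= t <= r -> `|u| <= M * r -> `|t - s| <= d ->
     `|u - euler N i| <= d -> `|F t u - y| <= e) ->
  `|i%:R / N%:R - s| <= N%:R^-1 -> (m%:R + 1) / N%:R <= d ->
  M * (m%:R / N%:R) <= d ->
  `|euler N (i + m) - euler N i| <= M * (m%:R / N%:R) /\
  `|euler N (i + m) - euler N i - m%:R / N%:R * y| <= m%:R / N%:R * e.
Proof.
move=> N0 + sr e0 Fy isN; elim: m => [|m IH] imN mNd Mmd.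
  by rewrite addn0 subrr !mul0r mulr0 subr0 normr0.
have iN : (i + m)%:R <= r * N%:R.
  by rewrite (le_trans _ imN)// ler_nat addnS.
have Ni : 0 <= N%:R^-1 :> R by rewrite invr_ge0.
have mN : m%:R / N%:R <= m.+1%:R / N%:R :> R.
  by rewrite ler_wpM2r// ler_nat.
have [||H1 H2] := IH iN.
- by rewrite (le_trans _ mNd)// ler_wpM2r// lerD2r ler_nat.
- by rewrite (le_trans _ Mmd)// ler_wpM2l.
have ei : `|euler N (i + m)| <= M * r.
  apply: (le_trans (euler_le N0 iN)); rewrite ler_wpM2l//.
  by have /andP[] := euler_time N0 iN.
have tr := euler_time N0 iN.
rewrite addnS /= -[m.+1%:R]natr1 mulrDl mul1r.
have FFM := FM tr ei.
split.
  rewrite addrAC (le_trans (ler_normD _ _))// mulrDr lerD//.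
  by rewrite normrM (ger0_norm Ni) ler_wpM2r.
rewrite (_ : _ - _ = (euler N (i + m) - euler N i - m%:R / N%:R * y) +
   (F ((i + m)%:R / N%:R) (euler N (i + m)) - y) / N%:R); last by ring.
rewrite (le_trans (ler_normD _ _))// [leRHS]mulrDl lerD// normrM mulrC.
rewrite (ger0_norm Ni) ler_wpM2l//.
apply: Fy => //.
  rewrite (_ : _ - s = (i%:R / N%:R - s) + m%:R / N%:R); last first.
    by rewrite natrD; ring.
  rewrite (le_trans (ler_normD _ _))// [X in _ + X]ger0_norm ?mulr_ge0//.
  by move: mNd isN; rewrite -natr1 !mulrDl !mul1r; lra.
by rewrite (le_trans H1)// (le_trans _ Mmd)// ler_wpM2l.
Qed.

(** A step function is enough in place of the Euler polygon: limits are taken pointwise in t, and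
    its jumps are of order 1 / N. *)
Definition euler_step (N : nat) (t : R) : R := euler N (Num.truncn (t * N%:R)).

Let trunc_bounds N (t : R) : (0 < N)%N -> 0 <= t ->
  (Num.truncn (t * N%:R))%:R / N%:R <= t <
    (Num.truncn (t * N%:R))%:R / N%:R + N%:R^-1.
Proof.
move=> N0 t0; have Np : 0 < N%:R :> R by rewrite ltr0n.
have /andP[t1 t2] := truncn_itv (mulr_ge0 t0 (ltW Np)).
rewrite ler_pdivrMr// t1/= -[X in _ + X]mul1r -mulrDl ltr_pdivlMr//.
by rewrite natr1.
Qed.

Lemma euler_step_le N t : (0 < N)%N -> 0 <= t <= r ->
  `|euler_step N t| <= M * t.
Proof.
move=> N0 /andP[t0 tr]; have /andP[t1 _] := trunc_bounds N0 t0.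
have Np : 0 < N%:R :> R by rewrite ltr0n.
apply: (le_trans (euler_le N0 _)); last by rewrite ler_wpM2l.
by rewrite -ler_pdivrMr// (le_trans t1).
Qed.

(** The size d does not depend on N, so the estimate survives the limit; rounding s and t to the
    grid costs the term in 1 / N. *)
Lemma euler_step_increment (e : R) : 0 < e -> exists2 d : R, 0 < d &
  forall N (s t : R), (0 < N)%N -> 0 <= s -> s <= t -> t <= r -> t - s <= d ->
  N%:R^-1 <= d ->
  `|euler_step N t - euler_step N s - (t - s) * F s (euler_step N s)| <=
    (t - s) * e + (e + M) * N%:R^-1.
Proof.
move=> e0; have [d d0 Fd] := F_uc e0.
pose k := 2 * (M + 1).
have k0 : 0 < k by rewrite mulr_gt0// ltr_wpDl.
exists (d / (2 * k)) => [|N s t N0 s0 st tr tsd Nd].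
  by rewrite divr_gt0// mulr_gt0.
have Np : 0 < N%:R :> R by rewrite ltr0n.
have Nv : 0 < N%:R^-1 :> R by rewrite invr_gt0.
have t0 : 0 <= t := le_trans s0 st.
have sr : s <= r := le_trans st tr.
rewrite /euler_step.
have /andP[s1 s2] := trunc_bounds N0 s0.
have /andP[t1 t2] := trunc_bounds N0 t0.
set i := Num.truncn (s * _) in s1 s2 *.
set i' := Num.truncn (t * _) in t1 t2 *.
have ii' : (i <= i')%N by apply: le_truncn; rewrite ler_wpM2r// ltW.
have i'E : i' = (i + (i' - i))%N by rewrite subnKC.
set m := (i' - i)%N in i'E.
have i'm : i'%:R / N%:R = i%:R / N%:R + m%:R / N%:R :> R.
  by rewrite i'E natrD mulrDl.
have Mk : M * (t - s + N%:R^-1) + (t - s + N%:R^-1) + 2 * N%:R^-1 <= d.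
  move: tsd Nd; have k2 : 0 < 2 * k by rewrite mulr_gt0.
  rewrite !(ler_pdivlMr _ _ k2) => tsd Nd.
  have : 0 <= M * N%:R^-1 by rewrite mulr_ge0// ltW.
  have : 0 <= M * (t - s) by rewrite mulr_ge0// subr_ge0.
  move: tsd Nd; rewrite /k; lra.
have mts : m%:R / N%:R <= t - s + N%:R^-1 by lra.
have Mmts : M * (m%:R / N%:R) <= M * (t - s + N%:R^-1) by rewrite ler_wpM2l.
have M1 : 0 <= M * (t - s + N%:R^-1).
  by rewrite mulr_ge0// addr_ge0 ?subr_ge0// ltW.
have srr : 0 <= s <= r by rewrite s0.
have [|||||H1 H2] := @euler_increment N i m s (F s (euler N i)) e d N0 _ srr (ltW e0).
- by rewrite -i'E -ler_pdivrMr// (le_trans t1).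
- move=> tt u ttr ur tts uN; apply: Fd => //.
  by have := @euler_step_le N s N0 srr => /le_trans; apply; rewrite ler_wpM2l.
- by rewrite ler_norml; apply/andP; split; lra.
- rewrite mulrDl mul1r; lra.
- lra.
rewrite i'E (_ : _ - _ = (euler N (i + m) - euler N i -
    m%:R / N%:R * F s (euler N i)) + (m%:R / N%:R - (t - s)) * F s (euler N i)); last by ring.
rewrite (le_trans (ler_normD _ _))//.
have H3 : `|(m%:R / N%:R - (t - s)) * F s (euler N i)| <= N%:R^-1 * M.
  rewrite normrM ler_pM//.
    by rewrite ler_norml; apply/andP; split; lra.
  apply: FM => //.
  by have := @euler_step_le N s N0 srr => /le_trans; apply; rewrite ler_wpM2l.
have H4 : m%:R / N%:R * e <= (t - s + N%:R^-1) * e by rewrite ler_wpM2r// ltW.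
lra.
Qed.

(** Compactness comes from an ultrafilter on the step numbers: for each t the bounded values of the
    scheme converge along it, and the increment estimate, uniform in N, passes to the limit. The
    conclusion is uniform in s and covers the endpoints. *)
Lemma peano_scalar : exists tau : R -> R,
  [/\ tau 0 = 0, forall t : R, 0 <= t <= r -> `|tau t| <= M * t &
  forall e : R, 0 < e -> exists2 d : R, 0 < d &
    forall s t : R, 0 <= s <= r -> 0 <= t <= r -> `|t - s| <= d ->
    `|tau t - tau s - (t - s) * F s (tau s)| <= e * `|t - s|].
Proof.
have [G [UG GF]] := ultraFilterLemma eventually_filter.
have lim_ex (t : R) : exists l : R, 0 <= t <= r ->
    `|l| <= M * t /\ (euler_step ^~ t) @ G --> l.
  case: (boolP (0 <= t <= r)) => [tr|_]; last by exists 0.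
  have [|l [/= + Gl]] := @segment_compact R (- (M * t)) (M * t)
    ((euler_step ^~ t) @ G).
    apply: GF; exists 1%N => // N /= N1.
    by rewrite in_itv/= -ler_norml; exact: euler_step_le.
  rewrite in_itv/= -ler_norml => lt; exists l => _; split=> // V Vl.
  have [//|GV] := in_ultra_setVsetC ((euler_step ^~ t) @^-1` V) UG.
  by have [x [/= nVx Vx]] := Gl (~` V) V GV Vl.
have [tau tauP] := choice lim_ex.
have pick_N (s t eta : R) : 0 <= s <= r -> 0 <= t <= r -> 0 < eta ->
    exists N, [/\ (0 < N)%N, N%:R^-1 <= eta,
      `|euler_step N s - tau s| <= eta & `|euler_step N t - tau t| <= eta].
  move=> sr tr eta0; have [_ Gs] := tauP s sr; have [_ Gt] := tauP t tr.
  have G1 : G [set N | (0 < N)%N /\ N%:R^-1 <= eta].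
    apply: GF; exists (Num.truncn eta^-1).+1 => // N /= N1.
    have N0 : (0 < N)%N by exact: leq_trans N1.
    split=> //; rewrite invf_ple ?posrE ?ltr0n//.
    apply: ltW; apply: (lt_le_trans (truncnS_gt _)).
    by rewrite ler_nat.
  move/cvgrPdist_le : Gs => /(_ _ eta0) Gs; move/cvgrPdist_le : Gt => /(_ _ eta0) Gt.
  have [N [[N0 N1] [Ns Nt]]] := filter_ex (filterI G1 (filterI Gs Gt)).
  by exists N; split=> //; rewrite distrC.
have tau_le t : 0 <= t <= r -> `|tau t| <= M * t by move=> /tauP[].
have tau_r t : 0 <= t <= r -> `|tau t| <= M * r.
  move=> tr; apply: (le_trans (tau_le _ tr)); rewrite ler_wpM2l//.
  by case/andP: tr.
have euler_r N t : (0 < N)%N -> 0 <= t <= r -> `|euler_step N t| <= M * r.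
  move=> N0 tr; apply: (le_trans (euler_step_le N0 tr)); rewrite ler_wpM2l//.
  by case/andP: tr.
exists tau; split=> //.
  have := tau_le 0; rewrite lexx (ltW r0) mulr0 => /(_ isT).
  by rewrite normr_le0 => /eqP.
have fwd (e : R) : 0 < e -> exists2 d : R, 0 < d &
    forall s t : R, 0 <= s -> s <= t -> t <= r -> t - s <= d ->
    `|tau t - tau s - (t - s) * F s (tau s)| <= e * (t - s).
  move=> e0; have [d d0 Hd] := euler_step_increment e0.
  exists d => // s t s0 st tr tsd.
  have sr' : 0 <= s <= r by rewrite s0 (le_trans st).
  have tr' : 0 <= t <= r by rewrite tr (le_trans s0).
  apply/ler_addgt0Pr => eta eta0.
  pose k := r + 2 + e + M; have k0 : 0 < k by rewrite ltr_wpDr// !addr_gt0.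
  have [d' d'0 Hd'] := F_uc (divr_gt0 eta0 k0).
  pose eta' := Num.min (Num.min d' d) (eta / k).
  have eta'0 : 0 < eta' by rewrite !lt_min d'0 d0 divr_gt0.
  have [N [N0 Ne Ns Nt]] := pick_N s t eta' sr' tr' eta'0.
  have := Hd N s t N0 s0 st tr tsd.
  move: Ne Ns Nt; rewrite !le_min => /andP[/andP[_ Nd] Ne] /andP[/andP[Ns' _] Ns]
    /andP[_ Nt] /(_ Nd) H1.
  have H2 := Hd' s s (tau s) (euler_step N s) sr' sr' (tau_r _ sr')
    (euler_r _ _ N0 sr').
  have {}H2 : `|F s (euler_step N s) - F s (tau s)| <= eta / k.
    by apply: H2 => //; rewrite subrr normr0 ltW.
  have H3 : `|(t - s) * (F s (euler_step N s) - F s (tau s))| <= r * (eta / k).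
    rewrite normrM ler_pM// ger0_norm ?subr_ge0//; lra.
  rewrite (_ : tau t - _ - _ =
    (euler_step N t - euler_step N s - (t - s) * F s (euler_step N s)) +
    (- (euler_step N t - tau t) + (euler_step N s - tau s) +
    (t - s) * (F s (euler_step N s) - F s (tau s)))); last by ring.
  have H4 : (e + M) * N%:R^-1 <= (e + M) * (eta / k).
    by rewrite ler_wpM2l// addr_ge0// ltW.
  have H5 : k * (eta / k) = eta by rewrite mulrC divfK// gt_eqF.
  have H6 := ler_normD (- (euler_step N t - tau t)) (euler_step N s - tau s).
  rewrite normrN in H6.
  apply: (le_trans (ler_normD _ _)).
  apply: (@le_trans _ _ ((t - s) * e + (e + M) * (eta / k) +
    (eta / k + eta / k + r * (eta / k)))).
    apply: lerD; first by apply: (le_trans H1); rewrite lerD2l.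
    apply: (le_trans (ler_normD _ _)); rewrite lerD//.
    by apply: (le_trans H6); rewrite lerD.
  rewrite -[in leRHS]H5 /k [e * _]mulrC -addrA lerD2l.
  by rewrite le_eqVlt; apply/orP; left; apply/eqP; ring.
move=> e e0; have e20 : 0 < e / 2 by rewrite divr_gt0.
have [d1 d10 H1] := fwd _ e20.
have [d2 d20 H2] := F_uc e20.
pose k := M + 1; have k0 : 0 < k by rewrite ltr_wpDl.
exists (Num.min d1 (Num.min d2 (Num.min 1 (d2 / (k + e))))) => [|s t sr tr].
  by rewrite !lt_min d10 d20 ltr01 divr_gt0// addr_gt0.
rewrite !le_min => /and4P[ts1 ts2 ts3 ts4].
have /andP[s0 s1] := sr; have /andP[t0 t1] := tr.
have re0 : 0 <= r := ltW r0.
have [st|/ltW ts] := leP s t.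
  move: ts1; rewrite ger0_norm ?subr_ge0// => ts1.
  apply: (le_trans (H1 _ _ s0 st t1 ts1)).
  by rewrite ler_wpM2r ?subr_ge0//; lra.
(* For t <= s the forward estimate is applied from t, and F t (tau t) is then replaced by F s (tau
   s), which is close by uniform continuity. *)
move: ts1 ts2 ts3 ts4; rewrite distrC ger0_norm ?subr_ge0// => ts1 ts2 ts3 ts4.
have A := H1 _ _ t0 ts s1 ts1.
have B : `|tau t - tau s| <= d2.
  have FtM := FM tr (tau_r _ tr).
  have : `|(s - t) * F t (tau t)| <= (s - t) * M.
    by rewrite normrM ger0_norm ?subr_ge0// ler_wpM2l// subr_ge0.
  move=> H3; have := ler_normD (tau s - tau t - (s - t) * F t (tau t))
    ((s - t) * F t (tau t)).
  rewrite subrK distrC => H4; apply: (le_trans H4).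
  move: ts4; rewrite (ler_pdivlMr _ _ (addr_gt0 k0 e0)) /k => ts4.
  have : 0 <= e * (s - t) by rewrite mulr_ge0 ?subr_ge0// ltW.
  have : 0 <= s - t by rewrite subr_ge0.
  lra.
have C : `|F t (tau t) - F s (tau s)| <= e / 2.
  by apply: H2; rewrite ?tau_r// distrC ger0_norm ?subr_ge0.
have D : `|(s - t) * (F t (tau t) - F s (tau s))| <= (s - t) * (e / 2).
  by rewrite normrM ger0_norm ?subr_ge0// ler_wpM2l// subr_ge0.
rewrite (_ : tau t - _ - _ = - (tau s - tau t - (s - t) * F t (tau t)) -
  (s - t) * (F t (tau t) - F s (tau s))); last by ring.
by apply: (le_trans (ler_normB _ _)); rewrite normrN; lra.
Qed.

End Peano.

(** * Compactness and one-variable calculus *)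

Section CompactContinuity.
Context (R : realType).

Lemma within_open_continuous (V W : topologicalType) (U : set V) (f : V -> W) x :
  open U -> {within U, continuous f} -> U x -> {for x, continuous f}.
Proof. by move=> oU; rewrite continuous_open_subspace// => cf /mem_set/cf. Qed.

Lemma compact_unif_continuous (V W : normedModType R) (U K : set V) (f : V -> W) :
  open U -> {within U, continuous f} -> compact K -> K `<=` U ->
  forall e : R, 0 < e -> exists2 d : R, 0 < d & forall p q, K p ->
    `|q - p| <= d -> U q /\ `|f q - f p| <= e.
Proof.
move=> oU cf /compact_near_coveringP cK KU e e0.
have e20 : 0 < e / 2 by rewrite divr_gt0.
have := cK R (0^'+) (fun (d : R) (p : V) => forall q : V, `|q - p| <= d ->
  U q /\ `|f q - f p| <= e) _.
case=> [x /KU Ux|].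
  have /cvgrPdist_le /(_ _ e20) fx := within_open_continuous oU cf Ux.
  have [rho rho0 Hr] := nbhs_norm_leP (filterI (open_nbhs_nbhs (conj oU Ux)) fx).
  exists ([set q | `|q - x| <= rho / 2], [set d | 0 < d < rho / 2]); first split.
  - by apply: nbhs_norm_le; rewrite divr_gt0.
  - near=> d => /=; apply/andP; split; near: d; first exact: nbhs_right_gt.
    by apply: nbhs_right_lt; rewrite divr_gt0.
  move=> [p d] /= [px /andP[d0 dr]] q qp.
  have qx : `|q - x| <= rho.
    rewrite -(subrKA p) (le_trans (ler_normD _ _))//; lra.
  have [Uq fq] := Hr _ qx.
  have [_ fp] := Hr p ltac:(lra).
  split=> //; rewrite (_ : f q - f p = (f x - f p) - (f x - f q)); last first.
    by rewrite opprB [RHS]addrC addrA subrK.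
  by apply: (le_trans (ler_normB _ _)); lra.
move=> d /= d0 Hd; exists (d / 2); first by rewrite divr_gt0.
move=> p q Kp qp; apply: (Hd (d / 2)) => //.
  rewrite /= sub0r normrN gtr0_norm ?divr_gt0//; lra.
by rewrite divr_gt0.
Unshelve. all: by end_near. Qed.

Lemma compact_norm_bounded (V W : normedModType R) (K : set V) (f : V -> W) :
  {within K, continuous f} -> compact K ->
  exists2 M : R, 0 <= M & forall p, K p -> `|f p| <= M.
Proof.
move=> cf /(continuous_compact cf)/compact_bounded[M [_ HM]].
exists (`|M| + 1) => [|p Kp]; first by rewrite addr_ge0.
by apply: (HM (`|M| + 1)); [rewrite ltr_pwDr// ler_norm|exists p].
Qed.

Lemma closed_norm_ball (V : normedModType R) (w : V) (r : R) :
  closed [set q | `|q - w| <= r].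
Proof.
apply: (@closed_comp _ _ (fun q => `|q - w|) [set x | x <= r]); last exact: closed_le.
move=> q _; apply: (@continuous_comp _ _ _ (fun q => q - w) Num.norm).
  by apply: cvgB; [exact: cvg_id|exact: cvg_cst].
exact: norm_continuous.
Qed.

Lemma compact_norm_ball n h (w : pointW R n h) (r : R) :
  compact [set q | `|q - w| <= r].
Proof.
have row k (x : 'rV[R]_k) : compact [set q | `|q - x| <= r].
  apply: bounded_closed_compact; last exact: closed_norm_ball.
  exists (`|x| + r); split; first exact: num_real.
  move=> M xM q /= qx; rewrite -(subrK x q) (le_trans (ler_normD _ _))//.
  by rewrite addrC (le_trans _ (ltW xM))// lerD2l.
rewrite (_ : [set q | _] = [set q | `|q - w.1| <= r] `*` [set q | `|q - w.2| <= r]).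
  by apply: compact_setX.
by apply/seteqP; split=> q /=; rewrite pair_norm_le => /andP.
Qed.

End CompactContinuity.

Section AffineMVT.
Context (R : realType).

Lemma increment_affine (g dg : R -> R) (r l eps : R) :
  {within `[0, r], continuous g} ->
  (forall t, 0 < t < r -> is_derive t 1 g (dg t)) ->
  (forall t, 0 < t < r -> `|dg t - l| <= eps) ->
  forall t, 0 <= t <= r -> `|g t - g 0 - l * t| <= eps * t.
Proof.
move=> cg dgP dgl t /andP[]; rewrite le_eqVlt => /predU1P[<- _|t0 tr].
  by rewrite subrr !mulr0 subr0 normr0.
have sub : `[0, t]%classic `<=` `[0, r].
  by apply: subset_itvl; rewrite bnd_simp.
have dgP' x : x \in `]0, t[%R -> is_derive x 1 g (dg x).
  by rewrite in_itv/= => /andP[x0 xt]; apply: dgP; rewrite x0 (lt_le_trans xt).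
have [c] := MVT t0 dgP' (continuous_subspaceW sub cg).
rewrite in_itv/= subr0 => /andP[c0 ct] ->.
rewrite -mulrBl normrM (gtr0_norm t0) ler_wpM2r ?(ltW t0)// dgl// c0.
exact: lt_le_trans ct tr.
Qed.

(** The mean value theorem for g minus its quadratic model bounds the error by eps c t for some c <
    t, whence eps t^2, the form recorded in [char_curve]. *)
Lemma increment_quadratic (g dg : R -> R) (r m l eps : R) : 0 <= eps ->
  {within `[0, r], continuous g} ->
  (forall t, 0 < t < r -> is_derive t 1 g (dg t)) ->
  (forall t, 0 < t < r -> `|dg t - m - l * t| <= eps * t) ->
  forall t, 0 <= t <= r ->
    `|g t - g 0 - t * m - 2^-1 * l * t ^+ 2| <= eps * t ^+ 2.
Proof.
move=> eps0 cg dgP dgl t /andP[]; rewrite le_eqVlt => /predU1P[<- _|t0 tr].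
  by rewrite subrr mul0r expr0n/= !mulr0 !subr0 normr0.
have sub : `[0, t]%classic `<=` `[0, r].
  by apply: subset_itvl; rewrite bnd_simp.
pose k s := g s - s * m - 2^-1 * l * s ^+ 2.
have dk x : x \in `]0, t[%R -> is_derive x 1 k (dg x - m - l * x).
  rewrite in_itv/= => /andP[x0 xt].
  have dgx : is_derive x 1 g (dg x) by apply: dgP; rewrite x0 (lt_le_trans xt).
  rewrite /k; apply: is_derive_eq.
  by rewrite /GRing.scale/=; field.
have c1 : {within `[0, t], continuous (fun x : R => x)}.
  by apply: continuous_subspaceT => z; exact: cvg_id.
have c2 : {within `[0, t], continuous (fun x : R => x ^+ 2)}.
  by apply: continuous_subspaceT => z; exact: exprn_continuous.
have ck : {within `[0, t], continuous k}.
  move=> s; apply: cvgB; first apply: cvgB.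
  - exact: (continuous_subspaceW sub cg).
  - apply: (@cvgM _ _ _ _ (fun s => s) (fun=> m)); last exact: cvg_cst.
    exact: c1.
  - apply: (@cvgM _ _ _ _ (fun=> 2^-1 * l) (fun s => s ^+ 2)).
      exact: cvg_cst.
    exact: c2.
have [c] := MVT t0 dk ck.
rewrite in_itv/= subr0 => /andP[c0 ct].
rewrite /k mul0r expr0n /= mulr0 !subr0 => kE.
rewrite (_ : _ - _ - _ - _ = (dg c - m - l * c) * t); last by rewrite -kE; ring.
rewrite normrM (gtr0_norm t0) expr2 mulrA ler_wpM2r ?(ltW t0)//.
apply: (le_trans (dgl _ _)); first by rewrite c0 (lt_le_trans ct).
by rewrite ler_wpM2l// ltW.
Qed.

End AffineMVT.

Section LocalDerivatives.
Context (R : realType).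

Lemma is_derive_eps (g : R -> R) (t v : R) :
  (forall e : R, 0 < e -> exists2 d : R, 0 < d & forall s, `|s - t| <= d ->
    `|g s - g t - (s - t) * v| <= e * `|s - t|) -> is_derive t 1 g v.
Proof.
move=> H.
have cv : h^-1 *: (g (h *: 1%R + t) - g t) @[h --> 0^'] --> v.
  apply/cvgrPdist_le => e /H[d d0 Hd]; near=> k.
  have k0 : k != 0 by near: k; exact: nbhs_dnbhs_neq.
  have kd : `|k| <= d by near: k; apply: dnbhs0_le.
  have := Hd (k + t); rewrite addrK => /(_ kd).
  move=> H1; rewrite /GRing.scale/= mulr1 distrC.
  rewrite (_ : _ - v = k^-1 * (g (k + t) - g t - k * v)); last first.
    by rewrite [RHS]mulrBr mulKf.
  by rewrite normrM normfV ler_pdivrMl ?normr_gt0// [leRHS]mulrC.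
apply: DeriveDef; first by apply/cvg_ex; exists v.
exact: cvg_lim cv.
Unshelve. all: by end_near. Qed.

Lemma is_derive_epsP (g : R -> R) (t v : R) : is_derive t 1 g v ->
  forall e : R, 0 < e -> exists2 d : R, 0 < d & forall s, `|s - t| <= d ->
    `|g s - g t - (s - t) * v| <= e * `|s - t|.
Proof.
move=> [dg gv] e e0; move: dg => /cvg_ex[l cl].
have lv : l = v by rewrite -gv; apply/esym; exact: cvg_lim cl.
move: cl; rewrite lv => /cvgrPdist_le/(_ _ e0) /nbhs_norm_leP[d d0 Hd].
exists d => // s st; have [->|sn] := eqVneq s t.
  by rewrite !subrr mul0r subr0 normr0 mulr0.
have s0 : s - t != 0 by rewrite subr_eq0.
have := Hd (s - t); rewrite subr0 => /(_ st s0).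
rewrite /GRing.scale/= mulr1 subrK distrC => H1.
rewrite (_ : _ - _ * v = (s - t) * ((s - t)^-1 * (g s - g t) - v)); last first.
  by rewrite [RHS]mulrBr mulVKf.
by rewrite normrM mulrC ler_wpM2r.
Qed.

Lemma within_continuous_eps (V W : normedModType R) (A : set V) (g : V -> W) :
  (forall t, A t -> forall e : R, 0 < e -> exists2 d : R, 0 < d &
     forall s, A s -> `|s - t| <= d -> `|g s - g t| <= e) ->
  {within A, continuous g}.
Proof.
move=> H; apply/subspace_continuousP => t At; apply/cvgrPdist_le => e e0.
have [d d0 Hd] := H t At e e0.
rewrite near_withinE; apply: filterS (nbhs_norm_le t d0) => s st As.
by rewrite distrC; exact: Hd.
Qed.

Lemma within_continuous_epsP (V W : normedModType R) (A : set V) (g : V -> W) :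
  {within A, continuous g} ->
  forall t, A t -> forall e : R, 0 < e -> exists2 d : R, 0 < d &
     forall s, A s -> `|s - t| <= d -> `|g s - g t| <= e.
Proof.
move=> /subspace_continuousP H t At e e0.
have /cvgrPdist_le/(_ _ e0) := H t At.
rewrite near_withinE => /nbhs_norm_leP[d d0 Hd].
by exists d => // s As st; rewrite distrC; exact: Hd.
Qed.

End LocalDerivatives.

(** * Integral curves of the projected fields *)

Section ExactCharacteristics.
Context (R : realType) (a h : nat).
Context (bb : 'I_a -> 'I_a -> 'rV[R]_h) (c : 'I_a -> 'rV[R]_h).
Local Notation pt := ('rV[R]_a * 'rV[R]_h)%type.
Local Notation cpt := (char_pt bb c).
Implicit Types (f : pt -> R) (w : pt) (j k : 'I_a).

Definition char_solution f j (s : R) w (r : R) (tau : R -> R) :=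
  [/\ {within `[0, r], continuous tau}, tau 0 = 0 &
      forall t, 0 < t < r -> is_derive t 1 tau (f (cpt j s w t (tau t)))].

Lemma char_pt0 j (s : R) w : cpt j s w 0 0 = w.
Proof.
by rewrite /char_pt mulr0 !scale0r !addr0 scaler0 subr0 -surjective_pairing.
Qed.

Lemma char_solution_curve f j (s : R) w (r l eps : R) tau : 0 <= eps ->
  char_solution f j s w r tau ->
  (forall t, 0 <= t <= r ->
     `|f (cpt j s w t (tau t)) - f w - s * l * t| <= eps * t) ->
  char_curve bb c f j s w r l eps.
Proof.
move=> eps0 [ctau tau0 dtau] H; exists tau; split=> // t tr; split; first exact: H.
have := increment_quadratic eps0 ctau dtau _ tr.
rewrite tau0 subr0 -(mulrA 2^-1); apply => t' /andP[t'0 t'r].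
by apply: H; rewrite !ltW.
Qed.

Lemma char_pt_sub j (s : R) w (t u t' u' : R) :
  cpt j s w t' u' - cpt j s w t u = cpt j s w (t' - t) (u' - u) - w.
Proof.
by congr (_, _); rewrite /=; apply/rowP => i; rewrite !mxE; ring.
Qed.

Lemma char_pt_lip j (s : R) w (t u t' u' : R) : `|s| <= 1 ->
  `|cpt j s w t' u' - cpt j s w t u| <=
    (1 + bb_bound bb * `|w|) * `|t' - t| + c_bound c * `|u' - u|.
Proof.
move=> s1; rewrite char_pt_sub.
set T := t' - t; set V := u' - u.
have [T0|T0] := leP 0 T.
  by rewrite (ger0_norm T0) (le_trans (char_pt_disp _ _ _ _ _ s1 T0))//; lra.
have NE : cpt j s w T V = cpt j (- s) w (- T) (- V).
  by congr (_, _); apply/rowP => i; rewrite !mxE; ring.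
rewrite NE; have s1' : `|- s| <= 1 by rewrite normrN.
have T0' : 0 <= - T by rewrite oppr_ge0 ltW.
rewrite (ltr0_norm T0) (le_trans (char_pt_disp _ _ _ _ _ s1' T0'))//.
by rewrite normrN; lra.
Qed.

(* The existence time depends on f through a bound only. *)
Lemma char_solution_exists (w0 : pt) (rho M : R) : 0 < rho -> 0 <= M ->
  exists2 r : R, 0 < r & forall f,
  (forall e : R, 0 < e -> exists2 d : R, 0 < d & forall p q, `|p - w0| <= rho ->
     `|q - w0| <= rho -> `|q - p| <= d -> `|f q - f p| <= e) ->
  (forall p, `|p - w0| <= rho -> `|f p| <= M) ->
  forall j (s : R) w, s = 1 \/ s = -1 -> `|w - w0| <= rho / 2 ->
  exists2 tau, char_solution f j s w r tau &
    forall t, 0 <= t <= r -> `|cpt j s w t (tau t) - w0| <= rho.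
Proof.
move=> rho0 M0.
pose B := 1 + bb_bound bb * (`|w0| + rho); pose C := c_bound c.
have C0 : 0 <= C := c_bound_ge0 c.
have B0 : 0 < B by rewrite ltr_pwDl// mulr_ge0 ?bb_bound_ge0// addr_ge0// ltW.
pose K := B + M * C; have K0 : 0 < K by rewrite ltr_pwDl// mulr_ge0.
(* K bounds the speed as long as |tau t| <= M t, so within time r a curve moves by at most rho /
   2. *)
pose r := rho / (2 * K).
have r0 : 0 < r by rewrite divr_gt0// mulr_gt0.
exists r => // f fuc fM j s w s1 ww0.
have ns : `|s| <= 1 by case: s1 => ->; rewrite ?normrN normr1.
pose F t u := f (cpt j s w t u).
have wB : 1 + bb_bound bb * `|w| <= B.
  rewrite lerD2l ler_wpM2l ?bb_bound_ge0//.
  rewrite -(subrK w0 w) (le_trans (ler_normD _ _))// addrC lerD2l.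
  apply: (le_trans ww0); lra.
have lip t u t' u' : `|cpt j s w t' u' - cpt j s w t u| <=
    B * `|t' - t| + C * `|u' - u|.
  apply: (le_trans (char_pt_lip _ _ _ _ _ _ ns)); rewrite lerD2r.
  by rewrite ler_wpM2r.
have box (t u : R) : 0 <= t <= r -> `|u| <= M * r -> `|cpt j s w t u - w0| <= rho.
  move=> /andP[t0 tr] ur; rewrite -(subrKA w) (le_trans (ler_normD _ _))//.
  have := lip 0 0 t u; rewrite char_pt0 !subr0 (ger0_norm t0) => H.
  have : B * t <= B * r by rewrite ler_wpM2l// ltW.
  have : C * `|u| <= C * (M * r) by rewrite ler_wpM2l.
  have rK : r * K = rho / 2 by rewrite /r invfM; field; rewrite gt_eqF.
  have : B * r + C * (M * r) = rho / 2 by rewrite -rK /K; ring.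
  lra.
have FM (t u : R) : 0 <= t <= r -> `|u| <= M * r -> `|F t u| <= M.
  by move=> tr ur; apply: fM; exact: box.
have [|tau [tau0 tauM tauD]] := @peano_scalar R r M F r0 M0 FM.
  move=> e /fuc[d d0 Hd].
  pose L := B + C; have L0 : 0 < L by rewrite ltr_pwDl.
  exists (d / L); first by rewrite divr_gt0.
  move=> t t' u u' tr t'r ur u'r tt uu; apply: Hd; [exact: box|exact: box|].
  apply: (le_trans (lip _ _ _ _)).
  have : B * `|t' - t| <= B * (d / L) by rewrite ler_wpM2l// ltW.
  have : C * `|u' - u| <= C * (d / L) by rewrite ler_wpM2l.
  have : L * (d / L) = d by rewrite mulrC divfK// gt_eqF.
  rewrite /L; lra.
have tauMr (t : R) : 0 <= t <= r -> `|tau t| <= M * r.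
  move=> tr; apply: (le_trans (tauM _ tr)); rewrite ler_wpM2l//.
  by case/andP: tr.
exists tau; last by move=> t tr; exact: box (tauMr _ tr).
split=> //.
- apply: within_continuous_eps => t /=; rewrite in_itv/= => tr e e0.
  have [d d0 Hd] := tauD 1 ltr01.
  pose k := M + 1; have k0 : 0 < k by rewrite ltr_wpDl.
  exists (Num.min d (e / k)); first by rewrite lt_min d0 divr_gt0.
  move=> x /=; rewrite in_itv/= le_min => xr /andP[xd xe].
  have H := Hd t x tr xr xd.
  have FtM : `|(x - t) * F t (tau t)| <= `|x - t| * M.
    by rewrite normrM ler_wpM2l// FM// tauMr.
  have := ler_normD (tau x - tau t - (x - t) * F t (tau t)) ((x - t) * F t (tau t)).
  rewrite subrK => H1; apply: (le_trans H1).
  by move: xe; rewrite ler_pdivlMr// /k; lra.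
- move=> t /andP[t0 tr]; apply: is_derive_eps => e e0.
  have [d d0 Hd] := tauD e e0.
  exists (Num.min d (Num.min t (r - t))) => [|x].
    by rewrite !lt_min d0 t0 subr_gt0.
  rewrite !le_min => /and3P[xd].
  rewrite 2!(ler_norml (x - t)) => /andP[x1 x2] /andP[x3 x4].
  by apply: Hd => //; [rewrite !ltW|apply/andP; split; move: x1 x2 x3 x4; clear; lra].
Qed.

End ExactCharacteristics.

Section DerivativeAlongCharacteristics.
Context (R : realType) (a h : nat).
Context (bb : 'I_a -> 'I_a -> 'rV[R]_h) (c : 'I_a -> 'rV[R]_h).
Local Notation pt := ('rV[R]_a * 'rV[R]_h)%type.
Local Notation cpt := (char_pt bb c).
Implicit Types (f : pt -> R) (w : pt) (j k : 'I_a).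

Lemma char_path_continuous j (s : R) w (r : R) tau : s = 1 \/ s = -1 ->
  {within `[0, r], continuous tau} ->
  {within `[0, r], continuous (fun t => cpt j s w t (tau t))}.
Proof.
move=> s1 /within_continuous_epsP ct; apply: within_continuous_eps => t tr e e0.
have ns : `|s| <= 1 by case: s1 => ->; rewrite ?normrN normr1.
pose B := 1 + bb_bound bb * `|w|; pose C := c_bound c.
have C0 : 0 <= C := c_bound_ge0 c.
have B0 : 0 < B by rewrite ltr_pwDl// mulr_ge0 ?bb_bound_ge0.
pose L := B + C; have L0 : 0 < L by rewrite ltr_pwDl.
have [d d0 Hd] := ct t tr (e / L) (divr_gt0 e0 L0).
exists (Num.min d (e / L)); first by rewrite lt_min d0 divr_gt0.
move=> x xr; rewrite le_min => /andP[xd xe].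
apply: (le_trans (char_pt_lip bb c j w t (tau t) x (tau x) ns)).
have : B * `|x - t| <= B * (e / L) by rewrite ler_wpM2l// ltW.
have : C * `|tau x - tau t| <= C * (e / L) by rewrite ler_wpM2l// Hd.
have : L * (e / L) = e by rewrite mulrC divfK// gt_eqF.
rewrite /L -/B -/C; lra.
Qed.

Lemma path_comp_continuous f (U : set pt) (A : set R) (p : R -> pt) :
  open U -> {within U, continuous f} -> {within A, continuous p} ->
  (forall t, A t -> U (p t)) -> {within A, continuous (f \o p)}.
Proof.
move=> oU cf /within_continuous_epsP cp Up.
apply: within_continuous_eps => t At e e0.
have /cvgrPdist_le/(_ _ e0)/nbhs_norm_leP[d d0 Hd] :=
  within_open_continuous oU cf (Up _ At).
have [d' d'0 Hd'] := cp t At d d0.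
by exists d' => // x Ax xt; rewrite distrC; apply: Hd; exact: Hd'.
Qed.

Lemma open_norm_ball (U : set pt) w0 : open U -> U w0 ->
  exists2 rho : R, 0 < rho & forall w, `|w - w0| <= rho -> U w.
Proof.
by move=> oU Uw0; apply: (@nbhs_norm_leP _ _ w0 U); exact: open_nbhs_nbhs.
Qed.

Lemma omega_near (U : set pt) (omega : pt -> 'rV[R]_a) w0 (eps : R) :
  open U -> {within U, continuous omega} -> U w0 -> 0 < eps ->
  exists2 rho : R, 0 < rho & forall w, `|w - w0| <= rho ->
    U w /\ forall j, `|omega w ord0 j - omega w0 ord0 j| <= eps.
Proof.
move=> oU co Uw0 eps0.
have /cvgrPdist_le/(_ _ eps0) H := within_open_continuous oU co Uw0.
have [rho rho0 Hr] := nbhs_norm_leP (filterI (open_nbhs_nbhs (conj oU Uw0)) H).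
exists rho => // w /Hr[Uw ow]; split=> // j.
by have := row_coord_le (omega w0 - omega w) j; rewrite !mxE distrC => /le_trans; apply.
Qed.

Lemma ball_bound_uc f (U : set pt) w0 (rho : R) : open U ->
  {within U, continuous f} -> (forall w, `|w - w0| <= rho -> U w) ->
  (exists2 M : R, 0 <= M & forall p, `|p - w0| <= rho -> `|f p| <= M) /\
  (forall e : R, 0 < e -> exists2 d : R, 0 < d & forall p q,
     `|p - w0| <= rho -> `|q - w0| <= rho -> `|q - p| <= d ->
     `|f q - f p| <= e).
Proof.
move=> oU cf bU; have cb := @compact_norm_ball R a h w0 rho; split.
  exact: compact_norm_bounded (continuous_subspaceW bU cf) cb.
move=> e e0; have [d d0 Hd] := compact_unif_continuous oU cf cb bU e0.
by exists d => // p q pb _ /(Hd p q pb)[].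
Qed.

Hypothesis bb_skew : forall j k, bb j k = - bb k j.
Hypothesis bb_c_basis : forall i, exists v : 'rV[R]_h,
  ((exists j, v = c j) \/ (exists j k, v = bb j k)) /\
  (delta_mx ord0 i = v \/ delta_mx ord0 i = - v).

(** The common end of cases (c) and (e): continuity of omega freezes the slope at omega w0 up to eps
    on a small ball, the mean value theorem turns the derivative into growth, and characteristics
    exist by Peano's theorem. *)
Lemma derivative_local_holder (U : set pt) f (omega : pt -> 'rV[R]_a) :
  open U -> {within U, continuous f} -> {within U, continuous omega} ->
  (forall j (s : R) w (r : R) tau, s = 1 \/ s = -1 ->
     char_solution bb c f j s w r tau ->
     (forall t, 0 <= t <= r -> U (cpt j s w t (tau t))) ->
     forall t, 0 < t < r -> is_derive t 1 (fun x => f (cpt j s w x (tau x)))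
       (s * omega (cpt j s w t (tau t)) ord0 j)) ->
  local_holder U f.
Proof.
move=> oU cf co H; apply: (chars_local_holder bb_skew bb_c_basis) => w0 Uw0.
exists (fun j => omega w0 ord0 j) => eps eps0.
have [rho rho0 Hrho] := omega_near oU co Uw0 eps0.
have bU w : `|w - w0| <= rho -> U w by move=> /Hrho[].
have [[M M0 fM] fuc] := ball_bound_uc oU cf bU.
have [r r0 Hr] := char_solution_exists bb c w0 rho0 M0.
exists (rho / 2), r, M; split=> //; first by rewrite divr_gt0.
have rho2 w : `|w - w0| <= rho / 2 -> `|w - w0| <= rho.
  by move=> H1; apply: (le_trans H1); lra.
move=> eta eta0; exists f; split.
- by move=> w _; rewrite subrr normr0 ltW.
- by move=> w /rho2; exact: fM.
move=> j s w s1 ww0; have [tau sol tb] := Hr f fuc fM j s w s1 ww0.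
have tU t : 0 <= t <= r -> U (cpt j s w t (tau t)) by move=> /tb; exact: bU.
apply: (char_solution_curve (ltW eps0) sol).
have [ctau tau0 _] := sol.
have cfp : {within `[0, r], continuous (fun t => f (cpt j s w t (tau t)))}.
  apply: (path_comp_continuous oU cf (char_path_continuous s1 ctau)).
  by move=> t; rewrite /= in_itv/=; exact: tU.
have := increment_affine cfp (H j s w r tau s1 sol tU) (l := s * omega w0 ord0 j).
move=> /(_ eps); rewrite tau0 char_pt0; apply => t /andP[t0 tr].
have /tb/Hrho[_ /(_ j) oj] : 0 <= t <= r by rewrite !ltW.
rewrite -mulrBr normrM.
have -> : `|s| = 1 by case: s1 => ->; rewrite ?normrN normr1.
by rewrite mul1r.
Qed.

End DerivativeAlongCharacteristics.

Section HasDerivativeIn.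
Context (R : realType) (V : normedModType R).

Lemma has_derivative_in_eps (I : set R) (g : R -> V) (t : R) (v : V) :
  has_derivative_in I g t v <->
  (forall e : R, 0 < e -> exists2 d : R, 0 < d & forall s, I s ->
     `|s - t| <= d -> `|g s - g t - (s - t) *: v| <= e * `|s - t|).
Proof.
have scale (s : R) : s != t ->
    `|v - (s - t)^-1 *: (g s - g t)| * `|s - t| = `|g s - g t - (s - t) *: v|.
  move=> st; have s0 : s - t != 0 by rewrite subr_eq0.
  rewrite mulrC -normrZ scalerBr scalerA mulfV// scale1r distrC//.
split=> [/cvgrPdist_le H e e0|H].
  have := H _ e0; rewrite near_withinE near_withinE => /nbhs_norm_leP[d d0 Hd].
  exists d => // s Is st; have [->|sn] := eqVneq s t.
    by rewrite !subrr scale0r subr0 !normr0 mulr0.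
  by rewrite -scale// ler_wpM2r//; exact: Hd.
apply/cvgrPdist_le => e /H[d d0 Hd]; rewrite near_withinE near_withinE.
apply: filterS (nbhs_norm_le t d0) => s /= st sn Is.
by have := Hd s Is st; rewrite -scale// ler_pM2r// normr_gt0 subr_eq0.
Qed.

End HasDerivativeIn.

(** * Intrinsic differentiability and broad solutions *)

Section GroupGeometry.
Context (R : realType) (g : vectType R) (A : step2_stratification g).
Context (n h : nat) (B : adapted_basis A n h).
Local Notation b := (structure_constant B).
Local Notation bbW := (bvecW B).
Local Notation cW := (cvecW B).
Local Notation hbW := (half_bracket bbW).
Local Notation G := (pointG R n h).
Local Notation Wt := (pointW R n h).
Implicit Types (p q : G) (w a : Wt) (t : R).

Lemma bvecW_skew j k : bbW j k = - bbW k j.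
Proof. exact: bvec_skew. Qed.

Lemma DvecE phi j w :
  Dvec b phi j w = (delta_mx ord0 j, - (hbW j w.1 + phi w *: cW j)).
Proof.
congr (_, _); apply/rowP => i; rewrite !mxE summxE; congr (- _).
rewrite [RHS]addrC; congr (_ + _); first by rewrite mulrC.
by congr (_ * _); apply: eq_bigr => k _; rewrite !mxE.
Qed.

Lemma Dvec_comb_delta phi (s : R) j w :
  Dvec_comb b phi (s *: delta_mx ord0 j) w = s *: Dvec b phi j w.
Proof.
rewrite /Dvec_comb (bigD1 j)//= !mxE !eqxx mulr1 big1 ?addr0// => k kj.
by rewrite !mxE (negPf kj) andbF mulr0 scale0r.
Qed.

Lemma gmul_snd p q : (gmul b p q).2 =
  p.2 + q.2 - 2^-1 *: \sum_j \sum_l (p.1 ord0 l * q.1 ord0 j) *: bvec B j l.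
Proof.
apply/rowP => i; rewrite !mxE summxE; congr (_ - _ * _).
apply: eq_bigr => j _; rewrite summxE; apply: eq_bigr => l _.
by rewrite !mxE -mulrA mulrC.
Qed.

(** This is half of [Y, X] for the elements X, Y of W with horizontal coordinates x, y, so it enters
    the group product with a minus sign. *)
Definition W_bracket (x y : 'rV[R]_n) : 'rV[R]_h := \sum_j y ord0 j *: hbW j x.

Lemma W_bracketE x y :
  W_bracket x y = 2^-1 *: \sum_j \sum_k (x ord0 k * y ord0 j) *: bbW j k.
Proof.
rewrite /W_bracket scaler_sumr; apply: eq_bigr => j _.
rewrite /half_bracket scalerA mulrC -scalerA scaler_sumr; congr (_ *: _).
by apply: eq_bigr => k _; rewrite scalerA mulrC.
Qed.

Lemma W_bracketNl x y : W_bracket (- x) y = - W_bracket x y.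
Proof.
rewrite /W_bracket -sumrN; apply: eq_bigr => j _.
by rewrite -scaleN1r half_bracketZ scaleN1r scalerN.
Qed.

Lemma W_bracketDr x y y' : W_bracket x (y + y') = W_bracket x y + W_bracket x y'.
Proof.
by rewrite /W_bracket -big_split; apply: eq_bigr => j _; rewrite mxE scalerDl.
Qed.

Lemma W_bracketNr x y : W_bracket x (- y) = - W_bracket x y.
Proof.
by rewrite /W_bracket -sumrN; apply: eq_bigr => j _; rewrite mxE scaleNr.
Qed.

Lemma W_bracketC x y : W_bracket x y = - W_bracket y x.
Proof.
rewrite !W_bracketE exchange_big/= -scalerN -sumrN; congr (_ *: _).
apply: eq_bigr => j _; rewrite -sumrN; apply: eq_bigr => k _.
by rewrite [bbW k j]bvecW_skew scalerN mulrC.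
Qed.

Lemma W_bracketxx x : W_bracket x x = 0.
Proof.
apply/rowP => i; have := congr1 (fun u : 'rV_h => u ord0 i) (W_bracketC x x).
by rewrite !mxE; lra.
Qed.

Lemma gmul_inW w a :
  gmul b (inW w) (inW a) = inW (w.1 + a.1, w.2 + a.2 - W_bracket w.1 a.1).
Proof.
congr (_, _); first by rewrite /= add_row_mx addr0.
rewrite -[LHS]/((gmul b (inW w) (inW a)).2) gmul_snd W_bracketE /=.
congr (_ - _ *: _).
rewrite big_split_ord/= big_ord1 big1 ?add0r => [|l _]; last first.
  by rewrite [X in _ * X]row_mxEl [X in _ * X]mxE mulr0 scale0r.
apply: eq_bigr => j _; rewrite big_split_ord/= big_ord1.
rewrite row_mxEl mxE mul0r scale0r add0r; apply: eq_bigr => k _.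
by rewrite !row_mxEr.
Qed.

Lemma ginv_inW a : ginv (inW a) = inW (- a).
Proof. by congr (_, _); rewrite /= opp_row_mx oppr0. Qed.

Lemma ginv_inL t : ginv (inL n h t) = inL n h (- t).
Proof. by congr (_, _) => /=; rewrite ?oppr0// opp_row_mx oppr0 raddfN. Qed.

Definition cW_sum (x : 'rV[R]_n) : 'rV[R]_h := \sum_j x ord0 j *: cW j.

Lemma cW_sumD x y : cW_sum (x + y) = cW_sum x + cW_sum y.
Proof.
by rewrite /cW_sum -big_split; apply: eq_bigr => j _; rewrite mxE scalerDl.
Qed.

Lemma graph_pointE w t : gmul b (inW w) (inL n h t) =
  (row_mx t%:M w.1, w.2 + (2^-1 * t) *: cW_sum w.1).
Proof.
congr (_, _); first by rewrite /= add_row_mx add0r addr0.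
rewrite -[LHS]/((gmul b (inW w) (inL n h t)).2) gmul_snd /= addr0; congr (_ + _).
rewrite -scalerN -scalerA; congr (_ *: _).
rewrite big_split_ord/= big_ord1 [X in _ + X]big1 ?addr0 => [|l _]; last first.
  by rewrite big1// => k _; rewrite [X in _ * X]row_mxEr [X in _ * X]mxE mulr0 scale0r.
rewrite big_split_ord/= big_ord1 row_mxEl mxE mul0r scale0r add0r.
rewrite -sumrN scaler_sumr; apply: eq_bigr => j _.
rewrite row_mxEr row_mxEl mxE eqxx mulr1n -scalerN -bvec_skew scalerA mulrC.
by congr (_ *: bvec _ _ _); rewrite /idx1 ord1.
Qed.
Lemma ginv_gmul p q : ginv (gmul b p q) = gmul b (ginv q) (ginv p).
Proof.
apply/eqP; rewrite [X in X == _]surjective_pairing [X in _ == X]surjective_pairing.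
apply/eqP; congr (_, _); first by rewrite /= opprD addrC.
rewrite [RHS]gmul_snd -[LHS]/(- (gmul b p q).2) gmul_snd /ginv /=.
rewrite [X in _ = _ - _ *: X](_ : _ = - \sum_j \sum_l
    (p.1 ord0 l * q.1 ord0 j) *: bvec B j l).
  by apply/rowP => i; rewrite !mxE; ring.
rewrite exchange_big/= -sumrN; apply: eq_bigr => j _.
rewrite -sumrN; apply: eq_bigr => l _.
by rewrite !mxE mulrNN bvec_skew scalerN mulrC.
Qed.

(** The W-component of the group product a . t . w. Left translation by the graph point of a carries
    w to this point, and phi translated to the origin is the increment of phi between a and it. *)
Definition trans_pt t a w : Wt :=
  (a.1 + w.1, a.2 + w.2 - (W_bracket a.1 w.1 + t *: cW_sum w.1)).

Lemma gmul_graph_point a t w :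
  gmul b (gmul b (inW a) (inL n h t)) (inW w) =
  gmul b (inW (trans_pt t a w)) (inL n h t).
Proof.
rewrite [RHS]graph_pointE graph_pointE.
rewrite [LHS]surjective_pairing; congr (_, _).
  by rewrite /= add_row_mx addr0.
rewrite gmul_snd /trans_pt /= cW_sumD scalerDr.
rewrite (_ : 2^-1 *: (\sum_j _) = W_bracket a.1 w.1 + (2^-1 * t) *: cW_sum w.1).
  by apply/rowP => i; rewrite !mxE; lra.
rewrite big_split_ord/= big_ord1 big1 ?add0r => [|l _]; last first.
  by rewrite [X in _ * X]row_mxEl [X in _ * X]mxE mulr0 scale0r.
rewrite W_bracketE /cW_sum -(scalerA 2^-1 t) -scalerDr; congr (_ *: _).
rewrite scaler_sumr -big_split /=.
apply: eq_bigr => j _; rewrite big_split_ord/= big_ord1 addrC; congr (_ + _).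
  by apply: eq_bigr => k _; rewrite !row_mxEr.
by rewrite row_mxEl row_mxEr mxE eqxx mulr1n scalerA.
Qed.

Lemma proj_graph_point w t :
  projL (gmul b (inW w) (inL n h t)) = t /\
  projW b (gmul b (inW w) (inL n h t)) = w.
Proof.
have := gmul_projE B (gmul b (inW w) (inL n h t)).
move: (projL _) (projW b _) => t' w'; rewrite !graph_pointE.
move=> -[/eq_row_mx[/matrixP/(_ ord0 ord0)]].
rewrite !mxE eqxx !mulr1n => -> w1 w2; split=> //; move: w2; rewrite w1 => /addIr w2.
by rewrite [LHS]surjective_pairing -w1 -w2 -surjective_pairing.
Qed.

Lemma ginv_base_point (phi : Wt -> R) a :
  ginv (base_point b phi a) = gmul b (inW a) (inL n h (phi a)).
Proof. by rewrite /base_point ginv_gmul /ginv !opprK. Qed.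

Lemma trans_domE (phi : Wt -> R) a U w :
  trans_dom b (base_point b phi a) U w = U (trans_pt (phi a) a w).
Proof.
rewrite /trans_dom /= ginv_base_point gmul_graph_point.
by have [_ ->] := proj_graph_point (trans_pt (phi a) a w) (phi a).
Qed.

Lemma trans_funE (phi : Wt -> R) a w :
  trans_fun b (base_point b phi a) phi w =
  phi (trans_pt (phi a) a w) - phi a.
Proof.
rewrite /trans_fun ginv_base_point gmul_graph_point.
have [-> ->] := proj_graph_point (trans_pt (phi a) a w) (phi a).
by rewrite addrC.
Qed.

Section Norm.
Context (N : G -> R) (hN : homogeneous_norm b N).

Lemma inL0 : inL n h 0 = gone R n h.
Proof. by congr (_, _); rewrite /= raddf0 row_mx0. Qed.

Lemma inW0 : inW (0 : Wt) = gone R n h.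
Proof. by congr (_, _); rewrite /= row_mx0. Qed.

Lemma hnorm1 : N (gone R n h) = 0.
Proof. by have [_ _ _ H] := hN; apply/H. Qed.

Lemma gmulgV p : gmul b p (ginv p) = gone R n h.
Proof.
rewrite [LHS]surjective_pairing; congr (_, _); first by rewrite /= subrr.
rewrite gmul_snd /= subrr sub0r; apply/eqP; rewrite oppr_eq0; apply/eqP.
set S := \sum_j _; suff S0 : S = - S.
  apply/rowP => i; have := congr1 (fun u : 'rV_h => u ord0 i) S0.
  by rewrite !mxE; lra.
rewrite /S [in LHS]exchange_big/= -sumrN; apply: eq_bigr => j _.
rewrite -sumrN; apply: eq_bigr => l _.
by rewrite !mxE bvec_skew scalerN !mulrN mulrC.
Qed.

Lemma hnorm_ge0 p : 0 <= N p.
Proof.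
have [_ HM HV _] := hN; have := HM p (ginv p).
by rewrite gmulgV hnorm1 HV; lra.
Qed.

Lemma hnorm_inL t : N (inL n h t) = `|t| * N (inL n h 1).
Proof.
have [HD _ HV _] := hN.
have pos s : 0 < s -> N (inL n h s) = s * N (inL n h 1).
  move=> s0; rewrite -HD//; congr N; congr (_, _); rewrite /= ?scaler0//.
  by rewrite scale_row_mx scaler0 scale_scalar_mx mulr1.
have [t0|t0|<-] := ltgtP 0 t.
- by rewrite gtr0_norm// pos.
- by rewrite ltr0_norm// -pos ?oppr_gt0// -ginv_inL HV.
- by rewrite normr0 mul0r inL0 hnorm1.
Qed.

Lemma hnorm_inL1_gt0 : 0 < N (inL n h 1).
Proof.
have [_ _ _ H] := hN; rewrite lt_neqAle hnorm_ge0 andbT eq_sym.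
apply/eqP => /H /(congr1 fst)/matrixP/(_ ord0 (lshift n ord0)).
by rewrite row_mxEl !mxE => /eqP; rewrite oner_eq0.
Qed.

Definition vert_const : R := \sum_i N (inW (0, delta_mx ord0 i)).

Lemma hnorm_inWD w a :
  N (inW (w.1 + a.1, w.2 + a.2 - W_bracket w.1 a.1)) <= N (inW w) + N (inW a).
Proof. by have [_ HM _ _] := hN; rewrite -gmul_inW. Qed.

Lemma W_bracket0r x : W_bracket x 0 = 0.
Proof. by rewrite /W_bracket big1// => j _; rewrite mxE scale0r. Qed.

Lemma hnorm_dil (s : R) w : 0 < s ->
  N (inW (s *: w.1, s ^+ 2 *: w.2)) = s * N (inW w).
Proof.
move=> s0; have [HD _ _ _] := hN; rewrite -HD//; congr N; congr (_, _).
by rewrite /= scale_row_mx scaler0.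
Qed.

Lemma hnorm_vert1 (v : 'rV[R]_h) (t : R) :
  N (inW (0, t *: v)) = Num.sqrt `|t| * N (inW (0, v)).
Proof.
have [_ _ HV _] := hN.
have pos s : 0 < s -> N (inW (0, s *: v)) = Num.sqrt s * N (inW (0, v)).
  move=> s0; have q0 : 0 < Num.sqrt s by rewrite sqrtr_gt0.
  rewrite -(hnorm_dil _ q0) /= scaler0 sqr_sqrtr//; exact: ltW.
have [t0|t0|<-] := ltgtP 0 t.
- by rewrite gtr0_norm// pos.
- rewrite ltr0_norm// -pos ?oppr_gt0// -[LHS]HV ginv_inW scaleNr.
  by congr (N (inW (_, _))); rewrite oppr0.
- by rewrite normr0 sqrtr0 mul0r scale0r inW0 hnorm1.
Qed.

Lemma hnorm_vertD (u v : 'rV[R]_h) :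
  N (inW (0, u + v)) <= N (inW (0, u)) + N (inW (0, v)).
Proof.
by have := hnorm_inWD (0, u) (0, v); rewrite /= addr0 W_bracket0r subr0.
Qed.

(** The dilation by sqrt t multiplies vertical coordinates by t, which gives the square root on each
    axis; vertical elements commute, so the norm is subadditive over the axes. *)
Lemma hnorm_vert (v : 'rV[R]_h) : N (inW (0, v)) <= vert_const * Num.sqrt `|v|.
Proof.
rewrite [v in inW (0, v)]row_sum_delta /vert_const mulr_suml.
elim: (index_enum _) => [|i r IH]; first by rewrite !big_nil inW0 hnorm1.
rewrite !big_cons (le_trans (hnorm_vertD _ _))// lerD//.
rewrite hnorm_vert1 mulrC ler_wpM2l ?hnorm_ge0// ler_wsqrtr//.
exact: row_coord_le.
Qed.

Lemma vert_const_ge0 : 0 <= vert_const.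
Proof. by apply: sumr_ge0 => i _; exact: hnorm_ge0. Qed.

Lemma W_bracket_le x y : `|W_bracket x y| <= n%:R * bb_bound bbW * `|x| * `|y|.
Proof.
rewrite (le_trans (ler_norm_sum _ _ _))//.
apply: (@le_trans _ _ (\sum_(j < n) (bb_bound bbW * `|x| * `|y|))).
  apply: ler_sum => j _; rewrite normrZ mulrC ler_pM ?row_coord_le//.
  exact: half_bracket_le.
by rewrite sumr_const card_ord -[leLHS]mulr_natl !mulrA.
Qed.

Lemma hnorm_hor1 (x : 'rV[R]_n) (t : R) :
  N (inW (t *: x, 0)) = `|t| * N (inW (x, 0)).
Proof.
have [_ _ HV _] := hN.
have pos s : 0 < s -> N (inW (s *: x, 0)) = s * N (inW (x, 0)).
  by move=> s0; rewrite -(hnorm_dil _ s0) /= scaler0.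
have [t0|t0|<-] := ltgtP 0 t.
- by rewrite gtr0_norm// pos.
- rewrite ltr0_norm// -pos ?oppr_gt0// -[LHS]HV ginv_inW scaleNr.
  by congr (N (inW (_, _))); rewrite oppr0.
- by rewrite normr0 mul0r scale0r inW0 hnorm1.
Qed.

Lemma hnorm_split x (v : 'rV[R]_h) :
  N (inW (x, v)) <= N (inW (x, 0)) + N (inW (0, v)).
Proof.
by have := hnorm_inWD (x, 0) (0, v); rewrite /= addr0 add0r W_bracket0r subr0.
Qed.

(** Only subadditivity and homogeneity of N are at hand. A horizontal vector is assembled from its
    coordinate parts; each product creates a vertical term [W_bracket], which a vertical factor of
    bounded norm removes. *)
Lemma hnorm_inW_le : exists2 C : R, 0 <= C &
  forall w, N (inW w) <= C * (`|w.1| + Num.sqrt `|w.2|).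
Proof.
have [K K0 HK] : exists2 K : R, 0 <= K &
    forall x : 'rV[R]_n, `|x| <= 1 -> N (inW (x, 0)) <= K.
  suff [K [K0 HK]] : exists K : R, 0 <= K /\
      forall x : 'rV[R]_n, `|x| <= 1 ->
      N (inW (\sum_(k <- index_enum 'I_n) x 0 k *: delta_mx ord0 k, 0)) <= K.
    by exists K => // x x1; rewrite [x]row_sum_delta; exact: HK.
  elim: (index_enum _) => [|k r [K [K0 HK]]].
    by exists 0; split=> // x _; rewrite big_nil inW0 hnorm1.
  pose C := n%:R * bb_bound bbW * 1 * (size r)%:R.
  exists (N (inW (delta_mx ord0 k, 0)) + K + vert_const * Num.sqrt C).
  split=> [|x x1].
    by rewrite !addr_ge0 ?hnorm_ge0// mulr_ge0 ?vert_const_ge0 ?sqrtr_ge0.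
  rewrite big_cons; set xr := \sum_(i <- r) _; set xk := _ *: _.
  have := hnorm_inWD (xk, 0) (xr, 0); rewrite /= addr0 sub0r => H1.
  have := hnorm_inWD (xk + xr, - W_bracket xk xr) (0, W_bracket xk xr).
  rewrite /= addr0 W_bracket0r subr0 addNr => /le_trans; apply.
  have xk1 : `|x 0 k| <= 1 by apply: le_trans x1; exact: row_coord_le.
  apply: lerD.
    apply: (le_trans H1); apply: lerD; last exact: HK.
    by rewrite hnorm_hor1 ler_piMl ?hnorm_ge0.
  apply: (le_trans (hnorm_vert _)); rewrite ler_wpM2l ?vert_const_ge0//.
  rewrite ler_wsqrtr// (le_trans (W_bracket_le _ _))//.
  have nb0 : 0 <= n%:R * bb_bound bbW by rewrite mulr_ge0// bb_bound_ge0.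
  rewrite ler_pM ?mulr_ge0 ?bb_bound_ge0//.
    rewrite ler_wpM2l// normrZ -[leRHS]mulr1 ler_pM//.
    exact: row_norm_delta.
  rewrite /xr; elim: (r) => [|i r' IH]; first by rewrite big_nil normr0.
  rewrite big_cons (le_trans (ler_normD _ _))//= -natr1 addrC lerD//.
  rewrite normrZ -[leRHS]mulr1 ler_pM ?row_norm_delta//.
  by apply: le_trans x1; exact: row_coord_le.
exists (K + vert_const) => [|[x v]] /=; first by rewrite addr_ge0 ?vert_const_ge0.
have KV : 0 <= K * Num.sqrt `|v| + vert_const * `|x|.
  by rewrite addr_ge0 ?mulr_ge0 ?sqrtr_ge0 ?vert_const_ge0.
have hx : N (inW (x, 0)) <= K * `|x|.
  have [->|x0] := eqVneq x 0; first by rewrite inW0 hnorm1 normr0 mulr0.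
  have xn : 0 < `|x| by rewrite normr_gt0.
  have -> : x = `|x| *: (`|x|^-1 *: x) by rewrite scalerA mulfV ?gt_eqF// scale1r.
  rewrite hnorm_hor1 [X in _ <= K * `|X|]scalerA mulfV ?gt_eqF// scale1r.
  rewrite normr_id mulrC ler_wpM2r// HK// normrZ normfV normr_id mulVf//.
  by rewrite gt_eqF.
apply: (le_trans (hnorm_split _ _)).
have := hnorm_vert v; lra.
Qed.

(** Since [W_bracket] vanishes on the diagonal, the vertical part of the product of the inverse of
    a0 with a is linear in a - a0. It counts with a square root, hence the radius e^2. *)
Lemma hnorm_dist_small (a0 : Wt) (d : R) : 0 < d -> exists2 rho : R, 0 < rho &
  forall a, `|a - a0| <= rho -> N (gmul b (ginv (inW a0)) (inW a)) < d.
Proof.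
move=> d0; have [C C0 HC] := hnorm_inW_le.
pose K := 1 + n%:R * bb_bound bbW * `|a0|.
have nb0 : 0 <= n%:R * bb_bound bbW by rewrite mulr_ge0// bb_bound_ge0.
have K0 : 0 <= K by rewrite addr_ge0// mulr_ge0.
pose L := C * (1 + Num.sqrt K) + 1.
have L0 : 0 < L by rewrite ltr_wpDl// mulr_ge0// addr_ge0// sqrtr_ge0.
pose e := Num.min 1 (d / (2 * L)).
have e0 : 0 < e by rewrite lt_min ltr01 divr_gt0// mulr_gt0.
have e1 : e <= 1 by rewrite ge_min lexx.
have eL : e * L < d.
  have : e <= d / (2 * L) by rewrite ge_min lexx orbT.
  rewrite ler_pdivlMr ?mulr_gt0//; lra.
exists (e ^+ 2) => [|a aa0]; first by rewrite exprn_gt0.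
rewrite ginv_inW gmul_inW; set u := (_, _).
have u1 : `|u.1| <= e ^+ 2.
  by rewrite /u /= addrC (le_trans (pair_norm1_le _) aa0).
have u2 : `|u.2| <= K * e ^+ 2.
  rewrite /u /= W_bracketNl opprK -(subr0 (W_bracket _ a.1)).
  rewrite -[X in _ - X](W_bracketxx a0.1) -[X in _ + (_ + X)]W_bracketNr -W_bracketDr.
  rewrite (le_trans (ler_normD _ _))// [leRHS]mulrDl mul1r; apply: lerD.
    by rewrite addrC (le_trans (pair_norm2_le _) aa0).
  rewrite (le_trans (W_bracket_le _ _))//; apply: ler_pM => //.
  - by rewrite mulr_ge0.
  - by rewrite ler_wpM2l// pair_norm1_le.
  - by rewrite (le_trans (pair_norm1_le _) aa0).
apply: le_lt_trans eL; apply: (le_trans (HC _)).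
have s2 : Num.sqrt `|u.2| <= e * Num.sqrt K.
  rewrite -[X in X * _](ger0_norm (ltW e0)) -sqrtr_sqr -sqrtrM ?sqr_ge0//.
  by rewrite ler_wsqrtr// mulrC.
have u1' : `|u.1| <= e.
  by rewrite (le_trans u1)// expr2 ler_piMr// ltW.
have : C * (`|u.1| + Num.sqrt `|u.2|) <= C * (e + e * Num.sqrt K).
  by rewrite ler_wpM2l// lerD.
by rewrite /L; lra.
Qed.

Lemma inL_mul s t : gmul b (inL n h s) (inL n h t) = inL n h (s + t).
Proof.
rewrite [LHS]surjective_pairing; congr (_, _).
  by rewrite /= add_row_mx addr0 raddfD.
rewrite gmul_snd /= addr0 sub0r big_split_ord/= big_ord1 [X in _ + X]big1.
  rewrite addr0 big_split_ord/= big_ord1 [X in _ + X]big1.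
    by rewrite addr0 (bb_diag (@bvec_skew _ _ _ _ _ B)) !scaler0 oppr0.
  by move=> l _; rewrite row_mxEr mxE mul0r scale0r.
move=> j _; rewrite big1// => l _.
by rewrite [X in _ * X]row_mxEr [X in _ * X]mxE mulr0 scale0r.
Qed.

Lemma intrinsic_quotientE (phi : Wt -> R) (lw : R) a w :
  N (gmul b (ginv (inL n h lw))
    (inL n h (trans_fun b (base_point b phi a) phi w))) =
  `|phi (trans_pt (phi a) a w) - phi a - lw| * N (inL n h 1).
Proof. by rewrite ginv_inL inL_mul trans_funE hnorm_inL addrC. Qed.

Lemma hnorm_inW_eq0 w : N (inW w) = 0 -> w = 0.
Proof.
have [_ _ _ H] := hN; move=> /H [w1 w2].
have /eq_row_mx[_ w10] : row_mx 0 w.1 = row_mx 0 0 :> 'rV[R]_(1 + n).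
  by rewrite w1 row_mx0.
by rewrite [w]surjective_pairing w10 w2.
Qed.

Lemma trans_pt0 t a : trans_pt t a 0 = a.
Proof.
rewrite /trans_pt /= !addr0 W_bracket0r /cW_sum big1 ?scaler0 ?addr0 ?subr0.
  by rewrite -surjective_pairing.
by move=> j _; rewrite mxE scale0r.
Qed.

Lemma dotp0 (v : 'rV[R]_n) : dotp v 0 = 0.
Proof. by rewrite /dotp big1// => j _; rewrite mxE mulr0. Qed.

Lemma intrinsic_gradient_eps U (phi : Wt -> R) a v :
  intrinsic_gradient b N U phi a v -> forall e : R, 0 < e ->
  exists2 d : R, 0 < d & forall w, U (trans_pt (phi a) a w) -> N (inW w) < d ->
    `|phi (trans_pt (phi a) a w) - phi a - dotp v w.1| <= e * N (inW w).
Proof.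
move=> [_ /limsup_eq0P H] e e0.
have N1 := hnorm_inL1_gt0.
have [d d0 Hd] := H (e * N (inL n h 1)) (mulr_gt0 e0 N1).
exists (d / 2) => [|w Uw wd]; first by rewrite divr_gt0.
have [w0|w0] := eqVneq (N (inW w)) 0.
  by rewrite w0 (hnorm_inW_eq0 w0) trans_pt0 dotp0 !subrr normr0 mulr0.
have wp : 0 < N (inW w) by rewrite lt_neqAle eq_sym w0 hnorm_ge0.
have := Hd (d / 2) _ _ (ex_intro _ w _).
rewrite trans_domE => /(_ _ _ (And3 Uw _ erefl)).
rewrite wp wd intrinsic_quotientE => H1.
have {}H1 := H1 ltac:(apply/andP; split; lra) isT.
by rewrite ler_pdivrMr// mulrAC ler_pM2r// in H1.
Qed.

Lemma gmul_self p : gmul b p p = p + p.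
Proof.
rewrite [LHS]surjective_pairing; congr (_, _).
rewrite gmul_snd; set S := \sum_j _; suff S0 : S = - S.
  apply/rowP => i; have := congr1 (fun u : 'rV_h => u ord0 i) S0.
  by rewrite !mxE; lra.
rewrite /S [in LHS]exchange_big/= -sumrN; apply: eq_bigr => j _.
rewrite -sumrN; apply: eq_bigr => l _.
by rewrite bvec_skew scalerN mulrC.
Qed.

(** The graph is closed under products and dilations. Squaring the graph point over (0, v) doubles
    l, the dilation by sqrt 2 multiplies it by sqrt 2, and both lead to the graph point over (0, 2
    v). *)
Lemma intrinsic_linear_vert (l : Wt -> R) (v : 'rV[R]_h) :
  intrinsically_linear b l -> l (0, v) = 0.
Proof.
move=> [_ HM _ HD].
have graph w : igraph b setT l (gmul b (inW w) (inL n h (l w))) by exists w.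
have uniq w t : igraph b setT l (gmul b (inW w) (inL n h t)) -> t = l w.
  move=> [w' _ E].
  have [t1 w1] := proj_graph_point w' (l w'); have [t2 w2] := proj_graph_point w t.
  by rewrite E t2 w2 in t1 w1; rewrite t1 w1.
have gE t : gmul b (inW (0, v)) (inL n h t) = (row_mx t%:M 0, v).
  by rewrite graph_pointE /= /cW_sum big1 ?scaler0 ?addr0// => j _; rewrite mxE scale0r.
have gE2 t : gmul b (inW (0, 2 *: v)) (inL n h t) = (row_mx t%:M 0, 2 *: v).
  by rewrite graph_pointE /= /cW_sum big1 ?scaler0 ?addr0// => j _; rewrite mxE scale0r.
have dbl : 2 * l (0, v) = l (0, 2 *: v).
  apply: uniq; rewrite gE2; have := HM _ _ (graph (0, v)) (graph (0, v)).
  rewrite gE gmul_self; congr igraph; congr (_, _); last by rewrite scaler_nat.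
  by rewrite /= add_row_mx addr0 -raddfD /= mulr_natl mulr2n.
have q2 : Num.sqrt 2 ^+ 2 = 2 :> R by rewrite sqr_sqrtr.
have dil : Num.sqrt 2 * l (0, v) = l (0, 2 *: v).
  apply: uniq; rewrite gE2.
  have s20 : 0 < Num.sqrt 2 :> R by rewrite sqrtr_gt0.
  have := HD _ _ s20 (graph (0, v)).
  rewrite gE /dilation /= q2; congr igraph; congr (_, _).
  by rewrite scale_row_mx scaler0 scale_scalar_mx.
have := dbl; rewrite -dil => /eqP; rewrite -subr_eq0 -mulrBl mulf_eq0.
case/orP => /eqP // q; exfalso.
have q3 : Num.sqrt 2 = 2 :> R by move: q; lra.
by move: q2; rewrite q3; lra.
Qed.

(** The increment w = (0, y' - y) translates (x, y) to (x, y'), its norm is of order sqrt |y' - y|,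
    and l vanishes on it. Uniformity in the base point lets (x, y) vary, so that no characteristics
    are involved. *)
Lemma unif_intrinsic_local_holder (U : set Wt) (phi : Wt -> R) :
  open U -> unif_intrinsic_differentiable b N U phi -> local_holder U phi.
Proof.
move=> oU H a0 Ua0 e e0; have [l [ll /limsup_eq0P {}H]] := H a0 Ua0.
have N1 := hnorm_inL1_gt0; have V0 := vert_const_ge0.
pose k := vert_const + 1; have k0 : 0 < k by rewrite ltr_wpDl.
pose e' := e * N (inL n h 1) / k.
have e'0 : 0 < e' by rewrite divr_gt0// mulr_gt0.
have [d d0 Hd] := H e' e'0.
have d20 : 0 < d / 2 by rewrite divr_gt0.
have [rho1 rho10 Hrho1] := hnorm_dist_small a0 d20.
have [rho2 rho20 Hrho2] := open_norm_ball oU Ua0.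
pose s := d / (2 * k); have s0 : 0 < s by rewrite divr_gt0// mulr_gt0.
pose rho := Num.min rho1 (Num.min rho2 (s ^+ 2 / 4)).
exists rho => [|x y y'].
  by rewrite !lt_min rho10 rho20 divr_gt0// exprn_gt0.
rewrite !le_min => /and3P[x1 x2 x3] /and3P[y1 y2 y3].
pose w : Wt := (0, y' - y).
have tw t : trans_pt t (x, y) w = (x, y').
  rewrite /trans_pt /= addr0 W_bracket0r /cW_sum big1 => [|j _].
    by rewrite scaler0 addr0 subr0 addrC subrK.
  by rewrite mxE scale0r.
have [->|yy] := eqVneq y' y; first by rewrite !subrr !normr0 sqrtr0 mulr0.
have wp : 0 < N (inW w).
  rewrite lt_neqAle hnorm_ge0 andbT eq_sym; apply/eqP => /hnorm_inW_eq0[] /eqP.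
  by rewrite subr_eq0 (negPf yy).
have Nw : N (inW w) <= vert_const * Num.sqrt `|y' - y| by exact: hnorm_vert.
have ys : Num.sqrt `|y' - y| < s.
  have ys2 : `|y' - y| < s ^+ 2.
    have := le_trans (pair_norm2_le _) y3; have := le_trans (pair_norm2_le _) x3.
    move=> /= h1 h2.
    have := ler_normB (y' - a0.2) (y - a0.2); rewrite opprB addrA subrK => h3.
    have : 0 < s ^+ 2 by rewrite exprn_gt0.
    move: (le_trans h3 (lerD h2 h1)); clear; lra.
  by rewrite -[ltRHS](gtr0_norm s0) -sqrtr_sqr ltr_sqrt// exprn_gt0.
have wd : N (inW w) < d / 2.
  have : vert_const * Num.sqrt `|y' - y| <= vert_const * s by rewrite ler_wpM2l// ltW.
  have : s * k = d / 2 by rewrite /s invfM; field; rewrite gt_eqF.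
  move: (s0); rewrite /k; lra.
have Uy' : trans_dom b (base_point b phi (x, y)) U w by rewrite trans_domE tw; exact: Hrho2.
have dd : 0 < d / 2 < d by rewrite divr_gt0//= ltr_pdivrMr// ltr_pMr// ltr1n.
have := Hd (d / 2) dd _ (ex_intro _ (x, y) (ex_intro _ w
  (And5 (Hrho2 _ x2) (Hrho1 _ x1) Uy' _ erefl))).
rewrite wp wd => /(_ isT).
rewrite intrinsic_quotientE tw intrinsic_linear_vert// subr0.
rewrite ler_pdivrMr// -ler_pdivlMr// => H1; apply: (le_trans H1).
have -> : e' * N (inW w) / N (inL n h 1) = e * (N (inW w) / k).
  by rewrite /e'; field; rewrite !gt_eqF.
rewrite ler_wpM2l ?(ltW e0)// ler_pdivrMr// (le_trans Nw)// mulrC.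
by rewrite ler_wpM2l ?sqrtr_ge0// lerDl.
Qed.
End Norm.
End GroupGeometry.

Section SlopeBound.
Context (R : realType).

(* Self-improvement: |u x| = O(|x-t| + sqrt(int_t^x u)) forces |u x| = O(|x-t|). *)
Lemma slope_self_improvement (tau u : R -> R) (t m0 r C : R) : 0 < t < r -> 0 <= C ->
  (forall x, 0 < x < r -> is_derive x 1 tau (m0 + u x)) ->
  {within `[0, r], continuous u} ->
  (exists2 d : R, 0 < d & forall x, `|x - t| <= d ->
    `|u x| <= C * (`|x - t| + Num.sqrt `|tau x - tau t - (x - t) * m0|)) ->
  exists2 d : R, 0 < d & forall x, `|x - t| <= d ->
    `|u x| <= (2 * C + C ^+ 2) * `|x - t| /\
    `|tau x - tau t - (x - t) * m0| <= (2 * C + C ^+ 2) * `|x - t| ^+ 2.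
Proof.
move=> /andP[t0 tr] C0 dtau cu [d d0 Hd].
have htr : 0 < r - t by rewrite subr_gt0.
pose d' := Num.min d (Num.min (t / 2) ((r - t) / 2)).
have d'0 : 0 < d' by rewrite !lt_min d0 !divr_gt0.
exists d' => // x xd'.
pose D : R := `|x - t|.
have [Dd Dt Dr] : [/\ D <= d, D <= t / 2 & D <= (r - t) / 2].
  by move: xd'; rewrite !le_min => /and3P[].
have D0 : 0 <= D by exact: normr_ge0.
have sub : `[t - D, t + D]%classic `<=` `[0, r].
  by move=> y /=; rewrite !in_itv/= => /andP[y1 y2]; apply/andP; split; move: y1 y2 Dt Dr t0 tr; clear; lra.
have cun : {within `[t - D, t + D], continuous (fun y => `|u y|)}.
  have /within_continuous_epsP cu' := continuous_subspaceW sub cu.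
  apply: within_continuous_eps => y yD e e0; have [d1 d10 H1] := cu' y yD e e0.
  by exists d1 => // z zD zy; apply: (le_trans (ler_dist_dist _ _)); exact: H1.
have tD : t - D <= t + D by lra.
have [y] := EVT_max tD cun; rewrite in_itv/= => yD ymax.
pose m : R := `|u y|; rewrite -/m in ymax.
have m0' : 0 <= m by exact: normr_ge0.
have eta z : `|z - t| <= D -> `|tau z - tau t - (z - t) * m0| <= m * `|z - t|.
  move=> zD; move: (zD); rewrite ler_norml => /andP[z1 z2].
  have seg (p q : R) : t - D <= p -> p <= q -> q <= t + D ->
      `|tau q - tau p - (q - p) * m0| <= m * (q - p).
    move=> p1 pq q1.
    have der s : s \in `]p, q[%R -> is_derive s 1 tau (m0 + u s).
      by rewrite in_itv/= => /andP[s1 s2]; apply: dtau; apply/andP; split; move: p1 q1 s1 s2 Dt Dr t0 tr; clear; lra.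
    have cont : {within `[p, q], continuous tau}.
      apply: derivable_within_continuous => s; rewrite in_itv/= => /andP[s1 s2].
      have : is_derive s 1 tau (m0 + u s) by apply: dtau; apply/andP; split; move: p1 q1 s1 s2 Dt Dr t0 tr; clear; lra.
      by case.
    have [s] := MVT_segment pq der cont.
    rewrite in_itv/= => /andP[s1 s2] ->.
    rewrite mulrC -mulrBr [m0 + _]addrC addrK normrM mulrC.
    have qp : 0 <= q - p by rewrite subr_ge0.
    rewrite (ger0_norm qp) ler_wpM2r// ymax// in_itv/=.
    by apply/andP; split; move: p1 q1 s1 s2; clear; lra.
  have [tz|/ltW zt] := leP t z.
    by rewrite (ger0_norm (_ : 0 <= z - t)) ?subr_ge0//; apply: seg => //; move: D0 z1 z2; clear; lra.
  have zE : `|z - t| = t - z by rewrite distrC ger0_norm ?subr_ge0.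
  rewrite zE (_ : tau z - _ - _ = - (tau t - tau z - (t - z) * m0)); last by ring.
  by rewrite normrN; apply: seg => //; move: D0 z1 z2; clear; lra.
have yD' : `|y - t| <= D.
  by rewrite ler_norml; case/andP: yD => y1 y2; apply/andP; split; move: y1 y2; clear; lra.
(* From m <= C (D + sqrt (m D)) and 2 C sqrt (m D) <= C^2 D + m, half of m is absorbed on the
   left. *)
have mK : m <= (2 * C + C ^+ 2) * D.
  have H1 : m <= C * (D + Num.sqrt (m * D)).
    apply: (le_trans (Hd y (le_trans yD' Dd))); rewrite ler_wpM2l// lerD//.
    rewrite ler_wsqrtr// (le_trans (eta y yD'))//.
    by rewrite ler_wpM2l.
  have sm : Num.sqrt (m * D) ^+ 2 = m * D by rewrite sqr_sqrtr// mulr_ge0.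
  have smE : Num.sqrt (m * D) = Num.sqrt m * Num.sqrt D by rewrite sqrtrM.
  have s1 : Num.sqrt m ^+ 2 = m by rewrite sqr_sqrtr.
  have s2 : Num.sqrt D ^+ 2 = D by rewrite sqr_sqrtr.
  have : 0 <= (C * Num.sqrt D - Num.sqrt m) ^+ 2 by rewrite sqr_ge0.
  rewrite sqrrB exprMn s1 s2.
  have E : C * Num.sqrt D * Num.sqrt m *+ 2 = 2 * (C * Num.sqrt (m * D)).
    by rewrite smE; ring.
  rewrite E; move: H1; rewrite mulrDr; clear; lra.
have xD : `|x - t| <= D by [].
have xin : x \in `[t - D, t + D]%R.
  move: xD; rewrite ler_norml => /andP[x1 x2]; rewrite in_itv/=.
  by apply/andP; split; move: x1 x2; clear; lra.
split; first exact: le_trans (ymax _ xin) mK.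
apply: (le_trans (eta x xD)); rewrite expr2 mulrA.
by rewrite ler_wpM2r.
Qed.

End SlopeBound.

Section BroadAndIntrinsic.
Context (R : realType) (g : vectType R) (A : step2_stratification g).
Context (n h : nat) (B : adapted_basis A n h).
Local Notation b := (structure_constant B).
Local Notation bbW := (bvecW B).
Local Notation cW := (cvecW B).
Local Notation Wt := (pointW R n h).
Local Notation cpt := (char_pt bbW cW).
Implicit Types (w a : Wt) (t : R).

Lemma half_bracket_char j (s : R) w (t u : R) :
  half_bracket bbW j (cpt j s w t u).1 = half_bracket bbW j w.1.
Proof.
rewrite /= half_bracketD half_bracketZ half_bracket_deltaj ?scaler0 ?addr0//.
exact: bvecW_skew.
Qed.

Lemma char_has_derivative j (s : R) w (tau : R -> R) (I : set R) (t v : R) :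
  `|s| <= 1 -> is_derive t 1 tau v ->
  has_derivative_in I (fun x => cpt j s w x (tau x)) t
    (s *: (delta_mx ord0 j, - (half_bracket bbW j w.1 + v *: cW j))).
Proof.
move=> s1 /is_derive_epsP dtau; apply/has_derivative_in_eps => e e0.
pose k := c_bound cW + 1; have k0 : 0 < k by rewrite ltr_wpDl ?c_bound_ge0.
have [d d0 Hd] := dtau (e / k) (divr_gt0 e0 k0).
exists d => // x _ xt.
have -> : cpt j s w x (tau x) - cpt j s w t (tau t) - (x - t) *:
    (s *: (delta_mx ord0 j, - (half_bracket bbW j w.1 + v *: cW j)))
  = (0, - (s * (tau x - tau t - (x - t) * v)) *: cW j).
  by congr (_, _); apply/rowP => i; rewrite !mxE; ring.
rewrite pair_norm_le /= normr0 mulr_ge0 ?(ltW e0)//=.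
rewrite normrZ normrN normrM.
have H := Hd x xt.
have H1 : `|s| * `|tau x - tau t - (x - t) * v| <= e / k * `|x - t|.
  by rewrite -[leRHS]mul1r ler_pM.
have H2 : e / k * `|x - t| * `|cW j| <= e / k * `|x - t| * k.
  rewrite ler_wpM2l ?mulr_ge0 ?(ltW e0) ?invr_ge0 ?(ltW k0)//.
  by rewrite (le_trans (c_le cW j))// lerDl.
have H3 : e / k * `|x - t| * k = e * `|x - t| by field; rewrite gt_eqF.
by rewrite -H3 (le_trans _ H2)// ler_wpM2r.
Qed.

(** A characteristic with sign s is an integral curve of D^phi_W for W = s X_j; it is restricted to
    the open interval because [broad] tests open intervals. *)
Lemma broad_local_holder (U : set Wt) (phi : Wt -> R) (omega : Wt -> 'rV[R]_n) :
  open U -> {within U, continuous phi} -> {within U, continuous omega} ->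
  broad b U phi omega -> local_holder U phi.
Proof.
move=> oU cphi com brd.
apply: (derivative_local_holder (@bvecW_skew _ _ _ _ _ B) (@bvecW_basis _ _ _ _ _ B)
  oU cphi com) => j s w r tau s1 [ctau tau0 dtau] Utau t tr.
have ns : `|s| <= 1 by case: s1 => ->; rewrite ?normrN normr1.
have sub : `]0, r[%classic `<=` `[0, r] by exact: subset_itv_oo_cc.
have Ur x : `]0, r[%classic x -> U (cpt j s w x (tau x)).
  by move=> /sub /=; rewrite in_itv/=; exact: Utau.
have cp : {within `]0, r[, continuous (fun x => cpt j s w x (tau x))}.
  exact: continuous_subspaceW sub (char_path_continuous s1 ctau).
pose c t := cpt j s w t (tau t).
have DE x : Dvec_comb b phi (s *: delta_mx ord0 j) (c x) =
    s *: (delta_mx ord0 j, - (half_bracket bbW j w.1 + phi (c x) *: cW j)).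
  by rewrite Dvec_comb_delta DvecE half_bracket_char.
have dE : dotp (omega (c t)) (s *: delta_mx ord0 j) = s * omega (c t) ord0 j.
  rewrite /dotp (bigD1 j)//= !mxE !eqxx mulr1 mulrC big1 ?addr0// => k kj.
  by rewrite !mxE (negPf kj) andbF mulr0 mulr0.
rewrite -[X in is_derive _ _ _ X]dE.
apply: (brd (s *: delta_mx ord0 j) `]0, r[%classic c); last by rewrite /= in_itv.
- exact: interval_open.
- exact: interval_is_interval.
- split=> //.
  + have /within_continuous_epsP cphip := path_comp_continuous oU cphi cp Ur.
    apply: within_continuous_eps => x xr e e0; rewrite /comp.
    pose k := c_bound cW + 1; have k0 : 0 < k by rewrite ltr_wpDl ?c_bound_ge0.
    have [d d0 Hd] := cphip x xr (e / k) (divr_gt0 e0 k0).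
    exists d => // y yr yx; rewrite !DE -scalerBr normrZ.
    rewrite (_ : _ - _ = (0, (phi (c x) - phi (c y)) *: cW j)); last first.
      by congr (_, _); apply/rowP => i; rewrite !mxE; ring.
    rewrite (le_trans (ler_wpM2r (normr_ge0 _) ns))// mul1r.
    rewrite pair_norm_le /= normr0 (ltW e0)/= normrZ distrC.
    apply: (@le_trans _ _ (e / k * k)); last by rewrite divfK// gt_eqF.
    rewrite ler_pM//; first exact: Hd.
    by rewrite (le_trans (c_le cW j))// lerDl.
  + move=> x xr; rewrite DE; apply: char_has_derivative => //.
    by apply: dtau; move: xr; rewrite /= in_itv.
Qed.

Section Norm.
Context (N : pointG R n h -> R) (hN : homogeneous_norm b N).

(** Seen from a = p t, the point p x of the curve is the translate by an increment whose vertical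
    part contains only the deviation of tau from its tangent at t. This is what keeps the
    homogeneous norm of the increment small. *)
Lemma char_trans_pt (phi : Wt -> R) j (s : R) w (tau : R -> R) (t x : R) :
  let a := cpt j s w t (tau t) in
  trans_pt B (phi a) a ((s * (x - t)) *: delta_mx ord0 j,
    - (s * (tau x - tau t - (x - t) * phi a)) *: cW j) = cpt j s w x (tau x).
Proof.
move=> a; rewrite /trans_pt /=.
have -> : W_bracket B a.1 ((s * (x - t)) *: delta_mx ord0 j) =
    (s * (x - t)) *: half_bracket bbW j w.1.
  rewrite /W_bracket (bigD1 j)//= big1 ?addr0 => [|k kj]; last first.
    by rewrite !mxE (negPf kj) andbF mulr0 scale0r.
  by rewrite !mxE !eqxx mulr1 half_bracket_char.
have -> : cW_sum B ((s * (x - t)) *: delta_mx ord0 j) = (s * (x - t)) *: cW j.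
  rewrite /cW_sum (bigD1 j)//= big1 ?addr0 => [|k kj]; last first.
    by rewrite !mxE (negPf kj) andbF mulr0 scale0r.
  by rewrite !mxE !eqxx mulr1.
by congr (_, _); rewrite /=; apply/rowP => i; rewrite !mxE; ring.
Qed.

(** Intrinsic differentiability at p t bounds the error of u by e times |x - t| + sqrt |eta x|,
    where eta is the integral of u. The case e = 1 feeds [slope_self_improvement] and gives eta x =
    O(|x - t|^2); with this, small e gives the derivative. *)
Lemma intrinsic_local_holder (U : set Wt) (phi : Wt -> R) :
  open U -> {within U, continuous phi} ->
  intrinsic_differentiable_C b N U phi -> local_holder U phi.
Proof.
move=> oU cphi [grad [dgrad cgrad]].
apply: (derivative_local_holder (@bvecW_skew _ _ _ _ _ B) (@bvecW_basis _ _ _ _ _ B)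
  oU cphi cgrad) => j s w r tau s1 [ctau tau0 dtau] Utau t tr.
have ns : `|s| = 1 by case: s1 => ->; rewrite ?normrN normr1.
pose p x := cpt j s w x (tau x); pose a := p t.
have Ua : U a by apply: Utau; case/andP: tr => ? ?; rewrite !ltW.
pose eta x := tau x - tau t - (x - t) * phi a.
pose wx x : Wt := ((s * (x - t)) *: delta_mx ord0 j, - (s * eta x) *: cW j).
have pE x : trans_pt B (phi a) a (wx x) = p x by exact: char_trans_pt.
have [C C0 HC] := hnorm_inW_le hN.
pose K := C * (1 + Num.sqrt (c_bound cW)).
have K0 : 0 <= K by rewrite mulr_ge0// addr_ge0// sqrtr_ge0.
have Nwx x : N (inW (wx x)) <= K * (`|x - t| + Num.sqrt `|eta x|).
  apply: (le_trans (HC _)); rewrite /K -mulrA ler_wpM2l//.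
  have h1 : `|(wx x).1| <= `|x - t|.
    by rewrite /= normrZ normrM ns mul1r ler_piMr// row_norm_delta.
  have h2 : Num.sqrt `|(wx x).2| <= Num.sqrt (c_bound cW) * Num.sqrt `|eta x|.
    rewrite -sqrtrM ?c_bound_ge0// ler_wsqrtr//= normrZ normrN normrM ns mul1r.
    by rewrite mulrC ler_wpM2r// c_le.
  have : 0 <= Num.sqrt (c_bound cW) * `|x - t| by rewrite mulr_ge0 ?sqrtr_ge0.
  have : 0 <= Num.sqrt `|eta x| by rewrite sqrtr_ge0.
  lra.
have dot x : dotp (grad a) (wx x).1 = s * (x - t) * grad a ord0 j.
  rewrite /dotp (bigD1 j)//= !mxE !eqxx mulr1 mulrC big1 ?addr0// => k kj.
  by rewrite !mxE (negPf kj) andbF mulr0 mulr0.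
have eta0 (d : R) : 0 < d -> exists2 d' : R, 0 < d' & forall x, `|x - t| <= d' ->
    `|eta x| <= `|x - t| /\ N (inW (wx x)) < d /\ U (p x).
  move=> d0; have [d1 d10 H1] := is_derive_epsP (dtau t tr) ltr01.
  pose k := 2 * (K + 1); have k0 : 0 < k by rewrite mulr_gt0// ltr_wpDl.
  pose q := Num.min 1 (d / (2 * k)).
  have q0 : 0 < q by rewrite lt_min ltr01 divr_gt0// mulr_gt0.
  have /andP[t0 t1] := tr; have t1' : 0 < r - t by rewrite subr_gt0.
  exists (Num.min d1 (Num.min (q ^+ 2) (Num.min t (r - t)))) => [|x].
    by rewrite !lt_min d10 exprn_gt0// t0.
  rewrite !le_min => /and4P[x1 x2 x3 x4].
  have ex : `|eta x| <= `|x - t| by rewrite -[leRHS]mul1r; exact: H1.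
  split=> //; split; last first.
    apply: Utau; move: x3 x4; rewrite !ler_norml => /andP[? ?] /andP[? ?].
    by apply/andP; split; lra.
  apply: (le_lt_trans (Nwx x)).
  have h1 : Num.sqrt `|eta x| <= q.
    rewrite -[leRHS](gtr0_norm q0) -[leRHS]sqrtr_sqr ler_wsqrtr//.
    exact: le_trans ex x2.
  have h2 : `|x - t| <= q.
    by apply: (le_trans x2); rewrite expr2 ler_piMr ?(ltW q0)// ge_min lexx.
  have h3 : K * (`|x - t| + Num.sqrt `|eta x|) <= K * (q + q).
    by rewrite ler_wpM2l// lerD.
  apply: (le_lt_trans h3).
  have : q * (2 * k) <= d.
    have k2 : 0 < 2 * k by rewrite mulr_gt0.
    by rewrite -(ler_pdivlMr _ _ k2) /q ge_min lexx orbT.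
  have : 0 <= K * q by rewrite mulr_ge0// ltW.
  by move: (q0); rewrite /k; lra.
have grad_eps := intrinsic_gradient_eps hN (dgrad a Ua).
pose u x := phi (p x) - phi a.
have u_eps (e : R) : 0 < e -> exists2 d : R, 0 < d & forall x, `|x - t| <= d ->
    `|u x - s * (x - t) * grad a ord0 j| <= e * (K * (`|x - t| + Num.sqrt `|eta x|)).
  move=> e0; have [d d0 Hd] := grad_eps e e0.
  have [d' d'0 Hd'] := eta0 d d0; exists d' => // x /Hd'[_ [Nd Up]].
  have := Hd (wx x); rewrite pE dot => /(_ Up Nd) H; apply: (le_trans H).
  by rewrite ler_wpM2l ?(ltW e0).
have cu : {within `[0, r], continuous u}.
  have Up x : `[0, r]%classic x -> U (p x) by rewrite /= in_itv/=; exact: Utau.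
  have /within_continuous_epsP H :=
    path_comp_continuous oU cphi (char_path_continuous s1 ctau) Up.
  apply: within_continuous_eps => x xr e e0; have [d d0 Hd] := H x xr e e0.
  exists d => // y yr yx; rewrite /u (_ : _ - _ = phi (p y) - phi (p x)).
    exact: Hd.
  by ring.
have du x : 0 < x < r -> is_derive x 1 tau (phi a + u x).
  by move=> xr; rewrite /u addrC subrK; exact: dtau.
pose C1 := `|grad a ord0 j| + K.
have C10 : 0 <= C1 by rewrite addr_ge0.
have ubnd : exists2 d : R, 0 < d & forall x, `|x - t| <= d ->
    `|u x| <= C1 * (`|x - t| + Num.sqrt `|eta x|).
  have [d d0 Hd] := u_eps 1 ltr01; exists d => // x /Hd.
  rewrite mul1r => H.
  have := ler_normD (u x - s * (x - t) * grad a ord0 j) (s * (x - t) * grad a ord0 j).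
  rewrite subrK !normrM ns mul1r => /le_trans; apply.
  have : 0 <= `|grad a ord0 j| * Num.sqrt `|eta x| by rewrite mulr_ge0 ?sqrtr_ge0.
  by move: H; rewrite /C1; lra.
have [d2 d20 H2] := slope_self_improvement tr C10 du cu ubnd.
pose L := 2 * C1 + C1 ^+ 2.
have L0 : 0 <= L by rewrite addr_ge0 ?sqr_ge0// mulr_ge0.
apply: is_derive_eps => e e0.
pose k := K * (1 + Num.sqrt L) + 1.
have k0 : 0 < k by rewrite ltr_wpDl// mulr_ge0// addr_ge0// sqrtr_ge0.
have [d3 d30 H3] := u_eps (e / k) (divr_gt0 e0 k0).
exists (Num.min d2 d3) => [|x]; first by rewrite lt_min d20.
rewrite le_min => /andP[/H2[_ ex] /H3 ux].
rewrite -/(p x) -/(p t) -/a -/(u x).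
rewrite (_ : (x - t) * _ = s * (x - t) * grad a ord0 j); last by ring.
apply: (le_trans ux).
have se : Num.sqrt `|eta x| <= Num.sqrt L * `|x - t|.
  rewrite -[X in _ * X]normr_id -[X in _ * X]sqrtr_sqr -sqrtrM//.
  by rewrite ler_wsqrtr.
have h1 : K * (`|x - t| + Num.sqrt `|eta x|) <= k * `|x - t|.
  have : K * (`|x - t| + Num.sqrt `|eta x|) <=
      K * (`|x - t| + Num.sqrt L * `|x - t|) by rewrite ler_wpM2l// lerD2l.
  have : 0 <= `|x - t| by [].
  rewrite /k; lra.
have h2 : e / k * (k * `|x - t|) = e * `|x - t| by field; rewrite gt_eqF.
by rewrite -h2 ler_wpM2l// divr_ge0// ltW.
Qed.

End Norm.
End BroadAndIntrinsic.

(** * Integrals over segments and a first-exit argument *)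

Section SegmentIntegrals.
Context (R : realType).
Local Notation mu := (@lebesgue_measure R).

Lemma continuous_segment_integrable (f : R -> R) (u v : R) :
  {within `[u, v], continuous f} -> mu.-integrable `[u, v] (EFin \o f).
Proof. by move=> cf; apply: continuous_compact_integrable => //; exact: segment_compact. Qed.

Lemma segment_antiderivative (f : R -> R) (r : R) : 0 < r ->
  {within `[0, r], continuous f} -> exists tau : R -> R,
  [/\ {within `[0, r], continuous tau}, tau 0 = 0 &
      forall t, 0 < t < r -> is_derive t 1 tau (f t)].
Proof.
move=> r0 cf; have intf := continuous_segment_integrable cf.
exists (fun x => \int[mu]_(y in `[0, x]) f y); split.
- exact: parameterized_integral_continuous (ltW r0) intf.
- by rewrite set_itv1 Rintegral_set1.
- move=> t /andP[t0 tr].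
  have ft : {for t, continuous f}.
    apply: (@within_open_continuous _ _ `]0, r[%classic); first exact: interval_open.
      by apply: continuous_subspaceW cf; exact: subset_itv_oo_cc.
    by rewrite /= in_itv/= t0.
  have [d dE] := continuous_FTC1_closed tr intf t0 ft.
  apply: (@DeriveDef _ _ _ _ _ _ _ d).
  by rewrite -derive1E; exact: dE.
Qed.

Lemma segment_integral_affine (f : R -> R) (u v l eps : R) : u <= v ->
  {within `[u, v], continuous f} ->
  (forall t, u <= t <= v -> `|f t - l| <= eps) ->
  `|\int[mu]_(t in `[u, v]) f t - l * (v - u)| <= eps * (v - u).
Proof.
move=> uv cf fl; have intf := continuous_segment_integrable cf.
have cst k : \int[mu]_(t in `[u, v]) k = k * (v - u).
  rewrite Rintegral_cst//; congr (_ * _).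
  have := @lebesgue_measure_itv R `[u, v]; rewrite /= lte_fin => ->.
  case: ltP => [_|vu]; first by [].
  by rewrite (_ : v = u) ?subrr//; apply/eqP; rewrite eq_le uv vu.
have intc k : mu.-integrable `[u, v] (EFin \o (fun=> k)).
  by apply: continuous_segment_integrable => x; exact: cvg_cst.
have le1 : (l - eps) * (v - u) <= \int[mu]_(t in `[u, v]) f t.
  rewrite -cst; apply: le_Rintegral => // t; rewrite /= in_itv/= => /fl.
  by rewrite ler_norml => /andP[? ?]; lra.
have le2 : \int[mu]_(t in `[u, v]) f t <= (l + eps) * (v - u).
  rewrite -cst; apply: le_Rintegral => // t; rewrite /= in_itv/= => /fl.
  by rewrite ler_norml => /andP[? ?]; lra.
move: le1 le2; move: (\int[mu]_(t in `[u, v]) f t) => I; clear=> le1 le2.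
by rewrite ler_norml; apply/andP; split; lra.
Qed.

(* First-exit argument: h cannot leave [h <= rho] if it never reaches rho. *)
Lemma continuous_trap (h : R -> R) (r rho : R) : 0 <= r ->
  {within `[0, r], continuous h} -> h 0 < rho ->
  (forall t, 0 <= t <= r -> (forall x, 0 <= x <= t -> h x <= rho) -> h t < rho) ->
  forall t, 0 <= t <= r -> h t <= rho.
Proof.
move=> r0 /within_continuous_epsP ch h0 trap.
pose S := [set t | 0 <= t <= r /\ forall x, 0 <= x <= t -> h x <= rho].
have S0 : S 0.
  split; first by rewrite lexx.
  by move=> x; rewrite -eq_le => /eqP <-; exact: ltW.
have supS : has_sup S.
  by split; [exists 0|exists r => t [/andP[]]].
pose T := sup S.
have T0 : 0 <= T by apply: ub_le_sup => //; case: supS.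
have Tr : T <= r by apply: ge_sup; [exists 0|move=> t [/andP[]]].
have below x : 0 <= x < T -> h x <= rho.
  move=> /andP[x0 xT]; have [t [_ tS] xt] := sup_gt (proj1 supS) xT.
  by apply: tS; rewrite x0 ltW.
have hT : h T <= rho.
  have [T00|TN] := eqVneq T 0; first by rewrite T00 ltW.
  have Tp : 0 < T by rewrite lt_neqAle eq_sym TN.
  apply/ler_addgt0Pr => e e0.
  have TI : `[0, r]%classic T by rewrite /= in_itv/= T0.
  have [d d0 Hd] := ch T TI e e0.
  pose x := Num.max 0 (T - d).
  have xT : x < T by rewrite /x gt_max Tp ltrBlDr ltrDl.
  have x0 : 0 <= x by rewrite le_max lexx.
  have xI : `[0, r]%classic x.
    by rewrite /= in_itv/= x0 (le_trans (ltW xT)).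
  have := Hd x xI; rewrite ltr0_norm ?subr_lt0// opprB.
  have xd : T - x <= d by rewrite lerBlDr -lerBlDl le_max lexx orbT.
  move=> /(_ xd); rewrite ler_norml => /andP[h1 h2].
  have := below x; rewrite x0 xT => /(_ isT); lra.
have leT x : 0 <= x <= T -> h x <= rho.
  move=> /andP[x0]; rewrite le_eqVlt => /predU1P[->//|xT].
  by apply: below; rewrite x0.
have ST : S T by split=> //; rewrite T0.
suff -> : r = T by exact: leT.
apply/eqP; rewrite eq_le Tr andbT leNgt; apply/negP => Tr'.
have hTs : h T < rho by apply: trap => //; rewrite T0.
have e0 : 0 < rho - h T by rewrite subr_gt0.
have TI : `[0, r]%classic T by rewrite /= in_itv/= T0.
have [d d0 Hd] := ch T TI _ e0.
pose y := Num.min r (T + d).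
have Ty : T < y by rewrite lt_min Tr' ltrDl.
have : y <= T; last by rewrite leNgt Ty.
apply: ub_le_sup; first by case: supS.
split; first by rewrite (le_trans T0 (ltW Ty)) ge_min lexx.
move=> x /andP[x0 xy]; have [xT|Tx] := leP x T; first by apply: leT; rewrite x0.
have xr : x <= r by apply: (le_trans xy); rewrite ge_min lexx.
have xI : `[0, r]%classic x by rewrite /= in_itv/= x0.
have xd : x <= T + d by apply: (le_trans xy); rewrite ge_min lexx orbT.
have := Hd x xI; rewrite gtr0_norm ?subr_gt0// lerBlDl => /(_ xd).
by rewrite ler_norml => /andP[_]; lra.
Qed.

End SegmentIntegrals.

(** * Solutions in the broad star sense *)

Section BroadStar.
Context (R : realType) (g : vectType R) (A : step2_stratification g).
Context (n h : nat) (B : adapted_basis A n h).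
Local Notation b := (structure_constant B).
Local Notation bbW := (bvecW B).
Local Notation cW := (cvecW B).
Local Notation Wt := (pointW R n h).
Local Notation cpt := (char_pt bbW cW).
Local Notation hb := (half_bracket bbW).

Lemma has_derivative_in_continuous (V : normedModType R) (I : set R) (p v : R -> V) :
  (forall t, I t -> has_derivative_in I p t (v t)) -> {within I, continuous p}.
Proof.
move=> dp; apply: within_continuous_eps => t It e e0.
have /has_derivative_in_eps/(_ 1 ltr01)[d d0 Hd] := dp t It.
pose k := 1 + `|v t|; have k0 : 0 < k by rewrite ltr_pwDl.
exists (Num.min d (e / k)) => [|x Ix]; first by rewrite lt_min d0 divr_gt0.
rewrite le_min ler_pdivlMr// => /andP[xd xe]; apply: le_trans xe.
have := ler_normD (p x - p t - (x - t) *: v t) ((x - t) *: v t).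
rewrite subrK normrZ => /le_trans; apply.
by have := Hd x Ix xd; rewrite /k mul1r mulrDr mulr1 lerD2r.
Qed.

Lemma has_derivative_in_interior (r : R) (y : R -> R) (t v : R) : 0 < t < r ->
  (forall e : R, 0 < e -> exists2 d : R, 0 < d & forall s, `[0, r]%classic s ->
    `|s - t| <= d -> `|y s - y t - (s - t) * v| <= e * `|s - t|) ->
  is_derive t 1 y v.
Proof.
move=> /andP[t0 tr] H; apply: is_derive_eps => e e0; have [d d0 Hd] := H e e0.
exists (Num.min d (Num.min t (r - t))) => [|x].
  by rewrite !lt_min d0 t0 subr_gt0.
rewrite !le_min => /and3P[xd]; rewrite 2!(ler_norml (x - t)).
move=> /andP[x1 x2] /andP[x3 x4]; apply: Hd => //.
by rewrite /= in_itv/=; apply/andP; split; lra.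
Qed.

Lemma segment_constant (r : R) (y : R -> R) : {within `[0, r], continuous y} ->
  (forall t, 0 < t < r -> is_derive t 1 y 0) ->
  forall t, 0 <= t <= r -> y t = y 0.
Proof.
move=> cy dy t tr.
have H0 x : 0 < x < r -> `|(0 : R) - 0| <= 0 by rewrite subrr normr0.
have := increment_affine (dg := fun=> 0) cy dy H0 tr.
by rewrite !mul0r subr0 normr_le0 subr_eq0 => /eqP.
Qed.

(** With tau the primitive of phi along p, each coordinate of p minus the one predicted by [char_pt]
    has zero derivative; the vertical prediction is affine in t and tau because [half_bracket] is
    constant along X_j. *)
Lemma integral_curve_char (U : set Wt) (phi : Wt -> R) j (s : R) a (r : R)
    (p : R -> Wt) : open U -> {within U, continuous phi} -> 0 < r ->
  p 0 = a -> (forall t, `[0, r]%classic t -> U (p t)) ->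
  (forall t, `[0, r]%classic t ->
     has_derivative_in `[0, r] p t (s *: Dvec b phi j (p t))) ->
  exists2 tau, char_solution bbW cW phi j s a r tau &
    forall t, 0 <= t <= r -> p t = cpt j s a t (tau t).
Proof.
move=> oU cphi r0 p0 Up dp.
have cp := has_derivative_in_continuous dp.
have cphip := path_comp_continuous oU cphi cp Up.
have [tau [ctau tau0 dtau]] := segment_antiderivative r0 cphip.
have tI t : 0 < t < r -> `[0, r]%classic t.
  by move=> /andP[t0 tr]; rewrite /= in_itv/= !ltW.
have coord1 k : {within `[0, r], continuous (fun t => (p t).1 ord0 k)}.
  move/within_continuous_epsP: cp => cp.
  apply: within_continuous_eps => t It e e0; have [d d0 Hd] := cp t It e e0.
  exists d => // x Ix xt; apply: le_trans (Hd x Ix xt).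
  apply: le_trans (pair_norm1_le _).
  by have := row_coord_le (p x - p t).1 k; rewrite !mxE.
have coord2 i : {within `[0, r], continuous (fun t => (p t).2 ord0 i)}.
  move/within_continuous_epsP: cp => cp.
  apply: within_continuous_eps => t It e e0; have [d d0 Hd] := cp t It e e0.
  exists d => // x Ix xt; apply: le_trans (Hd x Ix xt).
  apply: le_trans (pair_norm2_le _).
  by have := row_coord_le (p x - p t).2 i; rewrite !mxE.
have d1 k t : 0 < t < r -> is_derive t 1 (fun t => (p t).1 ord0 k)
    (s * (delta_mx ord0 j : 'rV[R]_n) ord0 k).
  move=> tr; apply: (has_derivative_in_interior tr) => e e0.
  have /has_derivative_in_eps/(_ e e0)[d d0 Hd] := dp t (tI t tr).
  exists d => // x Ix xt; apply: le_trans (Hd x Ix xt).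
  apply: le_trans (pair_norm1_le _).
  have := row_coord_le (p x - p t - (x - t) *: (s *: Dvec b phi j (p t))).1 k.
  by rewrite DvecE !mxE.
have d2 i t : 0 < t < r -> is_derive t 1 (fun t => (p t).2 ord0 i)
    (s * - (hb j (p t).1 ord0 i + phi (p t) * cW j ord0 i)).
  move=> tr; apply: (has_derivative_in_interior tr) => e e0.
  have /has_derivative_in_eps/(_ e e0)[d d0 Hd] := dp t (tI t tr).
  exists d => // x Ix xt; apply: le_trans (Hd x Ix xt).
  apply: le_trans (pair_norm2_le _).
  have := row_coord_le (p x - p t - (x - t) *: (s *: Dvec b phi j (p t))).2 i.
  by rewrite DvecE !mxE.
have cid : {within `[0, r], continuous (fun x : R => x)}.
  by apply: continuous_subspaceT => z; exact: cvg_id.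
have clin (q : R) : {within `[0, r], continuous (fun x : R => x * q)}.
  by move=> x; apply: cvgM; [exact: cid|exact: cvg_cst].
have E1 t : 0 <= t <= r -> (p t).1 = a.1 + (s * t) *: delta_mx ord0 j.
  move=> tr; apply/rowP => k.
  pose q := s * (delta_mx ord0 j : 'rV[R]_n) ord0 k.
  pose y x := (p x).1 ord0 k - x * q.
  have cy : {within `[0, r], continuous y}.
    by move=> x; apply: cvgB; [exact: coord1|exact: clin].
  have dy x : 0 < x < r -> is_derive x 1 y 0.
    move=> xr; have ? := d1 k x xr; apply: is_derive_eq.
    by rewrite /q /GRing.scale/= mulr0 add0r mulr1 subrr.
  have := segment_constant cy dy tr.
  rewrite /y p0 mul0r subr0 /q !mxE => <-; ring.
have hbE t : 0 <= t <= r -> hb j (p t).1 = hb j a.1.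
  move=> /E1 ->; rewrite half_bracketD half_bracketZ half_bracket_deltaj.
    by rewrite scaler0 addr0.
  exact: bvecW_skew.
have E t : 0 <= t <= r -> p t = cpt j s a t (tau t).
  move=> tr; rewrite [LHS]surjective_pairing E1//; congr (_, _).
  apply/rowP => i.
  pose y x := (p x).2 ord0 i + x * (s * hb j a.1 ord0 i) + tau x * (s * cW j ord0 i).
  have cy : {within `[0, r], continuous y}.
    move=> x; apply: cvgD; first by apply: cvgD; [exact: coord2|exact: clin].
    by apply: cvgM; [exact: ctau|exact: cvg_cst].
  have dy x : 0 < x < r -> is_derive x 1 y 0.
    move=> xr; have ? := d2 i x xr; have ? := dtau x xr.
    apply: is_derive_eq; rewrite /GRing.scale/= hbE.
      by ring.
    by case/andP: xr => ? ?; rewrite !ltW.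
  have := segment_constant cy dy tr.
  rewrite /y p0 mul0r tau0 mul0r !addr0 !mxE => <-; ring.
exists tau => //; split=> // t tr; rewrite -E; first exact: dtau.
by case/andP: tr => ? ?; rewrite !ltW.
Qed.

(** The integral identity is known only along the given curves E, not along every characteristic,
    but [char_curve] asks for one curve only. The sign s = -1 is obtained by running E backwards. *)
Lemma broad_star_local_holder (N : pointG R n h -> R) (U : set Wt) (phi : Wt -> R)
    (omega : Wt -> 'rV[R]_n) : homogeneous_norm b N ->
  open U -> {within U, continuous phi} -> {within U, continuous omega} ->
  broad_star b N U phi omega -> local_holder U phi.
Proof.
move=> hN oU cphi com bst.
apply: (chars_local_holder (@bvecW_skew _ _ _ _ _ B) (@bvecW_basis _ _ _ _ _ B)).
move=> w0 Uw0; have [d1 [d2 [E [/andP[d20 d12] cwU HE]]]] := bst w0 Uw0.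
exists (fun j => omega w0 ord0 j) => eps eps0.
have [rho1 rho10 Hrho1] := omega_near oU com Uw0 eps0.
have [rho2 rho20 Hrho2] := hnorm_dist_small hN w0 d20.
pose rho := Num.min rho1 rho2; have rho0 : 0 < rho by rewrite lt_min rho10.
have rhoP w : `|w - w0| <= rho -> [/\ U w,
    forall j, `|omega w ord0 j - omega w0 ord0 j| <= eps & cwball b N w0 d2 w].
  rewrite le_min => /andP[/Hrho1[Uw ow] /Hrho2 wN]; split=> //.
  exact: subset_closure.
have bU w : `|w - w0| <= rho -> U w by case/rhoP.
have [[M M0 phiM] _] := ball_bound_uc oU cphi bU.
(* K bounds the speed as long as the curve stays in the ball of radius rho. Since r K <= rho / 4, a
   curve issued from the ball of radius rho / 2 never reaches its boundary. *)
pose K := 1 + bb_bound bbW * (`|w0| + rho) + M * c_bound cW.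
have K0 : 0 < K.
  rewrite /K ltr_wpDr ?mulr_ge0 ?c_bound_ge0// ltr_pwDl//.
  by rewrite mulr_ge0 ?bb_bound_ge0// addr_ge0// ltW.
pose r := Num.min d2 (rho / (4 * K)).
have r0 : 0 < r by rewrite lt_min d20 divr_gt0// mulr_gt0.
exists (rho / 2), r, M; split=> //; first by rewrite divr_gt0.
have rho2' w : `|w - w0| <= rho / 2 -> `|w - w0| <= rho.
  by move=> H1; apply: (le_trans H1); lra.
move=> eta eta0; exists phi; split.
- by move=> w _; rewrite subrr normr0 ltW.
- by move=> w /rho2'; exact: phiM.
move=> j s a s1 aw0; have [_ _ acw] := rhoP a (rho2' _ aw0).
have ns : `|s| = 1 by case: s1 => ->; rewrite ?normrN normr1.
have [E0 [Ecw _ dE] incE] := HE j a acw.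
pose p t := E j a (s * t).
have st t : 0 <= t <= r -> `[- d2, d2]%classic (s * t).
  move=> /andP[t0]; rewrite le_min => /andP[td _]; rewrite /= in_itv/=.
  by case: s1 => ->; apply/andP; split; lra.
have p0 : p 0 = a by rewrite /p mulr0.
have Up t : `[0, r]%classic t -> U (p t).
  by rewrite /= in_itv/= => /st/Ecw/cwU.
have dp t : `[0, r]%classic t ->
    has_derivative_in `[0, r] p t (s *: Dvec b phi j (p t)).
  rewrite /= in_itv/= => tr; apply/has_derivative_in_eps => e e0.
  have /has_derivative_in_eps/(_ e e0)[d d0 Hd] := dE _ (st t tr).
  exists d => // x; rewrite /= in_itv/= => xr xt.
  have xs : s * x - s * t = s * (x - t) by ring.
  have := Hd (s * x) (st x xr); rewrite xs normrM ns mul1r => /(_ xt).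
  by rewrite -/(p x) -/(p t) scalerA [(x - t) * s]mulrC.
have [tau sol pE] := integral_curve_char oU cphi r0 p0 Up dp.
have [ctau tau0 dtau] := sol.
have cp := has_derivative_in_continuous dp.
have ch : {within `[0, r], continuous (fun t => `|p t - w0|)}.
  move/within_continuous_epsP: cp => cp.
  apply: within_continuous_eps => t It e e0; have [d d0 Hd] := cp t It e e0.
  exists d => // x Ix xt; apply: le_trans (Hd x Ix xt).
  apply: (le_trans (ler_dist_dist _ _)).
  by rewrite opprB addrA subrK.
have pball t : 0 <= t <= r -> `|p t - w0| <= rho.
  apply: (continuous_trap (ltW r0) ch); first by rewrite p0 (le_lt_trans aw0)//; lra.
  move=> {}t tr trap; have /andP[t0 t1] := tr.
  have sub : `[0, t]%classic `<=` `[0, r].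
    by apply: subset_itvl; rewrite bnd_simp.
  have tauM : `|tau t| <= M * t.
    have c1 := continuous_subspaceW sub ctau.
    have c2 x : 0 < x < t -> is_derive x 1 tau (phi (p x)).
      move=> /andP[x0 xt]; rewrite pE; last by rewrite (ltW x0) (le_trans (ltW xt)).
      by apply: dtau; rewrite x0 (lt_le_trans xt).
    have c3 x : 0 < x < t -> `|phi (p x) - 0| <= M.
      by move=> /andP[x0 xt]; rewrite subr0; apply/phiM/trap; rewrite !ltW.
    have tt : 0 <= t <= t by rewrite t0 lexx.
    by have := increment_affine c1 c2 c3 tt; rewrite tau0 mul0r !subr0.
  rewrite -(subrKA a) (le_lt_trans (ler_normD _ _))//.
  have aB : bb_bound bbW * `|a| <= bb_bound bbW * (`|w0| + rho).
    rewrite ler_wpM2l ?bb_bound_ge0// -(subrK w0 a) addrC.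
    by rewrite (le_trans (ler_normD _ _))// lerD2l rho2'.
  have H1 := char_pt_disp bbW cW j a (tau t) (eq_ind_r (fun x => x <= 1) (lexx 1) ns) t0.
  rewrite -pE// in H1.
  have H2 : t * (bb_bound bbW * `|a|) <= t * (bb_bound bbW * (`|w0| + rho)).
    by rewrite ler_wpM2l.
  have H3 : `|tau t| * c_bound cW <= M * t * c_bound cW.
    by rewrite ler_wpM2r ?c_bound_ge0.
  have H4 : K * t <= rho / 4.
    move: t1; rewrite le_min => /andP[_].
    rewrite ler_pdivlMr ?mulr_gt0//; lra.
  by move: H4 aw0; rewrite /K /=; lra.
apply: (char_solution_curve (ltW eps0) sol) => t tr; rewrite -pE//.
have /andP[t0 t1] := tr.
pose f x := omega (E j a x) ord0 j.
have cE : {within `[- d2, d2], continuous (E j a)} by exact: has_derivative_in_continuous dE.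
have cf : {within `[- d2, d2], continuous f}.
  have cj : {within U, continuous (fun w => omega w ord0 j)}.
    move/within_continuous_epsP: com => com.
    apply: within_continuous_eps => w Uw e e0; have [d d0 Hd] := com w Uw e e0.
    exists d => // x Ix xt; apply: le_trans (Hd x Ix xt).
    by have := row_coord_le (omega x - omega w) j; rewrite !mxE.
  by apply: (path_comp_continuous oU cj cE) => x /Ecw/cwU.
have fl x : 0 <= x <= t -> `|f (s * x) - omega w0 ord0 j| <= eps.
  move=> /andP[x0 xt]; have xr : 0 <= x <= r by rewrite x0 (le_trans xt).
  by have [_ + _] := rhoP _ (pball x xr); apply.
have std : - d2 <= s * t <= d2 by have := st t tr; rewrite /= in_itv.
rewrite (incE _ std) /oriented_integral -/f.
have td : t <= d2 by move: t1; rewrite le_min => /andP[].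
case: s1 => sE; rewrite sE in fl *.
  rewrite !mul1r t0.
  have := @segment_integral_affine R f 0 t (omega w0 ord0 j) eps t0.
  rewrite subr0; apply.
    apply: continuous_subspaceW cf; apply: subset_itv; rewrite bnd_simp ?oppr_le0// (le_trans t0 td)//.
  by move=> x /fl; rewrite mul1r.
rewrite !mulN1r; case: ifPn => nt.
  have -> : t = 0 by apply/eqP; rewrite eq_le t0 andbT -oppr_ge0.
  by rewrite oppr0 set_itv1 Rintegral_set1 !mulr0 subr0 normr0.
have nt0 : - t <= 0 by rewrite oppr_le0.
have := @segment_integral_affine R f (- t) 0 (omega w0 ord0 j) eps nt0.
rewrite sub0r opprK => H.
rewrite mulNr -opprD normrN; apply: H.
  apply: continuous_subspaceW cf; apply: subset_itv; rewrite bnd_simp ?lerN2// (le_trans t0 td)//.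
move=> x /andP[x0 x1]; have := fl (- x); rewrite mulN1r opprK; apply.
by rewrite oppr_ge0 x1 lerNl x0.
Qed.

End BroadStar.

(** * Approximation by functions of class C^1 *)

Section CubeMeasure.
Context (R : realType).
Local Notation T := (measurableTypeR R).
Local Open Scope ereal_scope.

Definition cube n (x : 'I_n -> R) (r : R) : set (n.-tuple T) :=
  [set t | forall i, (`|tnth t i - x i| < r)%R].

Lemma measurable_real_ball (x r : R) :
  measurable (ball x r : set (measurableTypeR R)).
Proof. by rewrite ball_itv; exact: measurable_itv. Qed.

Lemma cube_cons n (x : 'I_n.+1 -> R) (r : R) :
  @tuple_cons R n @^-1` cube x r =
  ball (x ord0) r `*` cube (fun i => x (lift ord0 i)) r.
Proof.
apply/seteqP; split=> [[t ts] /= H|[t ts] /= [Ht Hts] i].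
  split=> [|i]; first by have := H ord0; rewrite /ball/= distrC tnth0.
  by have := H (lift ord0 i); rewrite tnthS.
case: (unliftP ord0 i) => [k ->|->]; first by rewrite tnthS; exact: Hts.
by rewrite tnth0 distrC.
Qed.

Lemma measurable_cube n (x : 'I_n -> R) (r : R) : measurable (cube x r).
Proof.
rewrite (_ : cube x r = \bigcap_(i in [set: 'I_n])
    ((fun t : n.-tuple T => tnth t i) @^-1` ball (x i) r)).
  apply: fin_bigcap_measurable => // i _; rewrite -[X in measurable X]setTI.
  by apply: measurable_tnth => //; exact: measurable_real_ball.
apply/seteqP; split=> [t H i _|t H i]; first by rewrite /= /ball/= distrC.
by have := H i I; rewrite /= /ball/= distrC.
Qed.

Lemma cube_gt0 n (x : 'I_n -> R) (r : R) : (0 < r)%R ->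
  0 < lebesgueN R n (cube x r).
Proof.
move=> r0; elim: n x => [|n IH] x /=.
  by rewrite diracE mem_set ?lte01// => -[].
rewrite /leb_step /pushforward cube_cons product_measure1E//.
- apply: mule_gt0; last exact: IH.
  have r2 : 0 < (r *+ 2)%:E by rewrite lte_fin mulrn_wgt0.
  by apply: lt_le_trans r2 _; rewrite -(lebesgue_measure_ball (x ord0) (ltW r0)).
- exact: measurable_real_ball.
- exact: measurable_cube.
Qed.

Definition box2 a c (w : pointW R a c) (r : R) : set (a.-tuple T * c.-tuple T) :=
  cube (fun i => w.1 ord0 i) r `*` cube (fun i => w.2 ord0 i) r.

Lemma measurable_box2 a c (w : pointW R a c) r : measurable (box2 w r).
Proof. by apply: measurableX; exact: measurable_cube. Qed.

Lemma box2_gt0 a c (w : pointW R a c) (r : R) : (0 < r)%R ->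
  0 < (lebesgueN R a \x lebesgueN R c) (box2 w r).
Proof.
move=> r0; rewrite product_measure1E; try exact: measurable_cube.
by rewrite mule_gt0// cube_gt0.
Qed.

Lemma box2P a c (w : pointW R a c) (r : R) p : (0 < r)%R -> box2 w r p ->
  (`|point_of_tuples p - w| <= r)%R.
Proof.
move=> r0 [H1 H2]; rewrite pair_norm_le; apply/andP; split.
  by apply: row_norm_le (ltW r0) _ => i; rewrite !mxE; exact/ltW/H1.
by apply: row_norm_le (ltW r0) _ => i; rewrite !mxE; exact/ltW/H2.
Qed.

(** An essential bound on a continuous function holds at every interior point, since boxes have
    positive measure. *)
Lemma Linfty_norm_pointwise a c (D : set (pointW R a c)) (f : pointW R a c -> R)
    (w : pointW R a c) (eta : R) : nbhs w D -> {for w, continuous f} ->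
  Linfty_norm D f <= eta%:E -> (`|f w| <= eta)%R.
Proof.
move=> Dw fw fe; rewrite leNgt; apply/negP => fwe.
have e0 : (0 < `|f w| - eta)%R by rewrite subr_gt0.
have /cvgrPdist_lt/(_ _ e0) fw' := fw.
have [r r0 Hr] := nbhs_norm_leP (filterI Dw fw').
have := box2_gt0 w r0; rewrite ltNge => /negP; apply.
have muT : 0 < (lebesgueN R a \x lebesgueN R c) setT.
  apply: lt_le_trans (box2_gt0 w r0) _.
  by apply: le_measure => //; rewrite inE//; exact: measurable_box2.
move: fe; rewrite /Linfty_norm unlock muT => /ess_sup_inf.ess_supP[N [mN N0 HN]].
rewrite -N0; apply: le_measure; rewrite ?inE//; first exact: measurable_box2.
move=> p /(box2P r0) /Hr[Dp fp]; apply: HN => /=.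
rewrite indicE mem_set// mulr1 lee_fin; apply/negP; rewrite -ltNge.
have H := ler_normD (f w - f (point_of_tuples p))%R (f (point_of_tuples p)).
rewrite subrK in H; move: H fp.
move: `|f w|%R `|f (point_of_tuples p)|%R `|f w - f _|%R => x y z; clear; lra.
Qed.

End CubeMeasure.

(** * Strict differentiability of C^1 functions *)

Section StrictDifferentiability.
Context (R : realType) (V : normedModType R).

Lemma is_derive_line (f : V -> R) (v q : V) (t : R) :
  derivable f (q + t *: v) v ->
  is_derive t 1 (fun s : R => f (q + s *: v)) ('D_v f (q + t *: v)).
Proof.
move=> df.
have E : (fun s : R => s^-1 *: (((fun s => f (q + s *: v)) \o shift t) (s *: 1)
    - f (q + t *: v))) =
  (fun s : R => s^-1 *: ((f \o shift (q + t *: v)) (s *: v) - f (q + t *: v))).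
  apply/funext => s /=; congr (_ *: (f _ - _)).
  by rewrite [s *: 1]mulr1 scalerDl addrCA.
by split; [rewrite /derivable E | rewrite /derive E].
Qed.

Lemma line_increment (f : V -> R) (x v : V) (rho l eps : R) :
  (forall y, `|y - x| <= rho -> derivable f y v /\ `|'D_v f y - l| <= eps) ->
  forall q (t : R), `|q - x| <= rho / 2 -> `|t| * `|v| <= rho / 2 ->
  `|f (q + t *: v) - f q - t * l| <= eps * `|t|.
Proof.
move=> H.
have pos q (t : R) : 0 <= t -> (forall s : R, 0 <= s <= t -> `|q + s *: v - x| <= rho) ->
    `|f (q + t *: v) - f q - t * l| <= eps * t.
  move=> t0 Hs.
  have d s : 0 <= s <= t -> is_derive s 1 (fun s : R => f (q + s *: v)) ('D_v f (q + s *: v)).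
    by move=> st; apply: is_derive_line; exact: (H _ (Hs _ st)).1.
  have c : {within `[0, t], continuous (fun s : R => f (q + s *: v))}.
    apply: derivable_within_continuous => s; rewrite in_itv/= => st.
    by have [] := d s st.
  have d' s : 0 < s < t -> is_derive s 1 (fun s : R => f (q + s *: v)) ('D_v f (q + s *: v)).
    by move=> /andP[s0 st]; apply: d; rewrite !ltW.
  have b s : 0 < s < t -> `|'D_v f (q + s *: v) - l| <= eps.
    by move=> /andP[s0 st]; apply: (H _ (Hs _ _)).2; rewrite !ltW.
  have tt : 0 <= t <= t by rewrite t0 lexx.
  by have := increment_affine c d' b tt; rewrite scale0r addr0 mulrC.
move=> q t qx tv; have [t0|t0] := leP 0 t.
  rewrite (ger0_norm t0); apply: pos => // s /andP[s0 st].
  rewrite addrAC (le_trans (ler_normD _ _))// (splitr rho) lerD// normrZ.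
  by apply: le_trans tv; rewrite ler_wpM2r// !ger0_norm.
have qq : q + t *: v + (- t) *: v = q by rewrite scaleNr addrK.
have := pos (q + t *: v) (- t); rewrite qq (ltr0_norm t0) => H1.
have -> : f (q + t *: v) - f q - t * l = - (f q - f (q + t *: v) - - t * l) by ring.
rewrite normrN; apply: H1; first lra.
move=> s /andP[s0 st]; rewrite -(addrA q) -scalerDl addrAC.
rewrite (le_trans (ler_normD _ _))// (splitr rho) lerD// normrZ.
apply: le_trans tv; rewrite ler_wpM2r// (ltr0_norm t0) ler0_norm; lra.
Qed.

(** The directions are followed one after the other; the base point q is left free near x because
    the intermediate points of this path vary. *)
Lemma strict_increment (D : set V) (f : V -> R) (x : V) (I : Type) (r : seq I)
    (v : I -> V) : open D -> D x -> classC1_on D f ->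
  forall eps : R, 0 < eps -> exists2 d : R, 0 < d & forall q (t : I -> R),
    `|q - x| <= d -> (forall i, `|t i| <= d) ->
    `|f (q + \sum_(i <- r) t i *: v i) - f q - \sum_(i <- r) t i * 'D_(v i) f x|
      <= eps * \sum_(i <- r) `|t i|.
Proof.
move=> oD Dx cf; elim: r => [|i r IH] eps eps0.
  by exists 1 => // q t _ _; rewrite !big_nil addr0 !subrr normr0 mulr0 lexx.
have [d d0 Hd] := IH eps eps0.
have [df cdf] := cf (v i).
have /cvgrPdist_le/(_ _ eps0) near_x := within_open_continuous oD cdf Dx.
have [rho rho0 Hrho] := nbhs_norm_leP (filterI (open_nbhs_nbhs (conj oD Dx)) near_x).
have H y : `|y - x| <= rho -> derivable f y (v i) /\ `|'D_(v i) f y - 'D_(v i) f x| <= eps.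
  by move=> /Hrho[Dy yx]; split; [exact: df | rewrite distrC].
have v1 : 1 <= `|v i| + 1 by rewrite lerDr.
have v0 : 0 < `|v i| + 1 by exact: lt_le_trans v1.
pose m := Num.min d rho; have m0 : 0 < m by rewrite lt_min d0.
have md : m <= d by rewrite ge_min lexx.
have mr : m <= rho by rewrite ge_min lexx orbT.
exists (m / 2 / (`|v i| + 1)); first by rewrite !divr_gt0.
have dm s : s <= m / 2 / (`|v i| + 1) -> s <= m / 2.
  move=> /le_trans -> //; rewrite ler_pdivrMr// ler_peMr//; lra.
move=> q t qx tb; rewrite !big_cons.
have tv : `|t i| * `|v i| <= m / 2.
  have := tb i; rewrite ler_pdivlMr//; apply: le_trans.
  by rewrite ler_wpM2l// lerDl.
have inc1 : `|f (q + t i *: v i) - f q - t i * 'D_(v i) f x| <= eps * `|t i|.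
  apply: (line_increment H); first by apply: le_trans (dm _ qx) _; lra.
  by apply: (le_trans tv); lra.
have inc2 := Hd (q + t i *: v i) t.
rewrite addrA mulrDr.
rewrite (_ : _ - _ = (f (q + t i *: v i + \sum_(j <- r) t j *: v j)
    - f (q + t i *: v i) - \sum_(j <- r) t j * 'D_(v j) f x)
  + (f (q + t i *: v i) - f q - t i * 'D_(v i) f x)); last by ring.
rewrite (le_trans (ler_normD _ _))// [leRHS]addrC lerD//.
  apply: inc2 => [|k]; last by have := dm _ (tb k); lra.
  rewrite addrAC (le_trans (ler_normD _ _))// normrZ.
  by have := dm _ qx; lra.
Qed.

End StrictDifferentiability.

Section StrictDifferentiabilityCoordinates.
Context (R : realType) (a h : nat).
Local Notation pt := ('rV[R]_a * 'rV[R]_h)%type.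
Implicit Types (f : pt -> R) (w u x : pt).

Definition dir (i : 'I_a + 'I_h) : pt :=
  match i with inl k => dx R h k | inr k => dy R a k end.

Definition coordinate w (i : 'I_a + 'I_h) : R :=
  match i with inl k => w.1 ord0 k | inr k => w.2 ord0 k end.

Lemma sum_dir w : \sum_i coordinate w i *: dir i = w.
Proof.
rewrite big_sumType/=; case: w => x y /=.
have fstE : forall (I : Type) (r : seq I) (F : I -> pt),
    (\sum_(i <- r) F i) = (\sum_(i <- r) (F i).1, \sum_(i <- r) (F i).2).
  by move=> I r F; elim: r => [|i r IH]; rewrite ?big_nil// !big_cons IH.
rewrite !fstE /=; congr pair.
  rewrite /= [X in _ + X]big1 ?addr0 -?row_sum_delta// => i _.
  by rewrite scaler0.
rewrite /= [X in X + _]big1 ?add0r -?row_sum_delta// => i _.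
by rewrite scaler0.
Qed.

Lemma coordinate_le w i : `|coordinate w i| <= `|w|.
Proof.
case: i => k /=; apply: le_trans (row_coord_le _ k) _.
  exact: pair_norm1_le.
exact: pair_norm2_le.
Qed.

Definition grad_along f x u : R := \sum_i coordinate u i * 'D_(dir i) f x.

Lemma grad_alongZ f x (s : R) u : grad_along f x (s *: u) = s * grad_along f x u.
Proof.
rewrite /grad_along mulr_sumr; apply: eq_bigr => i _; rewrite mulrA.
by congr (_ * _); case: i => k; rewrite /= mxE.
Qed.

Lemma grad_alongB f x u v :
  grad_along f x (u - v) = grad_along f x u - grad_along f x v.
Proof.
rewrite /grad_along -sumrB; apply: eq_bigr => i _; rewrite -mulrBl.
by congr (_ * _); case: i => k; rewrite /= !mxE.
Qed.

Lemma grad_along_le f x u :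
  `|grad_along f x u| <= (\sum_i `|'D_(dir i) f x|) * `|u|.
Proof.
rewrite (le_trans (ler_norm_sum _ _ _))// mulr_suml; apply: ler_sum => i _.
by rewrite normrM mulrC ler_wpM2l// coordinate_le.
Qed.

Lemma strict_differentiable (D : set pt) f x : open D -> D x ->
  classC1_on D f -> forall eps : R, 0 < eps -> exists2 d : R, 0 < d &
  forall q u, `|q - x| <= d -> `|u| <= d ->
    `|f (q + u) - f q - grad_along f x u| <= eps * `|u|.
Proof.
move=> oD Dx cf eps eps0.
pose c : R := (#|{: 'I_a + 'I_h}|%:R + 1); have c0 : 0 < c by rewrite ltr_wpDl.
have ec : 0 < eps / c by rewrite divr_gt0.
have [d d0 Hd] := strict_increment (index_enum _) dir oD Dx cf ec.
exists d => // q u qx ud.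
have ui i : `|coordinate u i| <= d by exact: le_trans (coordinate_le _ _) ud.
have := Hd q _ qx ui; rewrite sum_dir => H; apply: le_trans H _.
rewrite -mulrA ler_wpM2l ?(ltW eps0)// ler_pdivrMl// mulrC.
rewrite (le_trans (ler_sum _ (fun i _ => coordinate_le u i)))//.
by rewrite sumr_const -mulr_natr ler_wpM2l// /c lerDl.
Qed.

Lemma classC1_continuous (D : set pt) f x : open D -> D x -> classC1_on D f ->
  {for x, continuous f}.
Proof.
move=> oD Dx cf; have [d d0 Hd] := strict_differentiable oD Dx cf ltr01.
pose M := \sum_i `|'D_(dir i) f x| + 1.
have M0 : 0 < M by rewrite ltr_wpDl// sumr_ge0.
apply/cvgrPdist_le => e e0.
have m0 : 0 < Num.min d (e / M) by rewrite lt_min d0 divr_gt0.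
apply: filterS (nbhs_norm_le x m0) => q /=; rewrite le_min => /andP[qd qe].
rewrite distrC; have := Hd x (q - x); rewrite subrr normr0 (ltW d0) => /(_ isT qd).
rewrite (addrC x) subrK mul1r => H.
have H2 := grad_along_le f x (q - x).
rewrite -(subrK (grad_along f x (q - x)) (f q - f x)) (le_trans (ler_normD _ _))//.
move: qe; rewrite ler_pdivlMr// mulrDr mulr1 => qe.
apply: le_trans (lerD H H2) _; rewrite addrC mulrC; exact: qe.
Qed.

Lemma derive_grad (D : set pt) f x u : open D -> D x -> classC1_on D f ->
  'D_u f x = grad_along f x u.
Proof.
move=> oD Dx cf; apply/cvg_lim => //; apply/cvgrPdist_le => e e0.
have u1 : 0 < `|u| + 1 by rewrite ltr_wpDl.
have [d d0 Hd] := strict_differentiable oD Dx cf (divr_gt0 e0 u1).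
have m0 : 0 < d / (`|u| + 1) by rewrite divr_gt0.
near=> t.
have t0 : t != 0 by near: t; exact: nbhs_dnbhs_neq.
have td : `|t *: u| <= d.
  rewrite normrZ; have : `|t| <= d / (`|u| + 1).
    near: t; apply: dnbhs0_le => //.
  rewrite ler_pdivlMr//; apply: le_trans; rewrite ler_wpM2l// lerDl//.
have := Hd x (t *: u); rewrite subrr normr0 (ltW d0) => /(_ isT td).
rewrite grad_alongZ normrZ => H; rewrite distrC /= [t *: u + x]addrC.
have tn0 : 0 < `|t| by rewrite normr_gt0.
rewrite -(ler_pM2l tn0) -normrM mulrBr mulrA divff// mul1r.
rewrite (le_trans H)// mulrCA ler_wpM2l// mulrAC ler_pdivrMr//.
by rewrite ler_wpM2l ?(ltW e0)// lerDl.
Unshelve. all: end_near.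
Qed.

Lemma chain_rule (D : set pt) f (I : set R) (p : R -> pt) (t : R) v :
  open D -> D (p t) -> classC1_on D f -> has_derivative_in I p t v ->
  has_derivative_in I (f \o p) t ('D_v f (p t)).
Proof.
move=> oD Dx cf /has_derivative_in_eps dp; apply/has_derivative_in_eps => e e0.
pose K := \sum_i `|'D_(dir i) f (p t)| + 1.
have K0 : 0 < K by rewrite ltr_wpDl// sumr_ge0.
pose L := `|v| + 1; have L0 : 0 < L by rewrite ltr_wpDl.
have e2 : 0 < e / 2 by rewrite divr_gt0.
have [d1 d10 H1] := strict_differentiable oD Dx cf (divr_gt0 e2 L0).
have m0 : 0 < Num.min 1 (e / 2 / K) by rewrite lt_min ltr01 divr_gt0.
have [d2 d20 H2] := dp _ m0.
exists (Num.min d2 (d1 / L)); first by rewrite lt_min d20 divr_gt0.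
move=> s Is; rewrite le_min => /andP[st2 st1].
have {}H2 := H2 s Is st2; set u := p s - p t in H2.
have [H21 H2K] : `|u - (s - t) *: v| <= `|s - t| /\ `|u - (s - t) *: v| <= e / 2 / K * `|s - t|.
  split; apply: le_trans H2 _; last by rewrite ler_wpM2r// ge_min lexx orbT.
  by rewrite -[leRHS]mul1r ler_wpM2r// ge_min lexx.
have uL : `|u| <= L * `|s - t|.
  rewrite -(subrK ((s - t) *: v) u) (le_trans (ler_normD _ _))//.
  by rewrite /L mulrDl mul1r addrC lerD// normrZ mulrC.
have ud : `|u| <= d1 by apply: le_trans uL _; rewrite mulrC -ler_pdivlMr.
have := H1 (p t) u; rewrite subrr normr0 (ltW d10) => /(_ isT ud).
rewrite {1}/u (addrC (p t)) subrK => H3.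
have -> : (s - t) *: 'D_v f (p t) = grad_along f (p t) ((s - t) *: v).
  by rewrite (derive_grad v oD Dx cf) grad_alongZ.
rewrite /=.
rewrite -(subrK (grad_along f (p t) u) (f (p s) - f (p t))) -addrA.
rewrite (le_trans (ler_normD _ _))// -grad_alongB.
rewrite [in leRHS](splitr e) mulrDl lerD//.
  by apply: le_trans H3 _; rewrite -mulrA ler_wpM2l ?(ltW e2)// ler_pdivrMl.
apply: le_trans (grad_along_le _ _ _) _.
apply: le_trans (_ : K * (e / 2 / K * `|s - t|) <= _).
  apply: ler_pM => //; first exact: sumr_ge0.
  by rewrite lerDl.
by rewrite mulrA mulrCA divff ?gt_eqF// mulr1.
Qed.

End StrictDifferentiabilityCoordinates.

Section Approximable.
Context (R : realType) (g : vectType R) (A : step2_stratification g).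
Context (n h : nat) (B : adapted_basis A n h).
Local Notation b := (structure_constant B).
Local Notation bbW := (bvecW B).
Local Notation cW := (cvecW B).
Local Notation Wt := (pointW R n h).
Local Notation cpt := (char_pt bbW cW).

Lemma coordinate_continuous (w : Wt) i :
  {for w, continuous (fun x : Wt => coordinate x i)}.
Proof.
apply/cvgrPdist_le => e e0; apply: filterS (nbhs_norm_le w e0) => q qw.
apply: le_trans qw; rewrite distrC.
have -> : coordinate q i - coordinate w i = coordinate (q - w) i.
  by case: i => k; rewrite /= !mxE.
exact: coordinate_le.
Qed.

Lemma Dvec_coordinate_continuous (f : Wt -> R) j i (w : Wt) :
  {for w, continuous f} ->
  {for w, continuous (fun x => coordinate (Dvec b f j x) i)}.
Proof.
move=> cf; case: i => i.
  by rewrite /prop_for /continuous_at /=; exact: cvg_cst.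
rewrite /prop_for /continuous_at /=.
under eq_cvg do rewrite mxE; rewrite mxE.
apply: cvgN; apply: cvgD; first exact: cvgMr.
apply: cvgMr; apply: cvg_big => [|k _]; first exact: add_continuous.
by apply: cvgMl; exact: (coordinate_continuous (i := inl k)).
Qed.

Lemma derive_Dvec_continuous (D : set Wt) (f : Wt -> R) j (w : Wt) :
  open D -> D w -> classC1_on D f ->
  {for w, continuous (fun x => 'D_(Dvec b f j x) f x)}.
Proof.
move=> oD Dw cf.
rewrite /prop_for /continuous_at (derive_grad _ oD Dw cf).
have c : grad_along f x (Dvec b f j x) @[x --> w] -->
    grad_along f w (Dvec b f j w).
  apply: cvg_big => [|i _]; first exact: add_continuous.
  apply: cvgM; last by have [_ c] := cf (dir R i); exact: (within_open_continuous oD c Dw).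
  exact/Dvec_coordinate_continuous/(classC1_continuous oD Dw cf).
apply: cvg_trans c; apply: near_eq_cvg.
apply: filterS (open_nbhs_nbhs (conj oD Dw)) => x Dx.
by rewrite (derive_grad _ oD Dx cf).
Qed.

Lemma cvg0_ereal_near (F : R -> \bar R) (eta : R) : 0 < eta ->
  F e @[e --> 0^'+] --> 0%E -> \forall e \near 0^'+, (F e <= eta%:E)%E.
Proof.
move=> eta0 F0; have : nbhs (0%E : \bar R) [set y | (y < eta%:E)%E].
  by apply: open_ereal_lt' => //; rewrite lte_fin.
by move=> /F0 near0; near=> e; apply: ltW; near: e.
Unshelve. all: end_near.
Qed.

(** Along its own characteristics a C^1 approximation f has derivative D^f_j f by the chain rule,
    and this is uniformly close to omega_j. The bound M + 1 holds for every approximation used, so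
    that r does not depend on it. *)
Lemma approximable_local_holder (N : pointG R n h -> R) (U : set Wt)
    (phi : Wt -> R) (omega : Wt -> 'rV[R]_n) : homogeneous_norm b N ->
  open U -> {within U, continuous phi} -> {within U, continuous omega} ->
  approximable b N U phi omega -> local_holder U phi.
Proof.
move=> hN oU cphi com apx.
apply: (chars_local_holder (@bvecW_skew _ _ _ _ _ B) (@bvecW_basis _ _ _ _ _ B)).
move=> w0 Uw0; have [delta [phie [delta0 wU C1 Lphi LD]]] := apx w0 Uw0.
exists (fun j => omega w0 ord0 j) => eps eps0.
have eps2 : 0 < eps / 2 by rewrite divr_gt0.
have [rho1 rho10 Hrho1] := omega_near oU com Uw0 eps2.
have [rho2 rho20 Hrho2] := hnorm_dist_small hN w0 delta0.
pose rho := Num.min rho1 rho2; have rho0 : 0 < rho by rewrite lt_min rho10.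
have rhoP w : `|w - w0| <= rho -> [/\ U w,
    forall j, `|omega w ord0 j - omega w0 ord0 j| <= eps / 2 & wball b N w0 delta w].
  by rewrite le_min => /andP[/Hrho1[Uw ow] /Hrho2 wN].
have bU w : `|w - w0| <= rho -> U w by case/rhoP.
have [[M M0 phiM] _] := ball_bound_uc oU cphi bU.
pose D : set Wt := [set w | `|w - w0| < rho].
have oD : open D.
  rewrite (_ : D = ball w0 rho); first exact: ball_open.
  by apply/seteqP; split=> x /=; rewrite -ball_normE /= distrC.
have DW : D `<=` wball b N w0 delta by move=> x /ltW/rhoP[].
have r20 : 0 < rho / 2 by rewrite divr_gt0.
have M10 : 0 <= M + 1 by rewrite addr_ge0.
have [r r0 Hr] := char_solution_exists bbW cW w0 r20 M10.
have r2D w : `|w - w0| <= rho / 2 -> D w by move=> H; rewrite /D /=; lra.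
have r4 w : `|w - w0| <= rho / 2 / 2 -> `|w - w0| <= rho / 2.
  by move=> H; apply: (le_trans H); lra.
exists (rho / 2 / 2), r, (M + 1); split=> //; first by rewrite !divr_gt0.
(* The three bounds serve, in order, the closeness to phi, the bound M + 1 and the slopes. *)
move=> eta eta0; pose eta' := Num.min eta (Num.min 1 (eps / 2)).
have eta'0 : 0 < eta' by rewrite !lt_min eta0 ltr01.
have [e [e01 Le LDe]] : exists e : R, [/\ 0 < e < 1,
    (Linfty_norm (wball b N w0 delta) (fun w => phie e w - phi w)%R <= eta'%:E)%E &
    forall j, (Linfty_norm (wball b N w0 delta)
      (fun w => 'D_(Dvec b (phie e) j w) (phie e) w - omega w ord0 j)%R <= eta'%:E)%E].
  near (0 : R)^'+ => e; exists e; split.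
  - by apply/andP; split; near: e; [exact: nbhs_right_gt | exact: nbhs_right_lt].
  - by near: e; exact: cvg0_ereal_near.
  - near: e; apply: filter_forall => j.
    exact: (cvg0_ereal_near eta'0 (LD j)).
pose f := phie e; have C1f : classC1_on D f.
  by move=> v; have [df cdf] := C1 e e01 v; split=> [x /DW/df//|];
    exact: continuous_subspaceW cdf.
have cf : {within D, continuous f}.
  by apply: continuous_in_subspaceT => x /set_mem Dx; exact: classC1_continuous Dx C1f.
have near_wball w : D w -> nbhs w (wball b N w0 delta).
  by move=> Dw; apply: filterS DW (open_nbhs_nbhs (conj oD Dw)).
have fphi w : D w -> `|f w - phi w| <= eta'.
  move=> Dw; apply: (@Linfty_norm_pointwise _ _ _ (wball b N w0 delta)
    (fun w => f w - phi w) w eta' (near_wball w Dw) _ Le).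
  apply: cvgB; first exact: classC1_continuous Dw C1f.
  exact: within_open_continuous (bU _ (ltW Dw)).
have Dom j w : D w -> `|'D_(Dvec b f j w) f w - omega w ord0 j| <= eta'.
  move=> Dw; apply: (@Linfty_norm_pointwise _ _ _ (wball b N w0 delta)
    (fun w => 'D_(Dvec b f j w) f w - omega w ord0 j) w eta' (near_wball w Dw) _ (LDe j)).
  apply: cvgB; first exact: derive_Dvec_continuous Dw C1f.
  have := within_open_continuous oU com (bU _ (ltW Dw)).
  by move=> c; exact: (continuous_comp c (@coord_continuous _ _ _ ord0 j (omega w))).
have r2P w : `|w - w0| <= rho / 2 -> D w by exact: r2D.
have [_ fuc] := ball_bound_uc oD cf r2P.
have fM w : `|w - w0| <= rho / 2 -> `|f w| <= M + 1.
  move=> wr; have Dw := r2D w wr.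
  rewrite -(subrK (phi w) (f w)) (le_trans (ler_normD _ _))// addrC lerD//.
    by apply: phiM; exact: ltW.
  by apply: le_trans (fphi w Dw) _; rewrite /eta' !ge_min lexx orbT.
exists f; split.
- move=> w /r4/r2D Dw; apply: le_trans (fphi w Dw) _.
  by rewrite /eta' ge_min lexx.
- by move=> w /r4; exact: fM.
move=> j s w s1 ww0; have [tau sol tb] := Hr f fuc fM j s w s1 ww0.
have ns : `|s| = 1 by case: s1 => ->; rewrite ?normrN normr1.
apply: (char_solution_curve (ltW eps0) sol).
have [ctau tau0 dtau] := sol.
have cfp : {within `[0, r], continuous (fun t => f (cpt j s w t (tau t)))}.
  apply: (path_comp_continuous oD cf (char_path_continuous s1 ctau)).
  by move=> t; rewrite /= in_itv/= => /tb/r2D.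
have df t : 0 < t < r -> is_derive t 1 (fun t => f (cpt j s w t (tau t)))
    (s * 'D_(Dvec b f j (cpt j s w t (tau t))) f (cpt j s w t (tau t))).
  move=> tr; have /andP[t0 t1] := tr; have Dt : D (cpt j s w t (tau t)).
    by apply/r2D/tb; rewrite !ltW.
  apply: (has_derivative_in_interior tr); apply/has_derivative_in_eps.
  have ns1 : `|s| <= 1 by rewrite ns.
  have dc : has_derivative_in `[0, r]%classic (fun x => cpt j s w x (tau x)) t
      (s *: (delta_mx ord0 j, - (half_bracket bbW j w.1 + f (cpt j s w t (tau t)) *: cW j))).
    exact: char_has_derivative ns1 (dtau t tr).
  have := @chain_rule _ _ _ D f _ (fun x => cpt j s w x (tau x)) t _ oD Dt C1f dc.
  by rewrite !(derive_grad _ oD Dt C1f) grad_alongZ DvecE half_bracket_char.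
have := increment_affine cfp df (l := s * omega w0 ord0 j) (eps := eps).
rewrite tau0 char_pt0; apply => t /andP[t0 t1].
have tr : 0 <= t <= r by rewrite !ltW.
have Dt := r2D _ (tb t tr); have [_ /(_ j) o _] := rhoP _ (ltW Dt).
rewrite -mulrBr normrM ns mul1r.
rewrite -(subrK (omega (cpt j s w t (tau t)) ord0 j) ('D_(_) _ _)) -addrA.
rewrite (le_trans (ler_normD _ _))// (splitr eps) lerD//.
by apply: le_trans (Dom j _ Dt) _; rewrite /eta' !ge_min lexx !orbT.
Unshelve. all: end_near.
Qed.

End Approximable.

(** * Test functions *)

Section SmoothFunctions.
Context (R : realType).

(** Unlike in [classC], continuity is recorded at every order: derivability in all directions does
    not imply it, and the induction for products passes to lower orders. *)
Fixpoint smoothN (V : normedModType R) (k : nat) (f : V -> R) : Prop :=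
  continuous f /\
  if k is k'.+1 then
    forall v, (forall x, derivable f x v) /\ smoothN k' (fun x => 'D_v f x)
  else True.

Definition smooth (V : normedModType R) (f : V -> R) : Prop :=
  forall k, smoothN k f.

Section Closure.
Context (V : normedModType R).
Implicit Types (f g : V -> R) (k : nat).

Lemma smoothN_classC k f : smoothN k f -> classC k f.
Proof.
elim: k f => [|k IH] f [cf] //= H v; have [df Hv] := H v.
by split=> //; exact: IH.
Qed.

Lemma smoothN_S k f : smoothN k.+1 f -> smoothN k f.
Proof.
elim: k f => [|k IH] f [cf H]; split=> // v; have [df Hv] := H v.
by split=> //; exact: IH.
Qed.

Lemma smooth_derivable f x v : smooth f -> derivable f x v.
Proof. by move=> /(_ 1%N)[_ /(_ v)[]]. Qed.

Lemma smooth_derive f v : smooth f -> smooth (fun x => 'D_v f x).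
Proof. by move=> sf k; have [_ /(_ v)[]] := sf k.+1. Qed.

Lemma smooth_continuous f : smooth f -> continuous f.
Proof. by move=> /(_ 0%N)[]. Qed.

Lemma smoothN_eq k f g : f = g -> smoothN k f -> smoothN k g.
Proof. by move=> ->. Qed.

Lemma smoothN_cst k (c : R) : smoothN k (fun _ : V => c).
Proof.
elim: k c => [|k IH] c; split=> //; try exact: cst_continuous.
move=> v; split=> [x|]; first exact: derivable_cst.
by apply: smoothN_eq (IH 0); apply/funext => x; rewrite derive_cst.
Qed.

Lemma smoothND k f g : smoothN k f -> smoothN k g ->
  smoothN k (fun x => f x + g x).
Proof.
elim: k f g => [|k IH] f g [cf Hf] [cg Hg].
  by split=> // x; apply: cvgD; [exact: cf | exact: cg].
split=> [x|v]; first by apply: cvgD; [exact: cf | exact: cg].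
have [df sf] := Hf v; have [dg sg] := Hg v; split=> [x|].
  exact: derivableD.
by apply: smoothN_eq (IH _ _ sf sg); apply/funext => x; rewrite -deriveD.
Qed.

Lemma smoothNM k f g : smoothN k f -> smoothN k g ->
  smoothN k (fun x => f x * g x).
Proof.
elim: k f g => [|k IH] f g.
  move=> [cf Hf] [cg Hg].
  by split=> // x; apply: cvgM; [exact: cf | exact: cg].
move=> sf sg; have [cf Hf] := sf; have [cg Hg] := sg.
split=> [x|v]; first by apply: cvgM; [exact: cf | exact: cg].
have [df sf'] := Hf v; have [dg sg'] := Hg v; split=> [x|].
  exact: derivableM.
have s1 := IH _ _ (smoothN_S sf) sg'; have s2 := IH _ _ (smoothN_S sg) sf'.
by apply: smoothN_eq (smoothND s1 s2); apply/funext => x; rewrite -deriveM.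
Qed.

Lemma smoothD f g : smooth f -> smooth g -> smooth (fun x => f x + g x).
Proof. by move=> sf sg k; exact: smoothND. Qed.

Lemma smoothM f g : smooth f -> smooth g -> smooth (fun x => f x * g x).
Proof. by move=> sf sg k; exact: smoothNM. Qed.

Lemma smooth_cst (c : R) : smooth (fun _ : V => c).
Proof. by move=> k; exact: smoothN_cst. Qed.

Lemma smoothZ (c : R) f : smooth f -> smooth (fun x => c * f x).
Proof. by move=> sf; apply: smoothM => //; exact: smooth_cst. Qed.

Lemma smoothB f g : smooth f -> smooth g -> smooth (fun x => f x - g x).
Proof.
move=> sf sg; have := smoothD sf (smoothZ (-1) sg).
by under [X in smooth X]eq_fun do rewrite mulN1r.
Qed.

Lemma smooth_prod (I : Type) (r : seq I) (P : pred I) (F : I -> V -> R) :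
  (forall i, P i -> smooth (F i)) -> smooth (fun x => \prod_(i <- r | P i) F i x).
Proof.
move=> sF; elim: r => [|i r IH].
  by under [X in smooth X]eq_fun do rewrite big_nil; exact: smooth_cst.
under [X in smooth X]eq_fun do rewrite big_cons.
by case Pi: (P i) => //; apply: smoothM => //; exact: sF.
Qed.

Lemma smooth_functional (l : V -> R) : continuous l ->
  (forall x (t : R) v, l (t *: v + x) = t * l v + l x) -> smooth l.
Proof.
move=> cl ll [|k]; split=> // v.
have dl x : is_derive x v l (l v).
  have E : (fun t : R => t^-1 *: ((l \o shift x) (t *: v) - l x)) @ 0^' --> l v.
    apply: (@cvg_trans _ (cst (l v) @ (0 : R)^')); last exact: cvg_cst.
    apply: near_eq_cvg; near=> t; rewrite /= ll addrK /GRing.scale /= mulrA mulVf ?mul1r//.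
    by near: t; exact: nbhs_dnbhs_neq.
  by split; [apply/cvg_ex; exists (l v) | apply/cvg_lim].
split=> [x|]; first by have [] := dl x.
apply: smoothN_eq (smoothN_cst k (l v)); apply/funext => x.
by rewrite derive_val.
Unshelve. all: end_near.
Qed.

End Closure.

(** The tower of successive derivatives is part of the data, so primitives and derivatives are
    handled by shifting it. *)
Definition smooth1 (f : R -> R) : Prop := exists d : nat -> R -> R,
  d 0%N = f /\ forall k (t : R), is_derive t 1 (d k) (d k.+1 t).

Lemma smooth_smooth1 (f : R^o -> R) : smooth f -> smooth1 f.
Proof.
move=> sf; pose d k := iter k (fun (g : R^o -> R) x => 'D_(1 : R^o) g x) f.
exists d; split=> // k t; have sd : smooth (d k).
  by elim: k => [|k IH] //=; exact: smooth_derive.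
have D := @smooth_derivable _ _ t (1 : R^o) sd.
exact: (DeriveDef D).
Qed.

Lemma is_derive_dir (V : normedModType R) (f : V -> R) (x v : V) (l : R) :
  is_derive (0 : R) 1 (fun s : R => f (x + s *: v)) l -> is_derive x v f l.
Proof.
have E : (fun s : R => s^-1 *: (((fun s => f (x + s *: v)) \o shift (0 : R)) (s *: 1)
    - f (x + 0 *: v))) = (fun s : R => s^-1 *: ((f \o shift x) (s *: v) - f x)).
  apply/funext => s /=; rewrite scale0r addr0 addr0.
  by congr (_ *: (f _ - _)); rewrite [s *: 1]mulr1 addrC.
by move=> [D <-]; split; [move: D; rewrite /derivable E | rewrite /derive E].
Qed.

Lemma is_derive_dirP (V : normedModType R) (f : V -> R) (x v : V) (l : R) :
  is_derive x v f l -> is_derive (0 : R) 1 (fun s : R => f (x + s *: v)) l.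
Proof.
move=> [D <-]; have := @is_derive_line R V f v x 0.
by rewrite scale0r addr0; apply.
Qed.

Lemma is_derive_comp1 (V : normedModType R) (phi : R -> R) (f : V -> R) (x v : V)
    (l m : R) : is_derive x v f l -> is_derive (f x) 1 phi m ->
  is_derive x v (phi \o f) (m * l).
Proof.
move=> /is_derive_dirP df dphi; apply: is_derive_dir.
have dphi' : is_derive (f (x + 0 *: v)) 1 phi m by rewrite scale0r addr0.
exact: (is_derive1_comp dphi' df).
Qed.

Lemma smooth_comp (V : normedModType R) (phi : R -> R) (f : V -> R) :
  smooth1 phi -> smooth f -> smooth (fun x => phi (f x)).
Proof.
move=> + sf k; elim: k phi => [|k IH] phi [d [d0 dd]].
  split=> // x; apply: continuous_comp; first exact: smooth_continuous sf x.
  apply/differentiable_continuous/derivable1_diffP.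
  by have [] := dd 0%N (f x); rewrite d0.
split=> [x|v].
  apply: continuous_comp; first exact: smooth_continuous sf x.
  apply/differentiable_continuous/derivable1_diffP.
  by have [] := dd 0%N (f x); rewrite d0.
have D x : is_derive x v (fun x => phi (f x)) (d 1%N (f x) * 'D_v f x).
  apply: (is_derive_comp1 (phi := phi)); last by rewrite -d0.
  by apply: DeriveDef => //; exact: smooth_derivable.
split=> [x|]; first by have [] := D x.
apply: smoothN_eq (smoothNM (IH (d 1%N) _) (smooth_derive v sf k)).
  by apply/funext => x; have [_ ->] := D x.
by exists (fun k => d k.+1).
Qed.

End SmoothFunctions.

Section RealSmoothFunctions.
Context (R : realType).
Local Notation mu := (@lebesgue_measure R).

Lemma smooth1_continuous (f : R -> R) : smooth1 f -> continuous f.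
Proof.
move=> [d [<- dd]] x; apply/differentiable_continuous/derivable1_diffP.
by have [] := dd 0%N x.
Qed.

Lemma smooth1_primitive (f F : R -> R) : smooth1 f ->
  (forall t : R, is_derive t 1 F (f t)) -> smooth1 F.
Proof.
move=> [d [d0 dd]] dF; exists (fun k => if k is k'.+1 then d k' else F).
by split=> // -[|k] t //=; rewrite d0.
Qed.

Lemma smooth1_derivative (f F : R -> R) : smooth1 F ->
  (forall t : R, is_derive t 1 F (f t)) -> smooth1 f.
Proof.
move=> [d [d0 dd]] dF; exists (fun k => d k.+1); split=> //.
apply/funext => t; have [_ <-] := dd 0%N t; rewrite d0.
by have [_ <-] := dF t.
Qed.

Lemma smooth_id : smooth (fun x : R^o => x : R).
Proof. by apply: smooth_functional => // x; exact: cvg_id. Qed.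

Lemma smooth1_smooth (f : R -> R) : smooth1 f -> smooth (f : R^o -> R).
Proof. by move=> sf; exact: (smooth_comp sf smooth_id). Qed.

Lemma is_derive_affine (f : R -> R) (a b t l : R) :
  is_derive (a * t + b) 1 f l -> is_derive t 1 (fun t : R => f (a * t + b)) (a * l).
Proof.
move=> df; rewrite mulrC.
have da : is_derive t 1 (fun t : R => a * t + b) a.
  by apply: is_derive_eq; rewrite /GRing.scale /=; ring.
exact: (@is_derive1_comp _ f (fun t : R => a * t + b) t l a df da).
Qed.

Lemma smooth1_affine (f : R -> R) (a b : R) : smooth1 f ->
  smooth1 (fun t : R => f (a * t + b)).
Proof.
move=> sf; apply: smooth_smooth1; apply: (smooth_comp sf).
by apply: smoothD; [apply: smoothZ; exact: smooth_id | exact: smooth_cst].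
Qed.

Lemma is_derive_local (f g : R -> R) (t l d : R) : 0 < d ->
  (forall s : R, `|s - t| <= d -> f s = g s) -> is_derive t 1 g l ->
  is_derive t 1 f l.
Proof.
move=> d0 fg /is_derive_epsP dg; apply: is_derive_eps => e e0.
have [d' d'0 H] := dg e e0; exists (Num.min d d'); first by rewrite lt_min d0.
move=> s; rewrite le_min => /andP[sd sd'].
by rewrite !fg ?subrr ?normr0 ?(ltW d0)//; exact: H.
Qed.

Lemma smoothN_real k (f f' : R^o -> R) :
  (forall x : R, is_derive x 1 f (f' x)) -> smoothN k f' -> smoothN k.+1 f.
Proof.
move=> df sf'; split=> [x|v].
  by apply/differentiable_continuous/derivable1_diffP; have [] := df x.
have D (x : R) : is_derive (x : R^o) v f (v * f' x).
  apply: is_derive_dir.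
  have E : (fun s : R => f (x + s *: v)) = fun s : R => f (v * s + x).
    by apply/funext => s; rewrite addrC mulrC.
  by rewrite E; apply: is_derive_affine; rewrite mulr0 add0r.
split=> [x|]; first by have [] := D x.
have H := @smoothNM _ R^o k _ _ (@smoothN_cst _ R^o k (v : R)) sf'.
rewrite (_ : (fun x => 'D_v f x) = (fun x : R^o => (v : R) * f' x)) //.
by apply/funext => x; have [_ ->] := D x.
Qed.

(** The functions u^(-n) exp (-1/u), extended by 0, form a family closed under differentiation, so
    smoothness at 0 needs only the first derivative at 0, for all n at once. *)
Definition flat (n : nat) (u : R) : R :=
  if 0 < u then u^-1 ^+ n * expR (- u^-1) else 0.

Lemma flat_ge0 n u : 0 <= flat n u.
Proof.
rewrite /flat; case: ifPn => // u0.
by rewrite mulr_ge0 ?expR_ge0// exprn_ge0// invr_ge0 ltW.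
Qed.

(** One term of the exponential series, of degree n + 2 in 1/u, bounds exp (1/u) from below; the
    remaining factor u^2 makes the derivative at 0 vanish. *)
Lemma flat_le n u : flat n u <= n.+2`!%:R * u ^+ 2.
Proof.
rewrite /flat; case: ifPn => u0; last by rewrite mulr_ge0// sqr_ge0.
have v0 : 0 < u^-1 by rewrite invr_gt0.
have H := expR_ge1Dxn n.+1 (ltW v0).
have {}H : u^-1 ^+ n.+2 / n.+2`!%:R <= expR u^-1 by apply: le_trans H; rewrite lerDr.
rewrite expRN ler_pdivrMr ?expR_gt0//.
apply: le_trans (_ : n.+2`!%:R * u ^+ 2 * (u^-1 ^+ n.+2 / n.+2`!%:R) <= _); last first.
  by rewrite ler_wpM2l// mulr_ge0// sqr_ge0.
have f0 : n.+2`!%:R != 0 :> R by rewrite pnatr_eq0 -lt0n fact_gt0.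
have u0' : u != 0 by rewrite gt_eqF.
rewrite le_eqVlt; apply/orP; left; apply/eqP.
move: (n.+2`!%:R) f0 => m m0; rewrite !exprS.
by move: (u^-1 ^+ n) => p; field; rewrite m0.
Qed.

Lemma flat_pos n u : 0 < u -> 0 < flat n u.
Proof. by move=> u0; rewrite /flat u0 mulr_gt0 ?expR_gt0// exprn_gt0// invr_gt0. Qed.

Lemma flat_npos n u : u <= 0 -> flat n u = 0.
Proof. by move=> u0; rewrite /flat ltNge u0. Qed.

Lemma is_derive_flat n (u : R) :
  is_derive u 1 (flat n) (flat n.+2 u - n%:R * flat n.+1 u).
Proof.
have [u0|u0|->] := ltgtP u 0.
- rewrite !flat_npos ?(ltW u0)// mulr0 subr0.
  have d0 : 0 < - u by rewrite oppr_gt0.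
  apply: (@is_derive_local _ (fun _ => 0) u 0 (- u)) => // s.
  by rewrite ler_norml => /andP[_ H]; rewrite flat_npos//; lra.
- have u0' : u != 0 by rewrite gt_eqF.
  have d0 : 0 < u / 2 by rewrite divr_gt0.
  apply: (@is_derive_local _ (fun u : R => u^-1 ^+ n * expR (- u^-1)) u _ (u / 2)) => //.
    move=> s; rewrite ler_norml => /andP[H _]; rewrite /flat ifT//; lra.
  have dV : is_derive u 1 (fun u : R => u^-1) (- u^-1 ^+ 2).
    have := is_deriveV u0' (is_derive_id u (1 : R)).
    by rewrite /GRing.scale /= mulr1 -exprVn.
  have dE : is_derive u 1 (fun u : R => expR (- u^-1)) (expR (- u^-1) * u^-1 ^+ 2).
    have dN : is_derive u 1 (fun u : R => - u^-1) (u^-1 ^+ 2).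
      by have := is_deriveN dV; rewrite opprK.
    exact: (@is_derive1_comp _ expR (fun u : R => - u^-1) u _ _ (is_derive_expR _) dN).
  have dX : is_derive u 1 (fun u : R => u^-1 ^+ n) (- (n%:R * u^-1 ^+ n.+1)).
    case: n => [|n].
      by rewrite mul0r oppr0; exact: (is_derive_cst (1 : R) u (1 : R)).
    have dP := is_deriveX n.+1 dV.
    rewrite (_ : (fun u1 : R => _) = (fun u : R => u^-1) ^+ n.+1); last first.
      by apply/funext => x; rewrite exprfctE.
    apply: is_derive_eq dP _.
    rewrite /GRing.scale /= -mulr_natl; move: n.+1%:R => m.
    by rewrite !exprS; move: (u^-1 ^+ n) (u^-1) => p v; ring.
  have dM := is_deriveM dX dE.
  apply: is_derive_eq dM _.
  rewrite /GRing.scale /= /flat u0 !exprS.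
  by move: (u^-1 ^+ n) (u^-1) (expR _) n%:R => p v q m; ring.
- rewrite !flat_npos// mulr0 subr0; apply: is_derive_eps => e e0.
  have f0 : 0 < n.+2`!%:R :> R by rewrite ltr0n fact_gt0.
  exists (e / n.+2`!%:R); first by rewrite divr_gt0.
  move=> s; rewrite (flat_npos _ (lexx 0)) !subr0 mulr0 subr0 ler_pdivlMr// => H.
  rewrite (ger0_norm (flat_ge0 n s)).
  have [s0|s0] := leP s 0.
    by rewrite flat_npos// mulr_ge0// ltW.
  rewrite (gtr0_norm s0) in H *; apply: le_trans (flat_le n s) _.
  by rewrite expr2 mulrA ler_wpM2r ?(ltW s0)// mulrC.
Qed.

Lemma smooth_flat n : smooth (flat n : R^o -> R).
Proof.
move=> k; elim: k n => [|k IH] n.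
  split=> // x; apply/differentiable_continuous/derivable1_diffP.
  by have [] := is_derive_flat n x.
apply: (smoothN_real (is_derive_flat n)).
have H := @smoothNM _ R^o k _ _ (@smoothN_cst _ R^o k (- n%:R)) (IH n.+1).
have := @smoothND _ R^o k _ _ (IH n.+2) H.
rewrite (_ : (fun x : R^o => _ + _) = (fun x => flat n.+2 x - n%:R * flat n.+1 x))//.
by apply/funext => x; rewrite mulNr.
Qed.

(** The integral starts at -1 because the integrands vanish on the negative axis: 0 is then an
    interior point for the fundamental theorem, and the value for negative u is 0. *)
Definition half_primitive (f : R -> R) (u : R) : R :=
  \int[mu]_(t in `[- 1, u]) f t.

Lemma half_primitive_npos (f : R -> R) (u : R) : (forall t : R, t <= 0 -> f t = 0) ->
  u <= 0 -> half_primitive f u = 0.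
Proof.
move=> f0 u0; rewrite /half_primitive; transitivity (\int[mu]_(t in `[- 1, u]) (0 : R)).
  apply: eq_Rintegral => t; rewrite inE/= in_itv/= => /andP[_ tu].
  by rewrite f0// (le_trans tu).
by rewrite Rintegral_cst ?mul0r//; exact: measurable_itv.
Qed.

Lemma is_derive_half_primitive (f : R -> R) (u : R) : continuous f ->
  (forall t : R, t <= 0 -> f t = 0) -> is_derive u 1 (half_primitive f) (f u).
Proof.
move=> cf f0; have [u1|u1] := leP u (- 2^-1).
  have d0 : 0 < 4^-1 :> R by rewrite invr_gt0.
  apply: (@is_derive_local _ (fun _ => 0) u _ 4^-1) => //.
    move=> s; rewrite ler_norml => /andP[_ H]; rewrite half_primitive_npos//; lra.
  rewrite f0; last lra.
  exact: (is_derive_cst (0 : R) u (1 : R)).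
have uu : u < u + 1 by rewrite ltrDl.
have intf := @continuous_segment_integrable R f (- 1) (u + 1) (continuous_subspaceT cf).
have u2 : -1 < u by lra.
have [d dE] := continuous_FTC1_closed uu intf u2 (cf u).
by apply: (@DeriveDef _ _ _ _ _ _ _ d); rewrite -derive1E; exact: dE.
Qed.

Lemma nondecreasing_of_derive (F f : R -> R) (x y : R) :
  (forall t : R, is_derive t 1 F (f t)) -> (forall t, 0 <= f t) -> x <= y ->
  F x <= F y.
Proof.
move=> dF f0 xy; have cF : {within `[x, y], continuous F}.
  apply: continuous_subspaceT => t.
  by apply/differentiable_continuous/derivable1_diffP; have [] := dF t.
have dF' t : t \in `]x, y[ -> is_derive t 1 F (f t) by move=> _; exact: dF.
have [c _ E] := MVT_segment xy dF' cF.
by rewrite -subr_ge0 E mulr_ge0// subr_ge0.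
Qed.

Lemma constant_of_derive (F f : R -> R) (a x : R) :
  (forall t : R, is_derive t 1 F (f t)) -> (forall t, a <= t -> f t = 0) ->
  a <= x -> F x = F a.
Proof.
move=> dF f0 ax; have cF : {within `[a, x], continuous F}.
  apply: continuous_subspaceT => t.
  by apply/differentiable_continuous/derivable1_diffP; have [] := dF t.
have dF' t : t \in `]a, x[ -> is_derive t 1 F (f t) by move=> _; exact: dF.
have [c + E] := MVT_segment ax dF' cF.
rewrite in_itv/= => /andP[ac _].
by apply/eqP; rewrite -subr_eq0 E f0// mul0r.
Qed.

(** The primitive P is kept because it interpolates slopes in [smooth_antiderivative_approx]; its
    smoothness passes to S and s by differentiation. *)
Record smooth_step (s S P : R -> R) : Prop := SmoothStep {
  step_P : smooth1 P;
  step_dP : forall t : R, is_derive t 1 P (S t);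
  step_dS : forall t : R, is_derive t 1 S (s t);
  step_s_ge0 : forall t, 0 <= s t;
  step_S0 : forall t, t <= 0 -> S t = 0;
  step_S1 : forall t, 1 <= t -> S t = 1;
  step_s_eq0 : forall t, t <= 0 \/ 1 <= t -> s t = 0 }.

Lemma smooth_step_exists : exists s S P, smooth_step s S P.
Proof.
pose k (t : R) := flat 0 t * flat 0 (- t + 1).
have sk : smooth (k : R^o -> R).
  apply: smoothM; first exact: smooth_flat.
  have := smooth1_smooth (@smooth1_affine _ (-1) 1 (smooth_smooth1 (@smooth_flat 0))).
  by under [X in smooth X -> _]eq_fun do rewrite mulN1r.
have ck : continuous k := smooth_continuous sk.
have k0 t : t <= 0 -> k t = 0 by move=> t0; rewrite /k flat_npos// mul0r.
have k1 t : 1 <= t -> k t = 0.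
  by move=> t1; rewrite /k [flat _ (- t + 1)]flat_npos ?mulr0//; lra.
have kge0 t : 0 <= k t by rewrite mulr_ge0// flat_ge0.
pose K := half_primitive k.
have dK (t : R) : is_derive t 1 K (k t) by exact: is_derive_half_primitive.
have K0 (t : R) : t <= 0 -> K t = 0 by exact: half_primitive_npos.
have K1 (t : R) : 1 <= t -> K t = K 1 by move=> t1; exact: (constant_of_derive dK k1 t1).
(* If K 1 were 0, K would vanish on [0, 1] by monotonicity, whereas its derivative at 1/2 is
   positive. *)
have Kpos : 0 < K 1.
  rewrite lt_neqAle -{2}(K0 0 (lexx 0)) (nondecreasing_of_derive dK)// andbT.
  apply/eqP => E; have Kc t : 0 <= t <= 1 -> K t = 0.
    move=> /andP[t0 t1]; apply/eqP; rewrite eq_le {1}E (nondecreasing_of_derive dK)//=.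
    by rewrite -(K0 0 (lexx 0)) (nondecreasing_of_derive dK).
  have h0 : 0 < 2^-1 :> R by rewrite invr_gt0.
  have kh : 0 < k 2^-1 by rewrite mulr_gt0// flat_pos//; lra.
  have H : is_derive (2^-1 : R) 1 (fun _ : R => (0 : R)) (k 2^-1).
    apply: (is_derive_local h0 _ (dK 2^-1)) => s.
    by rewrite ler_norml => /andP[s0 s1]; rewrite Kc//; apply/andP; split; lra.
  have [_ D] := H; move: kh; rewrite -D.
  by have [_ ->] := is_derive_cst (0 : R) (2^-1 : R) (1 : R); rewrite ltxx.
pose m := (K 1)^-1; have m0 : 0 < m by rewrite invr_gt0.
pose S t := m * K t; pose s t := m * k t.
have dS (t : R) : is_derive t 1 S (s t).
  have dc := is_derive_cst (m : R) t (1 : R).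
  apply: is_derive_eq (is_deriveM dc (dK t)) _.
  by rewrite /GRing.scale /= mulr0 addr0.
have S0 (t : R) : t <= 0 -> S t = 0 by move=> t0; rewrite /S K0// mulr0.
have S1 (t : R) : 1 <= t -> S t = 1 by move=> t1; rewrite /S K1// mulVf// gt_eqF.
have cS : continuous S.
  by move=> t; apply/differentiable_continuous/derivable1_diffP; have [] := dS t.
exists s, S, (half_primitive S); split=> //.
- apply: (@smooth1_primitive S) => [|t]; last exact: is_derive_half_primitive.
  apply: (@smooth1_primitive s) => //.
  by apply: smooth_smooth1; exact: smoothZ.
- by move=> t; exact: is_derive_half_primitive.
- by move=> t; rewrite mulr_ge0// ltW.
- by move=> t [t0|t1]; [rewrite /s k0 | rewrite /s k1]; rewrite ?mulr0.
Qed.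

End RealSmoothFunctions.

Section StepTheory.
Context (R : realType) (s S P : R -> R).
Hypothesis step : smooth_step s S P.

Lemma step_nondecreasing (x y : R) : x <= y -> S x <= S y.
Proof. exact: nondecreasing_of_derive (step_dS step) (step_s_ge0 step). Qed.

Lemma step_bounds (t : R) : 0 <= S t <= 1.
Proof.
apply/andP; split.
  have [t0|t0] := leP t 0; first by rewrite (step_S0 step).
  by rewrite -(step_S0 step (lexx 0)) step_nondecreasing// ltW.
have [t1|t1] := leP 1 t; first by rewrite (step_S1 step).
by rewrite -(step_S1 step (lexx 1)) step_nondecreasing// ltW.
Qed.

Lemma step_smooth : smooth1 S.
Proof. exact: smooth1_derivative (step_P step) (step_dP step). Qed.

Lemma step_P0 (t : R) : t <= 0 -> P t = P 0.
Proof.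
move=> t0; have dP' (x : R) : is_derive x 1 (fun t : R => P (-1 * t + 0)) (-1 * S (-1 * x + 0)).
  by apply: is_derive_affine; exact: step_dP step _.
have H : 0 <= - t by rewrite oppr_ge0.
have := constant_of_derive dP' _ H; rewrite mulr0 addr0 mulN1r opprK addr0.
by apply => x x0; rewrite mulN1r (step_S0 step) ?oppr0//; lra.
Qed.

(* On [t_m, t_m + d] the derivative of the approximation is a convex
   combination of two consecutive samples of v. *)
Lemma smooth_antiderivative_approx (v : R -> R) (r e : R) : 0 < r -> 0 < e ->
  {within `[0, r], continuous v} -> exists T dT : R -> R,
  [/\ smooth1 T, forall t : R, is_derive t 1 T (dT t), T 0 = 0 &
      forall t, 0 <= t <= r -> `|dT t - v t| <= e].
Proof.
move=> r0 e0 cv.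
(* The clamp extends v continuously to the whole line, an open set as [compact_unif_continuous]
   requires. *)
pose clamp (t : R) := Num.max 0 (Num.min t r).
have clampE t : 0 <= t <= r -> clamp t = t.
  by move=> /andP[t0 tr]; rewrite /clamp min_l// max_r.
have clamp_in t : 0 <= clamp t <= r.
  by rewrite /clamp le_max lexx/= ge_max (ltW r0) ge_min lexx orbT.
have clamp_lip x y : `|clamp x - clamp y| <= `|x - y|.
  have := ler_norm (x - y); have := ler_norm (y - x); rewrite (distrC y x) => H1 H2.
  rewrite ler_norml /clamp /Num.max /Num.min; clear - H1 H2 r0.
  by case: (ltP x r) => ?; case: (ltP y r) => ?; do 2? [case: ltP => ?];
    apply/andP; split; lra.
have cvc : {within setT, continuous (v \o clamp)}.
  move/within_continuous_epsP: cv => cv; apply: within_continuous_eps => x _ e1 e10.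
  have [d d0 Hd] := cv (clamp x) (clamp_in x) e1 e10; exists d => // y _ yx.
  by apply: Hd; [exact: clamp_in | exact: le_trans (clamp_lip _ _) yx].
have [d d0 Hd] := @compact_unif_continuous R R R setT `[0, r]%classic _ openT cvc
  (@segment_compact R 0 r) (@subsetT _ _) e e0.
have uc x y : 0 <= x <= r -> 0 <= y <= r -> `|y - x| <= d -> `|v y - v x| <= e.
  move=> x0 y0 /(Hd _ _ _)[|_]; first by rewrite /= in_itv.
  by rewrite /= !clampE.
have [N N0 hd] : exists2 N : nat, (0 < N)%N & r / N%:R <= d / 2.
  have d2 : 0 < d / 2 by rewrite divr_gt0.
  have HN := archi_boundP (ltW (divr_gt0 r0 d2)).
  exists (Num.bound (r / (d / 2))).+1 => //.
  rewrite ler_pdivrMr ?ltr0n// mulrC -ler_pdivrMr//.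
  by apply: (le_trans (ltW HN)); rewrite ler_nat.
pose h := r / N%:R; have h0 : 0 < h by rewrite divr_gt0 ?ltr0n.
have Nh : N%:R * h = r by rewrite mulrC divfK// pnatr_eq0 -lt0n.
have ih m : (m <= N)%N -> 0 <= m%:R * h <= r.
  move=> mN; rewrite mulr_ge0 ?(ltW h0)//= -Nh ler_wpM2r ?(ltW h0)// ler_nat //.
(* The derivative lags one node behind: past the last node it stays equal to the previous sample,
   and the next piece switches it to the following one. The lag spans two steps, hence the mesh at
   most d / 2. *)
suff [T [dT [sT DT T0 HT _]]] : exists T dT : R -> R,
    [/\ smooth1 T, forall t : R, is_derive t 1 T (dT t), T 0 = 0,
        forall t, 0 <= t <= N.-1.+1%:R * h -> `|dT t - v t| <= e &
        forall t, N.-1.+1%:R * h <= t -> dT t = v (N.-1%:R * h)].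
  by exists T, dT; split=> //; move: HT; rewrite prednK// Nh.
have : (N.-1 < N)%N by rewrite prednK.
elim: N.-1 => [|m IH] mN.
  exists (fun t => v 0 * t), (fun _ => v 0); split=> //.
  - by apply: smooth_smooth1; apply: smoothZ; exact: smooth_id.
  - move=> t; have dc := is_derive_cst (v 0 : R) t (1 : R).
    apply: is_derive_eq (is_deriveM dc (is_derive_id t (1 : R))) _.
    by rewrite /GRing.scale /= mulr1 mulr0 addr0.
  - by rewrite mulr0.
  - move=> t /andP[t0 t1]; rewrite mul1r in t1.
    apply: uc => //; [|by rewrite lexx (ltW r0)|].
      by have := ih 1%N N0; rewrite mul1r => /andP[_ hr]; rewrite t0 (le_trans t1).
    by rewrite sub0r normrN ger0_norm//; rewrite -/h in hd; lra.
  - by move=> t _; rewrite mul0r.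
have [T [dT [sT DT T0 HT HTc]]] := IH (ltnW mN).
pose a := m.+1%:R * h; pose c := v a - v (m%:R * h).
have aS : m.+2%:R * h = a + h by rewrite -[m.+2]addn1 natrD mulrDl mul1r.
have aP : a = m%:R * h + h by rewrite /a -[m.+1]addn1 natrD mulrDl mul1r.
have hN0 : h != 0 by rewrite gt_eqF.
have affE t : h^-1 * t + - (a / h) = (t - a) / h by rewrite mulrBl mulrC.
exists (fun t => T t + c * h * (P (h^-1 * t + - (a / h)) - P 0)),
  (fun t => dT t + c * S (h^-1 * t + - (a / h))); split.
- apply: smooth_smooth1; apply: smoothD; first exact: smooth1_smooth.
  apply: smoothZ; apply: smoothB; last exact: smooth_cst.
  apply: smooth1_smooth; apply: smooth1_affine; exact: step_P step.
- move=> t; have d1 := is_derive_affine (step_dP step (h^-1 * t + - (a / h))).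
  have d2 := is_deriveB d1 (is_derive_cst (P 0 : R) t (1 : R)).
  have d3 := is_deriveM (is_derive_cst (c * h : R) t (1 : R)) d2.
  apply: is_derive_eq (is_deriveD (DT t) d3) _.
  rewrite /GRing.scale /= subr0 mulr0 addr0; congr (_ + _).
  by rewrite mulrA -(mulrA c) divff// mulr1.
- rewrite T0 add0r mulr0 add0r step_P0 ?subrr ?mulr0// oppr_le0.
  by rewrite divr_ge0 ?(ltW h0)//; have /andP[] := ih m.+1 (ltnW mN).
- move=> t /andP[t0]; rewrite aS => tah; rewrite affE.
  have [ta|ta] := leP t a.
    rewrite (step_S0 step) ?mulr0 ?addr0.
      by apply: HT; rewrite t0.
    by rewrite ler_pdivrMr// mul0r subr_le0.
  have tr : 0 <= t <= r.
    by have /andP[_] := ih m.+2 mN; rewrite aS t0 => H; exact: le_trans tah H.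
  rewrite HTc ?(ltW ta)//; have /andP[s0 s1] := step_bounds ((t - a) / h).
  have H1 : `|v (m%:R * h) - v t| <= e.
    apply: uc => //; first exact: ih (ltnW (ltnW mN)).
    rewrite distrC ger0_norm; rewrite -/h in hd; lra.
  have H2 : `|v a - v t| <= e.
    apply: uc => //; first exact: ih (ltnW mN).
    rewrite distrC ger0_norm; rewrite -/h in hd; lra.
  move: H1 H2 s0 s1; rewrite /c.
  move: (S _) (v a) (v (m%:R * h)) (v t) => z x y w; clear.
  rewrite !ler_norml => /andP[a1 a2] /andP[b1 b2] z0 z1; apply/andP; split; nra.
- move=> t; rewrite aS affE => H; rewrite HTc.
    rewrite (step_S1 step) ?mulr1 /c ?subrKC// ler_pdivlMr// mul1r; lra.
  by apply: le_trans H; rewrite lerDl ltW.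
Qed.

End StepTheory.

(** * Integrals of products in sheared coordinates *)

Section ProductIntegrals.
Context (R : realType).
Local Notation T := (measurableTypeR R).
Local Notation mu := (@lebesgue_measure R).
Local Open Scope ereal_scope.

Lemma integral_translation (f : R -> R) (c : R) : continuous f ->
  (forall x : R, 0 <= f x)%R ->
  \int[mu]_x (f (x + c)%R)%:E = \int[mu]_x (f x)%:E.
Proof.
move=> cf f0; pose F (x : R) := (x + c)%R.
have dF (x : R) : is_derive x 1%R F 1%R.
  by apply: is_derive_eq; rewrite addr0.
have F1 : derive1 F = cst 1%R.
  by apply/funext => x; rewrite derive1E; have [_ ->] := dF x.
rewrite [RHS](@increasing_ge0_integration_by_substitutionT R F f) //.
- by apply: eq_integral => x _; rewrite F1 /= mulr1.
- by move=> x y; rewrite ltrD2r.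
- by rewrite F1; exact: cst_continuous.
- by rewrite F1; exact: is_cvg_cst.
- by rewrite F1; exact: is_cvg_cst.
- exact: cvg_addrr_Ny.
- exact: cvg_addrr.
Qed.

Lemma lebesgueN_integral_cons n (f : n.+1.-tuple T -> \bar R) :
  measurable_fun setT f -> (forall t, 0 <= f t) ->
  \int[lebesgueN R n.+1]_t f t =
  \int[lebesgueN R n]_t \int[mu]_x f (tuple_cons (x, t)).
Proof.
move=> mf f0.
have mc := @measurable_tuple_cons R n.
rewrite /= (ge0_integral_pushforward mc)//.
rewrite preimage_setT; have mfc := measurableT_comp mf mc.
exact: (@fubini_tonelli2 _ _ _ _ _ mu (lebesgueN R n) _ mfc (fun t => f0 _)).
Qed.

(** The shift of coordinate i depends on later coordinates only. Integrating the first coordinate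
    innermost, its shift is a constant and disappears by translation invariance; induction treats
    the rest. *)
Lemma lebesgueN_prod n (psi : 'I_n -> R -> R) (sg : 'I_n -> n.-tuple T -> R)
    (m : 'I_n -> R) :
  (forall i, continuous (psi i)) -> (forall i x, 0 <= psi i x)%R ->
  (forall i, measurable_fun setT (sg i)) ->
  (forall (i : 'I_n) (t t' : n.-tuple T), (forall k : 'I_n, (i < k)%N -> tnth t k = tnth t' k) ->
     sg i t = sg i t') ->
  (forall i, \int[mu]_x (psi i x)%:E = (m i)%:E) ->
  \int[lebesgueN R n]_t (\prod_i psi i (tnth t i + sg i t))%R%:E =
  (\prod_i m i)%R%:E.
Proof.
elim: n psi sg m => [|n IH] psi sg m cpsi psi0 msg hsg hm.
  rewrite /= integral_dirac//; last first.
    by under eq_fun do rewrite big_ord0; exact: measurable_cst.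
  by rewrite diracT mul1e !big_ord0.
have mterm i : measurable_fun setT (fun t : n.+1.-tuple T => psi i (tnth t i + sg i t)%R).
  apply: measurableT_comp; first exact: continuous_measurable_fun.
  by apply: measurable_funD => //; exact: measurable_tnth.
rewrite lebesgueN_integral_cons; first last.
- by move=> t; rewrite lee_fin prodr_ge0.
- by apply/measurable_EFinP; apply: measurable_prod => i _.
(* No shift depends on coordinate 0, so this coordinate may be filled with 0. *)
pose ext (t : n.-tuple T) := tuple_cons (0%R : T, t).
have mext : measurable_fun setT ext.
  apply: measurableT_comp; first exact: measurable_tuple_cons.
  exact: measurable_pair1.
have E t x : (\prod_i psi i (tnth (tuple_cons (x, t)) i + sg i (tuple_cons (x, t))) =
    psi ord0 (x + sg ord0 (ext t)) *
    \prod_i psi (lift ord0 i) (tnth t i + sg (lift ord0 i) (ext t)))%R.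
  rewrite big_ord_recl; congr (psi _ _ * _)%R.
    rewrite tnth0; congr (_ + _)%R; apply: hsg => k; case: (unliftP ord0 k) => [j ->|->] //.
    by rewrite !tnthS.
  apply: eq_bigr => i _; rewrite tnthS; congr (psi _ (_ + _))%R; apply: hsg => k.
  by case: (unliftP ord0 k) => [j ->|->] //; rewrite !tnthS.
transitivity (\int[lebesgueN R n]_t ((m ord0)%:E *
    (\prod_i psi (lift ord0 i) (tnth t i + sg (lift ord0 i) (ext t)))%R%:E)).
  apply: eq_integral => t _.
  under eq_integral do rewrite E EFinM.
  rewrite ge0_integralZr//; last 3 first.
  - apply/measurable_EFinP; apply: measurableT_comp; first exact: continuous_measurable_fun.
    by apply: measurable_funD => //; exact: measurable_cst.
  - by move=> x _; rewrite lee_fin.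
  - by rewrite lee_fin prodr_ge0.
  by rewrite integral_translation// hm.
rewrite ge0_integralZl//.
- have H := IH (fun i => psi (lift ord0 i)) (fun i t => sg (lift ord0 i) (ext t))
    (fun i => m (lift ord0 i)).
  rewrite big_ord_recl EFinM -H//.
  + by move=> i; apply: measurableT_comp.
  + move=> i t t' tt; apply: hsg => k; case: (unliftP ord0 k) => [j ->|->] //.
    by rewrite lift0 /= ltnS => ij; rewrite !tnthS; exact: tt.
- apply/measurable_EFinP; apply: measurable_prod => i _.
  apply: measurableT_comp; first exact: continuous_measurable_fun.
  apply: measurable_funD; first exact: measurable_tnth.
  exact: measurableT_comp.
- by move=> t _; rewrite lee_fin prodr_ge0.
- by rewrite -hm integral_ge0// => x _; rewrite lee_fin.
Qed.

End ProductIntegrals.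

Section PointIntegrals.
Context (R : realType) (a h : nat).
Local Notation pt := ('rV[R]_a * 'rV[R]_h)%type.
Local Notation T := (measurableTypeR R).
Local Notation mu := (@lebesgue_measure R).
Local Notation pot := (@point_of_tuples R a h).
Local Notation lam2 := (lebesgueN R a \x lebesgueN R h)%E.

Lemma rational_approx n (t : n.-tuple T) (e : R) : 0 < e ->
  exists q : 'rV[rat]_n, forall i, `|tnth t i - ratr (q ord0 i)| < e.
Proof.
move=> e0; have H i : exists q : rat, `|tnth t i - ratr q| < e.
  have lt : tnth t i - e < tnth t i + e by lra.
  have [q] := rat_in_itvoo lt; rewrite in_itv/= => /andP[q1 q2]; exists q; rewrite ltr_norml; apply/andP; split; lra.
have [q Hq] := choice H.
by exists (\row_i q i) => i; rewrite mxE.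
Qed.

(** An open set is the union of the boxes with rational centre and radius 1 / (k + 1) contained in
    it; this links the topology of row vectors to the product sigma-algebra of tuples. *)
Lemma measurable_open_points (D : set pt) : open D -> measurable (pot @^-1` D).
Proof.
move=> oD.
pose F (q : 'rV[rat]_a * 'rV[rat]_h * nat) : set (a.-tuple T * h.-tuple T) :=
  let A := @box2 R a h (map_mx ratr q.1.1, map_mx ratr q.1.2) q.2.+1%:R^-1 in
  if `[< A `<=` pot @^-1` D >] then A else set0.
have -> : pot @^-1` D = \bigcup_q F q.
  apply/seteqP; split=> [p Dp|p [q _]]; last first.
    by rewrite /F; case: ifPn => // /asboolP H /H.
  have [r r0 Hr] := nbhs_norm_leP (open_nbhs_nbhs (conj oD Dp)).
  have r2 : 0 < r / 2 by rewrite divr_gt0.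
  have HN := archi_boundP (ltW (divr_gt0 ltr01 r2)).
  pose k := Num.bound (1 / (r / 2)); pose e : R := k.+1%:R^-1.
  have e0 : 0 < e by rewrite invr_gt0.
  have er : e <= r / 2.
    rewrite /e -[leRHS]invrK lef_pV2 ?posrE ?invr_gt0//.
    by rewrite -div1r (le_trans (ltW HN))// ler_nat.
  have [q1 Hq1] := rational_approx p.1 e0.
  have [q2 Hq2] := rational_approx p.2 e0.
  have inA : @box2 R a h (map_mx ratr q1, map_mx ratr q2) e p.
    by split=> i /=; rewrite mxE; [exact: Hq1 | exact: Hq2].
  exists (q1, q2, k) => //; rewrite /F /= ifT//; apply/asboolP => p' inA'.
  apply: Hr; have H1 := box2P e0 inA; have H2 := box2P e0 inA'.
  rewrite -(subrKA (map_mx ratr q1, map_mx ratr q2)) (le_trans (ler_normD _ _))//.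
  by rewrite [`|_ - pot p|]distrC (le_trans (lerD H2 H1))//; lra.
apply: countable_bigcupT_measurable; first exact/countableP.
by move=> q; rewrite /F; case: ifPn => // _; exact: measurable_box2.
Qed.

Lemma measurable_continuous_points (U : set pt) (f : pt -> R) : open U ->
  {within U, continuous f} -> measurable_fun (pot @^-1` U) (f \o pot).
Proof.
move=> oU cf; apply: (measurability _ (RGenOInfty.measurableE R)).
move=> _ [_ [x ->] <-]; pose D : set pt := [set w | U w /\ x < f w].
have oD : open D.
  rewrite openE => w [Uw xf]; apply: filterI; first exact: (open_nbhs_nbhs (conj oU Uw)).
  have /cvgrPdist_lt c := within_open_continuous oU cf Uw.
  have xf0 : 0 < f w - x by rewrite subr_gt0.
  apply: filterS (c _ xf0) => q; rewrite ltr_norml => /andP[_ H]; rewrite /=; lra.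
rewrite (_ : _ `&` _ = pot @^-1` D); first exact: measurable_open_points.
by apply/seteqP; split=> p /=; rewrite in_itv/= andbT.
Qed.

Lemma cube_fin n (x : 'I_n -> R) (r : R) : 0 <= r ->
  (lebesgueN R n (cube x r) < +oo)%E.
Proof.
move=> r0; elim: n x => [|n IH] x /=.
  by rewrite diracE; case: (_ \in _); rewrite ?ltry.
rewrite /leb_step /pushforward cube_cons product_measure1E//.
- rewrite lte_mul_pinfty//.
    have H : (lebesgue_measure (ball (x ord0) r) \is a fin_num)%E.
      by rewrite (lebesgue_measure_ball (x ord0) r0).
    exact: H.
- exact: measurable_real_ball.
- exact: measurable_cube.
Qed.

Definition oball (w0 : pt) (rho : R) : set pt := [set w | `|w - w0| < rho].

Lemma open_oball w0 rho : open (oball w0 rho).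
Proof.
rewrite (_ : oball w0 rho = ball w0 rho); first exact: ball_open.
by apply/seteqP; split=> x /=; rewrite -ball_normE /= distrC.
Qed.

Lemma measurable_oball w0 rho : measurable (pot @^-1` oball w0 rho).
Proof. exact: (measurable_open_points (@open_oball w0 rho)). Qed.

Lemma oball_fin w0 rho : 0 <= rho -> (lam2 (pot @^-1` oball w0 rho) < +oo)%E.
Proof.
move=> r0; apply: (@le_lt_trans _ _ (lam2 (box2 w0 rho))).
  apply: le_measure.
  - by apply/mem_set; exact: measurable_oball.
  - by apply/mem_set; exact: measurable_box2.
  move=> p; rewrite /oball /= pair_norm_lt => /andP[H1 H2]; split=> i /=.
    by apply: le_lt_trans H1; have := row_coord_le ((pot p).1 - w0.1) i; rewrite !mxE.
  by apply: le_lt_trans H2; have := row_coord_le ((pot p).2 - w0.2) i; rewrite !mxE.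
rewrite product_measure1E; try exact: measurable_cube.
by rewrite lte_mul_pinfty ?ge0_fin_numE ?cube_fin.
Qed.

Lemma integrable_oball (U : set pt) (f : pt -> R) w0 rho : open U -> 0 <= rho ->
  (forall w, `|w - w0| <= rho -> U w) -> {within U, continuous f} ->
  lam2.-integrable (pot @^-1` oball w0 rho) (EFin \o (f \o pot)).
Proof.
move=> oU r0 bU cf; have BU : oball w0 rho `<=` U by move=> w /ltW/bU.
have [[M M0 fM] _] := ball_bound_uc oU cf bU.
apply: measurable_bounded_integrable.
- exact: measurable_oball.
- exact: oball_fin.
- apply: measurable_continuous_points; first exact: open_oball.
  exact: continuous_subspaceW cf.
- exists M; split; first exact: num_real.
  by move=> x Mx p /ltW/fM fp; exact: le_trans fp (ltW Mx).
Qed.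

Lemma integral2_support (D B : set pt) (f : pt -> R) : B `<=` D ->
  (forall w, D w -> ~ B w -> f w = 0) -> integral2 D f = integral2 B f.
Proof.
move=> BD f0; rewrite /integral2 /Rintegral; congr fine.
rewrite integral_mkcond [RHS]integral_mkcond; congr (integral _ _ _).
apply/funext => p; rewrite /restrict/=; case: ifPn => [/set_mem Dp|]; case: ifPn => //.
- by move=> /negP nB; rewrite f0// => /mem_set.
- by move=> /set_mem/BD Dp /negP; rewrite inE.
Qed.

Section Weights.
Variables (eta : 'I_a -> R -> R) (psi : 'I_h -> R -> R) (x0 : 'rV[R]_a).
Variables (al : 'I_h -> 'rV[R]_a -> R) (be : 'I_h -> R) (i0 : 'I_h).

(** A product of one-variable profiles in sheared coordinates. Vertical coordinate i is shifted by a
    function of x and by the multiple [be i] of the straightened coordinate i0; as [be i] vanishes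
    for i0 <= i, the shear is triangular in the order of [lebesgueN_prod]. *)
Definition weight (w : pt) : R :=
  (\prod_k eta k (w.1 ord0 k - x0 ord0 k)) *
  \prod_i psi i (w.2 ord0 i + (al i w.1 + be i * (w.2 ord0 i0 + al i0 w.1))).

Hypothesis be0 : forall i : 'I_h, (i0 <= i)%N -> be i = 0.
Hypothesis ceta : forall k, continuous (eta k).
Hypothesis cpsi : forall i, continuous (psi i).
Hypothesis eta0 : forall k x, 0 <= eta k x.
Hypothesis psi0 : forall i x, 0 <= psi i x.

Lemma integral2_weight (D : set pt) (m1 : 'I_a -> R) (m2 : 'I_h -> R) :
  continuous weight -> (forall w, ~ D w -> weight w = 0) ->
  (forall k, \int[mu]_x (eta k x)%:E = (m1 k)%:E)%E ->
  (forall i, \int[mu]_x (psi i x)%:E = (m2 i)%:E)%E ->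
  integral2 D weight = (\prod_k m1 k) * \prod_i m2 i.
Proof.
move=> cw wD hm1 hm2.
rewrite -(@integral2_support setT) => [||w _ /wD]//.
rewrite /integral2 preimage_setT /Rintegral.
have weight_ge0 w : 0 <= weight w by rewrite mulr_ge0// prodr_ge0.
have mw : measurable_fun setT (fun p => (weight (pot p))%:E).
  apply/measurable_EFinP.
  have := @measurable_continuous_points setT weight openT (continuous_subspaceT cw).
  by rewrite preimage_setT.
rewrite (@fubini_tonelli1 _ _ _ _ _ (lebesgueN R a) (lebesgueN R h) _ mw)//; last first.
  by move=> p; rewrite lee_fin.
rewrite /fubini_F.
transitivity (fine (\int[lebesgueN R a]_t
   ((\prod_i m2 i)%:E * (\prod_k eta k (tnth t k + - x0 ord0 k))%R%:E))%E).
  congr fine; apply: eq_integral => t _.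
  pose x : 'rV[R]_a := \row_i tnth t i.
  pose sg i (y : h.-tuple T) := al i x + be i * (tnth y i0 + al i0 x).
  have -> : (fun y => (weight (pot (t, y)))%:E) = (fun y =>
      (\prod_k eta k (tnth t k + - x0 ord0 k))%:E * (\prod_i psi i (tnth y i + sg i y))%:E)%E.
    apply/funext => y; rewrite /weight EFinM; congr (_ * _)%E; congr EFin.
      by apply: eq_bigr => k _; rewrite /= mxE.
    by apply: eq_bigr => i _; rewrite /sg /= !mxE.
  have msg i : measurable_fun setT (sg i).
    apply: measurable_funD; first exact: measurable_cst.
    apply: measurable_funM; first exact: measurable_cst.
    by apply: measurable_funD; [exact: measurable_tnth | exact: measurable_cst].
  rewrite ge0_integralZl//.
  - rewrite muleC (@lebesgueN_prod R h psi sg m2)// => i y y' yy.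
    rewrite /sg; case: (leqP i0 i) => ii; first by rewrite be0// !mul0r.
    by rewrite yy.
  - apply/measurable_EFinP; apply: measurable_prod => i _.
    apply: measurableT_comp; first exact: continuous_measurable_fun.
    by apply: measurable_funD => //; exact: measurable_tnth.
  - by move=> y _; rewrite lee_fin prodr_ge0.
  - by rewrite lee_fin prodr_ge0.
have m20 : (0%R <= (\prod_i m2 i)%:E)%E.
  rewrite lee_fin prodr_ge0// => i _; rewrite -lee_fin -hm2.
  by apply: integral_ge0 => x _; rewrite lee_fin.
rewrite ge0_integralZl//.
- rewrite (@lebesgueN_prod R a eta (fun k _ => - x0 ord0 k) m1)//.
  by rewrite -EFinM /= mulrC.
- apply/measurable_EFinP; apply: measurable_prod => i _.
  apply: measurableT_comp; first exact: continuous_measurable_fun.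
  by apply: measurable_funD; [exact: measurable_tnth | exact: measurable_cst].
- by move=> y _; rewrite lee_fin prodr_ge0.
Qed.

End Weights.

End PointIntegrals.

(** * Plateau profiles and their masses *)

Section Plateaus.
Context (R : realType) (s S P : R -> R).
Hypothesis step : smooth_step s S P.
Local Notation mu := (@lebesgue_measure R).

Definition ramp (A r u : R) : R := S (r^-1 * u + - (A / r)).
Definition edge (A r u : R) : R := r^-1 * s (r^-1 * u + - (A / r)).
(** The two widths are independent because the vertical profile of the test function rises slowly
    and falls sharply. *)
Definition plateau (A B r1 r2 u : R) : R := ramp A r1 u - ramp B r2 u.

Lemma ramp_argE (A r u : R) : r^-1 * u + - (A / r) = (u - A) / r.
Proof. by rewrite mulrBl mulrC. Qed.

Lemma ramp0 (A r u : R) : 0 < r -> u <= A -> ramp A r u = 0.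
Proof.
move=> r0 uA; rewrite /ramp ramp_argE (step_S0 step)//.
by rewrite ler_pdivrMr// mul0r subr_le0.
Qed.

Lemma ramp1 (A r u : R) : 0 < r -> A + r <= u -> ramp A r u = 1.
Proof.
move=> r0 uA; rewrite /ramp ramp_argE (step_S1 step)//.
by rewrite ler_pdivlMr// mul1r; lra.
Qed.

Lemma ramp_bounds (A r u : R) : 0 <= ramp A r u <= 1.
Proof. exact: step_bounds step _. Qed.

Lemma edge_eq0 (A r u : R) : 0 < r -> u <= A \/ A + r <= u -> edge A r u = 0.
Proof.
move=> r0 H; rewrite /edge ramp_argE (step_s_eq0 step) ?mulr0//.
case: H => H; [left; rewrite ler_pdivrMr// mul0r|right; rewrite ler_pdivlMr// mul1r]; lra.
Qed.

Lemma edge_ge0 (A r u : R) : 0 < r -> 0 <= edge A r u.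
Proof. by move=> r0; rewrite mulr_ge0 ?invr_ge0 ?(ltW r0)// (step_s_ge0 step). Qed.

Lemma is_derive_ramp (A r u : R) : is_derive u 1 (ramp A r) (edge A r u).
Proof. by apply: is_derive_affine; exact: step_dS step _. Qed.

Lemma smooth1_ramp (A r : R) : smooth1 (ramp A r).
Proof. by apply: smooth1_affine; exact: step_smooth step. Qed.

Lemma smooth1_edge (A r : R) : smooth1 (edge A r).
Proof. exact: smooth1_derivative (smooth1_ramp A r) (is_derive_ramp A r). Qed.

Lemma smooth1B (f g : R -> R) : smooth1 f -> smooth1 g -> smooth1 (fun u => f u - g u).
Proof. by move=> sf sg; apply/smooth_smooth1/smoothB; exact: smooth1_smooth. Qed.

Lemma smooth1M (f g : R -> R) : smooth1 f -> smooth1 g -> smooth1 (fun u => f u * g u).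
Proof. by move=> sf sg; apply/smooth_smooth1/smoothM; exact: smooth1_smooth. Qed.

Lemma smooth1_scale (f : R -> R) (d : R) : smooth1 f -> smooth1 (fun u => f (d * u)).
Proof.
move=> sf; have := smooth1_affine d 0 sf.
by under [X in smooth1 X -> _]eq_fun do rewrite addr0.
Qed.

Lemma is_derive_scale (f : R -> R) (d u l : R) : is_derive (d * u) 1 f l ->
  is_derive u 1 (fun u => f (d * u)) (d * l).
Proof.
move=> df; have := @is_derive_affine R f d 0 u l; rewrite addr0 => /(_ df).
by under [X in is_derive _ _ X _ -> _]eq_fun do rewrite addr0.
Qed.

Section PlateauShape.
Variables (A B r1 r2 : R).
Hypotheses (r10 : 0 < r1) (r20 : 0 < r2) (AB : A + r1 <= B).

Lemma smooth1_plateau : smooth1 (plateau A B r1 r2).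
Proof. by apply: smooth1B; exact: smooth1_ramp. Qed.

Lemma is_derive_plateau (u : R) :
  is_derive u 1 (plateau A B r1 r2) (edge A r1 u - edge B r2 u).
Proof. exact: is_deriveB (is_derive_ramp A r1 u) (is_derive_ramp B r2 u). Qed.

Lemma plateau_bounds (u : R) : 0 <= plateau A B r1 r2 u <= 1.
Proof.
rewrite /plateau; have /andP[a0 a1] := ramp_bounds A r1 u.
have /andP[b0 b1] := ramp_bounds B r2 u.
have [uB|uB] := leP u B; first by rewrite (ramp0 r20 uB); apply/andP; split; lra.
rewrite (ramp1 r10); first by apply/andP; split; lra.
by apply: (le_trans AB); exact: ltW.
Qed.

Lemma plateau_eq0 (u : R) : u <= A \/ B + r2 <= u -> plateau A B r1 r2 u = 0.
Proof.
rewrite /plateau => -[uA|uB].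
  have uB : u <= B by move: r10 AB; lra.
  by rewrite (ramp0 r10 uA) (ramp0 r20 uB) subrr.
have uA : A + r1 <= u by move: r20 AB; lra.
by rewrite (ramp1 r20 uB) (ramp1 r10 uA) subrr.
Qed.

Lemma plateau_eq1 (u : R) : A + r1 <= u <= B -> plateau A B r1 r2 u = 1.
Proof. by move=> /andP[uA uB]; rewrite /plateau (ramp1 r10 uA) (ramp0 r20 uB) subr0. Qed.

End PlateauShape.

Lemma integral_segment_support (f : R -> R) (x y : R) :
  (forall u, u <= x \/ y <= u -> f u = 0) ->
  (\int[mu]_u (f u)%:E = \int[mu]_(u in `[x, y]) (f u)%:E)%E.
Proof.
move=> f0; rewrite [RHS]integral_mkcond; apply: eq_integral => u _.
rewrite /restrict; case: ifPn => // /negP; rewrite inE/= in_itv/= => H.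
by rewrite f0//; case: (leP x u) H => [xu|ux _]; [case: (leP u y) => // ? _; right|left]; exact: ltW.
Qed.

Lemma finite_mass (f : R -> R) (x y : R) : x <= y -> continuous f ->
  (forall u, 0 <= f u) -> (forall u, u <= x \/ y <= u -> f u = 0) ->
  exists2 m : R, 0 <= m & (\int[mu]_u (f u)%:E = m%:E)%E.
Proof.
move=> xy cf f0 fs; rewrite (integral_segment_support fs).
have /integrable_fin_num fin := @continuous_segment_integrable R f x y (continuous_subspaceT cf).
exists (fine (\int[mu]_(u in `[x, y]) (f u)%:E)%E).
  by rewrite fine_ge0// integral_ge0// => u _; rewrite lee_fin.
by rewrite fineK//; apply: fin; exact: measurable_itv.
Qed.

Lemma mass_le (f : R -> R) (x y m : R) : x <= y -> continuous f ->
  (forall u, 0 <= f u <= 1) -> (forall u, u <= x \/ y <= u -> f u = 0) ->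
  (\int[mu]_u (f u)%:E = m%:E)%E -> m <= y - x.
Proof.
move=> xy cf f0 fs; rewrite (integral_segment_support fs) => E.
rewrite -lee_fin -E; apply: le_trans (_ : \int[mu]_(u in `[x, y]) (cst 1%:E) u <= _)%E.
  apply: ge0_le_integral => //.
  - by move=> u _; rewrite lee_fin; have /andP[] := f0 u.
  - apply/measurable_EFinP; apply: measurable_funTS; exact: continuous_measurable_fun.
  - by move=> u _; rewrite lee_fin; have /andP[] := f0 u.
rewrite integral_cst//= mul1e lebesgue_measure_itv/= lte_fin.
by case: ltP => // _; rewrite lee_fin subr_ge0.
Qed.

Lemma mass_ge (f : R -> R) (x y m : R) : x <= y -> continuous f ->
  (forall u, 0 <= f u) -> (forall u, x <= u <= y -> 1 <= f u) ->
  (\int[mu]_u (f u)%:E = m%:E)%E -> y - x <= m.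
Proof.
move=> xy cf f0 f1 E.
have mf : measurable_fun setT (EFin \o f).
  by apply/measurable_EFinP; exact: continuous_measurable_fun.
rewrite -lee_fin -E; apply: (@le_trans _ _ (\int[mu]_(u in `[x, y]) (f u)%:E)%E); last first.
  by apply: ge0_subset_integral => // u _; rewrite lee_fin.
apply: (@le_trans _ _ (\int[mu]_(u in `[x, y]) (cst 1%:E) u)%E); last first.
  apply: ge0_le_integral => //; first exact: measurable_funTS.
rewrite integral_cst//= mul1e lebesgue_measure_itv/= lte_fin.
by case: ltP => // yx; rewrite lee_fin subr_le0.
Qed.

Lemma mass_of_primitive (f F : R -> R) (x y : R) : x < y -> continuous f ->
  (forall u : R, is_derive u 1 F (f u)) -> (forall u, u <= x \/ y <= u -> f u = 0) ->
  (\int[mu]_u (f u)%:E = (F y - F x)%:E)%E.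
Proof.
move=> xy cf dF fs; rewrite (integral_segment_support fs) EFinB.
have cF : continuous F.
  by move=> u; apply/differentiable_continuous/derivable1_diffP; have [] := dF u.
apply: continuous_FTC2 => //.
- exact: continuous_subspaceT.
- by split=> [u _||]; [have [] := dF u | apply: cvg_at_right_filter; exact: cF | apply: cvg_at_left_filter; exact: cF].
- by move=> u _; rewrite derive1E; have [_ ->] := dF u.
Qed.

(** The mass of an edge does not depend on its width or position. This is why the terms in T^2 on
    the slow and on the sharp edge cancel after integration. *)
Lemma edge_mass (A r d : R) : 0 < r -> d != 0 ->
  (\int[mu]_u (edge A r (d * u))%:E = (`|d|^-1)%:E)%E.
Proof.
move=> r0 d0.
have ce : continuous (fun u => edge A r (d * u)).
  exact/smooth1_continuous/smooth1_scale/smooth1_edge.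
pose F u := d^-1 * ramp A r (d * u).
have dF (u : R) : is_derive u 1 F (edge A r (d * u)).
  have d1 := is_derive_scale (is_derive_ramp A r (d * u)).
  apply: is_derive_eq (is_deriveM (is_derive_cst (d^-1 : R) u (1 : R)) d1) _.
  by rewrite /GRing.scale /= mulr0 addr0 mulrA mulVf// mul1r.
have [dpos|dneg|dE] := ltgtP 0 d; last by rewrite -dE eqxx in d0.
- have xy : A / d < (A + r) / d by rewrite ltr_pM2r ?invr_gt0// ltrDl.
  rewrite (mass_of_primitive xy ce dF) => [|u H].
    rewrite /F ![d * (_ / d)]mulrC !divfK// (ramp1 r0 (lexx _)) (ramp0 r0 (lexx _)).
    by rewrite mulr1 mulr0 subr0 gtr0_norm.
  by apply: edge_eq0 => //; case: H; rewrite ?ler_pdivlMr ?ler_pdivrMr// mulrC; [left|right].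
- have xy : (A + r) / d < A / d by rewrite ltr_nM2r ?invr_lt0// ltrDl.
  rewrite (mass_of_primitive xy ce dF) => [|u H].
    rewrite /F ![d * (_ / d)]mulrC !divfK// (ramp1 r0 (lexx _)) (ramp0 r0 (lexx _)).
    by rewrite mulr1 mulr0 sub0r ltr0_norm// invrN.
  by apply: edge_eq0 => //; case: H; rewrite ?ler_ndivlMr ?ler_ndivrMr// mulrC; [right|left].
Qed.

End Plateaus.

(** * Test functions concentrated near a characteristic *)

Section TestFunctions.
Context (R : realType) (a h : nat).
Context (bb : 'I_a -> 'I_a -> 'rV[R]_h) (c : 'I_a -> 'rV[R]_h).
Hypothesis bb_skew : forall j k, bb j k = - bb k j.
Local Notation pt := ('rV[R]_a * 'rV[R]_h)%type.
Local Notation cpt := (char_pt bb c).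
Local Notation hb := (half_bracket bb).

Lemma smooth_coordinate i : smooth (fun w : pt => coordinate w i).
Proof.
apply: smooth_functional => [w|x t v].
  apply/cvgrPdist_le => e e0; apply: filterS (nbhs_norm_le w e0) => q qw.
  apply: le_trans qw; rewrite distrC.
  have -> : coordinate q i - coordinate w i = coordinate (q - w) i.
    by case: i => k; rewrite /= !mxE.
  exact: coordinate_le.
by case: i => k; rewrite /= !mxE.
Qed.

Lemma smooth_half_bracket j i : smooth (fun w : pt => hb j w.1 ord0 i).
Proof.
apply: smooth_functional => [w|x t v]; last first.
  by rewrite /= half_bracketD half_bracketZ !mxE.
have b0 : 0 < bb_bound bb + 1 by rewrite ltr_wpDl ?bb_bound_ge0.
apply/cvgrPdist_le => e e0.
apply: filterS (nbhs_norm_le w (divr_gt0 e0 b0)) => q.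
rewrite /= ler_pdivlMr// => qw; apply: le_trans qw; rewrite distrC.
have -> : hb j q.1 ord0 i - hb j w.1 ord0 i = hb j (q.1 - w.1) ord0 i.
  have -> : q.1 - w.1 = q.1 + (-1) *: w.1 by rewrite scaleN1r.
  by rewrite half_bracketD half_bracketZ !mxE mulN1r.
apply: (le_trans (row_coord_le _ _)); apply: (le_trans (half_bracket_le _ _ _)).
rewrite mulrC ler_pM ?bb_bound_ge0 ?lerDl//.
exact: (pair_norm1_le (q - w)).
Qed.

Variables (j : 'I_a) (i0 : 'I_h) (x0 : 'rV[R]_a) (y0 : 'rV[R]_h).
Variables (Ta dT : R -> R) (bp : R -> R) (be : 'I_h -> R).
Hypothesis sT : smooth1 Ta.
Hypothesis DT : forall t : R, is_derive t 1 Ta (dT t).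
Hypothesis sbp : smooth1 bp.
Hypothesis be0 : be i0 = 0.
Hypothesis beC : forall i, i != i0 -> c j ord0 i + be i * c j ord0 i0 = 0.

Definition time_of (x : 'rV[R]_a) : R := x ord0 j - x0 ord0 j.
(** Added to the vertical coordinate i, it gives the vertical deviation from the curve u = Ta t
    through (x0, y0), t being the time read off from coordinate j; the deviation vanishes on the
    curve. *)
Definition al (i : 'I_h) (x : 'rV[R]_a) : R :=
  - y0 ord0 i + (time_of x * hb j x ord0 i + Ta (time_of x) * c j ord0 i).
Definition at_index (I : eqType) (k0 : I) (F G : R -> R) (k : I) : R -> R :=
  if k == k0 then F else G.
Definition tweight (F G : R -> R) : pt -> R :=
  weight (at_index j F bp) (at_index i0 G bp) x0 al be i0.
Definition height (w : pt) : R := w.2 ord0 i0 + al i0 w.1.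
(** The multiple [be i] of the height cancels the i-th component of [c j]. These coordinates are
    therefore constant along both [Lvec] and [Cvec], and derivatives of the weight fall only on the
    profiles in time and height. *)
Definition transverse (i : 'I_h) (w : pt) : R :=
  w.2 ord0 i + (al i w.1 + be i * height w).
Definition cross (w : pt) : R :=
  (\prod_(k | k != j) bp (w.1 ord0 k - x0 ord0 k)) *
  \prod_(i | i != i0) bp (transverse i w).

Lemma tweightE F G w :
  tweight F G w = cross w * (F (time_of w.1) * G (height w)).
Proof.
rewrite /tweight /weight (bigD1 j)//= (bigD1 i0)//= /at_index !eqxx be0 mul0r addr0.
rewrite /cross mulrACA [RHS]mulrC; congr (_ * (_ * _)).
  by apply: eq_bigr => k /negPf ->.
by apply: eq_bigr => i /negPf ->.
Qed.

Lemma smooth1_at_index (I : eqType) (k0 : I) F G k :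
  smooth1 F -> smooth1 G -> smooth1 (at_index k0 F G k).
Proof. by rewrite /at_index; case: ifP. Qed.

Lemma smooth_time_of : smooth (fun w : pt => time_of w.1).
Proof. by apply: smoothB; [exact: (smooth_coordinate (inl j)) | exact: smooth_cst]. Qed.

Lemma smooth_al i : smooth (fun w : pt => al i w.1).
Proof.
apply: smoothD; first exact: smooth_cst.
apply: smoothD; first by apply: smoothM; [exact: smooth_time_of | exact: smooth_half_bracket].
by apply: smoothM; [exact: (smooth_comp sT smooth_time_of) | exact: smooth_cst].
Qed.

Lemma smooth_tweight F G : smooth1 F -> smooth1 G -> smooth (tweight F G).
Proof.
move=> sF sG; apply: smoothM; apply: smooth_prod => k _.
  apply: (smooth_comp (smooth1_at_index j k sF sbp)).
  by apply: smoothB; [exact: (smooth_coordinate (inl k)) | exact: smooth_cst].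
apply: (smooth_comp (smooth1_at_index i0 k sG sbp)).
apply: smoothD; first exact: (smooth_coordinate (inr k)).
apply: smoothD; first exact: smooth_al.
apply: smoothZ; apply: smoothD; last exact: smooth_al.
exact: (smooth_coordinate (inr i0)).
Qed.

(** The projected field splits as D^f_j = [Lvec] - f [Cvec], so that D^f_j f is formally L_j f minus
    half the derivative of f^2 along [Cvec]. *)
Definition Lvec (w : pt) : pt := (delta_mx ord0 j, - hb j w.1).
Definition Cvec : pt := (0, c j).

Lemma time_of_shift x (s : R) : time_of (x + s *: delta_mx ord0 j) = time_of x + s.
Proof. by rewrite /time_of !mxE !eqxx mulr1; ring. Qed.

Lemma half_bracket_shift x (s : R) : hb j (x + s *: delta_mx ord0 j) = hb j x.
Proof. by rewrite half_bracketD half_bracketZ half_bracket_deltaj// scaler0 addr0. Qed.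

Lemma al_shift i x (s : R) : al i (x + s *: delta_mx ord0 j) =
  al i x + s * hb j x ord0 i + (Ta (time_of x + s) - Ta (time_of x)) * c j ord0 i.
Proof. by rewrite /al time_of_shift half_bracket_shift; ring. Qed.

Lemma height_L w (s : R) : height (w + s *: Lvec w) =
  height w + (Ta (time_of w.1 + s) - Ta (time_of w.1)) * c j ord0 i0.
Proof. by rewrite /height /= al_shift !mxE; ring. Qed.

Lemma transverse_L i w (s : R) : i != i0 ->
  transverse i (w + s *: Lvec w) = transverse i w.
Proof.
move=> ii; rewrite /transverse height_L /= al_shift !mxE.
have -> : c j ord0 i = - (be i * c j ord0 i0).
  by apply/eqP; rewrite -addr_eq0; apply/eqP; exact: beC.
ring.
Qed.

Lemma cross_L w (s : R) : cross (w + s *: Lvec w) = cross w.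
Proof.
rewrite /cross; congr (_ * _); apply: eq_bigr => k kj; last by rewrite transverse_L.
by rewrite /= !mxE (negPf kj) andbF mulr0 addr0.
Qed.

Lemma height_C w (s : R) : height (w + s *: Cvec) = height w + s * c j ord0 i0.
Proof. by rewrite /height /= scaler0 addr0 !mxE; ring. Qed.

Lemma cross_C w (s : R) : cross (w + s *: Cvec) = cross w.
Proof.
rewrite /cross; congr (_ * _); apply: eq_bigr => k kj.
  by rewrite /= scaler0 addr0.
rewrite /transverse height_C /= scaler0 addr0 !mxE; congr bp.
have -> : c j ord0 k = - (be k * c j ord0 i0).
  by apply/eqP; rewrite -addr_eq0; apply/eqP; exact: beC.
ring.
Qed.

Section Derivatives.
Variables (F F' G G' : R -> R).
Hypothesis dF : forall t : R, is_derive t 1 F (F' t).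
Hypothesis dG : forall t : R, is_derive t 1 G (G' t).

Lemma tweight_derive_L w : 'D_(Lvec w) (tweight F G) w =
  cross w * (F' (time_of w.1) * G (height w)
    + F (time_of w.1) * (G' (height w) * (c j ord0 i0 * dT (time_of w.1)))).
Proof.
apply: (@derive_val _ _ _ _ _ _ _ _); apply: is_derive_dir.
set t := time_of w.1; set u := height w; set c0 := c j ord0 i0.
have -> : (fun s : R => tweight F G (w + s *: Lvec w)) = (fun s : R =>
    cross w * (F (t + s) * G (u + (Ta (t + s) - Ta t) * c0))).
  by apply/funext => s; rewrite tweightE cross_L height_L /= time_of_shift.
have shift_d (f f' : R -> R) : (forall x : R, is_derive x 1 f (f' x)) ->
    is_derive (0 : R) 1 (fun s : R => f (t + s)) (f' t).
  move=> df; have df' : is_derive (1 * 0 + t) 1 f (f' t) by rewrite mulr0 add0r.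
  have := is_derive_affine df'; rewrite mul1r.
  by under [X in is_derive _ _ X _ -> _]eq_fun do rewrite mul1r addrC.
have d1 := shift_d _ _ dF.
have d2 : is_derive (0 : R) 1 (fun s : R => u + (Ta (t + s) - Ta t) * c0) (c0 * dT t).
  have d3 := is_deriveM (is_deriveB (shift_d _ _ DT) (is_derive_cst (Ta t : R) (0 : R) (1 : R)))
    (is_derive_cst (c0 : R) (0 : R) (1 : R)).
  apply: is_derive_eq (is_deriveD (is_derive_cst (u : R) (0 : R) (1 : R)) d3) _.
  by rewrite /GRing.scale /= subr0 mulr0 !add0r.
have dG0 : is_derive (u + (Ta (t + 0) - Ta t) * c0) 1 G (G' u).
  by rewrite addr0 subrr mul0r addr0.
have d4 := @is_derive1_comp _ G (fun s : R => u + (Ta (t + s) - Ta t) * c0) 0 _ _ dG0 d2.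
apply: is_derive_eq (is_deriveM (is_derive_cst (cross w : R) (0 : R) (1 : R))
  (is_deriveM d1 d4)) _.
rewrite /GRing.scale /= addr0 subrr mul0r addr0 mulr0 addr0.
by congr (_ * _); rewrite addrC [G u * _]mulrC.
Qed.

Lemma tweight_derive_C w : 'D_Cvec (tweight F G) w =
  cross w * (F (time_of w.1) * (G' (height w) * c j ord0 i0)).
Proof.
apply: (@derive_val _ _ _ _ _ _ _ _); apply: is_derive_dir.
set t := time_of w.1; set u := height w; set c0 := c j ord0 i0.
have -> : (fun s : R => tweight F G (w + s *: Cvec)) = (fun s : R =>
    cross w * F t * G (c0 * s + u)).
  by apply/funext => s; rewrite tweightE cross_C height_C /= scaler0 addr0 mulrA [s * _]mulrC addrC.
have dG0 : is_derive (c0 * 0 + u) 1 G (G' u) by rewrite mulr0 add0r.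
apply: is_derive_eq (is_deriveM (is_derive_cst (cross w * F t : R) (0 : R) (1 : R))
  (is_derive_affine dG0)) _.
by rewrite /GRing.scale /= mulr0 addr0 -!mulrA [c0 * _]mulrC.
Qed.

End Derivatives.

(** Where [cross] does not vanish, the horizontal coordinates other than j and the transverse ones
    are at most eta away from the curve. What remains is the height and the gap between tau and its
    smooth approximation Ta; this locates the support of the test function. *)
Lemma near_curve (eta Be : R) w (tau : R) : 0 <= eta ->
  (forall u, eta <= `|u| -> bp u = 0) -> (forall i, `|be i| <= Be) ->
  cross w != 0 ->
  `|w - cpt j 1 (x0, y0) (time_of w.1) tau| <=
    (1 + `|time_of w.1| * bb_bound bb) * eta + (1 + Be) * `|height w|
      + c_bound c * `|tau - Ta (time_of w.1)|.
Proof.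
move=> eta0 bpe beB; rewrite mulf_eq0 negb_or => /andP[].
rewrite !prodf_seq_neq0 => /allP Hx /allP Hy.
set t := time_of w.1.
have bpP u : bp u != 0 -> `|u| <= eta.
  by rewrite leNgt; apply: contra => /ltW/bpe ->.
have Be0 : 0 <= Be by apply: le_trans (beB i0).
have xk k : k != j -> `|w.1 ord0 k - x0 ord0 k| <= eta.
  by move=> kj; apply: bpP; have /implyP := Hx k (mem_index_enum k); apply.
have yi i : i != i0 -> `|transverse i w| <= eta.
  by move=> ii; apply: bpP; have /implyP := Hy i (mem_index_enum i); apply.
pose v := w.1 - x0 - t *: delta_mx ord0 j.
have v_le : `|v| <= eta.
  apply: row_norm_le => // k; rewrite !mxE; have [->|kj] := eqVneq k j.
    by rewrite eqxx mulr1 /t /time_of subrr normr0.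
  by rewrite andbF mulr0 subr0; exact: xk.
have hbE : hb j w.1 = hb j x0 + hb j v.
  have -> : w.1 = x0 + v + t *: delta_mx ord0 j by rewrite /v addrA addrNK [x0 + _]addrC subrK.
  by rewrite half_bracket_shift half_bracketD.
have hv i : `|hb j v ord0 i| <= bb_bound bb * eta.
  apply: (le_trans (row_coord_le _ _)); apply: (le_trans (half_bracket_le _ _ _)).
  by rewrite ler_wpM2l// bb_bound_ge0.
have tb0 : 0 <= `|t| * bb_bound bb by rewrite mulr_ge0// bb_bound_ge0.
have cb0 : 0 <= c_bound c * `|tau - Ta t| by rewrite mulr_ge0// c_bound_ge0.
have Bh0 : 0 <= (1 + Be) * `|height w| by rewrite mulr_ge0// addr_ge0.
rewrite pair_norm_le; apply/andP; split.
  have -> : (w - cpt j 1 (x0, y0) t tau).1 = v by rewrite /= mul1r opprD addrA.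
  apply: (le_trans v_le); rewrite -addrA -[leLHS]addr0 lerD//; last exact: addr_ge0.
  by rewrite mulrDl mul1r lerDl mulr_ge0.
apply: row_norm_le; first by rewrite !addr_ge0// mulr_ge0// addr_ge0.
move=> i; have cE := c_le c j; have ci := le_trans (row_coord_le (c j) i) cE.
set y := w.2 ord0 i + al i w.1.
have -> : (w - cpt j 1 (x0, y0) t tau).2 ord0 i =
    y - t * hb j v ord0 i + (tau - Ta t) * c j ord0 i.
  rewrite /y /al hbE /= scale1r !mxE -/t; ring.
have yE : `|y| <= eta + (1 + Be) * `|height w|.
  have [ii|ii] := eqVneq i i0.
    rewrite /y ii -/(height w); apply: (@le_trans _ _ ((1 + Be) * `|height w|)).
      by rewrite mulrDl mul1r lerDl mulr_ge0.
    by rewrite lerDr.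
  have -> : y = transverse i w - be i * height w by rewrite /y /transverse; ring.
  rewrite (le_trans (ler_normB _ _))// lerD ?yi// normrM ler_wpM2r//.
  by apply: (le_trans (beB i)); rewrite lerDr.
rewrite (le_trans (ler_normD _ _))// lerD//; last first.
  by rewrite normrM mulrC ler_wpM2r.
rewrite (le_trans (ler_normB _ _))//.
apply: (le_trans (lerD yE (_ : _ <= `|t| * (bb_bound bb * eta)))).
  by rewrite normrM ler_wpM2l.
by rewrite [in leRHS]mulrDl mul1r mulrA addrAC.
Qed.

End TestFunctions.

Section WeightedIntegrals.
Context (R : realType) (a h : nat).
Local Notation pt := ('rV[R]_a * 'rV[R]_h)%type.
Local Notation mu := (@lebesgue_measure R).

Section Oball.
Variables (U : set pt) (w0 : pt) (rho : R).
Hypotheses (oU : open U) (rho0 : 0 <= rho) (bU : forall w, `|w - w0| <= rho -> U w).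
Implicit Types f g : pt -> R.
Local Notation B := (oball w0 rho).

Lemma integral2D f g : {within U, continuous f} -> {within U, continuous g} ->
  integral2 B (fun w => f w + g w) = integral2 B f + integral2 B g.
Proof.
move=> cf cg; apply: RintegralD; first exact: measurable_oball.
  exact: (integrable_oball oU rho0 bU cf).
exact: (integrable_oball oU rho0 bU cg).
Qed.

Lemma integral2Z f (k : R) : {within U, continuous f} ->
  integral2 B (fun w => k * f w) = k * integral2 B f.
Proof.
move=> cf; apply: RintegralZl; first exact: measurable_oball.
exact: (integrable_oball oU rho0 bU cf).
Qed.

Lemma le_integral2 f g : {within U, continuous f} -> {within U, continuous g} ->
  (forall w, B w -> f w <= g w) -> integral2 B f <= integral2 B g.
Proof.
move=> cf cg fg; apply: le_Rintegral; first exact: measurable_oball.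
- exact: (integrable_oball oU rho0 bU cf).
- exact: (integrable_oball oU rho0 bU cg).
- by move=> p; exact: fg.
Qed.

End Oball.

Lemma within_continuousD (U : set pt) (f g : pt -> R) : {within U, continuous f} ->
  {within U, continuous g} -> {within U, continuous (fun w => f w + g w)}.
Proof. by move=> cf cg x; apply: cvgD; [exact: cf | exact: cg]. Qed.

Lemma within_continuousM (U : set pt) (f g : pt -> R) : {within U, continuous f} ->
  {within U, continuous g} -> {within U, continuous (fun w => f w * g w)}.
Proof. by move=> cf cg x; apply: cvgM; [exact: cf | exact: cg]. Qed.

Lemma within_continuousZ (U : set pt) (f : pt -> R) (k : R) :
  {within U, continuous f} -> {within U, continuous (fun w => k * f w)}.
Proof. by move=> cf x; apply: cvgM; [exact: cvg_cst | exact: cf]. Qed.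

Context (bb : 'I_a -> 'I_a -> 'rV[R]_h) (c : 'I_a -> 'rV[R]_h).
Variables (j : 'I_a) (i0 : 'I_h) (x0 : 'rV[R]_a) (y0 : 'rV[R]_h).

(** The factors in [bp] are common to all the weights, so in the final inequality they divide out as
    one positive constant. *)
Lemma tweight_integral (Ta bp : R -> R) (be : 'I_h -> R) (D : set pt)
    (F G : R -> R) (mF mG mb : R) :
  (forall i : 'I_h, (i0 <= i)%N -> be i = 0) ->
  smooth1 Ta -> smooth1 bp -> smooth1 F -> smooth1 G ->
  (forall u, 0 <= bp u) -> (forall u, 0 <= F u) -> (forall u, 0 <= G u) ->
  (forall w, ~ D w -> tweight bb c j i0 x0 y0 Ta bp be F G w = 0) ->
  (\int[mu]_x (F x)%:E = mF%:E)%E -> (\int[mu]_x (G x)%:E = mG%:E)%E ->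
  (\int[mu]_x (bp x)%:E = mb%:E)%E ->
  integral2 D (tweight bb c j i0 x0 y0 Ta bp be F G) =
  (\prod_(k | k != j) mb) * (\prod_(i | i != i0) mb) * (mF * mG).
Proof.
move=> be0 sT sbp sF sG bp0 F0 G0 WD EF EG Eb.
have cw : continuous (tweight bb c j i0 x0 y0 Ta bp be F G).
  exact/smooth_continuous/smooth_tweight.
have H := @integral2_weight R a h (at_index j F bp) (at_index i0 G bp) x0
  (al bb c j x0 y0 Ta) be i0 be0 _ _ _ _ D (fun k => if k == j then mF else mb)
  (fun i => if i == i0 then mG else mb) cw WD.
rewrite /tweight H.
- rewrite (bigD1 j)//= (bigD1 i0)//= !eqxx mulrACA mulrC; congr (_ * _ * _).
    by apply: eq_bigr => k /negPf ->.
  by apply: eq_bigr => k /negPf ->.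
- by move=> k; exact/smooth1_continuous/smooth1_at_index.
- by move=> i; exact/smooth1_continuous/smooth1_at_index.
- by move=> k u; rewrite /at_index; case: ifP.
- by move=> k u; rewrite /at_index; case: ifP.
- by move=> k; rewrite /at_index; case: ifP.
- by move=> k; rewrite /at_index; case: ifP.
Qed.

Lemma nonneg_factor (x y : R) : 0 <= x -> (x != 0 -> 0 <= y) -> 0 <= x * y.
Proof.
by move=> x0'; have [->|xn /(_ isT) y0'] := eqVneq x 0; [rewrite mul0r | exact: mulr_ge0].
Qed.

(* The transport term is q ga (ri - sh) ((f - T)^2 - T^2) / 2: on the rising
   edge (f - T)^2 has a favourable sign, on the sharp edge it is small. *)
Lemma pointwise_balance (q f g e0 e1 F G ri sh ga T A0 A1 eps Lam : R) :
  0 <= q -> 0 <= e0 -> 0 <= e1 -> 0 <= F -> 0 <= G -> 0 <= ri -> 0 <= sh ->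
  0 <= ga ->
  (q * e1 * G != 0 -> A1 <= f) -> (q * e0 * G != 0 -> f <= A0) ->
  (q * F * sh != 0 -> (f - T) ^+ 2 <= eps) -> (q * F * G != 0 -> g <= Lam) ->
  q * (A1 * (e1 * G)) - q * (A0 * (e0 * G)) - 2^-1 * (ga * eps) * (q * (F * sh))
    - 2^-1 * ga * (q * (F * T ^+ 2 * ri)) + 2^-1 * ga * (q * (F * T ^+ 2 * sh))
    - Lam * (q * (F * G)) <=
  - f * (q * ((e0 - e1) * G + F * (ga * (ri - sh) * T)))
    + 2^-1 * f ^+ 2 * (q * (F * (ga * (ri - sh)))) - g * (q * (F * G)).
Proof.
move=> q0 e00 e10 F0 G0 ri0 sh0 ga0 H1 H0 Hs Hg; rewrite -subr_ge0.
have -> : (- f * (q * ((e0 - e1) * G + F * (ga * (ri - sh) * T)))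
    + 2^-1 * f ^+ 2 * (q * (F * (ga * (ri - sh)))) - g * (q * (F * G))) -
  (q * (A1 * (e1 * G)) - q * (A0 * (e0 * G)) - 2^-1 * (ga * eps) * (q * (F * sh))
    - 2^-1 * ga * (q * (F * T ^+ 2 * ri)) + 2^-1 * ga * (q * (F * T ^+ 2 * sh))
    - Lam * (q * (F * G))) =
  q * e1 * G * (f - A1) + q * e0 * G * (A0 - f)
  + 2^-1 * ga * (q * F * ri * (f - T) ^+ 2)
  + 2^-1 * ga * (q * F * sh * (eps - (f - T) ^+ 2)) + q * F * G * (Lam - g) by field.
have half0 : 0 <= 2^-1 * ga by rewrite mulr_ge0.
rewrite !addr_ge0//.
- by apply: nonneg_factor => [|/H1]; [rewrite !mulr_ge0 | rewrite subr_ge0].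
- by apply: nonneg_factor => [|/H0]; [rewrite !mulr_ge0 | rewrite subr_ge0].
- by rewrite mulr_ge0// mulr_ge0 ?sqr_ge0// !mulr_ge0.
- rewrite mulr_ge0//.
  by apply: nonneg_factor => [|/Hs]; [rewrite !mulr_ge0 | rewrite subr_ge0].
- by apply: nonneg_factor => [|/Hg]; [rewrite !mulr_ge0 | rewrite subr_ge0].
Qed.

End WeightedIntegrals.

(** * Weak solutions *)

Section WindowArithmetic.
Context (R : realType).
Implicit Types (x y e : R).

Lemma half_le x (rho : R) : 0 < rho -> x <= rho / 2 -> x <= rho.
Proof. by move=> r0 H; apply: (le_trans H); lra. Qed.

Lemma thirds_le x (M D : R) : M <= D -> x <= D / 3 -> M / 3 + x + M / 3 <= D.
Proof. by lra. Qed.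

Lemma quarter_lt x y (D rho : R) : 0 < rho -> x <= D -> D <= rho / 4 ->
  y <= rho / 2 -> x + y < rho.
Proof. by lra. Qed.

Lemma dist_bounds x y e : `|x - y| <= e -> y - e <= x /\ x <= y + e.
Proof. by rewrite ler_norml => /andP[? ?]; split; lra. Qed.

Lemma sqr_dist_le x y (z e : R) : 0 <= e -> `|x - y| <= e / 2 ->
  `|y - z| <= e / 2 -> (x - z) ^+ 2 <= e ^+ 2.
Proof.
move=> e0 H1 H2; rewrite -ler_sqrt ?sqr_ge0// !sqrtr_sqr (ger0_norm e0).
by rewrite -(subrKA y) (le_trans (ler_normD _ _))// (splitr e) lerD.
Qed.

Lemma window_total (f0 f1 e L o s : R) : f1 - e - (f0 + e) <= L + o + s ->
  o <= e -> f1 - f0 <= L + (3 * e + s).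
Proof. by lra. Qed.

Lemma bump_eq0 (s S P : R -> R) (eta u : R) : smooth_step s S P -> 0 < eta ->
  eta <= `|u| -> plateau S (- eta) (eta / 2) (eta / 2) (eta / 2) u = 0.
Proof.
move=> step eta0 H; have eta20 : 0 < eta / 2 by rewrite divr_gt0.
have sh : - eta + eta / 2 <= eta / 2 by lra.
apply: (plateau_eq0 step eta20 eta20 sh).
have [u0|u0] := leP 0 u; [right|left]; move: H.
  by rewrite ger0_norm//; lra.
by rewrite ltr0_norm//; lra.
Qed.

End WindowArithmetic.

Section WeakBalance.
Context (R : realType) (a h : nat).
Context (bb : 'I_a -> 'I_a -> 'rV[R]_h) (c : 'I_a -> 'rV[R]_h).
Hypothesis bb_skew : forall j k, bb j k = - bb k j.
Local Notation pt := ('rV[R]_a * 'rV[R]_h)%type.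
Local Notation cpt := (char_pt bb c).
Local Notation mu := (@lebesgue_measure R).

(* The weak form, in the direction X_j, of the balance law
   X_j f - div_y (f^2 c_j) / 2 = g; L_j is formally skew-adjoint. *)
Definition weak_balance (U : set pt) (f g : pt -> R) j : Prop :=
  forall xi, test_function U xi ->
    integral2 U (fun w => - f w * 'D_(Lvec bb j w) xi w
      + 2^-1 * f w ^+ 2 * 'D_(Cvec c j) xi w) =
    integral2 U (fun w => g w * xi w).

Section OneSided.
Variables (U : set pt) (f g : pt -> R) (j : 'I_a) (i0 : 'I_h).
Variables (w0 x : pt) (rho r Lam : R) (tau : R -> R).
Hypothesis oU : open U.
Hypothesis cf : {within U, continuous f}.
Hypothesis cg : {within U, continuous g}.
Hypothesis wb : weak_balance U f g j.
Hypothesis c_last : forall i : 'I_h, (i0 < i)%N -> c j ord0 i = 0.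
Hypothesis c_zero : c j ord0 i0 = 0 -> c j = 0.
Hypothesis rho0 : 0 < rho.
Hypothesis bU : forall w, `|w - w0| <= rho -> U w.
Hypothesis gLam : forall w, `|w - w0| <= rho -> g w <= Lam.
Hypothesis sol : char_solution bb c f j 1 x r tau.
Hypothesis ball_sol : forall t, 0 <= t <= r -> `|cpt j 1 x t (tau t) - w0| <= rho / 2.

Let p (t : R) := cpt j 1 x t (tau t).
Let c0 : R := c j ord0 i0.
Let be (i : 'I_h) : R := if i == i0 then 0 else - (c j ord0 i / c0).
(** Rescales the height so that [ga] = d c0 is 1, or 0 in the linear case c_j = 0. Its sign puts the
    slow edge on the side where the square has the favourable sign. *)
Let d : R := if c0 == 0 then 1 else c0^-1.
Let ga : R := d * c0.

Let d_neq0 : d != 0.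
Proof. by rewrite /d; case: ifPn => [_|c00]; rewrite ?oner_neq0 ?invr_eq0. Qed.

Let ga_ge0 : 0 <= ga.
Proof. by rewrite /ga /d; case: eqVneq => [->|c00]; rewrite ?mulr0 ?mulVf. Qed.

Let ga_le1 : ga <= 1.
Proof. by rewrite /ga /d; case: eqVneq => [->|c00]; rewrite ?mulr0 ?mulVf. Qed.

Let be0 (i : 'I_h) : (i0 <= i)%N -> be i = 0.
Proof.
rewrite /be leq_eqVlt => /orP[/eqP/val_inj <-|ii]; first by rewrite eqxx.
by rewrite c_last// mul0r oppr0; case: ifP.
Qed.

Let beC i : i != i0 -> c j ord0 i + be i * c j ord0 i0 = 0.
Proof.
move=> ii; rewrite /be (negPf ii) -/c0; have [c00|c00] := eqVneq c0 0.
  by rewrite c_zero// mxE c00 mulr0 addr0.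
by rewrite mulNr divfK// subrr.
Qed.

Section Windows.
Variables (s S P : R -> R).
Hypothesis step : smooth_step s S P.
Variables (Ta dT : R -> R) (eta om ww ka e1 t0 t1 : R).
Hypothesis sT : smooth1 Ta.
Hypothesis DT : forall t : R, is_derive t 1 Ta (dT t).
Hypotheses (eta0 : 0 < eta) (om0 : 0 < om) (ww0 : 0 < ww) (ka0 : 0 < ka).
Hypothesis kaw : ka <= ww / 2.
Hypotheses (t0om : 0 <= t0) (t01 : t0 + om <= t1) (t1r : t1 + om <= r).

Let bp := plateau S (- eta) (eta / 2) (eta / 2) (eta / 2).
Let F := plateau S t0 t1 om om.
(** The profile in the rescaled height lives on [- 2 ww, 0]: it rises over the width ww and falls
    over the last ka before the curve. Since ka may be taken small at fixed ww, the falling edge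
    sees only values of f close to dT. *)
Let Gs := plateau S (- (2 * ww)) (- ka) ww ka.
Let G u := Gs (d * u).
Let ri u := edge s (- (2 * ww)) ww (d * u).
Let sh u := edge s (- ka) ka (d * u).
Local Notation W := (tweight bb c j i0 x.1 x.2 Ta bp be).
Local Notation q := (cross bb c j i0 x.1 x.2 Ta bp be).
Local Notation tm w := (time_of j x.1 w.1).
Local Notation ht := (height bb c j i0 x.1 x.2 Ta).
Local Notation B := (oball w0 rho).

Hypothesis stay : forall w, q w != 0 -> 0 <= tm w <= r -> `|d * ht w| <= 2 * ww ->
  `|w - w0| < rho.

Let bp_shape : - eta + eta / 2 <= eta / 2.
Proof. by move: eta0; lra. Qed.

Let eta20 : 0 < eta / 2. Proof. by rewrite divr_gt0. Qed.

Let Gs_shape : - (2 * ww) + ww <= - ka.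
Proof. by move: ww0 kaw; lra. Qed.

Let bp_ge0 u : 0 <= bp u.
Proof. by have /andP[] := plateau_bounds step eta20 eta20 bp_shape u. Qed.

Let F_ge0 u : 0 <= F u.
Proof. by have /andP[] := plateau_bounds step om0 om0 t01 u. Qed.

Let Gs_ge0 u : 0 <= Gs u.
Proof. by have /andP[] := plateau_bounds step ww0 ka0 Gs_shape u. Qed.

Let sbp : smooth1 bp. Proof. exact: (smooth1_plateau step). Qed.
Let sF : smooth1 F. Proof. exact: (smooth1_plateau step). Qed.
Let sG : smooth1 G.
Proof. by apply: smooth1_scale; exact: (smooth1_plateau step). Qed.
Let sri : smooth1 ri. Proof. by apply: smooth1_scale; exact: (smooth1_edge step). Qed.
Let ssh : smooth1 sh. Proof. by apply: smooth1_scale; exact: (smooth1_edge step). Qed.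
Let sdT : smooth1 dT. Proof. exact: smooth1_derivative sT DT. Qed.

Let dF (t : R) : is_derive t 1 F (edge s t0 om t - edge s t1 om t).
Proof. exact: (is_derive_plateau step). Qed.

Let dG (u : R) : is_derive u 1 G (d * (ri u - sh u)).
Proof. by apply: is_derive_scale; exact: (is_derive_plateau step). Qed.

Let Fout (t : R) : ~ (0 <= t <= r) -> t <= t0 \/ t1 + om <= t.
Proof.
move=> H; have [|tt0] := leP t t0; first by left.
have [|tt1] := leP (t1 + om) t; first by right.
by case: H; apply/andP; split; move: t0om t1r tt0 tt1; lra.
Qed.

Let Gout (u : R) : 2 * ww < `|u| -> u <= - (2 * ww) \/ 0 <= u.
Proof.
have [|u0] := leP 0 u; first by right.
by rewrite ltr0_norm// => H; left; lra.
Qed.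

Let WE F1 G1 w : W F1 G1 w = q w * (F1 (tm w) * G1 (ht w)).
Proof. by apply: tweightE; exact: be0. Qed.

Let W_out (F1 G1 : R -> R) w : (forall t, ~ (0 <= t <= r) -> F1 t = 0) ->
  (forall u, 2 * ww < `|d * u| -> G1 u = 0) -> ~ B w -> W F1 G1 w = 0.
Proof.
move=> F1out G1out nB; rewrite WE.
have [->|q0] := eqVneq (q w) 0; first by rewrite mul0r.
have [tr|/negP ntr] := boolP (0 <= tm w <= r); last by rewrite F1out// mul0r mulr0.
have [ur|ur] := leP `|d * ht w| (2 * ww); last by rewrite G1out// !mulr0.
by case: nB; exact: stay.
Qed.

Let F_out t : ~ (0 <= t <= r) -> F t = 0.
Proof. by move=> /Fout; exact: (plateau_eq0 step om0 om0 t01). Qed.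

Let e0_out t : ~ (0 <= t <= r) -> edge s t0 om t = 0.
Proof.
move=> /Fout[H|H]; apply: (edge_eq0 step om0); [by left|right].
by move: H t01 om0; lra.
Qed.

Let e1_out t : ~ (0 <= t <= r) -> edge s t1 om t = 0.
Proof.
move=> /Fout[H|H]; apply: (edge_eq0 step om0); [left|by right].
by move: H t01 om0; lra.
Qed.

Let G_out u : 2 * ww < `|d * u| -> G u = 0.
Proof.
move=> /Gout H; apply: (plateau_eq0 step ww0 ka0 Gs_shape).
by rewrite addNr.
Qed.

Let ri_out u : 2 * ww < `|d * u| -> ri u = 0.
Proof.
move=> /Gout[H|H]; apply: (edge_eq0 step ww0); [by left|right].
by move: H ww0; lra.
Qed.

Let sh_out u : 2 * ww < `|d * u| -> sh u = 0.
Proof.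
move=> /Gout[H|H]; apply: (edge_eq0 step ka0); [left|right].
  by move: H ww0 kaw; lra.
by rewrite addNr.
Qed.

Let mass_bp : exists2 mb : R, 0 < mb & (\int[mu]_u (bp u)%:E = mb%:E)%E.
Proof.
have cb := smooth1_continuous sbp.
have xy : - eta <= eta / 2 + eta / 2 by move: eta0; lra.
have [mb _ E] := finite_mass xy cb bp_ge0 (plateau_eq0 step eta20 eta20 bp_shape).
exists mb => //; have xy' : - eta + eta / 2 <= eta / 2 := bp_shape.
have b1 u : - eta + eta / 2 <= u <= eta / 2 -> 1 <= bp u.
  by move=> H; rewrite /bp (plateau_eq1 step eta20 eta20 H).
by have := mass_ge xy' cb bp_ge0 b1 E; move: eta0; lra.
Qed.

Let mass_F : exists2 mF : R, (\int[mu]_u (F u)%:E = mF%:E)%E &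
  0 <= mF <= r /\ `|mF - (t1 - t0)| <= om.
Proof.
have cF := smooth1_continuous sF.
have xy : t0 <= t1 + om by move: t01 om0; lra.
have [mF mF0 E] := finite_mass xy cF F_ge0 (plateau_eq0 step om0 om0 t01).
exists mF => //.
have H1 := mass_le xy cF (plateau_bounds step om0 om0 t01)
  (plateau_eq0 step om0 om0 t01) E.
have b1 u : t0 + om <= u <= t1 -> 1 <= F u by move=> H; rewrite /F (plateau_eq1 step om0 om0 H).
have H2 := mass_ge t01 cF F_ge0 b1 E.
split; first by rewrite mF0/=; move: H1 t0om t1r; lra.
by rewrite ler_norml; apply/andP; split; move: H1 H2; lra.
Qed.

Let mass_G : exists2 mG : R, (\int[mu]_u (G u)%:E = mG%:E)%E & ww / 2 <= mG * `|d|.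
Proof.
have cG := smooth1_continuous sG.
have nd : 0 < `|d| by rewrite normr_gt0.
have G_ge0 u : 0 <= G u by exact: Gs_ge0.
have xy : - (2 * ww / `|d|) <= 2 * ww / `|d|.
  by rewrite ge0_cp// divr_ge0// mulr_ge0// ltW.
have Gs0 u : u <= - (2 * ww / `|d|) \/ 2 * ww / `|d| <= u -> G u = 0.
  move=> H; have : 2 * ww <= `|d * u|.
    rewrite normrM [leRHS]mulrC -ler_pdivrMr//; case: H => H.
      by rewrite -[`|u|]normrN; apply: le_trans (ler_norm _); rewrite lerNr.
    by apply: le_trans (ler_norm _).
  move=> {}H; apply: (plateau_eq0 step ww0 ka0 Gs_shape); rewrite addNr.
  have [|u0] := leP 0 (d * u); first by right.
  by left; move: H; rewrite ltr0_norm//; lra.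
have [mG mG0 E] := finite_mass xy cG G_ge0 Gs0.
exists mG => //; rewrite -ler_pdivrMr//.
have Gs1 u : - ww <= d * u <= - ka -> 1 <= G u.
  move=> H; rewrite /G /Gs (plateau_eq1 step ww0 ka0)//.
  by move: H => /andP[u1 u2]; apply/andP; split=> //; move: u1; lra.
have wk : ww / 2 <= ww - ka by move: kaw; lra.
apply: le_trans (_ : (ww - ka) / `|d| <= _); first by rewrite ler_wpM2r// invr_ge0.
have := d_neq0; rewrite neq_lt => /orP[dn|dp].
- have xy' : ka / `|d| <= ww / `|d|.
    by rewrite ler_wpM2r ?invr_ge0//; move: kaw ww0; lra.
  have G1 u : ka / `|d| <= u <= ww / `|d| -> 1 <= G u.
    rewrite ler_pdivrMr// ler_pdivlMr// (ltr0_norm dn) => /andP[u1 u2].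
    by apply: Gs1; apply/andP; split; move: u1 u2; lra.
  by have := mass_ge xy' cG G_ge0 G1 E; rewrite -mulrBl.
- have xy' : - (ww / `|d|) <= - (ka / `|d|).
    by rewrite lerN2 ler_wpM2r ?invr_ge0//; move: kaw ww0; lra.
  have G1 u : - (ww / `|d|) <= u <= - (ka / `|d|) -> 1 <= G u.
    rewrite -!mulNr ler_pdivrMr// ler_pdivlMr// (gtr0_norm dp) => /andP[u1 u2].
    by apply: Gs1; apply/andP; split; move: u1 u2; lra.
  by have := mass_ge xy' cG G_ge0 G1 E; rewrite opprK addrC -mulrBl.
Qed.

Let mass_FT : exists mFT : R, (\int[mu]_u (F u * dT u ^+ 2)%:E = mFT%:E)%E.
Proof.
have xy : t0 <= t1 + om by move: t01 om0; lra.
have sFT : smooth1 (fun u => F u * dT u ^+ 2).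
  by apply: smooth1M => //; exact: smooth1M.
have FT0 u : 0 <= F u * dT u ^+ 2 by rewrite mulr_ge0// sqr_ge0.
have FTs u : u <= t0 \/ t1 + om <= u -> F u * dT u ^+ 2 = 0.
  by move=> H; rewrite /F (plateau_eq0 step om0 om0 t01 H) mul0r.
by have [m _ E] := finite_mass xy (smooth1_continuous sFT) FT0 FTs; exists m.
Qed.

Let mass_e A : (\int[mu]_u (edge s A om u)%:E = 1%:E)%E.
Proof.
have := edge_mass step A om0 (oner_neq0 R); rewrite normr1 invr1 => <-.
by apply: eq_integral => u _; rewrite mul1r.
Qed.

(** The inequality [pointwise_balance] is integrated against the weak equation. The edges in time
    give (A1 - A0) mG; the sharp edge costs eps mF / (2 |d|), and dividing by mG, which is at least
    ww / (2 |d|), leaves eps / ww times r. The term |Lam| om is the error in the mass of the time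
    profile. *)
Lemma window_inequality (A0 A1 eps : R) : 0 <= eps ->
  (forall w, B w -> q w != 0 -> t1 <= tm w <= t1 + om -> `|d * ht w| <= 2 * ww ->
     A1 <= f w) ->
  (forall w, B w -> q w != 0 -> t0 <= tm w <= t0 + om -> `|d * ht w| <= 2 * ww ->
     f w <= A0) ->
  (forall w, B w -> q w != 0 -> 0 <= tm w <= r -> `|d * ht w| <= ka ->
     (f w - dT (tm w)) ^+ 2 <= eps) ->
  A1 - A0 <= Lam * (t1 - t0) + `|Lam| * om + eps / ww * r.
Proof.
move=> eps0 HA1 HA0 Hsh.
have [mb mb0 Eb] := mass_bp.
have [mF EF [/andP[mF0 mFr] mFt]] := mass_F.
have [mG EG mGw] := mass_G.
have [mT ET] := mass_FT.
have Eri : (\int[mu]_u (ri u)%:E = (`|d|^-1)%:E)%E by exact: (edge_mass step _ ww0 d_neq0).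
have Esh : (\int[mu]_u (sh u)%:E = (`|d|^-1)%:E)%E by exact: (edge_mass step _ ka0 d_neq0).
have ge0e A u : 0 <= edge s A om u by exact: (edge_ge0 step _ _ om0).
have ri0 u : 0 <= ri u by exact: (edge_ge0 step _ _ ww0).
have sh0 u : 0 <= sh u by exact: (edge_ge0 step _ _ ka0).
have G_ge0 u : 0 <= G u by exact: Gs_ge0.
pose FT (k : R -> R) u := F u * k u.
pose T2 u := dT u ^+ 2.
have sT2 : smooth1 T2 by exact: smooth1M.
have FT0 u : 0 <= FT T2 u by rewrite mulr_ge0// sqr_ge0.
have FT_out k t : ~ (0 <= t <= r) -> FT k t = 0 by move=> /F_out H; rewrite /FT H mul0r.
have sFT k : smooth1 k -> smooth1 (FT k) by exact: smooth1M.
pose K : R := (\prod_(k : 'I_a | k != j) mb) * (\prod_(i | i != i0) mb).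
have K0 : 0 < K by rewrite mulr_gt0// prodr_gt0.
have se A : smooth1 (edge s A om) by exact: (smooth1_edge step _ _).
have I F1 G1 (m1 m2 : R) : smooth1 F1 -> smooth1 G1 ->
    (forall t, ~ (0 <= t <= r) -> F1 t = 0) ->
    (forall u, 2 * ww < `|d * u| -> G1 u = 0) ->
    (forall u, 0 <= F1 u) -> (forall u, 0 <= G1 u) ->
    (\int[mu]_u (F1 u)%:E = m1%:E)%E -> (\int[mu]_u (G1 u)%:E = m2%:E)%E ->
    integral2 B (W F1 G1) = K * (m1 * m2).
  move=> sF1 sG1 o1 o2 p1 p2 E1 E2; apply: tweight_integral => //.
  by move=> w; exact: W_out.
pose xi := W F G.
have sxi : smooth xi by exact: smooth_tweight.
have tf : test_function U xi.
  split=> [k|]; first by apply: smoothN_classC; exact: sxi.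
  exists [set w | `|w - w0| <= rho]; split=> //; first exact: compact_norm_ball.
  by move=> w nB; apply: W_out => // /ltW.
have cW F1 G1 : smooth1 F1 -> smooth1 G1 -> {within U, continuous (W F1 G1)}.
  move=> s1 s2; apply: continuous_subspaceT.
  exact/smooth_continuous/smooth_tweight.
have BU : B `<=` U by move=> w /ltW/bU.
pose dFe t := edge s t0 om t - edge s t1 om t.
have sdF : smooth1 dFe by exact: smooth1B.
(* The integrand of the weak equation, written with sums and multiples of weights so that
   [integral2D] and [integral2Z] apply; Q below has the same form. *)
pose H w := - f w * (W dFe G w + ga * (W (FT dT) ri w + - 1 * W (FT dT) sh w))
  + 2^-1 * (f w * f w) * (ga * (W F ri w + - 1 * W F sh w)).
have HE w : - f w * 'D_(Lvec bb j w) xi w + 2^-1 * f w ^+ 2 * 'D_(Cvec c j) xi w = H w.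
  rewrite (tweight_derive_L bb_skew x.1 x.2 bp DT (be0 (leqnn _)) beC dF dG).
  rewrite (tweight_derive_C bb x.1 x.2 Ta bp (be0 (leqnn _)) beC F dG).
  by rewrite /H !WE /FT /ga -/c0 /dFe; ring.
have Hout w : ~ B w -> H w = 0.
  move=> nB; have dF_out t : ~ (0 <= t <= r) -> dFe t = 0.
    by move=> nt; rewrite /dFe e0_out// e1_out// subrr.
  have FdT := FT_out dT.
  by rewrite /H !W_out//; ring.
have cH : {within U, continuous H}.
  apply: within_continuousD; apply: within_continuousM.
  - have : {within U, continuous (fun w => -1 * f w)} by exact: within_continuousZ.
    by under [X in {within U, continuous X} -> _]eq_fun do rewrite mulN1r.
  - apply: within_continuousD; first exact: cW.
    apply: within_continuousZ; apply: within_continuousD; first by apply: cW => //; exact: sFT.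
    by apply: within_continuousZ; apply: cW => //; exact: sFT.
  - by apply: within_continuousZ; exact: within_continuousM.
  - apply: within_continuousZ; apply: within_continuousD; first exact: cW.
    by apply: within_continuousZ; exact: cW.
have cgx : {within U, continuous (fun w => g w * xi w)}.
  by apply: within_continuousM => //; exact: cW.
have balance : integral2 B H = integral2 B (fun w => g w * xi w).
  have := wb tf.
  have -> : (fun w => - f w * 'D_(Lvec bb j w) xi w
      + 2^-1 * f w ^+ 2 * 'D_(Cvec c j) xi w) = H by apply/funext.
  rewrite (integral2_support BU) => [->|w _ /Hout//].
  by rewrite (integral2_support BU)// => w _ nB; rewrite /xi W_out// mulr0.
pose Q w := A1 * W (edge s t1 om) G w + - A0 * W (edge s t0 om) G w
  + - (2^-1 * (ga * eps)) * W F sh w + - (2^-1 * ga) * W (FT T2) ri w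
  + 2^-1 * ga * W (FT T2) sh w + - Lam * W F G w.
have QH w : B w -> Q w <= H w + -1 * (g w * xi w).
  move=> Bw; have qw0 : 0 <= q w by rewrite mulr_ge0// prodr_ge0.
  have supp (F1 G1 : R -> R) (Q1 : Prop) : (q w != 0 -> F1 (tm w) != 0 ->
      G1 (ht w) != 0 -> Q1) -> q w * F1 (tm w) * G1 (ht w) != 0 -> Q1.
    move: (q w) (F1 _) (G1 _) => y1 y2 y3 HQ; rewrite !mulf_eq0 !negb_or.
    by move=> /andP[/andP[]]; exact: HQ.
  have Gw2 : G (ht w) != 0 -> `|d * ht w| <= 2 * ww.
    by rewrite leNgt; apply: contra => /G_out ->.
  have P0 : q w * edge s t1 om (tm w) * G (ht w) != 0 -> A1 <= f w.
    apply: (supp (edge s t1 om) G) => qn en /Gw2; apply: HA1 => //.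
    apply/andP; split; rewrite leNgt; apply: contra en => /ltW H1; apply/eqP.
      by apply: (edge_eq0 step om0); left.
    by apply: (edge_eq0 step om0); right.
  have P1 : q w * edge s t0 om (tm w) * G (ht w) != 0 -> f w <= A0.
    apply: (supp (edge s t0 om) G) => qn en /Gw2; apply: HA0 => //.
    apply/andP; split; rewrite leNgt; apply: contra en => /ltW H1; apply/eqP.
      by apply: (edge_eq0 step om0); left.
    by apply: (edge_eq0 step om0); right.
  have P2 : q w * F (tm w) * sh (ht w) != 0 -> (f w - dT (tm w)) ^+ 2 <= eps.
    apply: (supp F sh) => qn Fn sn; apply: Hsh => //.
      have [//|/negP H1] := boolP (0 <= tm w <= r).
      by move/F_out: H1 Fn => ->; rewrite eqxx.
    rewrite leNgt; apply: contra sn => H1; apply/eqP.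
    apply: (edge_eq0 step ka0); rewrite addNr.
    have [|u0] := leP 0 (d * ht w); first by right.
    left; move: H1; rewrite ltr0_norm// ltrNr; exact: ltW.
  have P3 : q w * F (tm w) * G (ht w) != 0 -> g w <= Lam.
    by move=> _; apply: gLam; exact: ltW.
  have := pointwise_balance qw0 (ge0e t0 (tm w)) (ge0e t1 (tm w)) (F_ge0 (tm w))
    (G_ge0 (ht w)) (ri0 (ht w)) (sh0 (ht w)) ga_ge0 P0 P1 P2 P3.
  rewrite /Q /H /xi !WE /FT /T2 /dFe.
  move: (q w) (f w) (g w) (edge _ _ _ _) (edge _ t1 _ _) (F _) (G _) (ri _) (sh _) (dT _).
  move=> q' f' g' x0 x1 F' G' r' s' T' H1.
  rewrite (_ : _ + _ + _ + _ + _ + _ = q' * (A1 * (x1 * G')) - q' * (A0 * (x0 * G'))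
    - 2^-1 * (ga * eps) * (q' * (F' * s')) - 2^-1 * ga * (q' * (F' * T' ^+ 2 * r'))
    + 2^-1 * ga * (q' * (F' * T' ^+ 2 * s')) - Lam * (q' * (F' * G'))); last by ring.
  by apply: (le_trans H1); rewrite le_eqVlt; apply/orP; left; apply/eqP; ring.
have cZ k F1 G1 : smooth1 F1 -> smooth1 G1 -> {within U, continuous (fun w => k * W F1 G1 w)}.
  by move=> s1 s2; apply: within_continuousZ; exact: cW.
have r0 : 0 <= rho by exact: ltW.
have sFT2 := sFT _ sT2.
have c1 := cZ A1 _ _ (se t1) sG; have c2 := cZ (- A0) _ _ (se t0) sG.
have c3 := cZ (- (2^-1 * (ga * eps))) _ _ sF ssh.
have c4 := cZ (- (2^-1 * ga)) _ _ sFT2 sri; have c5 := cZ (2^-1 * ga) _ _ sFT2 ssh.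
have c6 := cZ (- Lam) _ _ sF sG.
have c12 := within_continuousD c1 c2; have c13 := within_continuousD c12 c3.
have c14 := within_continuousD c13 c4; have c15 := within_continuousD c14 c5.
have IQ : integral2 B Q <= 0.
  have cQ : {within U, continuous Q} := within_continuousD c15 c6.
  have cgx' : {within U, continuous (fun w => -1 * (g w * xi w))} by exact: within_continuousZ.
  have := le_integral2 oU r0 bU cQ (within_continuousD cH cgx') QH.
  rewrite (integral2D oU r0 bU cH cgx') (integral2Z oU r0 bU _ cgx) balance.
  by rewrite mulN1r subrr.
have IZ k F1 G1 : smooth1 F1 -> smooth1 G1 ->
    integral2 B (fun w => k * W F1 G1 w) = k * integral2 B (W F1 G1).
  by move=> s1 s2; apply: (integral2Z oU r0 bU); exact: cW.
(* The two integrals with profile T2 both equal K mT / |d| and enter with opposite signs. *)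
have {}IQ : K * ((A1 - A0) * mG - 2^-1 * (ga * eps) * (mF * `|d|^-1) - Lam * (mF * mG)) <= 0.
  move: IQ; rewrite /Q.
  rewrite (integral2D oU r0 bU c15 c6) (integral2D oU r0 bU c14 c5).
  rewrite (integral2D oU r0 bU c13 c4) (integral2D oU r0 bU c12 c3).
  rewrite (integral2D oU r0 bU c1 c2).
  rewrite !IZ//; have FT2o := FT_out T2.
  rewrite (I _ _ 1 mG)// (I _ _ 1 mG)// (I _ _ mF `|d|^-1)// (I _ _ mT `|d|^-1)//.
  rewrite (I _ _ mT `|d|^-1)// (I _ _ mF mG)//.
  move=> H1; apply: le_trans H1; rewrite le_eqVlt; apply/orP; left; apply/eqP; ring.
move: IQ; rewrite pmulr_rle0// => IQ.
have nd : 0 < `|d| by rewrite normr_gt0.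
have mGp : 0 < mG * `|d| by apply: lt_le_trans mGw; rewrite divr_gt0.
have mG0 : 0 < mG by move: mGp; rewrite pmulr_lgt0.
have H1 : A1 - A0 <= Lam * mF + 2^-1 * (ga * eps) * mF / (mG * `|d|).
  rewrite -(ler_pM2r mG0); apply: le_trans (_ : Lam * (mF * mG) + 2^-1 * (ga * eps) * (mF * `|d|^-1) <= _).
    by move: IQ; lra.
  rewrite le_eqVlt; apply/orP; left; apply/eqP.
  by field; rewrite !gt_eqF.
have H2 : 2^-1 * (ga * eps) * mF / (mG * `|d|) <= eps / ww * r.
  rewrite ler_pdivrMr//; apply: le_trans (_ : eps / ww * r * (ww / 2) <= _); last first.
    by rewrite ler_wpM2l// mulr_ge0 ?divr_ge0 ?(ltW ww0)//; apply: le_trans mFr.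
  have -> : eps / ww * r * (ww / 2) = 2^-1 * (1 * eps) * r by field; rewrite gt_eqF.
  have g0 := ga_ge0; have g1 := ga_le1.
  apply: ler_pM => //; first by rewrite mulr_ge0 ?invr_ge0// mulr_ge0.
  by rewrite ler_wpM2l ?invr_ge0// ler_wpM2r.
have H3 : Lam * mF <= Lam * (t1 - t0) + `|Lam| * om.
  have -> : Lam * mF = Lam * (t1 - t0) + Lam * (mF - (t1 - t0)) by ring.
  rewrite lerD2l; apply: (le_trans (ler_norm _)).
  by rewrite normrM ler_wpM2l.
by move: H1 H2 H3; lra.
Qed.

End Windows.

(** The parameters are chosen in this order: om from the continuity of p at t0 and t1; ww so that f
    varies by at most e1 on the end windows; eps = e1 ww; and only then ka, eta and e2, so small
    that (f - dT)^2 <= eps on the sharp edge. The loss eps r / ww is thus e1 r. *)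
Lemma weak_increment_le (t0 t1 : R) : 0 <= t0 -> t0 < t1 -> t1 < r ->
  f (p t1) - f (p t0) <= Lam * (t1 - t0).
Proof.
move=> t00 t01 t1r; have r0 : 0 < r := le_lt_trans t00 (lt_trans t01 t1r).
have [ctau tau0 dtau] := sol.
apply/ler_addgt0Pr => e e0.
pose e1 := e / (3 + r); have e10 : 0 < e1 by rewrite divr_gt0// addr_gt0.
have eE : e = 3 * e1 + e1 * r by rewrite /e1; field; rewrite gt_eqF// addr_gt0.
have [_ fuc] := ball_bound_uc oU cf bU.
have [de de0 Hde] := fuc e1 e10.
have cp : {within `[0, r], continuous p}.
  by apply: (char_path_continuous _ ctau); left.
have tin t : 0 <= t <= r -> `[0, r]%classic t by rewrite /= in_itv.
have pB t : 0 <= t <= r -> `|p t - w0| <= rho.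
  by move=> /ball_sol H; exact: half_le rho0 H.
have t0r : 0 <= t0 <= r by rewrite t00 (ltW (lt_trans t01 t1r)).
have t1r' : 0 <= t1 <= r by rewrite (le_trans t00 (ltW t01)) ltW.
have de2 : 0 < de / 2 by rewrite divr_gt0.
have cpe := within_continuous_epsP cp.
have [om1 om10 Hom1] := cpe t1 (tin _ t1r') _ de2.
have [om2 om20 Hom2] := cpe t0 (tin _ t0r) _ de2.
have L0 : 0 < `|Lam| + 1 by rewrite ltr_wpDl.
pose om := Num.min (Num.min om1 om2)
  (Num.min (e1 / (`|Lam| + 1)) (Num.min (t1 - t0) (r - t1))).
have om0 : 0 < om by rewrite !lt_min om10 om20 divr_gt0// !subr_gt0 t01.
have [omom1 [omom2 [omL [omt omr]]]] :
    om <= om1 /\ om <= om2 /\ om <= e1 / (`|Lam| + 1) /\ om <= t1 - t0 /\ om <= r - t1.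
  by rewrite /om !ge_min !lexx ?orbT.
pose D := Num.min (de / 2) (rho / 4).
have D0 : 0 < D by rewrite lt_min de2 divr_gt0.
have [Dde Drho] : D <= de / 2 /\ D <= rho / 4 by rewrite /D !ge_min !lexx ?orbT.
have nd : 0 < `|d| by rewrite normr_gt0.
pose Be := \sum_i `|be i|.
have beB i : `|be i| <= Be by rewrite /Be (bigD1 i)//= lerDl sumr_ge0.
have Be0 : 0 <= Be by exact: sumr_ge0.
pose C1 := 1 + r * bb_bound bb; pose C2 := 1 + Be; pose C3 := c_bound c + 1.
have C10 : 0 < C1 by rewrite ltr_pwDl// mulr_ge0 ?bb_bound_ge0// ltW.
have C20 : 0 < C2 by rewrite ltr_pwDl.
have C30 : 0 < C3 by rewrite ltr_wpDl// c_bound_ge0.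
(* A height of 2 ww amounts to a distance D / 3 in [near_curve]; the width eta and the gap between
   tau and Ta contribute M / 3 each, with M <= D. *)
pose ww := D / 6 * `|d| / C2; have ww0 : 0 < ww by rewrite divr_gt0// mulr_gt0// divr_gt0.
pose eps := e1 * ww; have eps0 : 0 < eps by rewrite mulr_gt0.
pose sg := Num.min 1 eps; have sg0 : 0 < sg by rewrite lt_min ltr01.
have sgeps : sg ^+ 2 <= eps.
  have [s1 s2] : sg <= 1 /\ sg <= eps by rewrite /sg !ge_min !lexx ?orbT.
  by rewrite expr2 (le_trans _ s2)// ler_piMr// ltW.
have sg20 : 0 < sg / 2 by rewrite divr_gt0.
have [ds ds0 Hds] := fuc _ sg20.
pose M := Num.min D ds; have M0 : 0 < M by rewrite lt_min D0.
have MD : M <= D by rewrite /M ge_min lexx.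
have Mds : M <= ds by rewrite /M ge_min lexx orbT.
have M3 : 0 < M / 3 by rewrite divr_gt0.
pose ka := Num.min (ww / 2) (M / 3 * `|d| / C2).
have ka0 : 0 < ka by rewrite lt_min (divr_gt0 ww0)//= divr_gt0// mulr_gt0.
have kaw : ka <= ww / 2 by rewrite /ka ge_min lexx.
have kaM : ka <= M / 3 * `|d| / C2 by rewrite /ka ge_min lexx orbT.
pose eta := M / 3 / C1; have eta0 : 0 < eta by rewrite divr_gt0.
have C3r : 0 < C3 * (r + 1) by rewrite mulr_gt0// addr_gt0.
pose e2 := Num.min (sg / 2) (M / 3 / (C3 * (r + 1))).
have e20 : 0 < e2 by rewrite lt_min sg20 divr_gt0.
have e2sg : e2 <= sg / 2 by rewrite /e2 ge_min lexx.
have e2M : e2 <= M / 3 / (C3 * (r + 1)) by rewrite /e2 ge_min lexx orbT.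
have cfp : {within `[0, r], continuous (f \o p)}.
  apply: (path_comp_continuous oU cf cp) => t; rewrite /= in_itv/= => tr.
  by apply/bU/pB.
have [s [S [P step]]] := smooth_step_exists R.
have [Ta [dT [sT DT Ta0 HdT]]] := smooth_antiderivative_approx step r0 e20 cfp.
have tauTa t : 0 <= t <= r -> c_bound c * `|tau t - Ta t| <= M / 3.
  move=> tr; have cTa : {within `[0, r], continuous Ta}.
    by apply: continuous_subspaceT; exact: smooth1_continuous.
  have cd : {within `[0, r], continuous (fun t => tau t - Ta t)}.
    by move=> y; apply: cvgB; [exact: ctau | exact: cTa].
  have dd y : 0 < y < r -> is_derive y 1 (fun t => tau t - Ta t) (f (p y) - dT y).
    by move=> yr; exact: (is_deriveB (dtau y yr) (DT y)).
  have db y : 0 < y < r -> `|f (p y) - dT y - 0| <= e2.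
    by move=> /andP[y0 y1]; rewrite subr0 distrC; apply: HdT; rewrite !ltW.
  have := increment_affine cd dd db tr; rewrite tau0 Ta0 mul0r !subr0 => H.
  have /andP[tt0 ttr] := tr.
  have H2 : `|tau t - Ta t| <= M / 3 / (C3 * (r + 1)) * (r + 1).
    apply: (le_trans H); apply: ler_pM => //; first exact: ltW.
    by apply: (le_trans ttr); rewrite lerDl.
  apply: le_trans (_ : C3 * (M / 3 / (C3 * (r + 1)) * (r + 1)) <= _).
    by apply: ler_pM => //; [exact: c_bound_ge0 | rewrite lerDl].
  rewrite le_eqVlt; apply/orP; left; apply/eqP; field.
  by rewrite !gt_eqF// addr_gt0.
pose bp := plateau S (- eta) (eta / 2) (eta / 2) (eta / 2).
have bpout u : eta <= `|u| -> bp u = 0 by exact: bump_eq0 step eta0.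
pose q := cross bb c j i0 x.1 x.2 Ta bp be.
pose tm (w : pt) := time_of j x.1 w.1.
pose ht := height bb c j i0 x.1 x.2 Ta.
have near_p w K : q w != 0 -> 0 <= tm w <= r -> `|d * ht w| <= K ->
    `|w - p (tm w)| <= M / 3 + C2 * (K / `|d|) + M / 3.
  move=> qw tr; rewrite normrM [leLHS]mulrC -ler_pdivlMr// => hK.
  have beq := be0 (leqnn i0).
  have /= H := near_curve bb_skew (tau (tm w)) (ltW eta0) bpout beB qw.
  rewrite -surjective_pairing in H; apply: (le_trans H).
  rewrite lerD ?tauTa// lerD//; last by rewrite ler_wpM2l// ltW.
  have /andP[tm0 tmr] := tr; rewrite -/(tm w) (ger0_norm tm0).
  apply: le_trans (_ : C1 * eta <= _); last first.
    by rewrite /eta mulrC divfK// gt_eqF.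
  by rewrite ler_wpM2r ?(ltW eta0)// lerD2l ler_wpM2r// bb_bound_ge0.
have near_D w : q w != 0 -> 0 <= tm w <= r -> `|d * ht w| <= 2 * ww ->
    `|w - p (tm w)| <= D.
  move=> qw tr hw; apply: le_trans (near_p w _ qw tr hw) _.
  have -> : C2 * (2 * ww / `|d|) = D / 3 by rewrite /ww; field; rewrite !gt_eqF.
  exact: thirds_le MD (lexx _).
have near_M w : q w != 0 -> 0 <= tm w <= r -> `|d * ht w| <= ka ->
    `|w - p (tm w)| <= M.
  move=> qw tr hw; apply: le_trans (near_p w _ qw tr hw) _.
  apply: thirds_le (lexx _) _.
  apply: le_trans (_ : C2 * (M / 3 * `|d| / C2 / `|d|) <= _).
    by rewrite ler_wpM2l ?(ltW C20)// ler_wpM2r// invr_ge0.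
  by rewrite le_eqVlt; apply/orP; left; apply/eqP; field; rewrite !gt_eqF.
have stay w : q w != 0 -> 0 <= tm w <= r -> `|d * ht w| <= 2 * ww -> `|w - w0| < rho.
  move=> qw tr hw; have H1 := near_D w qw tr hw; have H2 := ball_sol tr.
  rewrite -(subrKA (p (tm w))) (le_lt_trans (ler_normD _ _))//.
  exact: quarter_lt rho0 H1 Drho H2.
have t0om : t0 + om <= t1 by rewrite -lerBrDl.
have t1om : t1 + om <= r by rewrite -lerBrDl.
have close w t : oball w0 rho w -> 0 <= t <= r -> `|w - p t| <= de -> `|f w - f (p t)| <= e1.
  by move=> /ltW wB /pB pb H; apply: Hde.
have main := @window_inequality s S P step Ta dT eta om ww ka t0 t1 sT DT eta0
  om0 ww0 ka0 kaw t00 t0om t1om stay (f (p t0) + e1) (f (p t1) - e1) eps (ltW eps0).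
have {}main : f (p t1) - e1 - (f (p t0) + e1) <=
    Lam * (t1 - t0) + `|Lam| * om + eps / ww * r.
  apply: main => w wB qw.
  - move=> /andP[w1 w2] hw; have tr : 0 <= tm w <= r.
      by rewrite (le_trans (ltW (le_lt_trans t00 t01)) w1) (le_trans w2 t1om).
    have H1 := near_D w qw tr hw.
    have H2 : `|p (tm w) - p t1| <= de / 2.
      apply: Hom1; first exact: tin.
      by rewrite ger0_norm ?subr_ge0// lerBlDl (le_trans w2)// lerD2l.
    have H3 : `|w - p t1| <= de.
      rewrite -(subrKA (p (tm w))) (le_trans (ler_normD _ _))// (splitr de).
      by rewrite lerD// (le_trans H1).
    by have [] := dist_bounds (close w t1 wB t1r' H3).
  - move=> /andP[w1 w2] hw; have tr : 0 <= tm w <= r.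
      by rewrite (le_trans t00 w1) (le_trans w2 (le_trans t0om (ltW t1r))).
    have H1 := near_D w qw tr hw.
    have H2 : `|p (tm w) - p t0| <= de / 2.
      apply: Hom2; first exact: tin.
      by rewrite ger0_norm ?subr_ge0// lerBlDl (le_trans w2)// lerD2l.
    have H3 : `|w - p t0| <= de.
      rewrite -(subrKA (p (tm w))) (le_trans (ler_normD _ _))// (splitr de).
      by rewrite lerD// (le_trans H1).
    by have [] := dist_bounds (close w t0 wB t0r H3).
  - move=> tr hw; have H1 := near_M w qw tr hw.
    have H2 : `|f w - f (p (tm w))| <= sg / 2.
      by apply: Hds; [exact: pB | exact: ltW | exact: le_trans H1 Mds].
    have H3 := HdT _ tr.
    apply: le_trans sgeps; apply: sqr_dist_le (ltW sg0) H2 _.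
    by rewrite distrC; exact: le_trans H3 e2sg.
have epsE : eps / ww * r = e1 * r by rewrite /eps mulfK// gt_eqF.
have omE : `|Lam| * om <= e1.
  apply: le_trans (_ : (`|Lam| + 1) * om <= _).
    by rewrite ler_wpM2r ?(ltW om0)// lerDl.
  by rewrite mulrC -ler_pdivlMr.
rewrite epsE in main; rewrite eE.
exact: window_total main omE.
Qed.

End OneSided.
End WeakBalance.

(** * From one-sided to two-sided growth *)

Section TwoSided.
Context (R : realType).

(** No integrability is assumed, so positive and negative parts are exchanged by hand; [fine] sends
    infinite values of either sign to 0. *)
Lemma integral2N a h (D : set (pointW R a h)) (f : pointW R a h -> R) :
  integral2 D (fun w => - f w) = - integral2 D f.
Proof.
rewrite /integral2 /Rintegral.
set F := fun p => (f (point_of_tuples p))%:E.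
rewrite (_ : (fun p => _) = (\- F)%E)//.
rewrite (integralE _ _ (\- F)%E) (integralE _ _ F) funeposN funenegN.
have : (0 <= \int[lebesgueN R a \x lebesgueN R h]_(p in @point_of_tuples R a h @^-1` D) F^\+ p)%E.
  exact: integral_ge0.
have : (0 <= \int[lebesgueN R a \x lebesgueN R h]_(p in @point_of_tuples R a h @^-1` D) F^\- p)%E.
  exact: integral_ge0.
move: (integral _ _ _) (integral _ _ _) => [x| |] [y| |] //= _ _; rewrite ?oppr0//.
by rewrite opprB.
Qed.

(** The final time window lies to the right of t1, so t1 = r is reached only by continuity. *)
Lemma closed_increment (phi : R -> R) (r Lam : R) :
  {within `[0, r], continuous phi} ->
  (forall t0 t1, 0 <= t0 -> t0 < t1 -> t1 < r ->
     phi t1 - phi t0 <= Lam * (t1 - t0)) ->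
  forall t0 t1, 0 <= t0 -> t0 <= t1 -> t1 <= r ->
     phi t1 - phi t0 <= Lam * (t1 - t0).
Proof.
move=> cphi H t0 t1 t00; rewrite le_eqVlt => /orP[/eqP <- _|t01].
  by rewrite !subrr mulr0.
rewrite le_eqVlt => /orP[/eqP E|]; last exact: H.
apply/ler_addgt0Pr => e e0; rewrite E in t01 *.
have r0 : 0 <= r by apply: le_trans (ltW t01).
have rin : `[0, r]%classic r by rewrite /= in_itv/= r0 lexx.
have e2 : 0 < e / 2 by rewrite divr_gt0.
have [d d0 Hd] := within_continuous_epsP cphi rin e2.
have L0 : 0 < `|Lam| + 1 by rewrite ltr_wpDl.
pose k := Num.min d (Num.min ((r - t0) / 2) (e / 2 / (`|Lam| + 1))).
have k0 : 0 < k by rewrite !lt_min d0 !divr_gt0// subr_gt0.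
have kd : k <= d by rewrite /k ge_min lexx.
have kt : k <= (r - t0) / 2 by rewrite /k !ge_min lexx orbT.
have kL : k <= e / 2 / (`|Lam| + 1) by rewrite /k !ge_min lexx !orbT.
have t0k : t0 < r - k by move: kt t01; lra.
have krr : r - k < r by rewrite ltrBlDr ltrDl.
have H1 := H _ _ t00 t0k krr.
have H2 : `|phi (r - k) - phi r| <= e / 2.
  apply: Hd; last by rewrite addrAC subrr sub0r normrN gtr0_norm.
  by rewrite /= in_itv/= (le_trans t00 (ltW t0k)) ltW.
have H3 : `|Lam * k| <= e / 2.
  rewrite normrM (gtr0_norm k0); apply: le_trans (_ : (`|Lam| + 1) * k <= _).
    by rewrite ler_wpM2r ?(ltW k0)// lerDl.
  by rewrite mulrC -ler_pdivlMr.
move: H2 H3; rewrite !ler_norml => /andP[a1 _] /andP[b1 _].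
by move: H1 a1 b1; rewrite (_ : r - k - t0 = r - t0 - k) ?mulrBr; [lra | ring].
Qed.

Context (a h : nat) (bb : 'I_a -> 'I_a -> 'rV[R]_h).
Hypothesis bb_skew : forall j k, bb j k = - bb k j.
Local Notation pt := ('rV[R]_a * 'rV[R]_h)%type.

Lemma char_ptN c j (s : R) (w : pt) (t u : R) :
  char_pt bb (fun k => - c k) j s w t (- u) = char_pt bb c j s w t u.
Proof. by rewrite /char_pt scaleNr scalerN opprK. Qed.

Lemma is_derive_oppdir (V : normedModType R) (f : V -> R) (x v : V) (l : R) :
  is_derive x v f l -> is_derive x (- v) f (- l).
Proof.
move=> /is_derive_dirP df; apply: is_derive_dir.
have df' : is_derive (-1 * (0 : R)) 1 (fun s : R => f (x + s *: v)) l by rewrite mulr0.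
have := is_derive_scale df'; rewrite mulN1r.
by under [X in is_derive _ _ X _ -> _]eq_fun do rewrite mulN1r scaleNr -scalerN.
Qed.

(** Changing the signs of f, c and tau keeps the curves and the balance law and turns g into - g, so
    an upper bound on increments yields a lower one. *)
Lemma weak_balanceN c (U : set pt) f g j : weak_balance bb c U f g j ->
  weak_balance bb (fun k => - c k) U (fun w => - f w) (fun w => - g w) j.
Proof.
move=> wb xi txi.
have -> : (fun w => - g w * xi w) = (fun w => - (g w * xi w)).
  by apply/funext => w; rewrite mulNr.
rewrite integral2N -(wb xi txi) -integral2N; congr (integral2 _ _).
apply/funext => w; have [dxi _] := txi.1 1%N (Cvec c j).
have -> : Cvec (fun k => - c k) j = - Cvec c j :> pt by congr pair; rewrite ?oppr0.
have D : is_derive w (- Cvec c j) xi (- 'D_(Cvec c j) xi w).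
  by apply: is_derive_oppdir; apply: DeriveDef => //; exact: dxi.
rewrite (@derive_val _ _ _ _ _ _ _ D).
by move: ('D_(Lvec _ _ _) _ _) ('D_(Cvec _ _) _ _) (f w) => y1 y2 y3; ring.
Qed.

Lemma weak_increment c (U : set pt) f g j (i0 : 'I_h) (w0 x : pt)
    (rho r lam eps : R) (tau : R -> R) : open U -> {within U, continuous f} ->
  {within U, continuous g} -> weak_balance bb c U f g j ->
  (forall i : 'I_h, (i0 < i)%N -> c j ord0 i = 0) -> (c j ord0 i0 = 0 -> c j = 0) ->
  0 < rho -> (forall w, `|w - w0| <= rho -> U w) ->
  (forall w, `|w - w0| <= rho -> `|g w - lam| <= eps) ->
  char_solution bb c f j 1 x r tau ->
  (forall t, 0 <= t <= r -> `|char_pt bb c j 1 x t (tau t) - w0| <= rho / 2) ->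
  forall t0 t1, 0 <= t0 -> t0 <= t1 -> t1 <= r ->
  `|f (char_pt bb c j 1 x t1 (tau t1)) - f (char_pt bb c j 1 x t0 (tau t0))
    - lam * (t1 - t0)| <= eps * (t1 - t0).
Proof.
move=> oU cf cg wb c1 c2 rho0 bU glam sol ball_sol.
pose p t := char_pt bb c j 1 x t (tau t).
have [ctau tau0 dtau] := sol.
have cp : {within `[0, r], continuous p}.
  by apply: (char_path_continuous _ ctau); left.
have cfp : {within `[0, r], continuous (f \o p)}.
  apply: (path_comp_continuous oU cf cp) => t; rewrite /= in_itv/= => /ball_sol H.
  by apply/bU/(half_le rho0 H).
have up w : `|w - w0| <= rho -> g w <= lam + eps.
  by move=> /glam/dist_bounds[].
have low w : `|w - w0| <= rho -> - g w <= - lam + eps.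
  by move=> /glam/dist_bounds[H _]; move: H; clear; lra.
have H1 := closed_increment cfp (weak_increment_le bb_skew oU cf cg wb c1 c2 rho0 bU
  up sol ball_sol).
have cfN : {within U, continuous (fun w => - f w)} by move=> w; apply: cvgN; exact: cf.
have cgN : {within U, continuous (fun w => - g w)} by move=> w; apply: cvgN; exact: cg.
have c1N (i : 'I_h) : (i0 < i)%N -> (- c j) ord0 i = 0.
  by move=> /c1 H; rewrite mxE H oppr0.
have c2N : (- c j) ord0 i0 = 0 -> - c j = 0.
  by move=> /eqP; rewrite mxE oppr_eq0 => /eqP/c2 ->; rewrite oppr0.
have solN : char_solution bb (fun k => - c k) (fun w => - f w) j 1 x r (fun t => - tau t).
  split.
  - by move=> t; apply: cvgN; exact: ctau.
  - by rewrite tau0 oppr0.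
  - by move=> t tr; rewrite char_ptN; exact: (is_deriveN (dtau t tr)).
have ballN t : 0 <= t <= r ->
    `|char_pt bb (fun k => - c k) j 1 x t (- tau t) - w0| <= rho / 2.
  by rewrite char_ptN; exact: ball_sol.
have cfpN : {within `[0, r], continuous (fun t => - f (p t))}.
  by move=> t; apply: cvgN; exact: cfp.
have H2 := @weak_increment_le _ _ _ bb (fun k => - c k) bb_skew U _ _ j i0 w0 x rho r
  (- lam + eps) _ oU cfN cgN (weak_balanceN wb) c1N c2N rho0 bU low solN ballN.
have {}H2 t0 t1 : 0 <= t0 -> t0 < t1 -> t1 < r ->
    - f (p t1) - - f (p t0) <= (- lam + eps) * (t1 - t0).
  by move=> a1 a2 a3; have := H2 t0 t1 a1 a2 a3; rewrite !char_ptN.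
have {}H2 := closed_increment cfpN H2.
move=> t0 t1 a1 a2 a3; have := H1 t0 t1 a1 a2 a3; have := H2 t0 t1 a1 a2 a3.
rewrite /= -/(p t0) -/(p t1) ler_norml !mulrDl mulNr.
move: (f (p t1)) (f (p t0)) (lam * _) (eps * _) => y1 y0 z1 z2; clear => b1 b2.
by apply/andP; split; lra.
Qed.

(* A curve with s = -1 is the time reversal of a curve with s = 1 issued from
   its endpoint. *)
Lemma char_pt_reverse c j (x : pt) (T t u uT : R) :
  char_pt bb c j 1 (char_pt bb c j (-1) x T uT) t (uT - u) =
  char_pt bb c j (-1) x (T - t) u.
Proof.
rewrite /char_pt /= half_bracket_shift//; congr pair.
  by rewrite -addrA -scalerDl; congr (_ + _ *: _); ring.
apply/rowP => i; rewrite !mxE; ring.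
Qed.

Lemma weak_increment_signed c (U : set pt) f g j (i0 : 'I_h) (w0 x : pt)
    (rho r s lam eps : R) (tau : R -> R) : open U -> {within U, continuous f} ->
  {within U, continuous g} -> weak_balance bb c U f g j ->
  (forall i : 'I_h, (i0 < i)%N -> c j ord0 i = 0) -> (c j ord0 i0 = 0 -> c j = 0) ->
  0 < rho -> (forall w, `|w - w0| <= rho -> U w) ->
  (forall w, `|w - w0| <= rho -> `|g w - lam| <= eps) ->
  s = 1 \/ s = -1 -> char_solution bb c f j s x r tau ->
  (forall t, 0 <= t <= r -> `|char_pt bb c j s x t (tau t) - w0| <= rho / 2) ->
  forall t, 0 <= t <= r ->
  `|f (char_pt bb c j s x t (tau t)) - f x - s * lam * t| <= eps * t.
Proof.
move=> oU cf cg wb c1 c2 rho0 bU glam [->|->] sol ball_sol t /andP[t0 tr].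
  have := weak_increment oU cf cg wb c1 c2 rho0 bU glam sol ball_sol (lexx 0) t0 tr.
  by have [_ -> _] := sol; rewrite char_pt0 subr0 mul1r.
have [ctau tau0 dtau] := sol; pose y := char_pt bb c j (-1) x t (tau t).
pose tb u := tau t - tau (t - u).
have ptE u : char_pt bb c j 1 y u (tb u) = char_pt bb c j (-1) x (t - u) (tau (t - u)).
  exact: char_pt_reverse.
have in_r u : 0 <= u <= t -> 0 <= t - u <= r.
  by move=> /andP[u0 ut]; rewrite subr_ge0 ut/= lerBlDr (le_trans tr)// lerDl.
have solb : char_solution bb c f j 1 y t tb.
  split.
  - apply: within_continuous_eps => u; rewrite /= in_itv/= => ut e e0.
    have rin : `[0, r]%classic (t - u) by rewrite /= in_itv/=; exact: in_r.
    have [d d0 Hd] := within_continuous_epsP ctau rin e0.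
    exists d => // v; rewrite /= in_itv/= => vt uv; rewrite /tb.
    have -> : tau t - tau (t - v) - (tau t - tau (t - u)) =
        - (tau (t - v) - tau (t - u)) by ring.
    rewrite normrN; apply: Hd; first by rewrite /= in_itv/=; exact: in_r.
    by rewrite opprB addrCA addrAC subrr add0r distrC.
  - by rewrite /tb subr0 subrr.
  - move=> u /andP[u0 ut]; rewrite ptE.
    have d1 : is_derive (-1 * u + t) 1 tau (f (char_pt bb c j (-1) x (t - u) (tau (t - u)))).
      rewrite mulN1r addrC; apply: dtau.
      by rewrite subr_gt0 ut/= ltrBlDr (le_lt_trans tr)// ltrDl.
    have d2 := is_derive_affine d1; have d3 := is_derive_cst (tau t : R) u (1 : R).
    apply: is_derive_eq (_ : is_derive u 1 tb (0 - -1 * f (char_pt bb c j (-1) x (t - u) (tau (t - u))))) _.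
      have := is_deriveB d3 d2.
      rewrite (_ : (cst (tau t) - _) = tb)//; apply/funext => v.
      by rewrite /tb /= -[(_ - _) v]/(tau t - tau (-1 * v + t)) mulN1r [- v + t]addrC.
    by rewrite mulN1r opprK add0r.
have ballb u : 0 <= u <= t -> `|char_pt bb c j 1 y u (tb u) - w0| <= rho / 2.
  by move=> /in_r ut; rewrite ptE; exact: ball_sol.
have := weak_increment oU cf cg wb c1 c2 rho0 bU glam solb ballb (lexx 0) t0 (lexx t).
rewrite !ptE subrr subr0 tau0 char_pt0 -/y.
rewrite (_ : f y - f x - -1 * lam * t = - (f x - f y - lam * t)) ?normrN//.
by move: (f x) (f y) => z1 z2; ring.
Qed.

(** Supplies the index i0 that makes the shear of the test functions triangular; k serves when v =
    0. *)
Lemma last_nonzero (v : 'rV[R]_h) (k : 'I_h) : exists i0 : 'I_h,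
  (forall i : 'I_h, (i0 < i)%N -> v ord0 i = 0) /\ (v ord0 i0 = 0 -> v = 0).
Proof.
have [i1 vi|v0] := pickP (fun i => v ord0 i != 0); last first.
  have vz : v = 0 by apply/rowP => i; rewrite mxE; apply/eqP; have := v0 i; case: eqP.
  by exists k; split=> // i _; rewrite vz mxE.
case: (arg_maxnP (P := fun i => v ord0 i != 0) (fun i : 'I_h => i : nat) vi) => i0 vi0 max.
exists i0; split=> [i ii|/eqP]; last by rewrite (negPf vi0).
by apply/eqP/negPn/negP => /max; rewrite /geq /= leqNgt ii.
Qed.

(** Serves case (g) and, with c = 0 on the whole group, case (a). Exact characteristics are used
    here, and the weak equation gives the growth along each of them. *)
Lemma weak_balance_chars c (U : set pt) f (g : 'I_a -> pt -> R) w0 (eps : R) :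
  open U -> {within U, continuous f} -> (forall j, {within U, continuous (g j)}) ->
  (forall j, weak_balance bb c U f (g j) j) -> U w0 -> 0 < eps -> 'I_h ->
  exists rho r M : R,
  [/\ 0 < rho, 0 < r, 0 <= M, forall w, `|w - w0| <= rho -> `|f w| <= M &
      chars_on bb c f [set w | `|w - w0| <= rho] r (fun j => g j w0) eps].
Proof.
move=> oU cf cg wb Uw0 eps0 k.
have near_g : \forall w \near w0, U w /\ forall j, `|g j w - g j w0| <= eps.
  apply: filterI; first exact: (open_nbhs_nbhs (conj oU Uw0)).
  apply: (@filter_forall pt 'I_a (fun j w => `|g j w - g j w0| <= eps) (nbhs w0)) => j.
  have /cvgrPdist_le/(_ _ eps0) := within_open_continuous oU (cg j) Uw0.
  by apply: filterS => w; rewrite distrC.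
have [rho rho0 Hrho] := nbhs_norm_leP near_g.
have bU w : `|w - w0| <= rho -> U w by move=> /Hrho[].
have [[M M0 fM] _] := ball_bound_uc oU cf bU.
have rho20 : 0 < rho / 2 by rewrite divr_gt0.
have half w : `|w - w0| <= rho / 2 -> `|w - w0| <= rho by exact: half_le.
have bU2 w : `|w - w0| <= rho / 2 -> U w by move=> /half/bU.
have [_ fuc] := ball_bound_uc oU cf bU2.
have fM2 w : `|w - w0| <= rho / 2 -> `|f w| <= M by move=> /half/fM.
have [r r0 Hr] := char_solution_exists bb c w0 rho20 M0.
exists (rho / 2 / 2), r, M; split=> //; first by rewrite divr_gt0.
  by move=> w /(half_le rho20)/fM2.
move=> j s w s1 ww0; have [tau sol tb] := Hr f fuc fM2 j s w s1 ww0.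
have [i0 [c1 c2]] := last_nonzero (c j) k.
apply: (char_solution_curve (ltW eps0) sol).
apply: (weak_increment_signed oU cf (cg j) (wb j) c1 c2 rho0 bU _ s1 sol tb).
by move=> w1 /Hrho[_]; apply.
Qed.

Lemma weak_balance_local_holder c (U : set pt) f (g : 'I_a -> pt -> R) :
  (forall i, exists v : 'rV[R]_h,
    ((exists j, v = c j) \/ (exists j k, v = bb j k)) /\
    (delta_mx ord0 i = v \/ delta_mx ord0 i = - v)) ->
  open U -> {within U, continuous f} -> (forall j, {within U, continuous (g j)}) ->
  (forall j, weak_balance bb c U f (g j) j) -> 'I_h -> local_holder U f.
Proof.
move=> basis oU cf cg wb k; apply: (chars_local_holder bb_skew basis) => w0 Uw0.
exists (fun j => g j w0) => eps eps0.
have [rho [r [M [rho0 r0 M0 fM ch]]]] := weak_balance_chars oU cf cg wb Uw0 eps0 k.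
exists rho, r, M; split=> // eta eta0; exists f; split=> // w _.
by rewrite subrr normr0 ltW.
Qed.

End TwoSided.

(** * Solutions in the distributional sense *)

Section DistributionalSolutions.
Context (R : realType) (g : vectType R) (A : step2_stratification g).
Context (n h : nat) (B : adapted_basis A n h).
Local Notation b := (structure_constant B).
Local Notation bbW := (bvecW B).
Local Notation cW := (cvecW B).
Local Notation Wt := (pointW R n h).

Lemma layer2_index : 'I_h.
Proof.
case: h B => [|k] B'; last exact: ord0.
have := span_basis (basY_basis B').
have -> : val (basY B') = [::] by apply/size0nil/size_tuple.
by rewrite span_nil => E; have := layer2_neq0 A; rewrite -E eqxx.
Qed.

Lemma classC1_on_setT (V : normedModType R) (xi : V -> R) :
  classC 1 xi -> classC1_on setT xi.
Proof.
by move=> H v; have [dxi cxi] := H v; split=> //; exact: continuous_subspaceT.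
Qed.

Lemma derive_split (xi : Wt -> R) (u : Wt) w : classC 1 xi ->
  'D_u xi w = \sum_j u.1 ord0 j * 'D_(dx R h j) xi w
            + \sum_i u.2 ord0 i * 'D_(dy R n i) xi w.
Proof.
move=> C1; rewrite (derive_grad u openT I (classC1_on_setT C1)).
by rewrite /grad_along big_sumType.
Qed.

Lemma derive_Lvec (xi : Wt -> R) j w : classC 1 xi ->
  'D_(Lvec bbW j w) xi w = 'D_(dx R h j) xi w
    + \sum_i (Lvec bbW j w).2 ord0 i * 'D_(dy R n i) xi w.
Proof.
move=> C1; rewrite derive_split//; congr (_ + _).
rewrite (bigD1 j)//= mxE !eqxx mul1r big1 ?addr0// => k kj.
by rewrite mxE (negPf kj) andbF mul0r.
Qed.

Lemma derive_Cvec (xi : Wt -> R) j w : classC 1 xi ->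
  'D_(Cvec cW j) xi w = \sum_i (Cvec cW j).2 ord0 i * 'D_(dy R n i) xi w.
Proof.
move=> C1; rewrite derive_split// big1 ?add0r// => k _.
by rewrite mxE mul0r.
Qed.

Lemma distributional_weak_balance (U : set Wt) (phi : Wt -> R)
    (omega : Wt -> 'rV[R]_n) j : distributional b U phi omega ->
  weak_balance bbW cW U phi (fun w => omega w ord0 j) j.
Proof.
move=> H xi txi; rewrite -(H j xi txi); congr (integral2 _ _).
apply/funext => w; have C1 := txi.1 1%N.
rewrite (derive_Lvec j w C1) (derive_Cvec j w C1) mulrDr -!addrA.
congr (_ + _); rewrite [LHS]addrC; congr (_ + _).
  rewrite -mulrA; congr (_ * _); rewrite mulr_sumr; apply: eq_bigr => i _.
  by rewrite !mxE mulrCA mulrA.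
rewrite !mulr_sumr; apply: eq_bigr => i _.
rewrite /= !mxE mulNr mulNr mulrN opprK summxE -mulrA mulrCA; congr (_ * _).
rewrite mulr_suml mulr_sumr.
by apply: eq_bigr => k _; rewrite !mxE; ring.
Qed.

Lemma distributional_local_holder (U : set Wt) (phi : Wt -> R)
    (omega : Wt -> 'rV[R]_n) : open U -> {within U, continuous phi} ->
  {within U, continuous omega} -> distributional b U phi omega ->
  local_holder U phi.
Proof.
move=> oU cphi com dist.
apply: (weak_balance_local_holder (@bvecW_skew _ _ _ _ _ B)
  (@bvecW_basis _ _ _ _ _ B) oU cphi (g := fun j w => omega w ord0 j)).
- move=> j; move/within_continuous_epsP: com => com.
  apply: within_continuous_eps => w Uw e e0; have [d d0 Hd] := com w Uw e e0.
  exists d => // x Ix xt; apply: le_trans (Hd x Ix xt).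
  by have := row_coord_le (omega x - omega w) j; rewrite !mxE.
- by move=> j; exact: distributional_weak_balance.
- exact: layer2_index.
Qed.

End DistributionalSolutions.

(** * Hypersurfaces *)

Section Hypersurface.
Context (R : realType) (g : vectType R) (A : step2_stratification g).
Context (n h : nat) (B : adapted_basis A n h).
Local Notation b := (structure_constant B).
Local Notation bbG := (bvec B).
Local Notation cW := (cvecW B).
Local Notation Wt := (pointW R n h).
Local Notation G := (pointG R n h).

Lemma gmul_expX j (p : G) (t : R) :
  gmul b p (expX h j t) = p + t *: Lvec bbG j p.
Proof.
rewrite [RHS]surjective_pairing; congr (_, _).
apply/rowP => i; rewrite !mxE addr0; congr (_ + _); rewrite mulrN; congr (- _).
rewrite mulrCA; congr (_ * _); rewrite summxE mulr_sumr (bigD1 j)//= [X in _ + X]big1 ?addr0.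
  by apply: eq_bigr => l _; rewrite !mxE !eqxx mulr1; ring.
by move=> k kj; rewrite big1// => l _; rewrite !mxE (negPf kj) andbF !mulr0.
Qed.

Lemma leftXE j (xi : G -> R) p : classC 1 xi -> leftX b j xi p = 'D_(Lvec bbG j p) xi p.
Proof.
move=> C1; rewrite /leftX; under [X in derive1 X]eq_fun do rewrite gmul_expX.
have [dxi _] := C1 (Lvec bbG j p).
have D := is_derive_dirP (DeriveDef (dxi p) erefl).
by rewrite derive1E; exact: (@derive_val _ _ _ _ _ _ _ D).
Qed.

Lemma weak_leftX_balance j (D : set G) (f d : G -> R) : weak_leftX b j D f d ->
  weak_balance bbG (fun _ => 0) D f d j.
Proof.
move=> H xi txi; have := H xi txi; have C1 := txi.1 1%N.
move=> /(congr1 -%R); rewrite opprK -integral2N => <-; congr (integral2 _ _).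
apply/funext => p; rewrite leftXE//.
have D0 : is_derive p (Cvec (fun _ : 'I_(1 + n) => 0 : 'rV[R]_h) j) xi 0.
  apply: is_derive_dir; rewrite /Cvec.
  under [X in is_derive _ _ X _]eq_fun do rewrite scaler0 addr0.
  exact: (is_derive_cst (xi p : R) (0 : R) (1 : R)).
by rewrite (@derive_val _ _ _ _ _ _ _ D0) mulr0 addr0 mulNr.
Qed.

(** If X_1 f vanished at p, the point (1, 0) of L would lie in the tangent group, against the
    trivial intersection. *)
Lemma tangent_transversal (Xf : 'I_(1 + n) -> G -> R) p :
  complementary b (tangent_group Xf p) (@Lgroup R n h) -> Xf (idx1 n) p != 0.
Proof.
move=> [_ _ _ H]; apply/eqP => X0.
have : [set gone R n h] (inL n h 1).
  rewrite -H; split; last by exists 1.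
  rewrite /tangent_group /= big_split_ord /= big_ord1 row_mxEl X0 mulr0 add0r big1//.
  by move=> k _; rewrite row_mxEr mxE mul0r.
move=> /(congr1 (fun q : G => q.1 ord0 (idx1 n))); rewrite /= row_mxEl !mxE /=.
by move/eqP; rewrite oner_eq0.
Qed.

Definition graph_point (w : Wt) (t : R) : G := gmul b (inW w) (inL n h t).

(** For fixed w the points w . exp (t X_1) form a flow line of X_1, which is straight in exponential
    coordinates because [X_1, X_1] = 0. *)
Lemma graph_point_flow (w : Wt) (t t' : R) :
  graph_point w t' = graph_point w t + (t' - t) *: Lvec bbG (idx1 n) (graph_point w t).
Proof.
rewrite /graph_point !graph_pointE /Lvec /=.
have -> : half_bracket bbG (idx1 n) (row_mx t%:M w.1) = - (2^-1 *: cW_sum B w.1).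
  rewrite /half_bracket big_split_ord /= big_ord1 -scalerN; congr (_ *: _).
  rewrite [bbG _ _](_ : _ = 0) ?scaler0 ?add0r; last first.
    by apply/rowP => i; rewrite !mxE; exact: structure_constant_diag.
  rewrite /cW_sum -sumrN; apply: eq_bigr => k _.
  by rewrite row_mxEr -scalerN -bvec_skew.
congr pair.
  apply/rowP => k; rewrite [RHS]mxE [X in _ = _ + X]mxE [X in _ = _ + _ * X]mxE.
  case: (split_ordP k) => i -> /=; rewrite ?row_mxEl ?row_mxEr.
    by rewrite (ord1 i) !mxE !eqxx !mulr1n mulr1 subrKC.
  by rewrite mulr0 addr0.
by apply/rowP => i; rewrite !mxE; ring.
Qed.

Lemma graph_point_close (w0 : Wt) (t0 e : R) : 0 < e ->
  exists2 d : R, 0 < d & forall w t, `|w - w0| <= d -> `|t - t0| <= d ->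
    `|graph_point w t - graph_point w0 t0| <= e.
Proof.
move=> e0.
pose F (q : Wt * R) : 'rV[R]_h := q.1.2 + (2^-1 * q.2) *: cW_sum B q.1.1.
have cF : {for (w0, t0), continuous F}.
  apply: cvgD; first exact: (cvg_comp _ _ cvg_fst cvg_snd).
  apply: cvgZ; first by apply: cvgMr; exact: cvg_snd.
  apply: cvg_big => [|k _]; first exact: add_continuous.
  apply: cvgZl; apply: (cvg_comp (fun q : Wt * R => q.1.1) _ _ (@coord_continuous _ _ _ ord0 k _)).
  exact: (cvg_comp _ _ cvg_fst cvg_fst).
have /cvgrPdist_le/(_ _ e0) nF := cF.
have [d d0 Hd] := nbhs_norm_leP nF.
exists (Num.min d e) => [|w t]; first by rewrite lt_min d0.
rewrite !le_min => /andP[wd we] /andP[td te].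
have q : `|(w, t) - (w0, t0)| <= d by rewrite pair_norm_le /= wd.
rewrite /graph_point !graph_pointE pair_norm_le/=; apply/andP; split; last first.
  by rewrite distrC; exact: (Hd _ q).
apply: row_norm_le => [|k]; first exact: ltW.
rewrite !mxE; case: splitP => i _; first by rewrite !mxE (ord1 i) !mulr1n.
apply: le_trans we; apply: le_trans (pair_norm1_le _).
by have := row_coord_le (w.1 - w0.1) i; rewrite !mxE.
Qed.

(** With c = 0 the value of tau does not affect [char_pt], so the curves are the flow lines of X_j
    themselves and the growth of f along them becomes explicit. *)
Lemma weak_balance_flow (D : set G) (f : G -> R) (Xf : 'I_(1 + n) -> G -> R) p0 (eps : R) :
  open D -> C1H b D f Xf -> D p0 -> 0 < eps ->
  exists rho r : R, [/\ 0 < rho, 0 < r & forall j p t, `|p - p0| <= rho -> `|t| <= r ->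
    `|f (p + t *: Lvec bbG j p) - f p - Xf j p0 * t| <= eps * `|t|].
Proof.
move=> oD [cf H] Dp0 eps0.
have wb j := weak_leftX_balance (H j).2.
have [rho [r [M [rho0 r0 _ _ ch]]]] :=
  weak_balance_chars (@bvec_skew _ _ _ _ _ B) oD cf (fun j => (H j).1) wb Dp0 eps0 (layer2_index B).
exists rho, r; split=> // j p t pp tr.
have flow s (u : R) : s = 1 \/ s = -1 -> 0 <= u <= r ->
    `|f (p + (s * u) *: Lvec bbG j p) - f p - s * Xf j p0 * u| <= eps * u.
  move=> s1 ur; have [tau [_ _ /(_ u ur)[]]] := ch j s p s1 pp.
  rewrite /char_pt scaler0 addr0 scalerA => + _.
  congr (`|f _ - _ - _| <= _); rewrite [RHS]surjective_pairing; congr (_, _).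
  by rewrite /= scalerN.
have [t0|t0] := leP 0 t; move: tr.
  rewrite ger0_norm// => tr.
  by have := flow 1 t (or_introl erefl); rewrite t0 tr !mul1r => /(_ isT).
rewrite ltr0_norm// => tr; have := flow (-1) (- t) (or_intror erefl).
rewrite oppr_ge0 (ltW t0) tr !mulNr !mulrN !mul1r opprK => /(_ isT).
by rewrite opprK.
Qed.

(** Let q, q' be the graph points over (x, y) and (x, y'), and m the point over (x, y) with the
    X_1-coordinate t' of q'. The points m and q' differ only vertically, by exactly y' - y, while m
    and q lie on one flow line of X_1. As f vanishes at q and q', its growth with slope lam up to
    |lam| / 2 gives |lam| / 2 |t' - t| <= |f m|, and the vertical regularity of f bounds |f m|. *)
Lemma hypersurface_local_holder (U : set Wt) (phi : Wt -> R) : open U ->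
  {within U, continuous phi} -> C1H_hypersurface_complemented b (igraph b U phi) ->
  local_holder U phi.
Proof.
move=> oU cphi hyp w0 Uw0 e e0.
have S w : U w -> igraph b U phi (graph_point w (phi w)) by move=> Uw; exists w.
have [D [f [Xf [[oD Dp0] C1f SD _ tr]]]] := hyp _ (S _ Uw0).
set p0 := graph_point w0 (phi w0) in Dp0 tr.
have lam0 : 0 < `|Xf (idx1 n) p0| by rewrite normr_gt0; exact: tangent_transversal.
set lam := Xf (idx1 n) p0 in lam0.
have lam20 : 0 < `|lam| / 2 by rewrite divr_gt0.
have [rho [r [rho0 r0 flow]]] := weak_balance_flow oD C1f Dp0 lam20.
have fh : local_holder D f.
  have [cf H] := C1f.
  apply: (weak_balance_local_holder (@bvec_skew _ _ _ _ _ B) _ oD cf (fun j => (H j).1)).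
  - move=> i; have [j [k jk]] := bvec_basis B i; exists (bbG j k).
    by split; [right; exists j, k|left].
  - by move=> j; exact: weak_leftX_balance (H j).2.
  - exact: (layer2_index B).
have [r1 r10 Hr1] := fh _ Dp0 _ (mulr_gt0 e0 lam20).
have [r2 r20 Hr2] := nbhs_norm_leP (open_nbhs_nbhs (conj oD Dp0)).
have m0 : 0 < Num.min rho (Num.min r1 r2) by rewrite !lt_min rho0 r10.
have [d d0 close] := graph_point_close w0 (phi w0) m0.
have dr0 : 0 < Num.min d (r / 2) by rewrite lt_min d0 divr_gt0.
have near_phi : \forall w \near w0, U w /\ `|phi w - phi w0| <= Num.min d (r / 2).
  apply: filterI; first exact: (open_nbhs_nbhs (conj oU Uw0)).
  have /cvgrPdist_le/(_ _ dr0) := within_open_continuous oU cphi Uw0.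
  by apply: filterS => w; rewrite distrC.
have [r3 r30 Hr3] := nbhs_norm_leP near_phi.
exists (Num.min d r3) => [|x y y']; first by rewrite lt_min d0.
rewrite !le_min => /andP[wd /Hr3[Uw]]; rewrite le_min => /andP[td tr2].
move=> /andP[wd' /Hr3[Uw']]; rewrite le_min => /andP[td' tr2'].
have := close _ _ wd td; rewrite !le_min => /and3P[q1 q2 q3].
have := close _ _ wd td'; rewrite !le_min => /and3P[m1 m2 m3].
have := close _ _ wd' td'; rewrite !le_min => /and3P[q'1 q'2 q'3].
have f0 w : U w -> D (graph_point w (phi w)) -> f (graph_point w (phi w)) = 0.
  move=> /S Sw Dw; have : (D `&` [set q | f q = 0]) (graph_point w (phi w)) by rewrite -SD.
  by case.
have fq := f0 _ Uw (Hr2 _ q3); have fq' := f0 _ Uw' (Hr2 _ q'3).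
set t := phi (x, y) in td tr2 q1 q2 q3 m1 m2 m3 fq *.
set t' := phi (x, y') in td' tr2' m1 m2 m3 q'1 q'2 q'3 fq' *.
have tt : `|t' - t| <= r.
  by rewrite (le_trans (ler_distD (phi w0) _ _))// (splitr r) lerD// distrC.
have := flow (idx1 n) _ _ q1 tt; rewrite -graph_point_flow fq subr0 => fl.
have := Hr1 (graph_point (x, y) t').1 (graph_point (x, y) t').2 (graph_point (x, y') t').2.
rewrite -surjective_pairing; have -> : ((graph_point (x, y) t').1, (graph_point (x, y') t').2) =
    graph_point (x, y') t' by [].
have -> : (graph_point (x, y') t').2 - (graph_point (x, y) t').2 = y' - y.
  by rewrite /graph_point !graph_pointE /= opprD addrACA subrr addr0.
move=> /(_ m2 q'2); rewrite fq' sub0r normrN => hf.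
rewrite -(ler_pM2l lam20).
have : `|lam * (t' - t)| <= `|f (graph_point (x, y) t')| + `|lam| / 2 * `|t' - t|.
  by rewrite -lerBlDl; apply: le_trans fl; rewrite distrC; exact: lerB_dist.
rewrite normrM {1}(splitr `|lam|) mulrDl lerD2r => H; apply: (le_trans H).
by rewrite mulrA [_ / 2 * e]mulrC.
Qed.

End Hypersurface.

Theorem theorem4p7 (R : realType) (g : vectType R)
    (A : step2_stratification g) (n h : nat) (B : adapted_basis A n h)
    (N : pointG R n h -> R)
    (hN : homogeneous_norm (structure_constant B) N)
    (U : set (pointW R n h)) (phi : pointW R n h -> R)
    (hU : open U) (hphi : {within U, continuous phi}) :
  let b := structure_constant B in
     C1H_hypersurface_complemented b (igraph b U phi)
  \/ unif_intrinsic_differentiable b N U phi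
  \/ intrinsic_differentiable_C b N U phi
  \/ (exists omega : pointW R n h -> 'rV[R]_n,
        {within U, continuous omega} /\ approximable b N U phi omega)
  \/ (exists omega : pointW R n h -> 'rV[R]_n,
        {within U, continuous omega} /\ broad b U phi omega)
  \/ (exists omega : pointW R n h -> 'rV[R]_n,
        {within U, continuous omega} /\ broad_star b N U phi omega)
  \/ (exists omega : pointW R n h -> 'rV[R]_n,
        {within U, continuous omega} /\ distributional b U phi omega) ->
  local_little_holder_vertical 2^-1 U phi.
Proof.
move=> b cond; apply: local_holder_little.
case: cond => [hyp|[unif|[grad|[[om [com apx]]|[[om [com br]]|[[om [com br]]|[om [com dist]]]]]]]].
- exact: (hypersurface_local_holder hU hphi hyp).
- exact: (unif_intrinsic_local_holder hN hU unif).
- exact: (intrinsic_local_holder hN hU hphi grad).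
- exact: (approximable_local_holder hN hU hphi com apx).
- exact: (broad_local_holder hU hphi com br).
- exact: (broad_star_local_holder hN hU hphi com br).
- exact: (distributional_local_holder hU hphi com dist).
Qed.
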